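(* Let $n\geqslant 1$, $\tau,\delta,\frac{B}{A},\sigma>0$, $\mathcal{A}=(-\Delta)^{\sigma}$, $\alpha\leqslant 0$ and $s\geqslant s_{\mathrm{crit}}:=\frac n2-\sigma$. Let $N_0=N_0(\tau,\delta,\sigma)>0$ be the constant described in the context. Assume $$(\psi_0,\psi_1,\psi_2)\in E^{\alpha}_{s+\sigma}\times E^{\alpha}_{s+\sigma}\times E^{\alpha}_s,\qquad \psi_1^2\in E^{\alpha}_s,$$ and $\operatorname{supp}\widehat{\psi}_j\subset \mathbb{R}^n_{\mathrm{Oct},N_0}$ for $j\in\{0,1,2\}$. Set $$\epsilon_{\mathrm{Rough}}:=\|(\psi_0,\psi_1,\psi_2)\|_{E^{\alpha}_{s+\sigma}\times E^{\alpha}_{s+\sigma}\times E^{\alpha}_s}+\|\psi_1^2\|_{E^{\alpha}_s}>0 .$$ Suppose that one of the following holds: (i) $\alpha<0$ (with no restriction on the size of $\epsilon_{\mathrm{Rough}}$); (ii) $\alpha=0$ and $\epsilon_{\mathrm{Rough}}$ is sufficiently small, i.e. $\epsilon_{\mathrm{Rough}}\leqslant\epsilon_*$ for a suitable $\epsilon_*>0$ not depending on the data. Then there exists $\alpha_0\leqslant\alpha$ such that the Cauchy problem $$\begin{cases}\tau\partial_t^3\psi+\partial_t^2\psi+\mathcal{A}\psi+(\delta+\tau)\mathcal{A}\partial_t\psi=\big(1+\frac{B}{2A}\big)\partial_t\big[(\partial_t\psi)^2\big],& x\in\mathbb{R}^n,\ t>0,\\ \psi(0,x)=\psi_0(x),\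 \partial_t\psi(0,x)=\psi_1(x),\ \partial_t^2\psi(0,x)=\psi_2(x),& x\in\mathbb{R}^n,\end{cases}$$ with complex-valued $\psi$ has a uniquely determined global in-time solution (in the time-derivative sense) $$\partial_t\psi\in\mathcal{C}(\mathbb{R}_+,E^{\alpha_0}_{s+\sigma})\cap\widetilde{L}^1(\mathbb{R}_+,E^{\alpha_0,s+\sigma}_{2,2})\cap\widetilde{L}^{\infty}(\mathbb{R}_+,E^{\alpha_0,s+\sigma}_{2,2}).$$
   Context: Notation. $|\xi|$ is the Euclidean norm, $|\xi|_\infty$ the maximum norm, $\langle\xi\rangle=\sqrt{1+|\xi|^2}$. $(-\Delta)^\sigma$ is the Fourier multiplier with symbol $|\xi|^{2\sigma}$. For time intervals, $\mathbb{R}_+$ means $[0,\infty)$. Octants. $\mathbb{R}^n_{\mathrm{Oct}}=\{\xi\in\mathbb{R}^n:\xi_j\geqslant0,\ j=1,\dots,n\}$ and, for $R>0$, $\mathbb{R}^n_{\mathrm{Oct},R}=\{\xi\in\mathbb{R}^n_{\mathrm{Oct}}:|\xi|_\infty\geqslant R\}$. Spaces. $\mathcal{S}_{\mathrm{G-S}}$ is the Fréchet space of Schwartz functions $f$ with $\sup_x e^{\lambda|x|}|f(x)|+\sup_\xi e^{\lambda|\xi|}|\widehat f(\xi)|<\infty$ for every $\lambda>0$; $\mathcal{S}'_{\mathrm{G-S}}$ is its dual, on which the Fourier transform is defined by duality. For $\alpha,s\in\mathbb{R}$, $E^\alpha_s=\{f\in\mathcal{S}'_{\mathrm{G-S}}:\langle\xi\rangle^s2^{\alpha|\xi|}\widehat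 f(\xi)\in L^2\}$ with norm $\|f\|_{E^\alpha_s}=\|\langle\xi\rangle^s2^{\alpha|\xi|}\widehat f\|_{L^2}$. For $k\in\mathbb{Z}^n$, $\square_kf=\mathcal{F}^{-1}(\chi_{k+[0,1)^n}\mathcal{F}f)$. For $\gamma\in[1,\infty]$, $\widetilde L^\gamma(\mathbb{R}_+,E^{\alpha,s}_{2,2})$ is the space with norm $$\|g\|_{\widetilde L^\gamma(\mathbb{R}_+,E^{\alpha,s}_{2,2})}=\Big(\sum_{k\in\mathbb{Z}^n}\big(\langle k\rangle^s2^{\alpha|k|}\|\square_kg\|_{L^\gamma_tL^2_x}\big)^2\Big)^{1/2}.$$ Products such as $\psi_1^2$ and $(\partial_t\psi)^2$ of elements with Fourier support in $\mathbb{R}^n_{\mathrm{Oct}}$ are defined through convolution on the Fourier side (with the constant corresponding to the chosen normalization of the Fourier transform); for each fixed frequency the convolution integral runs over a bounded set. Kernels and $N_0$. For $\lambda>0$ and $j\in\{0,1,2\}$, $\widehat{\mathcal{K}}_j(t,|\xi|;\lambda)$ is the solution $y(t)$ of $\tau y'''+y''+(\delta+\tau)|\lambda^{-1}\xi|^{2\sigma}y'+|\lambda^{-1}\xi|^{2\sigma}y=0$ with $y^{(i)}(0)=1$ if $i=j$ and $0$ if $i\neq j$, $i\in\{0,1,2\}$; $\mathcal{K}_j(t,|D|;\lambda)$ is the corresponding Fourier multiplier, and $\mathcal{K}_j(t,|D|):=\mathcal{K}_j(t,|D|;1)$. The constant $N_0>0$ depends only on $\tau,\delta,\sigma$ and is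 fixed so large that for all $\lambda>0$ and all $|\xi|\geqslant N_0\lambda$: the cubic $\tau\mu^3+\mu^2+(\delta+\tau)|\lambda^{-1}\xi|^{2\sigma}\mu+|\lambda^{-1}\xi|^{2\sigma}=0$ has one real root and two non-real complex conjugate roots, and, with constants $c,C>0$ independent of $\lambda,\xi,t$, $|\partial_t\widehat{\mathcal{K}}_0|+|\partial_t\widehat{\mathcal{K}}_1|+|\partial_t^2\widehat{\mathcal{K}}_2|\leqslant Ce^{-ct}$ and $|\partial_t\widehat{\mathcal{K}}_2|\leqslant C\lambda^\sigma|\xi|^{-\sigma}e^{-ct}$ for $t\geqslant0$. Solution. ''Solution in the time-derivative sense'' means that $\partial_t\psi$, with $\operatorname{supp}\partial_t\widehat\psi(t,\cdot)\subset\mathbb{R}^n_{\mathrm{Oct},N_0}$ for all $t$, satisfies the mild (Duhamel, integrated by parts in time) formulation $$\partial_t\psi(t)=\sum_{j=0}^2\partial_t\mathcal{K}_j(t,|D|)\psi_j-\tfrac1\tau\big(1+\tfrac{B}{2A}\big)\partial_t\mathcal{K}_2(t,|D|)\psi_1^2+\tfrac1\tau\big(1+\tfrac{B}{2A}\big)\int_0^t\partial_t^2\mathcal{K}_2(t-\theta,|D|)[\partial_t\psi(\theta)]^2\,d\theta .$$ *)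

(* Defs.v *)
From HB Require Import structures.
From mathcomp Require Import all_boot all_order all_algebra complex.
From mathcomp Require Import all_classical all_reals all_analysis.
Set Implicit Arguments.
Unset Strict Implicit.
Unset Printing Implicit Defensive.
Import Order.TTheory GRing.Theory Num.Def Num.Theory.
Import numFieldNormedType.Exports.
Local Open Scope classical_set_scope.
Local Open Scope ring_scope.
Local Open Scope complex_scope.

(* Borel sigma-algebra of R^n, generated by the coordinate functions. *)
Definition rV_display : measure_display -> measure_display.
Proof. exact. Qed.

Section measurable_rV.
Context {d} {T : measurableType d}.
Variable n : nat.

Let coords (i : 'I_n) (x : 'rV[T]_n) : T := x 0 i.

Let rV_set0 : g_sigma_preimage coords set0.
Proof. exact: sigma_algebra0. Qed.

Let rV_setC A : g_sigma_preimage coords A -> g_sigma_preimage coords (~` A).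
Proof. exact: sigma_algebraC. Qed.

Let rV_bigcup (F : (set 'rV[T]_n)^nat) :
  (forall i, g_sigma_preimage coords (F i)) ->
  g_sigma_preimage coords (\bigcup_i (F i)).
Proof. exact: sigma_algebra_bigcup. Qed.

HB.instance Definition _ := @isMeasurable.Build (rV_display d)
  'rV[T]_n (g_sigma_preimage coords) rV_set0 rV_setC rV_bigcup.

Lemma measurable_coord (i : 'I_n) :
  measurable_fun [set: 'rV[T]_n] (fun x : 'rV[T]_n => x 0 i).
Proof.
move=> _ Y mY; rewrite setTI; apply: sub_sigma_algebra => /=.
rewrite -bigcup_seq/=; exists i => /=; first by rewrite mem_index_enum.
by exists Y => //; rewrite setTI.
Qed.

Lemma measurable_fun_coordP d1 (T1 : measurableType d1) (f : T1 -> 'rV[T]_n) :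
  (forall i, measurable_fun [set: T1] (fun x => f x 0 i)) ->
  measurable_fun [set: T1] f.
Proof.
move=> mf.
have mc : measurable_fun [set: T1] (f : T1 -> g_sigma_algebraType
    (\big[setU/set0]_(i < n) preimage_set_system setT (@coords i) measurable)).
  apply: measurability => //.
  move=> _ [B + <-]; rewrite -bigcup_seq/= => -[i _ [A mA <-]].
  rewrite setTI; have := mf i measurableT A mA.
  by rewrite !setTI.
by move=> mT A mA; exact: mc.
Qed.

End measurable_rV.

Section lebesgue_rV.
Context {R : realType}.

Definition rV_cons n (p : R * 'rV[R]_n) : 'rV[R]_n.+1 :=
  \row_i oapp (p.2 0) p.1 (unlift ord0 i).

Lemma measurable_rV_cons n : measurable_fun [set: R * 'rV[R]_n] (@rV_cons n).
Proof.
apply: measurable_fun_coordP => i; case: (unliftP ord0 i) => [j|] ->.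
  rewrite (_ : (fun x => _) = (fun x : 'rV[R]_n => x 0 j) \o snd).
    exact: (measurableT_comp (measurable_coord j)).
  by apply/funext => x /=; rewrite mxE liftK.
rewrite (_ : (fun x => _) = fst); first exact: measurable_fst.
by apply/funext => x /=; rewrite mxE unlift_none.
Qed.

Section step.
Variables (n : nat) (m : {sigma_finite_measure set 'rV[R]_n -> \bar R}).

Definition lebesgue_rV_step : set 'rV[R]_n.+1 -> \bar R :=
  pushforward (@lebesgue_measure R \x m)%E (@rV_cons n).

HB.instance Definition _ := Measure.copy lebesgue_rV_step
  (measure_function_pushforward__canonical__measure_function_Measure
    (@lebesgue_measure R \x m)%E (@measurable_rV_cons n)).

Let lebesgue_rV_step_sigma_finite : sigma_finite setT lebesgue_rV_step.
Proof.
have [F FT Ffin] : sigma_finite setT (@lebesgue_measure R \x m)%E.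
  have /sigma_finiteP[A [TA ndA Aoo]] := sigma_finiteT (@lebesgue_measure R).
  have /sigma_finiteP[B [TB ndB Boo]] := sigma_finiteT m.
  exists (fun k => A k `*` B k).
    rewrite -setXTT TA TB predeqE => -[x y]; split=> [|[k _ []/= ? ?]].
      move=> [/= [i _ Aix] [j _ Bjy]]; exists (maxn i j) => //; split.
      - by move: x Aix; exact/subsetPset/ndA/leq_maxl.
      - by move: y Bjy; exact/subsetPset/ndB/leq_maxr.
    by split; exists k.
  move=> k; have [? ?] := Aoo k; have [? ?] := Boo k.
  split; first exact: measurableX.
  by rewrite product_measure1E// lte_mul_pinfty// ge0_fin_numE.
pose uncons (x : 'rV[R]_n.+1) := (x 0 ord0, \row_j x 0 (lift ord0 j)).
have consK : cancel (@rV_cons n) uncons.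
  move=> [a x]; rewrite /uncons /rV_cons !mxE unlift_none/=; congr pair.
  by apply/rowP => j; rewrite !mxE liftK.
have unconsK : cancel uncons (@rV_cons n).
  move=> x; apply/rowP => i; rewrite !mxE.
  by case: unliftP => [j|] -> /=; rewrite ?mxE.
have muncons : measurable_fun setT uncons.
  apply/measurable_fun_pairP; split; first exact: measurable_coord.
  apply: measurable_fun_coordP => i.
  rewrite (_ : (fun _ => _) = fun x : 'rV[R]_n.+1 => x 0 (lift ord0 i)).
    exact: measurable_coord.
  by apply/funext => x; rewrite /= mxE.
exists (fun k => uncons @^-1` F k).
  by rewrite -preimage_bigcup -FT preimage_setT.
move=> k; have [mF Foo] := Ffin k; split.
  by rewrite -[X in measurable X]setTI; exact: muncons.
rewrite /lebesgue_rV_step /pushforward -comp_preimage.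
by rewrite (_ : uncons \o _ = id) //; apply/funext => p; exact: consK.
Qed.

HB.instance Definition _ := Measure_isSigmaFinite.Build _ _ _
  lebesgue_rV_step lebesgue_rV_step_sigma_finite.
End step.

Fixpoint lebesgue_rV n : {sigma_finite_measure set 'rV[R]_n -> \bar R} :=
  if n is n'.+1 then lebesgue_rV_step (lebesgue_rV n')
  else \d_(0 : 'rV[R]_0).

End lebesgue_rV.

Section complex_functions.
Context {R : realType}.

Definition cabs (z : R[i]) : R := Normc.normc z.

Definition cis (t : R) : R[i] := cos t +i* sin t.

Context {d : measure_display} {T : measurableType d}.
Variable mu : {measure set T -> \bar R}.

Definition cmeasurable (D : set T) (f : T -> R[i]) : Prop :=
  measurable_fun D (fun x => complex.Re (f x)) /\
  measurable_fun D (fun x => complex.Im (f x)).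

Definition cintegrable (D : set T) (f : T -> R[i]) : Prop :=
  mu.-integrable D (fun x => (complex.Re (f x))%:E) /\
  mu.-integrable D (fun x => (complex.Im (f x))%:E).

Definition cintegral (D : set T) (f : T -> R[i]) : R[i] :=
  (\int[mu]_(x in D) complex.Re (f x)) +i* (\int[mu]_(x in D) complex.Im (f x)).

End complex_functions.

Section gelfand_shilov.
Context {R : realType} {n : nat}.
Local Notation V := 'rV[R]_n.
Local Notation C := R[i].
Local Notation leb := (@lebesgue_rV R n).

Definition dotp (x y : V) : R := \sum_(i < n) x 0 i * y 0 i.

(* The library norm on 'rV[R]_n is the maximum norm. *)
Definition enorm (x : V) : R := Num.sqrt (\sum_(i < n) x 0 i ^+ 2).

Definition japanese (x : V) : R := Num.sqrt (1 + enorm x ^+ 2).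

(* Unitary normalization of the Fourier transform. *)
Definition fourier_const : R := (Num.sqrt (2 * pi) ^+ n)^-1.

Definition fourier (f : V -> C) (xi : V) : C :=
  fourier_const%:C * cintegral leb setT (fun x => f x * cis (- dotp x xi)).

Definition inverse_fourier (g : V -> C) (x : V) : C :=
  fourier_const%:C * cintegral leb setT (fun xi => g xi * cis (dotp x xi)).

Definition partials (l : seq 'I_n) (f : V -> R) : V -> R :=
  foldr (fun i g x => 'D_(delta_mx 0 i) g x) f l.

Definition real_schwartz (f : V -> R) : Prop :=
  forall l : seq 'I_n,
    (forall x, differentiable (partials l f) x) /\
    (forall m : nat, exists M : R,
      forall x, japanese x ^+ m * `|partials l f x| <= M).

Definition schwartz (f : V -> C) : Prop :=
  real_schwartz (fun x => complex.Re (f x)) /\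
  real_schwartz (fun x => complex.Im (f x)).

Definition gs_norm (lambda : R) (f : V -> C) : \bar R :=
  (ereal_sup (range (fun x => (expR (lambda * enorm x) * cabs (f x))%:E)) +
   ereal_sup (range
     (fun xi => (expR (lambda * enorm xi) * cabs (fourier f xi))%:E)))%E.

Definition gs_space : set (V -> C) :=
  [set f | schwartz f /\
           forall lambda, 0 < lambda -> (gs_norm lambda f < +oo)%E].

(* Functionals are total maps on functions, but only their values on
   [gs_space] matter. *)
Definition functional : Type := (V -> C) -> C.

Definition eq_on_gs (T1 T2 : functional) : Prop :=
  forall f, gs_space f -> T1 f = T2 f.

(* The norms [gs_norm lambda] increase with lambda and generate the Frechet
   topology, so a linear functional is continuous iff one of them bounds it. *)
Definition gs_dual : set functional :=
  [set T | (forall (a : C) (f g : V -> C), gs_space f -> gs_space g ->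
              T (fun x => a * f x + g x) = a * T f + T g) /\
           exists lambda M : R, 0 < lambda /\
             forall f, gs_space f ->
               ((cabs (T f))%:E <= M%:E * gs_norm lambda f)%E].

Definition dual_fourier (T : functional) : functional := fun f => T (fourier f).

Definition represents (g : V -> C) (T : functional) : Prop :=
  cmeasurable setT g /\
  forall f, gs_space f ->
    cintegrable leb setT (fun x => g x * f x) /\
    T f = cintegral leb setT (fun x => g x * f x).

Definition regular (T : functional) : Prop := exists g, represents g T.

(* The (almost everywhere unique) function representing T; junk value 0. *)
Definition density (T : functional) : V -> C :=
  xget (fun=> 0) [set g | represents g T].

Definition hat (T : functional) : V -> C := density (dual_fourier T).

(* F^-1 of the functional represented by g. *)
Definition of_hat (g : V -> C) : functional :=
  fun f => cintegral leb setT (fun xi => g xi * inverse_fourier f xi).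

(* || w T ||_{L^2}, infinite when T is not represented by a function *)
Definition weighted_L2 (w : V -> R) (T : functional) : \bar R :=
  if `[< regular T >]
  then Lnorm leb 2%:E (fun x => (w x * cabs (density T x))%:E)
  else +oo%E.

Definition L2norm (T : functional) : \bar R := weighted_L2 (fun=> 1) T.

Definition supp (g : V -> C) : set V :=
  [set x | forall U : set V, nbhs x U -> ~ {ae leb, forall y, U y -> g y = 0}].

Definition multiplier (m : V -> C) (T : functional) : functional :=
  of_hat (fun xi => m xi * hat T xi).

(* With the unitary normalization the transform of a product fg is
   (2 pi)^{-n/2} times the convolution of the transforms. *)
Definition square (T : functional) : functional :=
  of_hat (fun xi => fourier_const%:C *
    cintegral leb setT (fun eta => hat T (xi - eta) * hat T eta)).

Definition octant : set V := [set xi | forall i, 0 <= xi 0 i].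

Definition octant_ge (N : R) : set V := octant `&` [set xi | N <= `|xi|].

Definition exp_weight (alpha s : R) (xi : V) : R :=
  japanese xi `^ s * 2 `^ (alpha * enorm xi).

Definition Enorm (alpha s : R) (T : functional) : \bar R :=
  weighted_L2 (exp_weight alpha s) (dual_fourier T).

Definition Espace (alpha s : R) : set functional :=
  [set T | gs_dual T /\ (Enorm alpha s T < +oo)%E].

Definition cube (k : 'rV[int]_n) : set V :=
  [set xi | forall i, (k 0 i)%:~R <= xi 0 i < (k 0 i)%:~R + 1].

Definition box_op (k : 'rV[int]_n) : functional -> functional :=
  multiplier (fun xi => (\1_(cube k) xi)%:C).

Definition box_norm (gamma : \bar R) (u : R -> functional) (k : 'rV[int]_n)
    : \bar R :=
  Lnorm (@lebesgue_measure R) gamma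
    (fun t => if 0 <= t then L2norm (box_op k (u t)) else 0%E).

Definition Ltilde_norm (gamma : \bar R) (alpha s : R) (u : R -> functional)
    : \bar R :=
  ((\esum_(k in [set: 'rV[int]_n])
      ((exp_weight alpha s (map_mx intr k))%:E * box_norm gamma u k) ^+ 2)
     `^ 2^-1)%E.

(* The regularity requirement is there because the operators [box_op k] are
   only meaningful when the Fourier transform of u(t) is a function. *)
Definition Ltilde (gamma : \bar R) (alpha s : R) : set (R -> functional) :=
  [set u | [/\ forall t : R, 0 <= t ->
                 gs_dual (u t) /\ regular (dual_fourier (u t)),
               forall f, gs_space f ->
                 cmeasurable (`[0, +oo[ : set R) (fun t => u t f)
             & (Ltilde_norm gamma alpha s u < +oo)%E]].

Definition Ccurves (alpha s : R) : set (R -> functional) :=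
  [set u | forall t : R, 0 <= t ->
     Espace alpha s (u t) /\
     Enorm alpha s (fun f => u r f - u t f)
       @[r --> within (`[0, +oo[ : set R) (nbhs t)] --> 0%E].

End gelfand_shilov.

Section kernels.
Context {R : realType}.
Variables tau delta sigma : R.

(* [r] stands for |xi| and [rho] for |xi / lambda|^(2 sigma) *)
Definition kernel_ode (rho : R) (y : R -> R) : Prop :=
  forall t : R, (forall m, (m < 3)%N -> derivable (derive1n m y) t 1) /\
    tau * derive1n 3 y t + derive1n 2 y t + (delta + tau) * rho * derive1n 1 y t
      + rho * y t = 0.

Definition jmgt_kernel (j : nat) (lambda r : R) : R -> R :=
  xget (fun=> 0) [set y | kernel_ode ((r / lambda) `^ (2 * sigma)) y /\
    forall i, (i < 3)%N -> derive1n i y 0 = (i == j)%:R].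

Definition kernel_cubic (lambda r : R) : {poly R[i]} :=
  let rho := (r / lambda) `^ (2 * sigma) in
  map_poly (fun x : R => x%:C)
    (tau *: 'X^3 + 'X^2 + ((delta + tau) * rho) *: 'X + rho%:P).

Definition high_frequency (N0 : R) : Prop :=
  [/\ 0 < N0,
      forall lambda r : R, 0 < lambda -> N0 * lambda <= r ->
        exists (mu : R) (z : R[i]), complex.Im z != 0 /\
          kernel_cubic lambda r =
            tau%:C *: (('X - (mu%:C)%:P) * ('X - z%:P) * ('X - (z^*)%:P))
    & exists c M : R, [/\ 0 < c, 0 < M &
        forall lambda r t : R, 0 < lambda -> N0 * lambda <= r -> 0 <= t ->
          `|derive1n 1 (jmgt_kernel 0 lambda r) t|
            + `|derive1n 1 (jmgt_kernel 1 lambda r) t|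
            + `|derive1n 2 (jmgt_kernel 2 lambda r) t| <= M * expR (- c * t) /\
          `|derive1n 1 (jmgt_kernel 2 lambda r) t|
            <= M * lambda `^ sigma * r `^ (- sigma) * expR (- c * t)]].

Definition kernel_op {n : nat} (m j : nat) (t : R)
    : @functional R n -> @functional R n :=
  multiplier (fun xi => (derive1n m (jmgt_kernel j 1 (enorm xi)) t)%:C).

(* Here v stands for d_t psi and BA for B/A, and the Duhamel integral is the
   weak integral in the dual space. *)
Definition time_derivative_solution {n : nat} (BA N0 : R)
    (psi0 psi1 psi2 : @functional R n) (v : R -> @functional R n) : Prop :=
  let kappa := ((1 + BA / 2) / tau)%:C in
  forall t : R, 0 <= t ->
    supp (hat (v t)) `<=` octant_ge N0 /\
    forall f, gs_space f ->
      let nonlinearity theta := kernel_op 2 2 (t - theta) (square (v theta)) f in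
      cintegrable (@lebesgue_measure R) `[0, t] nonlinearity /\
      v t f = kernel_op 1 0 t psi0 f + kernel_op 1 1 t psi1 f
              + kernel_op 1 2 t psi2 f
              - kappa * kernel_op 1 2 t (square psi1) f
              + kappa * cintegral (@lebesgue_measure R) `[0, t] nonlinearity.

End kernels.

Definition solution_space {R : realType} {n : nat} (alpha s : R)
    : set (R -> @functional R n) :=
  Ccurves alpha s `&` Ltilde 1%:E alpha s `&` Ltilde +oo%E alpha s.

(* Main.v *)
From HB Require Import structures.
From mathcomp Require Import all_boot all_order all_algebra complex ring lra.
From mathcomp Require Import all_classical all_reals all_analysis measurable_realfun.
Require Import Defs.
Set Implicit Arguments.
Unset Strict Implicit.
Unset Printing Implicit Defensive.
Import Order.TTheory GRing.Theory Num.Def Num.Theory.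
Import numFieldNormedType.Exports.
Local Open Scope classical_set_scope.
Local Open Scope ring_scope.
Local Open Scope complex_scope.

(* The exponent [alpha0] may be taken as negative as one likes, which removes every smallness
   condition. On the Fourier side the equation reads
     g t = l t + duhamel k g t,  |k t| <= M e^(-ct) and |l t x| <= e^(-ct) a x,
   with everything supported in the octant, where [norm1] is additive and at least [N0] on the
   supports. Hence a convolution at x only involves values at points of norm at most
   [norm1 x - N0]: the Picard iterates are eventually constant at each point, so the limit
   needs no contraction. For the same reason the factor e^(b norm1) commutes with convolution;
   for b large the weighted data are small in L^1 and L^2, and a scalar majorant iteration
   gives |g t x| <= e^(-ct) e^(b norm1 x) A x with A in L^1 and L^2, which the weight
   of [alpha0] absorbs.

   Uniqueness is an induction on m: two solutions agree for [norm1 x < m N0]. The mild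
   formulation only holds against test functions, so it is tested with Gaussians, whose
   transforms are explicit, and extended to indicators of bounded Borel sets by dominated
   limits. This also yields Fourier inversion, uniqueness of densities and the Plancherel
   inequality needed to identify the norms of the solution. *)

(** * Complex-valued integrals *)

(** Two obstacles shape the development. First, [hat] picks a density separately at each time, so a
    solution given in advance has no joint measurability in time and frequency. Existence builds a
    jointly measurable [g], where Fubini is available; uniqueness only ever uses iterated integrals,
    frequency first and time second, and passes to the limit in each of them. Second, densities are
    determined only almost everywhere, whereas the localisation of convolutions on the octant is
    pointwise; [cut] replaces a density by a version that vanishes everywhere outside [octant_ge].

    The majorant is kept in both L^1 and L^2 because the quadratic map uses both: the L^2 bound
    makes the self-convolution finite at every point, the L^1 bound makes its integral the square of
    a small number, and together they control its L^2 norm. Time decay is preserved because the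
    nonlinearity carries e^(-2 c theta), half of which pays for the time integral. *)

Section complex_modulus.
Context {R : realType}.
Implicit Types z w : R[i].

Lemma ReM z w : complex.Re (z * w) =
  complex.Re z * complex.Re w - complex.Im z * complex.Im w.
Proof. by case: z w => a b [c d]. Qed.

Lemma ImM z w : complex.Im (z * w) =
  complex.Re z * complex.Im w + complex.Im z * complex.Re w.
Proof. by case: z w => a b [c d]. Qed.

Lemma ReD z w : complex.Re (z + w) = complex.Re z + complex.Re w.
Proof. by case: z w => a b [c d]. Qed.

Lemma ImD z w : complex.Im (z + w) = complex.Im z + complex.Im w.
Proof. by case: z w => a b [c d]. Qed.

Lemma ReN z : complex.Re (- z) = - complex.Re z.
Proof. by case: z. Qed.

Lemma ImN z : complex.Im (- z) = - complex.Im z.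
Proof. by case: z. Qed.

Lemma complexP z w : complex.Re z = complex.Re w ->
  complex.Im z = complex.Im w -> z = w.
Proof. by case: z w => a b [c d] /= -> ->. Qed.

Lemma sqr_cabs z : cabs z ^+ 2 = complex.Re z ^+ 2 + complex.Im z ^+ 2.
Proof. by case: z => a b /=; rewrite /cabs/= sqr_sqrtr// addr_ge0// sqr_ge0. Qed.

Lemma cabs_ge0 z : 0 <= cabs z.
Proof. by case: z => a b; rewrite /cabs/= sqrtr_ge0. Qed.

Lemma cabsM z w : cabs (z * w) = cabs z * cabs w.
Proof. exact: Normc.normcM. Qed.

Lemma cabsD z w : cabs (z + w) <= cabs z + cabs w.
Proof. exact: le_normcD. Qed.

Lemma cabsN z : cabs (- z) = cabs z.
Proof. by case: z => a b; rewrite /cabs/= !sqrrN. Qed.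

Lemma cabs0 : cabs (0 : R[i]) = 0.
Proof. exact: Normc.normc0. Qed.

Lemma cabs_eq0 z : cabs z = 0 -> z = 0.
Proof. exact: Normc.eq0_normc. Qed.

Lemma cabs_real (x : R) : cabs x%:C = `|x|.
Proof. by rewrite /cabs/= expr0n/= addr0 sqrtr_sqr. Qed.

Lemma cabs_cis (x : R) : cabs (cis x) = 1.
Proof. by rewrite /cabs/= cos2Dsin2 sqrtr1. Qed.

Lemma cisD (x y : R) : cis (x + y) = cis x * cis y.
Proof. by apply: complexP; rewrite ?ReM ?ImM/= ?cosD ?sinD// addrC. Qed.

Lemma normr_Re_le z : `|complex.Re z| <= cabs z.
Proof.
by rewrite -(@ler_pXn2r _ 2) ?nnegrE ?cabs_ge0// sqr_cabs real_normK ?num_real// lerDl sqr_ge0.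
Qed.

Lemma normr_Im_le z : `|complex.Im z| <= cabs z.
Proof.
by rewrite -(@ler_pXn2r _ 2) ?nnegrE ?cabs_ge0// sqr_cabs real_normK ?num_real// lerDr sqr_ge0.
Qed.

Lemma cabs_le_ReIm z : cabs z <= `|complex.Re z| + `|complex.Im z|.
Proof.
rewrite -(@ler_pXn2r _ 2) ?nnegrE ?cabs_ge0 ?addr_ge0// sqr_cabs sqrrD.
rewrite !real_normK ?num_real// lerD2r lerDl mulrn_wge0// mulr_ge0//.
Qed.

(** Rotating a complex integral onto the positive axis reduces its triangle inequality to the real
    one. *)
Lemma cabs_rotate z : exists2 u : R[i], cabs u <= 1 & complex.Re (u * z) = cabs z.
Proof.
have [->|z0] := eqVneq z 0.
  by rewrite cabs0; exists 0; rewrite ?mul0r ?cabs0.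
have cz0 : cabs z != 0 by apply: contra_neq z0; exact: cabs_eq0.
have s : cabs z ^+ 2 = complex.Re z ^+ 2 + complex.Im z ^+ 2 by exact: sqr_cabs.
exists (complex.Complex (complex.Re z / cabs z) (- complex.Im z / cabs z)).
  rewrite /cabs/= -/(cabs z) !expr_div_n sqrrN -mulrDl -s divff ?expf_neq0//.
  by rewrite sqrtr1.
rewrite ReM/=; apply: (mulIf cz0); rewrite -expr2 s mulrBl.
by field.
Qed.

End complex_modulus.

Section complex_measurability.
Context {R : realType} {d : measure_display} {T : measurableType d}.
Implicit Types (D : set T) (f g : T -> R[i]).

Lemma cmeasurable_cst D (c : R[i]) : cmeasurable D (fun=> c).
Proof. by split; exact: measurable_cst. Qed.

Lemma cmeasurable_real D (f : T -> R) : measurable_fun D f ->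
  cmeasurable D (fun x => (f x)%:C).
Proof. by move=> mf; split => //=; exact: measurable_cst. Qed.

Lemma cmeasurableD D f g : cmeasurable D f -> cmeasurable D g ->
  cmeasurable D (fun x => f x + g x).
Proof.
move=> [mf1 mf2] [mg1 mg2]; split.
- by under eq_fun do rewrite ReD; exact: measurable_funD.
- by under eq_fun do rewrite ImD; exact: measurable_funD.
Qed.

Lemma cmeasurableN D f : cmeasurable D f -> cmeasurable D (fun x => - f x).
Proof.
move=> [mf1 mf2]; split.
- by under eq_fun do rewrite ReN; exact: measurableT_comp.
- by under eq_fun do rewrite ImN; exact: measurableT_comp.
Qed.

Lemma cmeasurableB D f g : cmeasurable D f -> cmeasurable D g ->
  cmeasurable D (fun x => f x - g x).
Proof. by move=> mf mg; apply: cmeasurableD => //; exact: cmeasurableN. Qed.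

Lemma cmeasurableM D f g : cmeasurable D f -> cmeasurable D g ->
  cmeasurable D (fun x => f x * g x).
Proof.
move=> [mf1 mf2] [mg1 mg2]; split.
- under eq_fun do rewrite ReM.
  by apply: measurable_funB; exact: measurable_funM.
- under eq_fun do rewrite ImM.
  by apply: measurable_funD; exact: measurable_funM.
Qed.

Lemma cmeasurable_cis D (f : T -> R) : measurable_fun D f ->
  cmeasurable D (fun x => cis (f x)).
Proof.
move=> mf; split => /=.
- by apply: measurableT_comp => //; apply: continuous_measurable_fun; exact: continuous_cos.
- by apply: measurableT_comp => //; apply: continuous_measurable_fun; exact: continuous_sin.
Qed.

Lemma measurable_cabs D f : cmeasurable D f ->
  measurable_fun D (fun x => cabs (f x)).
Proof.
move=> [mf1 mf2].
rewrite (_ : (fun _ => _) = fun x => Num.sqrt (complex.Re (f x) ^+ 2 + complex.Im (f x) ^+ 2)).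
  apply: (@measurableT_comp _ _ _ _ _ _ (@Num.sqrt R)) => //.
    by apply: continuous_measurable_fun; exact: sqrt_continuous.
  by apply: measurable_funD; apply: measurable_funX.
by apply/funext => x; rewrite /cabs; case: (f x).
Qed.

Lemma measurable_ecabs D f : cmeasurable D f ->
  measurable_fun D (fun x => (cabs (f x))%:E).
Proof. by move=> mf; apply/measurable_EFinP; exact: measurable_cabs. Qed.

Lemma cmeasurableS D f : measurable D -> cmeasurable setT f -> cmeasurable D f.
Proof. by move=> mD [mf1 mf2]; split; exact: measurable_funTS. Qed.

Lemma cmeasurable_comp {d'} {T' : measurableType d'} (D : set T') (g : T' -> T) f :
  cmeasurable setT f -> measurable_fun D g -> cmeasurable D (fun x => f (g x)).
Proof. by move=> [mf1 mf2] mg; split; [exact: (measurableT_comp mf1)|exact: (measurableT_comp mf2)]. Qed.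

Lemma cmeasurable_indic D (A : set T) : measurable A ->
  cmeasurable D (fun x => (\1_A x : R)%:C).
Proof. by move=> mA; apply: cmeasurable_real; apply: measurable_indic. Qed.

Lemma cmeasurable_cvg D (u : nat -> T -> R[i]) f : measurable D ->
  (forall k, cmeasurable D (u k)) ->
  (forall x, D x -> (fun k => complex.Re (u k x)) @ \oo --> complex.Re (f x)) ->
  (forall x, D x -> (fun k => complex.Im (u k x)) @ \oo --> complex.Im (f x)) ->
  cmeasurable D f.
Proof.
move=> mD mu c1 c2; split.
- by apply: (measurable_fun_cvg (h := fun k x => complex.Re (u k x))) => // k; case: (mu k).
- by apply: (measurable_fun_cvg (h := fun k x => complex.Im (u k x))) => // k; case: (mu k).
Qed.

End complex_measurability.

Section complex_integral.
Context {R : realType} {d : measure_display} {T : measurableType d}.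
Variable mu : {measure set T -> \bar R}.
Variable D : set T.
Hypothesis mD : measurable D.
Implicit Types f g : T -> R[i].

Lemma cintegrable_cmeasurable f : cintegrable mu D f -> cmeasurable D f.
Proof.
by move=> [/measurable_int /measurable_EFinP ? /measurable_int /measurable_EFinP ?]; split.
Qed.

Lemma cintegrable_le f (g : T -> R) : cmeasurable D f ->
  mu.-integrable D (EFin \o g) -> (forall x, D x -> cabs (f x) <= g x) ->
  cintegrable mu D f.
Proof.
move=> [mf1 mf2] ig fg; split.
- apply: (le_integrable mD _ _ ig); first exact/measurable_EFinP.
  move=> x Dx; rewrite /= lee_fin (le_trans (normr_Re_le _))//.
  by rewrite (le_trans (fg _ Dx))// ler_norm.
- apply: (le_integrable mD _ _ ig); first exact/measurable_EFinP.
  move=> x Dx; rewrite /= lee_fin (le_trans (normr_Im_le _))//.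
  by rewrite (le_trans (fg _ Dx))// ler_norm.
Qed.

Lemma integrable_cabs f : cintegrable mu D f ->
  mu.-integrable D (fun x => (cabs (f x))%:E).
Proof.
move=> fi; have [f1 f2] := fi.
have := integrableD mD (integrable_abse f1) (integrable_abse f2).
apply: le_integrable => //.
  by apply: measurable_ecabs; exact: cintegrable_cmeasurable.
move=> x Dx /=; rewrite lee_fin ger0_norm ?cabs_ge0// ger0_norm ?addr_ge0//.
exact: cabs_le_ReIm.
Qed.

Lemma cintegrableP f : cintegrable mu D f <->
  cmeasurable D f /\ (\int[mu]_(x in D) (cabs (f x))%:E < +oo)%E.
Proof.
split=> [fi|[mf foo]].
  split; first exact: cintegrable_cmeasurable.
  by have /integrable_lty := integrable_cabs fi; apply.
apply: (@cintegrable_le _ (fun x => cabs (f x))) => //.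
apply/integrableP; split; first exact: measurable_ecabs.
by under eq_integral do rewrite /= ger0_norm ?cabs_ge0//.
Qed.

Lemma cintegrable_lty f : cmeasurable D f ->
  (\int[mu]_(x in D) (cabs (f x))%:E < +oo)%E -> cintegrable mu D f.
Proof. by move=> ? ?; apply/cintegrableP. Qed.

Lemma cintegrableD f g : cintegrable mu D f -> cintegrable mu D g ->
  cintegrable mu D (fun x => f x + g x).
Proof.
move=> [f1 f2] [g1 g2]; split.
- by under eq_fun do rewrite ReD EFinD; exact: integrableD.
- by under eq_fun do rewrite ImD EFinD; exact: integrableD.
Qed.

Lemma cintegrableZ (c : R[i]) f : cintegrable mu D f ->
  cintegrable mu D (fun x => c * f x).
Proof.
move=> fi; have iabs := integrable_cabs fi.
apply: (@cintegrable_le _ (fun x => cabs c * cabs (f x))).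
- by apply: cmeasurableM; [exact: cmeasurable_cst|exact: cintegrable_cmeasurable].
- exact: (integrableZl mD (cabs c) iabs).
- by move=> x _; rewrite cabsM.
Qed.

Lemma cintegrableB f g : cintegrable mu D f -> cintegrable mu D g ->
  cintegrable mu D (fun x => f x - g x).
Proof.
move=> fi gi; have := cintegrableD fi (cintegrableZ (-1) gi).
by under eq_fun do rewrite mulN1r.
Qed.

Lemma cintegrable_bounded f g (M : R) : cintegrable mu D f -> cmeasurable D g ->
  (forall x, D x -> cabs (g x) <= M) -> cintegrable mu D (fun x => g x * f x).
Proof.
move=> fi mg gM.
have iabs := integrable_cabs fi.
apply: (@cintegrable_le _ (fun x => M * cabs (f x))).
- by apply: cmeasurableM => //; exact: cintegrable_cmeasurable.
- exact: (integrableZl mD M iabs).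
- by move=> x Dx; rewrite cabsM ler_wpM2r ?cabs_ge0// gM.
Qed.

Lemma eq_cintegral f g : {in D, f =1 g} -> cintegral mu D f = cintegral mu D g.
Proof.
by move=> fg; rewrite /cintegral; congr (_ +i* _); apply: eq_Rintegral => x xD; rewrite fg.
Qed.

Lemma ae_eq_cintegral f g : cmeasurable D f -> cmeasurable D g ->
  {ae mu, forall x, D x -> f x = g x} -> cintegral mu D f = cintegral mu D g.
Proof.
move=> [f1 f2] [g1 g2] fg; rewrite /cintegral /Rintegral; congr (fine _ +i* fine _).
- apply: ae_eq_integral => //; [exact/measurable_EFinP|exact/measurable_EFinP|].
  by apply: filterS fg => x + Dx => ->.
- apply: ae_eq_integral => //; [exact/measurable_EFinP|exact/measurable_EFinP|].
  by apply: filterS fg => x + Dx => ->.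
Qed.

Lemma cintegral0 : cintegral mu D (fun=> 0) = 0.
Proof. by rewrite /cintegral /Rintegral/= integral0. Qed.

Lemma cintegralD f g : cintegrable mu D f -> cintegrable mu D g ->
  cintegral mu D (fun x => f x + g x) = cintegral mu D f + cintegral mu D g.
Proof.
move=> [f1 f2] [g1 g2]; rewrite /cintegral.
under eq_Rintegral do rewrite ReD.
under [X in _ +i* X]eq_Rintegral do rewrite ImD.
by rewrite !RintegralD.
Qed.

Lemma cintegralZ (c : R[i]) f : cintegrable mu D f ->
  cintegral mu D (fun x => c * f x) = c * cintegral mu D f.
Proof.
move=> [f1 f2]; apply: complexP.
- rewrite ReM /cintegral/=; under eq_Rintegral do rewrite ReM.
  rewrite RintegralB//; last 2 first.
  - exact: (integrableZl mD _ f1).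
  - exact: (integrableZl mD _ f2).
  by rewrite !RintegralZl.
- rewrite ImM /cintegral/=; under eq_Rintegral do rewrite ImM.
  rewrite RintegralD//; last 2 first.
  - exact: (integrableZl mD _ f2).
  - exact: (integrableZl mD _ f1).
  by rewrite !RintegralZl.
Qed.

Lemma cintegralB f g : cintegrable mu D f -> cintegrable mu D g ->
  cintegral mu D (fun x => f x - g x) = cintegral mu D f - cintegral mu D g.
Proof.
move=> fi gi; under eq_cintegral do rewrite -mulN1r.
by rewrite cintegralD//; [rewrite cintegralZ// mulN1r|exact: cintegrableZ].
Qed.

Lemma le_cabs_cintegral_integrable f : cintegrable mu D f ->
  ((cabs (cintegral mu D f))%:E <= \int[mu]_(x in D) (cabs (f x))%:E)%E.
Proof.
move=> fi; have [u u1 uE] := cabs_rotate (cintegral mu D f).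
have iabs := integrable_cabs fi.
have [ui _] := cintegrableZ u fi.
rewrite -uE -cintegralZ//= /Rintegral fineK; last exact: integrable_fin_num.
apply: le_integral => // x _.
rewrite lee_fin (le_trans (ler_norm _))// (le_trans (normr_Re_le _))// cabsM.
by rewrite ler_piMl// cabs_ge0.
Qed.

(** If [f] is not integrable the right-hand side is +oo, so measurability is enough and estimates
    can precede the proof of integrability. *)
Lemma le_cabs_cintegral f : cmeasurable D f ->
  ((cabs (cintegral mu D f))%:E <= \int[mu]_(x in D) (cabs (f x))%:E)%E.
Proof.
move=> mf; have [foo|] := ltP (\int[mu]_(x in D) (cabs (f x))%:E)%E +oo%E.
  by apply: le_cabs_cintegral_integrable; exact: cintegrable_lty.
by rewrite leye_eq => /eqP ->; rewrite leey.
Qed.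

Lemma cdominated_convergence (u : nat -> T -> R[i]) f (g : T -> R) :
  (forall k, cmeasurable D (u k)) -> mu.-integrable D (EFin \o g) ->
  (forall k x, D x -> cabs (u k x) <= g x) ->
  (forall x, D x -> (fun k => complex.Re (u k x)) @ \oo --> complex.Re (f x)) ->
  (forall x, D x -> (fun k => complex.Im (u k x)) @ \oo --> complex.Im (f x)) ->
  [/\ cintegrable mu D f,
      (fun k => complex.Re (cintegral mu D (u k))) @ \oo --> complex.Re (cintegral mu D f) &
      (fun k => complex.Im (cintegral mu D (u k))) @ \oo --> complex.Im (cintegral mu D f)].
Proof.
move=> mu_ ig ug cre cim.
have mf : cmeasurable D f by exact: (cmeasurable_cvg mD mu_ cre cim).
have ui k : cintegrable mu D (u k) by apply: (cintegrable_le (mu_ k) ig); exact: ug.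
(* [F] is the real or the imaginary part; all that matters is that the modulus dominates both. *)
have aux (F : R[i] -> R) : (forall z, `|F z| <= cabs z) ->
    (forall k, measurable_fun D (F \o u k)) -> measurable_fun D (F \o f) ->
    (forall x, D x -> (fun k => F (u k x)) @ \oo --> F (f x)) ->
    mu.-integrable D (EFin \o F \o f) /\
    (fun k => \int[mu]_(x in D) F (u k x)) @ \oo --> \int[mu]_(x in D) F (f x).
  move=> Fle mFu mFf cF.
  have [] := @dominated_convergence _ _ _ mu D mD (fun k x => (F (u k x))%:E)
    (fun x => (F (f x))%:E) (EFin \o g) _ _ _ ig _.
  - by move=> k; apply/measurable_EFinP; exact: mFu.
  - by apply/measurable_EFinP; exact: mFf.
  - by apply: aeW => x Dx; apply: cvg_EFin; [exact: nearW|exact: cF].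
  - by apply: aeW => x k Dx /=; rewrite lee_fin (le_trans (Fle _))// ug.
  - move=> iF _ cI; split => //.
    apply: fine_cvg; rewrite fineK//; exact: integrable_fin_num.
have [i1 c1] := aux (@complex.Re R) (@normr_Re_le R) (fun k => (mu_ k).1) mf.1 cre.
have [i2 c2] := aux (@complex.Im R) (@normr_Im_le R) (fun k => (mu_ k).2) mf.2 cim.
by [].
Qed.

End complex_integral.

Section complex_fubini.
Context {R : realType} {d1 d2 : measure_display}.
Context {T1 : measurableType d1} {T2 : measurableType d2}.
Variables (m1 : {sigma_finite_measure set T1 -> \bar R})
          (m2 : {sigma_finite_measure set T2 -> \bar R}).

Lemma measurable_fubini_integral (f : T1 * T2 -> \bar R) : measurable_fun setT f ->
  measurable_fun setT (fun x => \int[m2]_y f (x, y))%E.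
Proof.
move=> mf.
rewrite (_ : (fun x => _) = (fun x => \int[m2]_y (f^\+ (x, y)) - \int[m2]_y (f^\- (x, y)))%E).
  apply: emeasurable_funB.
  - by apply: (measurable_fun_fubini_tonelli_F f^\+%E) => //; exact: measurable_funepos.
  - by apply: (measurable_fun_fubini_tonelli_F f^\-%E) => //; exact: measurable_funeneg.
apply/funext => x; rewrite integralE; congr (_ - _)%E; apply: eq_integral => y _.
- by rewrite !funeposE.
- by rewrite !funenegE.
Qed.

Lemma cmeasurable_cintegral (f : T1 * T2 -> R[i]) : cmeasurable setT f ->
  cmeasurable setT (fun x => cintegral m2 setT (fun y => f (x, y))).
Proof.
move=> [mf1 mf2]; split; rewrite /cintegral /Rintegral/=.
- apply: measurableT_comp => //; apply: (@measurable_fubini_integral (fun p => (complex.Re (f p))%:E)).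
  exact/measurable_EFinP.
- apply: measurableT_comp => //; apply: (@measurable_fubini_integral (fun p => (complex.Im (f p))%:E)).
  exact/measurable_EFinP.
Qed.

(** The inner integrals of [cintegral] are taken through [fine], so they agree with the
    extended-real ones only where these are finite, that is almost everywhere. The equalities [e1]
    and [e2] below carry Fubini's theorem across this difference. *)
Lemma cFubini (f : T1 * T2 -> R[i]) : cmeasurable setT f ->
  (\int[m1]_x \int[m2]_y (cabs (f (x, y)))%:E < +oo)%E ->
  [/\ cintegrable m1 setT (fun x => cintegral m2 setT (fun y => f (x, y))),
      cintegrable m2 setT (fun y => cintegral m1 setT (fun x => f (x, y))) &
      cintegral m1 setT (fun x => cintegral m2 setT (fun y => f (x, y))) =
      cintegral m2 setT (fun y => cintegral m1 setT (fun x => f (x, y)))].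
Proof.
move=> [mf1 mf2] foo.
have iF (F : R[i] -> R) : (forall z, `|F z| <= cabs z) -> measurable_fun setT (F \o f) ->
    (m1 \x m2)%E.-integrable setT (fun p => (F (f p))%:E).
  move=> Fle mF; apply/integrable12ltyP; first exact/measurable_EFinP.
  apply: le_lt_trans foo; apply: ge0_le_integral => //.
  - by move=> x _; exact: integral_ge0.
  - apply: (@measurable_fun_fubini_tonelli_F _ _ _ _ _ m2 (fun p => `|(F (f p))%:E|)%E) => //.
    by apply: measurableT_comp => //; exact/measurable_EFinP.
  - apply: (@measurable_fun_fubini_tonelli_F _ _ _ _ _ m2 (fun p => (cabs (f p))%:E)) => //.
    + exact: measurable_ecabs.
    + by move=> ?; rewrite lee_fin cabs_ge0.
  - move=> x _; apply: ge0_le_integral => //.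
    + apply: measurableT_comp => //; apply/measurable_EFinP.
      exact: (measurableT_comp mF).
    + by apply: measurable_ecabs; apply: (cmeasurable_comp (f := f)).
    + by move=> y _; rewrite lee_fin.
have aux (F : R[i] -> R) : (forall z, `|F z| <= cabs z) -> measurable_fun setT (F \o f) ->
  [/\ m1.-integrable setT (fun x => (\int[m2]_y (F (f (x, y))))%:E),
      m2.-integrable setT (fun y => (\int[m1]_x (F (f (x, y))))%:E) &
      \int[m1]_x (\int[m2]_y (F (f (x, y)))) = \int[m2]_y (\int[m1]_x (F (f (x, y))))].
  move=> Fle mF; have ip := iF F Fle mF.
  have i1 := integrable_fubini_F ip.
  have msw : measurable_fun setT (fun p : T2 * T1 => (F (f (p.2, p.1)))%:E).
    apply/measurable_EFinP; apply: (measurableT_comp mF) => //=.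
    exact: measurable_swap.
  (* The product in the opposite order, so that integrability of the first marginal also yields that
     of the second. *)
  have ip' : (m2 \x m1)%E.-integrable setT (fun p => (F (f (p.2, p.1)))%:E).
    apply/(integrable12ltyP _ _ msw) => /=.
    rewrite -(fubini_tonelli (fun p => `|(F (f p))%:E|%E))//; last first.
      by apply: measurableT_comp => //; exact/measurable_EFinP.
    have mEF : measurable_fun setT (fun p => (F (f p))%:E) by exact/measurable_EFinP.
    exact: ((integrable12ltyP m1 m2 mEF).1 ip).
  have i2 : m2.-integrable setT (fubini_G m1 (fun p => (F (f p))%:E)).
    exact: (integrable_fubini_F ip').
  have e1 : {ae m1, forall x, setT x -> (\int[m2]_y (F (f (x, y))))%:E = fubini_F m2 (fun p => (F (f p))%:E) x}.
    have := integrable_ae measurableT i1; apply: filterS => x /(_ I) fx _.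
    by rewrite /Rintegral fineK.
  have e2 : {ae m2, forall y, setT y -> (\int[m1]_x (F (f (x, y))))%:E = fubini_G m1 (fun p => (F (f p))%:E) y}.
    have := integrable_ae measurableT i2; apply: filterS => x /(_ I) fx _.
    by rewrite /Rintegral fineK.
  have mm1 : measurable_fun setT (fun x => (\int[m2]_y (F (f (x, y))))%:E).
    by apply/measurable_EFinP; apply: measurableT_comp => //; exact: (measurable_int _ i1).
  have mm2 : measurable_fun setT (fun y => (\int[m1]_x (F (f (x, y))))%:E).
    by apply/measurable_EFinP; apply: measurableT_comp => //; exact: (measurable_int _ i2).
  split.
  - apply/integrableP; split => //.
    have /integrableP[_] := i1; rewrite (@ae_eq_integral _ _ _ m1 setT (abse \o fubini_F m2 (fun p => (F (f p))%:E)) (fun x => `|(\int[m2]_y (F (f (x, y))))%:E|)%E)//.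
    + by apply: measurableT_comp.
    + by apply: measurableT_comp => //; exact: (measurable_int _ i1).
    + by apply: filterS e1 => x /(_ I) ex _ /=; rewrite -ex.
  - apply/integrableP; split => //.
    have /integrableP[_] := i2; rewrite (@ae_eq_integral _ _ _ m2 setT (abse \o fubini_G m1 (fun p => (F (f p))%:E)) (fun y => `|(\int[m1]_x (F (f (x, y))))%:E|)%E)//.
    + by apply: measurableT_comp.
    + by apply: measurableT_comp => //; exact: (measurable_int _ i2).
    + by apply: filterS e2 => x /(_ I) ex _ /=; rewrite -ex.
  - rewrite [LHS]/Rintegral [RHS]/Rintegral; congr fine.
    rewrite (@ae_eq_integral _ _ _ m1 setT (fubini_F m2 (fun p => (F (f p))%:E)))//; last first.
      exact: (measurable_int _ i1).
    rewrite [RHS](@ae_eq_integral _ _ _ m2 setT (fubini_G m1 (fun p => (F (f p))%:E)))//; last first.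
      exact: (measurable_int _ i2).
    exact: Fubini.
have [a1 a2 a3] := aux (@complex.Re R) (@normr_Re_le R) mf1.
have [b1 b2 b3] := aux (@complex.Im R) (@normr_Im_le R) mf2.
by split => //; rewrite /cintegral/= a3 b3.
Qed.

End complex_fubini.

(** * Integration and norms on R^n *)

Section lebesgue_rV_integral.
Context {R : realType}.
Local Notation mu := (@lebesgue_measure R).
Local Notation leb n := (@lebesgue_rV R n).

Lemma integral_rV0 (f : 'rV[R]_0 -> \bar R) : measurable_fun setT f ->
  (\int[leb 0]_x f x = f 0%R)%E.
Proof. by move=> mf; rewrite integral_dirac// diracT mul1e. Qed.

Lemma measurable_fun_rV_cons d (T : measurableType d) n (f : 'rV[R]_n.+1 -> T) :
  measurable_fun setT f -> measurable_fun setT (fun p : R * 'rV[R]_n => f (rV_cons p)).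
Proof. by move=> mf; apply: (measurableT_comp mf); exact: measurable_rV_cons. Qed.

Lemma ge0_integral_rVS n (f : 'rV[R]_n.+1 -> \bar R) : measurable_fun setT f ->
  (forall x, 0 <= f x)%E ->
  (\int[leb n.+1]_x f x = \int[mu]_a \int[leb n]_x f (rV_cons (a, x)))%E.
Proof.
move=> mf f0.
have mphi : measurable_fun [set: (measurableTypeR R * 'rV[R]_n)%type] (@rV_cons R n).
  exact: measurable_rV_cons.
rewrite [LHS](ge0_integral_pushforward mphi (mu \x leb n)%E)//=.
by rewrite preimage_setT fubini_tonelli1//; exact: measurable_fun_rV_cons.
Qed.

Lemma cintegral_rVS n (f : 'rV[R]_n.+1 -> R[i]) : cintegrable (leb n.+1) setT f ->
  cintegral (leb n.+1) setT f =
  cintegral mu setT (fun a => cintegral (leb n) setT (fun x => f (rV_cons (a, x)))).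
Proof.
move=> fi; have mf := cintegrable_cmeasurable fi.
have aux (F : R[i] -> R) : (forall z, `|F z| <= cabs z) -> measurable_fun setT (F \o f) ->
    \int[leb n.+1]_x F (f x) = \int[mu]_a \int[leb n]_x F (f (rV_cons (a, x))).
  move=> Fle mF.
  have mF' : measurable_fun setT (fun x => (F (f x))%:E) by exact/measurable_EFinP.
  have mFc := measurable_fun_rV_cons mF'.
  have ip : (mu \x leb n)%E.-integrable setT (fun p => (F (f (rV_cons p)))%:E).
    apply/integrable12ltyP => //.
    rewrite -(@ge0_integral_rVS n (fun x => `|(F (f x))%:E|)%E)//; last first.
      exact: measurableT_comp.
    have /cintegrableP[//|_] := fi.
    apply: le_lt_trans; apply: ge0_le_integral => //.
    - exact: measurableT_comp.
    - exact: measurable_ecabs.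
    - by move=> x _; rewrite lee_fin.
  have E1 : (\int[leb n.+1]_x (F (f x))%:E = \int[mu]_a \int[leb n]_x (F (f (rV_cons (a, x))))%:E)%E.
    have mphi : measurable_fun [set: (measurableTypeR R * 'rV[R]_n)%type] (@rV_cons R n).
      exact: measurable_rV_cons.
    rewrite [LHS](integral_pushforward mphi (mu := (mu \x leb n)%E) mF')//.
      by rewrite preimage_setT -(integral12_prod_meas1 ip).
  rewrite [LHS]/Rintegral E1 [RHS]/Rintegral; congr fine.
  have iF := integrable_fubini_F ip.
  apply: ae_eq_integral => //.
  - exact: (measurable_int _ iF).
  - by apply/measurable_EFinP; apply: measurableT_comp => //; exact: (measurable_int _ iF).
  - by have := integrable_ae measurableT iF; apply: filterS => x /(_ I) fx _; rewrite /Rintegral fineK.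
apply: complexP => /=.
- by apply: aux => //; [exact: normr_Re_le|case: mf].
- by apply: aux => //; [exact: normr_Im_le|case: mf].
Qed.

Lemma measurable_rVD d (T : measurableType d) n (f g : T -> 'rV[R]_n) :
  measurable_fun setT f -> measurable_fun setT g ->
  measurable_fun setT (fun x => f x + g x).
Proof.
move=> mf mg; apply: measurable_fun_coordP => i.
under eq_fun do rewrite mxE.
by apply: measurable_funD; [exact: (measurableT_comp (measurable_coord i) mf)
  |exact: (measurableT_comp (measurable_coord i) mg)].
Qed.

Lemma measurable_rVN d (T : measurableType d) n (f : T -> 'rV[R]_n) :
  measurable_fun setT f -> measurable_fun setT (fun x => - f x).
Proof.
move=> mf; apply: measurable_fun_coordP => i.
under eq_fun do rewrite mxE.
by apply: measurableT_comp => //; exact: (measurableT_comp (measurable_coord i) mf).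
Qed.

Lemma measurable_rVB d (T : measurableType d) n (f g : T -> 'rV[R]_n) :
  measurable_fun setT f -> measurable_fun setT g ->
  measurable_fun setT (fun x => f x - g x).
Proof. by move=> mf mg; apply: measurable_rVD => //; exact: measurable_rVN. Qed.

Lemma ge0_integral_shift1 (a : R) (f : R -> \bar R) : measurable_fun setT f ->
  (forall x, 0 <= f x)%E -> (\int[mu]_x f (a + x)%R = \int[mu]_x f x)%E.
Proof.
move=> mf f0.
pose phi : measurableTypeR R -> measurableTypeR R := fun x => a + x.
have ma : measurable_fun [set: measurableTypeR R] phi by exact: measurable_funD.
have := ge0_integral_pushforward ma mu measurableT mf (fun x _ => f0 x).
rewrite preimage_setT => <-; apply: eq_measure_integral => A mA _ /=.
(* The translated measure gives every half-open interval its length, which characterises Lebesgue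
   measure. *)
apply/esym; apply: (@lebesgue_measure_unique _ (pushforward mu phi)) => // X [[b c] _ <-].
rewrite /=; have -> : pushforward mu phi `]b, c]%classic = mu `](b - a), (c - a)]%classic.
  rewrite /pushforward; congr (mu _).
  by apply/seteqP; split => x /=; rewrite !in_itv/= ltrBlDl lerBrDl.
rewrite !lebesgue_measure_itv/= !lte_fin ltrD2r; case: ifPn => // _.
by rewrite -!EFinB; congr EFin; ring.
Qed.

Lemma ge0_integral_opp1 (f : R -> \bar R) : measurable_fun setT f ->
  (forall x, 0 <= f x)%E -> (\int[mu]_x f (- x)%R = \int[mu]_x f x)%E.
Proof.
move=> mf f0.
pose phi : measurableTypeR R -> measurableTypeR R := fun x => - x.
have ma : measurable_fun [set: measurableTypeR R] phi by exact: oppr_measurable.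
have := ge0_integral_pushforward ma mu measurableT mf (fun x _ => f0 x).
rewrite preimage_setT => <-; apply: eq_measure_integral => A mA _ /=; exact: lebesgue_measureN.
Qed.

Lemma ge0_integral_shift n (a : 'rV[R]_n) (f : 'rV[R]_n -> \bar R) :
  measurable_fun setT f -> (forall x, 0 <= f x)%E ->
  (\int[leb n]_x f (a + x)%R = \int[leb n]_x f x)%E.
Proof.
elim: n a f => [|n ih] a f mf f0.
  rewrite !integral_rV0//; first by congr f; apply/rowP => -[].
  by apply: (measurableT_comp mf); exact: measurable_rVD.
have mfa : measurable_fun setT (fun x => f (a + x)).
  by apply: (measurableT_comp mf); exact: measurable_rVD.
rewrite (ge0_integral_rVS mfa (fun x => f0 _)) (ge0_integral_rVS mf f0).
pose a' : 'rV_n := \row_j a 0 (lift ord0 j); pose a0 := a 0 0.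
have E b x : a + rV_cons (b, x) = rV_cons (a0 + b, a' + x).
  apply/rowP => i; rewrite !mxE; case: (unliftP ord0 i) => [j|] -> /=.
    by rewrite !mxE.
  by [].
have mcons b : measurable_fun setT (fun x => f (rV_cons (b, x))).
  apply: (measurableT_comp mf); apply: (measurableT_comp (@measurable_rV_cons R n)).
  exact: measurable_pair1.
under eq_integral do under eq_integral do rewrite E.
under eq_integral => b _ do rewrite (ih a' (fun x => f (rV_cons (a0 + b, x))))//.
rewrite (ge0_integral_shift1 a0 (f := fun b => \int[leb n]_x f (rV_cons (b, x)))%E)//.
  by apply: (measurable_fun_fubini_tonelli_F (fun p => f (rV_cons p))) => //; exact: measurable_fun_rV_cons.
by move=> x; exact: integral_ge0.
Qed.

Lemma ge0_integral_opp n (f : 'rV[R]_n -> \bar R) :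
  measurable_fun setT f -> (forall x, 0 <= f x)%E ->
  (\int[leb n]_x f (- x)%R = \int[leb n]_x f x)%E.
Proof.
elim: n f => [|n ih] f mf f0.
  rewrite !integral_rV0//; first by congr f; apply/rowP => -[].
  by apply: (measurableT_comp mf); exact: measurable_rVN.
have mfa : measurable_fun setT (fun x : 'rV[R]_n.+1 => f (- x)).
  by apply: (measurableT_comp mf); exact: measurable_rVN.
rewrite (ge0_integral_rVS mfa (fun x => f0 _)) (ge0_integral_rVS mf f0).
have E (b : R) (x : 'rV_n) : - rV_cons (b, x) = rV_cons (- b, - x).
  by apply/rowP => i; rewrite !mxE; case: (unlift ord0 i) => [j|] //=; rewrite !mxE.
have mcons b : measurable_fun setT (fun x => f (rV_cons (b, x))).
  apply: (measurableT_comp mf); apply: (measurableT_comp (@measurable_rV_cons R n)).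
  exact: measurable_pair1.
under eq_integral do under eq_integral do rewrite E.
under eq_integral => b _ do rewrite (ih (fun x => f (rV_cons (- b, x))))//.
rewrite (ge0_integral_opp1 (f := fun b => \int[leb n]_x f (rV_cons (b, x)))%E)//.
  by apply: (measurable_fun_fubini_tonelli_F (fun p => f (rV_cons p))) => //; exact: measurable_fun_rV_cons.
by move=> x; exact: integral_ge0.
Qed.

Lemma ge0_integral_reflect n (a : 'rV[R]_n) (f : 'rV[R]_n -> \bar R) :
  measurable_fun setT f -> (forall x, 0 <= f x)%E ->
  (\int[leb n]_x f (a - x)%R = \int[leb n]_x f x)%E.
Proof.
move=> mf f0; rewrite (ge0_integral_opp (f := fun x => f (a + x)))//.
  exact: ge0_integral_shift.
by apply: (measurableT_comp mf); exact: measurable_rVD.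
Qed.

(** Allows an almost everywhere equality to be used inside a convolution, at the argument
    [x - y]. *)
Lemma ae_reflect n (a : 'rV[R]_n) (P : 'rV[R]_n -> Prop) :
  {ae leb n, forall x, P x} -> {ae leb n, forall x, P (a - x)}.
Proof.
move=> [N [mN N0 PN]]; exists ((fun x => a - x) @^-1` N); split.
- by rewrite -[X in measurable X]setTI; apply: measurable_rVB.
- have mN' : measurable ((fun x => a - x) @^-1` N).
    by rewrite -[X in measurable X]setTI; apply: measurable_rVB.
  have := @integral_indic _ _ _ (leb n) _ measurableT _ mN'; rewrite setIT => <-.
  rewrite -[RHS]N0 -[in RHS](setIT N) -integral_indic//.
  rewrite -(ge0_integral_reflect a (f := fun x => (\1_N x)%:E))//.
  by apply/measurable_EFinP; exact: measurable_indic.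
- by move=> x /= nP; apply: PN.
Qed.

Lemma ge0_integral_prod n (f : 'I_n -> R -> R) :
  (forall i, measurable_fun setT (f i)) -> (forall i x, 0 <= f i x) ->
  (\int[leb n]_x (\prod_(i < n) f i (x 0 i))%:E = \prod_(i < n) \int[mu]_t (f i t)%:E)%E.
Proof.
have mprod m (g : 'I_m -> R -> R) : (forall i, measurable_fun setT (g i)) ->
    measurable_fun setT (fun x : 'rV[R]_m => (\prod_(i < m) g i (x 0 i))%:E).
  move=> mg; apply/measurable_EFinP; apply: measurable_prod => i _.
  exact: (measurableT_comp (mg i) (measurable_coord i)).
elim: n f => [|n ih] f mf f0.
  by rewrite integral_rV0//; [rewrite !big_ord0|exact: mprod].
rewrite ge0_integral_rVS//; last 2 first.
- exact: mprod.
- by move=> x; rewrite lee_fin prodr_ge0.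
have E a (x : 'rV_n) : (\prod_(i < n.+1) f i (rV_cons (a, x) 0 i))%:E =
    ((f ord0 a)%:E * (\prod_(i < n) f (lift ord0 i) (x 0 i))%:E)%E.
  rewrite big_ord_recl EFinM mxE unlift_none/=; congr (_ * _%:E)%E.
  by apply: eq_bigr => i _; rewrite mxE liftK.
under eq_integral do under eq_integral do rewrite E.
under eq_integral => a _.
  rewrite ge0_integralZl//; last 3 first.
  - by apply: (mprod _ (fun i => f (lift ord0 i))) => i.
  - by move=> x _; rewrite lee_fin prodr_ge0.
  - by rewrite lee_fin.
  rewrite (ih (fun i => f (lift ord0 i)))//; over.
rewrite ge0_integralZr//.
- by rewrite big_ord_recl.
- by apply/measurable_EFinP; exact: mf.
- by move=> x _; rewrite lee_fin.
- by apply: prode_ge0 => i _; apply: integral_ge0 => x _; rewrite lee_fin.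
Qed.

Lemma cintegral_prod n (f : 'I_n -> R -> R[i]) :
  (forall i, cintegrable mu setT (f i)) ->
  cintegrable (leb n) setT (fun x => \prod_(i < n) f i (x 0 i)) /\
  cintegral (leb n) setT (fun x => \prod_(i < n) f i (x 0 i)) =
  \prod_(i < n) cintegral mu setT (f i).
Proof.
move=> fi.
have mf i : cmeasurable setT (f i) := cintegrable_cmeasurable (fi i).
have cabs_prod m (g : 'I_m -> R[i]) : cabs (\prod_(i < m) g i) = \prod_(i < m) cabs (g i).
  elim: m g => [|m ih] g; first by rewrite !big_ord0 -[1]/(1%:C) cabs_real normr1.
  by rewrite !big_ord_recl cabsM ih.
have mprod m (g : 'I_m -> R -> R[i]) : (forall i, cmeasurable setT (g i)) ->
    cmeasurable setT (fun x : 'rV[R]_m => \prod_(i < m) g i (x 0 i)).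
  elim: m g => [|m ih] g mg; first by under eq_fun do rewrite big_ord0; exact: cmeasurable_cst.
  have -> : (fun x : 'rV[R]_m.+1 => \prod_(i < m.+1) g i (x 0 i)) =
    (fun x : 'rV[R]_m.+1 => g ord0 (x 0 ord0) * \prod_(i < m) g (lift ord0 i) ((\row_j x 0 (lift ord0 j) : 'rV_m) 0 i)).
    apply/funext => x; rewrite big_ord_recl; congr (_ * _).
    by apply: eq_bigr => i _; rewrite mxE.
  apply: cmeasurableM; first exact: (cmeasurable_comp (mg ord0) (measurable_coord _)).
  apply: (cmeasurable_comp (ih (fun i => g (lift ord0 i)) _)) => //.
  apply: measurable_fun_coordP => i; under eq_fun do rewrite mxE.
  exact: measurable_coord.
have ip m (g : 'I_m -> R -> R[i]) : (forall i, cintegrable mu setT (g i)) ->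
    cintegrable (leb m) setT (fun x => \prod_(i < m) g i (x 0 i)).
  move=> gi; apply: cintegrable_lty => //.
    by apply: mprod => i; exact: cintegrable_cmeasurable (gi i).
  under eq_integral do rewrite cabs_prod.
  rewrite (ge0_integral_prod (f := fun i t => cabs (g i t))).
  - rewrite -ge0_fin_numE; last by apply: prode_ge0 => i _; apply: integral_ge0 => x _; rewrite lee_fin cabs_ge0.
    apply: prode_fin_num => i _; rewrite ge0_fin_numE; last by apply: integral_ge0 => x _; rewrite lee_fin cabs_ge0.
    by have /cintegrableP[//|_] := gi i.
  - by move=> i; apply: measurable_cabs; exact: cintegrable_cmeasurable (gi i).
  - by move=> *; exact: cabs_ge0.
split; first exact: ip.
elim: n f fi {mf} => [|n ih] f fi.
  rewrite big_ord0; under eq_cintegral do rewrite big_ord0.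
  by rewrite /cintegral /Rintegral !integral_rV0.
rewrite cintegral_rVS; last exact: ip.
have E a : cintegral (leb n) setT (fun x => \prod_(i < n.+1) f i (rV_cons (a, x) 0 i)) =
    (\prod_(i < n) cintegral mu setT (f (lift ord0 i))) * f ord0 a.
  rewrite mulrC -ih// -cintegralZ//; last by apply: (ip _ (fun i => f (lift ord0 i))).
  apply: eq_cintegral => x _; rewrite big_ord_recl mxE unlift_none/=; congr (_ * _).
  by apply: eq_bigr => i _; rewrite mxE liftK.
by under eq_cintegral do rewrite E; rewrite cintegralZ// big_ord_recl mulrC.
Qed.

End lebesgue_rV_integral.

(** * Rational boxes: Borel sets and local null-set arguments on R^n *)

Section rV_topology.
Context {R : realType} {n : nat}.
Local Notation V := 'rV[R]_n.

(** A countable basis of the topology, indexed by rational centres and radii. It relates open sets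
    to the sigma-algebra of the coordinates and makes countable coverings available. *)
Definition rat_box (q : 'rV[rat]_n * rat) : set V :=
  [set y | forall i, `|y 0 i - ratr (q.1 0 i)| < ratr q.2].

Lemma measurable_rat_box q : measurable (rat_box q).
Proof.
rewrite (_ : rat_box q = \bigcap_(i in setT) [set y : V | `|y 0 i - ratr (q.1 0 i)| < ratr q.2]).
  apply: fin_bigcap_measurable => // i _.
  rewrite -[X in measurable X]setTI.
  apply: measurable_fun_ltr => //.
  apply: measurableT_comp => //; apply: measurable_funB => //; exact: measurable_coord.
by apply/seteqP; split => [x h i _|x h i]; [exact: h|exact: (h i)].
Qed.

Lemma rat_box_nbhs (x : V) (U : set V) : nbhs x U ->
  exists q, rat_box q x /\ rat_box q `<=` U.
Proof.
move=> /nbhs_ballP[e /= e0 eU].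
(* Half of [e], because two points of the box are compared through its centre. *)
have [r] : exists r : rat, ratr r \in `]0, (e / 2)[ by apply: rat_in_itvoo; rewrite divr_gt0.
rewrite in_itv/= => /andP[r0 re].
have qx i : exists q : rat, `|x 0 i - ratr q| < ratr r.
  have [q] : exists q : rat, ratr q \in `](x 0 i - ratr r), (x 0 i)[.
    by apply: rat_in_itvoo; rewrite ltrBlDr ltrDl.
  rewrite in_itv/= => /andP[q1 q2]; exists q.
  by rewrite gtr0_norm ?subr_gt0// ltrBlDr addrC -ltrBlDr.
have [Q HQ] := choice qx.
exists (\row_i Q i, r); split => [i|y hy] /=; first by rewrite mxE.
apply: eU; split => // i j; rewrite ord1 /ball/=.
have := hy j; rewrite /= mxE => h.
have -> : x 0 j - y 0 j = (x 0 j - ratr (Q j)) - (y 0 j - ratr (Q j)) by ring.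
rewrite (le_lt_trans (ler_normB _ _))// [e]splitr ltrD// (lt_trans _ re)//.
Qed.

Lemma bigcup_rat_box_measurable (P : set ('rV[rat]_n * rat)) :
  measurable (\bigcup_(q in P) rat_box q).
Proof.
rewrite bigcup_mkcond; apply: countable_bigcupT_measurable => // q.
by case: ifPn => // _; exact: measurable_rat_box.
Qed.

Lemma open_measurable_rV (U : set V) : open U -> measurable U.
Proof.
move=> oU; rewrite (_ : U = \bigcup_(q in [set q | rat_box q `<=` U]) rat_box q).
  exact: bigcup_rat_box_measurable.
apply/seteqP; split => [x Ux|x [q /= qU qx]]; last exact: qU.
have [q [qx qU]] := rat_box_nbhs (open_nbhs_nbhs (conj oU Ux)).
by exists q.
Qed.

Lemma continuous_measurable_rV (f : V -> R) : continuous f -> measurable_fun setT f.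
Proof.
move=> cf; apply: (measurability _ (RGenOpens.measurableE R)) => _ [_ [a [b ->] <-]].
rewrite setTI; apply: open_measurable_rV.
by apply: open_comp => // x _; exact: cf.
Qed.

(** Each point of [A] lies in a rational box on which the property holds almost everywhere, and
    there are only countably many such boxes. *)
Lemma ae_locally (P : V -> Prop) (A : set V) :
  (forall x, A x -> exists2 U : set V, nbhs x U & {ae @lebesgue_rV R n, forall y, U y -> P y}) ->
  {ae @lebesgue_rV R n, forall y, A y -> P y}.
Proof.
move=> h.
pose good q := {ae @lebesgue_rV R n, forall y, rat_box q y -> P y}.
have : forall q, (@lebesgue_rV R n).-negligible ([set y | good q /\ rat_box q y /\ ~ P y]).
  move=> q; have [gq|ngq] := pselect (good q).
    by apply: negligibleS gq => y [_ [qy nPy]] /(_ qy).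
  have -> : [set y | good q /\ rat_box q y /\ ~ P y] = set0 by apply/seteqP; split => // y [].
  exact: negligible_set0.
move=> neg.
pose F (k : nat) := if unpickle k is Some q then [set y | good q /\ rat_box q y /\ ~ P y] else set0.
have : (@lebesgue_rV R n).-negligible (\bigcup_k F k).
  by apply: negligible_bigcup => k; rewrite /F; case: unpickle => [q|]; [exact: neg|exact: negligible_set0].
apply: negligibleS => y /= /not_implyP[Ay nPy].
have [U Ux UP] := h _ Ay.
have [q [qy qU]] := rat_box_nbhs Ux.
exists (pickle q) => //; rewrite /F pickleK; split => //.
by apply: filterS UP => z Uz /qU.
Qed.

End rV_topology.

(** * Comparison of the norms on R^n and measurability of the weights *)

Section rV_norms.
Context {R : realType} {n : nat}.
Local Notation V := 'rV[R]_n.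
Implicit Types x y : V.

Definition norm1 x : R := \sum_(i < n) `|x 0 i|.

Lemma norm1_ge0 x : 0 <= norm1 x.
Proof. by apply: sumr_ge0. Qed.

Lemma norm1N x : norm1 (- x) = norm1 x.
Proof. by apply: eq_bigr => i _; rewrite mxE normrN. Qed.

Lemma enorm_ge0 x : 0 <= enorm x.
Proof. exact: sqrtr_ge0. Qed.

Lemma sqr_enorm x : enorm x ^+ 2 = \sum_(i < n) x 0 i ^+ 2.
Proof. by rewrite sqr_sqrtr// sumr_ge0// => i _; rewrite sqr_ge0. Qed.

Lemma enormN x : enorm (- x) = enorm x.
Proof. by congr Num.sqrt; apply: eq_bigr => i _; rewrite mxE sqrrN. Qed.

Lemma normr_coord_le_enorm x i : `|x 0 i| <= enorm x.
Proof.
rewrite -(@ler_pXn2r _ 2) ?nnegrE ?enorm_ge0// real_normK ?num_real// sqr_enorm.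
by rewrite (bigD1 i)//= lerDl sumr_ge0// => j _; rewrite sqr_ge0.
Qed.

Lemma normr_coord_le_norm1 x i : `|x 0 i| <= norm1 x.
Proof. by rewrite /norm1 (bigD1 i)//= lerDl sumr_ge0. Qed.

Lemma norm1_le_enorm x : norm1 x <= n%:R * enorm x.
Proof.
rewrite mulr_natl -[X in _ *+ X]card_ord -sumr_const ler_sum// => i _.
exact: normr_coord_le_enorm.
Qed.

Lemma enorm_le_norm1 x : enorm x <= norm1 x.
Proof.
rewrite -(@ler_pXn2r _ 2) ?nnegrE ?enorm_ge0 ?norm1_ge0// sqr_enorm expr2 {2}/norm1 mulr_sumr.
apply: ler_sum => i _; rewrite -real_normK ?num_real// expr2 ler_wpM2r//.
exact: normr_coord_le_norm1.
Qed.

Lemma normr_le_enorm x : `|x| <= enorm x.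
Proof.
rewrite /Num.Def.normr/= mx_normrE; apply/bigmax_leP; split => /=; first exact: enorm_ge0.
by move=> [i j] _; rewrite ord1; exact: normr_coord_le_enorm.
Qed.

Lemma normr_le_norm1 x : `|x| <= norm1 x.
Proof. exact: le_trans (normr_le_enorm x) (enorm_le_norm1 x). Qed.

Lemma norm1_octantD x y : octant x -> octant y -> norm1 (x + y) = norm1 x + norm1 y.
Proof.
move=> ox oy; rewrite /norm1 -big_split/=; apply: eq_bigr => i _.
by rewrite mxE !ger0_norm// addr_ge0.
Qed.

Lemma japanese_ge1 x : 1 <= japanese x.
Proof.
by rewrite /japanese -{1}(@sqrtr1 R) ler_sqrt ?lerDl ?sqr_ge0// addr_ge0// sqr_ge0.
Qed.

Lemma japanese_gt0 x : 0 < japanese x.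
Proof. exact: lt_le_trans (japanese_ge1 x). Qed.

Lemma japanese_le x : japanese x <= 1 + enorm x.
Proof.
rewrite -(@ler_pXn2r _ 2) ?nnegrE ?(ltW (japanese_gt0 _)) ?addr_ge0 ?enorm_ge0//.
rewrite /japanese sqr_sqrtr ?addr_ge0 ?sqr_ge0// sqrrD expr1n mul1r lerD2r lerDl.
by rewrite mulrn_wge0 ?enorm_ge0.
Qed.

Lemma enorm_le_japanese x : enorm x <= japanese x.
Proof.
rewrite -(@ler_pXn2r _ 2) ?nnegrE ?(ltW (japanese_gt0 _)) ?addr_ge0 ?enorm_ge0//.
by rewrite /japanese [leRHS]sqr_sqrtr ?addr_ge0 ?sqr_ge0// lerDr.
Qed.

Lemma measurable_norm1 : measurable_fun setT norm1.
Proof.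
apply: measurable_sum => i; apply: measurableT_comp => //; exact: measurable_coord.
Qed.

Lemma measurable_enorm : measurable_fun setT (@enorm R n).
Proof.
apply: (@measurableT_comp _ _ _ _ _ _ (@Num.sqrt R)).
  by apply: continuous_measurable_fun; exact: sqrt_continuous.
by apply: measurable_sum => i; apply: measurable_funX; exact: measurable_coord.
Qed.

Lemma measurable_japanese : measurable_fun setT (@japanese R n).
Proof.
apply: (@measurableT_comp _ _ _ _ _ _ (@Num.sqrt R)).
  by apply: continuous_measurable_fun; exact: sqrt_continuous.
by apply: measurable_funD => //; apply: measurable_funX; exact: measurable_enorm.
Qed.

Lemma measurable_exp_weight a s : measurable_fun setT (@exp_weight R n a s).
Proof.
apply: measurable_funM.
  exact: (measurableT_comp (measurable_powR s) measurable_japanese).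
apply: (@measurableT_comp _ _ _ _ _ _ (fun t => 2 `^ t)).
  have -> : (fun t : R => 2 `^ t) = (fun t => expR (t * ln 2)).
    by apply/funext => t; rewrite /powR pnatr_eq0.
  by apply: measurableT_comp => //; exact: measurable_funM.
by apply: measurable_funM => //; exact: measurable_enorm.
Qed.

Lemma measurable_dotp d (T : measurableType d) (f g : T -> V) :
  measurable_fun setT f -> measurable_fun setT g ->
  measurable_fun setT (fun t => dotp (f t) (g t)).
Proof.
move=> mf mg; apply: measurable_sum => i; apply: measurable_funM.
- exact: (measurableT_comp (measurable_coord i) mf).
- exact: (measurableT_comp (measurable_coord i) mg).
Qed.

Lemma measurable_octant_ge N : measurable (@octant_ge R n N).
Proof.
apply: measurableI.
  rewrite (_ : octant = \bigcap_(i in setT) [set y : V | 0 <= y 0 i]); last first.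
    by apply/seteqP; split => [x h i _|x h i]; [exact: h|exact: (h i)].
  apply: fin_bigcap_measurable => // i _.
  rewrite -[X in measurable X]setTI; apply: measurable_fun_ler => //.
  exact: measurable_coord.
have -> : [set xi : V | N <= `|xi|] = ~` [set xi : V | `|xi| < N].
  by apply/seteqP; split => x /=; rewrite leNgt => /negP.
apply: measurableC; apply: open_measurable_rV.
rewrite (_ : [set _ | _] = (normr : V -> R) @^-1` [set t | t < N])//.
apply: open_comp => [x _|]; first exact: norm_continuous.
exact: open_lt.
Qed.

End rV_norms.

(** * Gaussian packets and their Fourier transform *)

Section gaussian_1d.
Context {R : realType}.
Local Notation mu := (@lebesgue_measure R).

Definition gauss (l x : R) : R := expR (- l * x ^+ 2).

Lemma gauss_ge0 l x : 0 <= gauss l x. Proof. exact: expR_ge0. Qed.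

Lemma gaussE (l x : R) : 0 < l -> gauss l x = normal_fun 0 (Num.sqrt (2 * l))^-1 x.
Proof.
move=> l0; rewrite /gauss /normal_fun; congr expR.
rewrite subr0 exprVn sqr_sqrtr ?mulr_ge0 ?ltW//.
by field; rewrite gt_eqF.
Qed.

Lemma measurable_gauss l : measurable_fun setT (gauss l).
Proof.
by apply: measurableT_comp => //; apply: measurable_funM => //; exact: measurable_funX.
Qed.

Lemma gauss_integral l : 0 < l ->
  mu.-integrable setT (EFin \o gauss l) /\
  \int[mu]_x gauss l x = Num.sqrt (pi / l).
Proof.
move=> l0; pose s := (Num.sqrt (2 * l))^-1.
have s0 : 0 < s by rewrite invr_gt0 sqrtr_gt0 mulr_gt0.
have s2 : s ^+ 2 = (2 * l)^-1 by rewrite exprVn sqr_sqrtr ?mulr_ge0 ?ltW.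
pose k := Num.sqrt (pi / l).
have k0 : 0 < k by rewrite sqrtr_gt0 divr_gt0// pi_gt0.
have pk : normal_peak s = k^-1.
  rewrite /normal_peak s2 /k; congr (Num.sqrt _)^-1.
  by field; rewrite gt_eqF.
have E x : gauss l x = k * normal_pdf 0 s x.
  by rewrite /normal_pdf gt_eqF// pk mulrA divff ?gt_eqF// mul1r gaussE.
have ip := integrable_normal_pdf 0 s.
split.
  rewrite (_ : EFin \o gauss l = (fun x => k%:E * (normal_pdf 0 s x)%:E)%E).
    exact: integrableZl.
  by apply/funext => x /=; rewrite E.
under eq_Rintegral do rewrite E.
rewrite RintegralZl// -[RHS]mulr1; congr (_ * _).
by rewrite /Rintegral integral_normal_pdf.
Qed.

Lemma integrable_gauss l : 0 < l -> mu.-integrable setT (EFin \o gauss l).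
Proof. by move=> /gauss_integral[]. Qed.

(** Half of the exponent absorbs the factor: |x| <= 1 + x^2, and u <= e^u with u = l x^2 / 2. The
    bound dominates the derivative when the Gaussian transform is differentiated under the
    integral. *)
Lemma normr_gauss_le (l x : R) : 0 < l ->
  `|x| * gauss l x <= (1 + 2 / l) * gauss (l / 2) x.
Proof.
move=> l0.
have -> : gauss l x = gauss (l / 2) x * gauss (l / 2) x.
  by rewrite /gauss -expRD; congr expR; field.
rewrite mulrA ler_wpM2r ?gauss_ge0//.
have h1 : gauss (l / 2) x <= 1.
  by rewrite /gauss -expR0 ler_expR mulNr oppr_le0 mulr_ge0 ?sqr_ge0// divr_ge0// ltW.
have h2 : x ^+ 2 * gauss (l / 2) x <= 2 / l.
  rewrite /gauss mulNr expRN ler_pdivrMr ?expR_gt0//.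
  apply: (@le_trans _ _ (2 / l * (l / 2 * x ^+ 2))).
    by rewrite mulrA (_ : 2 / l * (l / 2) = 1) ?mul1r//; field; rewrite gt_eqF.
  apply: ler_wpM2l; first by rewrite divr_ge0// ltW.
  by apply: le_trans (expR_ge1Dx _); rewrite lerDr.
apply: (@le_trans _ _ ((1 + x ^+ 2) * gauss (l / 2) x)).
  rewrite ler_wpM2r ?gauss_ge0// -[x ^+ 2]real_normK ?num_real//.
  have := sqr_ge0 (`|x| - 1); have := normr_ge0 x; nra.
by rewrite mulrDl mul1r lerD.
Qed.

Lemma integrable_normr_gauss l : 0 < l ->
  mu.-integrable setT (EFin \o (fun x => `|x| * gauss l x)).
Proof.
move=> l0.
have l20 : 0 < l / 2 by rewrite divr_gt0.
have ig := integrableZl measurableT (1 + 2 / l) (integrable_gauss l20).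
apply: (le_integrable measurableT _ _ ig).
  apply/measurable_EFinP; apply: measurable_funM; last exact: measurable_gauss.
  exact: normr_measurable.
move=> x _ /=; rewrite lee_fin ger0_norm ?mulr_ge0 ?gauss_ge0//.
by apply: le_trans (normr_gauss_le _ l0) _; rewrite ler_norm.
Qed.

(** The fundamental theorem of calculus on [-k, k] in the limit k -> oo; it is used as integration
    by parts without boundary terms. *)
Lemma Rintegral_derive_eq0 (F f : R -> R) :
  (forall x, is_derive x (1 : R) F (f x)) -> continuous f ->
  mu.-integrable setT (EFin \o f) ->
  (fun k : nat => F k%:R) @ \oo --> 0 -> (fun k : nat => F (- k%:R)) @ \oo --> 0 ->
  \int[mu]_x f x = 0.
Proof.
move=> dF cf fi F1 F2.
have mf : measurable_fun setT f by exact: continuous_measurable_fun.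
have FTC (k : nat) : \int[mu]_(x in `[- k.+1%:R, k.+1%:R]) f x = F k.+1%:R - F (- k.+1%:R).
  have h : - k.+1%:R < k.+1%:R :> R by rewrite gtrN.
  rewrite /Rintegral (continuous_FTC2 (F := F) h)//.
  - exact: continuous_subspaceT.
  - split.
    + by move=> x _; case: (dF x).
    + apply: cvg_at_right_filter; apply: differentiable_continuous; apply/derivable1_diffP; by case: (dF (- k.+1%:R)).
    + apply: cvg_at_left_filter; apply: differentiable_continuous; apply/derivable1_diffP; by case: (dF k.+1%:R).
  - by move=> x _; rewrite derive1E; case: (dF x).
have c1 : (fun k : nat => \int[mu]_(x in `[- k.+1%:R, k.+1%:R]) f x) @ \oo --> \int[mu]_x f x.
  have [] := @dominated_convergence _ _ _ mu setT measurableT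
    (fun (k : nat) x => ((f \_ `[- k.+1%:R, k.+1%:R]) x)%:E) (EFin \o f) (fun x => `|f x|%:E).
  - move=> k; apply/measurable_EFinP; apply: (measurable_restrictT f _).1 => //.
    exact: measurable_funTS.
  - exact/measurable_EFinP.
  - apply: aeW => x _; apply: cvg_EFin; first exact: nearW.
    apply: cvg_near_cst; near=> k.
    rewrite /= patchE ifT// inE/= in_itv/= -ler_norml.
    near: k; exists (Num.truncn `|x|).+1 => // m /= hm.
    apply: ltW; apply: lt_le_trans (truncnS_gt _) _.
    by rewrite ler_nat ltnW.
  - exact: integrable_abse fi.
  - apply: aeW => x k _ /=; rewrite lee_fin patchE; case: ifPn => // _.
    by rewrite normr0.
  move=> _ _; rewrite /Rintegral => h; apply: fine_cvg; rewrite fineK ?integrable_fin_num//.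
  have -> : (fun k : nat => \int[mu]_(x in `[(- k.+1%:R)%R, k.+1%:R]) (f x)%:E)%E =
    (fun k : nat => \int[mu]_x ((f \_ `[(- k.+1%:R)%R, k.+1%:R]) x)%:E)%E.
    apply/funext => k; rewrite [LHS]integral_mkcond; apply: eq_integral => x _.
    by rewrite !patchE; case: ifP.
  exact: h.
have c2 : (fun k : nat => F k.+1%:R - F (- k.+1%:R)) @ \oo --> 0 - 0.
  by apply: cvgB; [move: F1|move: F2]; rewrite -cvg_shiftS.
rewrite subr0 in c2; move: c1; under eq_fun do rewrite FTC.
by move=> c1; exact: (cvg_unique _ c1 c2).
Unshelve. all: by end_near.
Qed.

Lemma is_derive_gauss (l x : R) : is_derive x (1 : R) (gauss l) (- 2 * l * x * gauss l x).
Proof.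
rewrite /gauss.
have h : is_derive x (1 : R) (fun x : R => - l * x ^+ 2) (- l * (2 * x)).
  by apply: is_derive_eq; rewrite /GRing.scale/= ?expr1; ring.
by apply: is_derive_eq; rewrite /GRing.scale/=; ring.
Qed.

Lemma integrable_gauss_bounded l (h : R -> R) M : 0 < l -> measurable_fun setT h ->
  (forall x, `|h x| <= M) -> mu.-integrable setT (EFin \o (fun x => gauss l x * h x)).
Proof.
move=> l0 mh hM.
have ig := integrableZl measurableT M (integrable_gauss l0).
apply: (le_integrable measurableT _ _ ig).
  by apply/measurable_EFinP; apply: measurable_funM => //; exact: measurable_gauss.
move=> x _ /=; rewrite lee_fin normrM mulrC (ger0_norm (gauss_ge0 _ _)).
apply: le_trans (ler_norm _); rewrite ler_wpM2r// gauss_ge0//.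
Qed.

Lemma measurable_cosM (z : R) : measurable_fun setT (fun x : R => cos (z * x)).
Proof.
apply: measurableT_comp; last exact: measurable_funM.
by apply: continuous_measurable_fun; exact: continuous_cos.
Qed.

Lemma measurable_sinM (z : R) : measurable_fun setT (fun x : R => sin (z * x)).
Proof.
apply: measurableT_comp; last exact: measurable_funM.
by apply: continuous_measurable_fun; exact: continuous_sin.
Qed.

Lemma normr_sin_le1 (x : R) : `|sin x| <= 1.
Proof. by rewrite ler_norml sin_geN1 sin_le1. Qed.

Lemma normr_cos_le1 (x : R) : `|cos x| <= 1.
Proof. by rewrite ler_norml cos_geN1 cos_le1. Qed.

Lemma cvg_gauss_nat l : 0 < l -> (fun k : nat => gauss l k%:R) @ \oo --> (0 : R).
Proof.
move=> l0.
have h : (fun k : nat => (l * k%:R + 1)^-1) @ \oo --> (0 : R).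
  apply/gtr0_cvgV0; first by apply: nearW => k; rewrite ltr_wpDl// mulr_ge0// ltW.
  apply/cvgryPge => A; near=> k.
  have : A / l <= k%:R by near: k; exact: nbhs_infty_ger.
  by rewrite ler_pdivrMr// => /le_trans; apply; rewrite mulrC lerDl.
apply: (@squeeze_cvgr _ _ _ _ (fun=> 0) (fun k : nat => (l * k%:R + 1)^-1)) => //; last exact: cvg_cst.
apply: nearW => k; rewrite gauss_ge0/= /gauss mulNr expRN lef_pV2 ?posrE ?expR_gt0//; last first.
  by rewrite ltr_wpDl// mulr_ge0// ltW.
apply: le_trans (expR_ge1Dx _); rewrite addrC lerD2l.
apply: ler_wpM2l; first exact: ltW.
by rewrite -natrX ler_nat; case: k => // k; rewrite expnS leq_pmulr.
Unshelve. all: by end_near.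
Qed.

Lemma gauss_opp l (x : R) : gauss l (- x) = gauss l x.
Proof. by rewrite /gauss sqrrN. Qed.

Lemma gauss_sin_by_parts (l z : R) : 0 < l ->
  2 * l * \int[mu]_x (x * gauss l x * sin (z * x)) =
  z * \int[mu]_x (gauss l x * cos (z * x)).
Proof.
move=> l0.
pose F x := gauss l x * sin (z * x).
pose f x := z * (gauss l x * cos (z * x)) - 2 * l * (x * gauss l x * sin (z * x)).
have dF x : is_derive x (1 : R) F (f x).
  have dg := is_derive_gauss l x.
  have ds : is_derive x (1 : R) (fun x : R => sin (z * x)) (z * cos (z * x)).
    by apply: is_derive_eq; rewrite /GRing.scale/=; ring.
  by apply: is_derive_eq; rewrite /f /GRing.scale/=; ring.
have i1 : mu.-integrable setT (EFin \o (fun x => gauss l x * cos (z * x))).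
  apply: (@integrable_gauss_bounded _ _ 1) => //; first exact: measurable_cosM.
  by move=> x; exact: normr_cos_le1.
have i2 : mu.-integrable setT (EFin \o (fun x => x * gauss l x * sin (z * x))).
  apply: (le_integrable measurableT _ _ (integrable_normr_gauss l0)).
    apply/measurable_EFinP; apply: measurable_funM; last exact: measurable_sinM.
    by apply: measurable_funM => //; exact: measurable_gauss.
  move=> x _ /=; rewrite lee_fin !normrM normr_id ler_piMr ?mulr_ge0//.
  exact: normr_sin_le1.
have fi : mu.-integrable setT (EFin \o f).
  have := integrableB measurableT (integrableZl measurableT z i1) (integrableZl measurableT (2 * l) i2).
  by apply: eq_integrable => // x _ /=; rewrite -!EFinM -EFinB.
have := Rintegral_derive_eq0 dF _ fi.
rewrite /f RintegralB//; last 2 first.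
- exact: (integrableZl measurableT z i1).
- exact: (integrableZl measurableT (2 * l) i2).
rewrite !RintegralZl// => h; apply/esym/eqP; rewrite -subr_eq0; apply/eqP; apply: h.
- move=> x; apply: differentiable_continuous; apply/derivable1_diffP.
  have dg := is_derive_gauss l x.
  have ds : is_derive x (1 : R) (fun x : R => sin (z * x)) (z * cos (z * x)).
    by apply: is_derive_eq; rewrite /GRing.scale/=; ring.
  have dc : is_derive x (1 : R) (fun x : R => cos (z * x)) (- z * sin (z * x)).
    by apply: is_derive_eq; rewrite /GRing.scale/=; ring.
  by [].
- have h0 := cvg_gauss_nat l0.
  apply/norm_cvg0P; apply: (@squeeze_cvgr _ _ _ _ (fun=> 0) (fun k : nat => gauss l k%:R)) => //; last exact: cvg_cst.
  apply: nearW => k; rewrite normr_ge0/= normrM (ger0_norm (gauss_ge0 _ _)).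
  by rewrite ler_piMr ?gauss_ge0// normr_sin_le1.
- have h0 := cvg_gauss_nat l0.
  apply/norm_cvg0P; apply: (@squeeze_cvgr _ _ _ _ (fun=> 0) (fun k : nat => gauss l k%:R)) => //; last exact: cvg_cst.
  apply: nearW => k; rewrite normr_ge0/= normrM (ger0_norm (gauss_ge0 _ _)) gauss_opp.
  by rewrite ler_piMr ?gauss_ge0// normr_sin_le1.
Qed.

(** Differentiation under the integral followed by integration by parts: the cosine transform of a
    Gaussian solves y' = - z / (2 l) y. *)
Lemma is_derive_gauss_cos (l z : R) : 0 < l ->
  is_derive z (1 : R) (fun z => \int[mu]_x (gauss l x * cos (z * x)))
    (- (z / (2 * l)) * \int[mu]_x (gauss l x * cos (z * x))).
Proof.
move=> l0.
pose f (z x : R) := gauss l x * cos (z * x).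
have df (w x : R) : is_derive w (1 : R) (f ^~ x) (- (x * gauss l x * sin (w * x))).
  have dc : is_derive w (1 : R) (fun w : R => cos (w * x)) (- x * sin (w * x)).
    by apply: is_derive_eq; rewrite /GRing.scale/=; ring.
  by apply: is_derive_eq; rewrite /GRing.scale/=; ring.
have dfE (w x : R) : partial1of2 f w x = - (x * gauss l x * sin (w * x)).
  by rewrite /partial1of2 derive1E; case: (df w x).
have zI : `]z - 1, z + 1[%classic z by rewrite /= in_itv/= gtrBl ltrDl ltr01.
have fi (x : R) : `]z - 1, z + 1[%classic x -> mu.-integrable setT (EFin \o f x).
  move=> _; apply: (@integrable_gauss_bounded _ _ 1) => //; first exact: measurable_cosM.
  by move=> y; exact: normr_cos_le1.
have dfx (x y : R) : `]z - 1, z + 1[%classic x -> setT y -> derivable (f ^~ y) x 1.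
  by move=> _ _; case: (df x y).
have G0 (y : R) : 0 <= `|y| * gauss l y by rewrite mulr_ge0 ?gauss_ge0.
have Gub (x y : R) : `]z - 1, z + 1[%classic x -> setT y -> `|partial1of2 f x y| <= `|y| * gauss l y.
  move=> _ _; rewrite dfE normrN !normrM (ger0_norm (gauss_ge0 _ _)) ler_piMr ?mulr_ge0 ?gauss_ge0//.
  exact: normr_sin_le1.
have h1 := derivable_under_integral measurableT zI fi dfx G0 (integrable_normr_gauss l0) Gub.
have h2 := differentiation_under_integral measurableT zI fi dfx G0 (integrable_normr_gauss l0) Gub.
split => //; rewrite -derive1E h2.
have -> : \int[mu]_x (partial1of2 f)^~ x z = - \int[mu]_x (x * gauss l x * sin (z * x)).
  under eq_Rintegral do rewrite dfE -mulN1r.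
  rewrite RintegralZl ?mulN1r//.
  apply: (le_integrable measurableT _ _ (integrable_normr_gauss l0)).
    apply/measurable_EFinP; apply: measurable_funM; last exact: measurable_sinM.
    by apply: measurable_funM => //; exact: measurable_gauss.
  move=> x _ /=; rewrite lee_fin !normrM normr_id ler_piMr ?mulr_ge0//.
  exact: normr_sin_le1.
have l2 : 2 * l != 0 by rewrite mulf_neq0 ?gt_eqF.
by apply: (mulfI l2); rewrite mulrN gauss_sin_by_parts//; field; rewrite gt_eqF.
Qed.

Lemma gauss_cos_integral (l z : R) : 0 < l ->
  \int[mu]_x (gauss l x * cos (z * x)) = Num.sqrt (pi / l) * gauss (4 * l)^-1 z.
Proof.
move=> l0.
pose Phi z := \int[mu]_x (gauss l x * cos (z * x)).
(* At a negative parameter [gauss] is the growing function e^(z^2 / (4 l)), the integrating factor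
   of the equation for [Phi]. *)
have dP (w : R) : is_derive w (1 : R) (fun z => Phi z * gauss (- (4 * l)^-1) z) 0.
  have d1 := is_derive_gauss_cos w l0.
  have d2 := is_derive_gauss (- (4 * l)^-1) w.
  by apply: is_derive_eq; rewrite /GRing.scale/= -/(Phi w); field; rewrite gt_eqF.
have := is_derive_0_is_cst z 0 dP.
rewrite {2}/gauss expr0n/= mulr0 expR0 mulr1.
have -> : Phi 0 = Num.sqrt (pi / l).
  have [_ <-] := gauss_integral l0; apply: eq_Rintegral => x _.
  by rewrite mul0r cos0 mulr1.
move=> <-; rewrite -mulrA /gauss -expRD (_ : _ + _ = 0) ?expR0 ?mulr1//.
by ring.
Qed.

Lemma gauss_sin_integral (l z : R) : 0 < l ->
  \int[mu]_x (gauss l x * sin (z * x)) = 0.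
Proof.
move=> l0; pose h x := gauss l x * sin (z * x).
have mh : measurable_fun setT h by apply: measurable_funM; [exact: measurable_gauss|exact: measurable_sinM].
rewrite /Rintegral integralE -/h.
(* The integrand is odd, so its negative part is the reflection of its positive part. *)
rewrite (_ : (fun x => _)^\-%E = (fun x => (fun y => (h y)%:E)^\+%E (- x)%R)).
  rewrite (ge0_integral_opp1 (f := (fun y => (h y)%:E)^\+%E)).
  - rewrite subee//.
    have ih : mu.-integrable setT (EFin \o h).
      apply: (@integrable_gauss_bounded _ _ 1) => //; first exact: measurable_sinM.
      by move=> y; exact: normr_sin_le1.
    exact: integrable_pos_fin_num ih.
  - by apply: measurable_funepos; exact/measurable_EFinP.
  - by move=> x; exact: funepos_ge0.
by apply/funext => x; rewrite funenegE funeposE /h gauss_opp mulrN sinN mulrN.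
Qed.

End gaussian_1d.

Section gaussian_packets_1d.
Context {R : realType}.
Local Notation mu := (@lebesgue_measure R).

Lemma Rintegral_shift1 (a : R) (f : R -> R) : measurable_fun setT f ->
  \int[mu]_x f (a + x) = \int[mu]_x f x.
Proof.
move=> mf; have mE : measurable_fun setT (EFin \o f) by exact/measurable_EFinP.
rewrite /Rintegral; congr fine; rewrite integralE [RHS]integralE; congr (_ - _)%E.
- rewrite -(ge0_integral_shift1 a (f := (EFin \o f)^\+%E)).
  + by apply: eq_integral => x _; rewrite !funeposE.
  + exact: measurable_funepos.
  + by move=> x; exact: funepos_ge0.
- rewrite -(ge0_integral_shift1 a (f := (EFin \o f)^\-%E)).
  + by apply: eq_integral => x _; rewrite !funenegE.
  + exact: measurable_funeneg.
  + by move=> x; exact: funeneg_ge0.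
Qed.

Lemma cintegral_shift1 (a : R) (f : R -> R[i]) : cmeasurable setT f ->
  cintegral mu setT (fun x => f (a + x)) = cintegral mu setT f.
Proof.
move=> [m1 m2]; apply: complexP => /=.
- exact: (Rintegral_shift1 a (f := fun x => complex.Re (f x))).
- exact: (Rintegral_shift1 a (f := fun x => complex.Im (f x))).
Qed.

Lemma cis0 : cis (0 : R) = 1.
Proof. by rewrite /cis cos0 sin0. Qed.

Lemma cis_sum I (s : seq I) (F : I -> R) : cis (\sum_(i <- s) F i) = \prod_(i <- s) cis (F i).
Proof.
elim: s => [|i s ih]; first by rewrite !big_nil cis0.
by rewrite !big_cons cisD ih.
Qed.

(** A Gaussian centred at [a] and modulated at frequency [b]. The modulation makes the family
    stable, up to constants, under the Fourier transform, which exchanges centre and frequency up to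
    a sign. *)
Definition packet1 (l a b x : R) : R[i] := (gauss l (x - a))%:C * cis (b * x).

Lemma cabs_packet1 l a b x : cabs (packet1 l a b x) = gauss l (x - a).
Proof. by rewrite cabsM cabs_cis mulr1 cabs_real ger0_norm// gauss_ge0. Qed.

Lemma cmeasurable_packet1 l a b : cmeasurable setT (packet1 l a b).
Proof.
apply: cmeasurableM.
  apply: cmeasurable_real; apply: (measurableT_comp (measurable_gauss l)).
  exact: measurable_funB.
by apply: cmeasurable_cis; exact: measurable_funM.
Qed.

Lemma integrable_gauss_shift (l a : R) : 0 < l ->
  mu.-integrable setT (EFin \o (fun x => gauss l (x - a))).
Proof.
move=> l0; have mga : measurable_fun setT (fun x : R => gauss l (x - a)).
  by apply: (measurableT_comp (measurable_gauss l)); exact: measurable_funB.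
apply/integrableP; split; first exact/measurable_EFinP.
under eq_integral do rewrite /= ger0_norm ?gauss_ge0// addrC.
rewrite (ge0_integral_shift1 (- a) (f := fun x => (gauss l x)%:E)).
- by apply: integrable_lty => //; exact: integrable_gauss.
- by apply/measurable_EFinP; exact: measurable_gauss.
- by move=> x; rewrite lee_fin gauss_ge0.
Qed.

Lemma cintegrable_packet1 l a b : 0 < l -> cintegrable mu setT (packet1 l a b).
Proof.
move=> l0; apply: (@cintegrable_le _ _ _ mu _ measurableT _ (fun x => gauss l (x - a))).
- exact: cmeasurable_packet1.
- exact: integrable_gauss_shift.
- by move=> x _; rewrite cabs_packet1.
Qed.

Lemma cintegral_gauss_cis l z : 0 < l ->
  cintegral mu setT (fun x => (gauss l x)%:C * cis (z * x)) =
  (Num.sqrt (pi / l) * gauss (4 * l)^-1 z)%:C.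
Proof.
move=> l0; apply: complexP => /=.
- rewrite -gauss_cos_integral//; apply: eq_Rintegral => x _.
  by rewrite /= mul0r subr0.
- rewrite -[RHS](gauss_sin_integral z l0); apply: eq_Rintegral => x _.
  by rewrite /= mul0r addr0.
Qed.

Lemma fourier_packet1 (l a b xi : R) : 0 < l ->
  cintegral mu setT (fun x => packet1 l a b x * cis (- (x * xi))) =
  (Num.sqrt (pi / l))%:C * cis (a * b) * packet1 (4 * l)^-1 b (- a) xi.
Proof.
move=> l0.
have mF : cmeasurable setT (fun x : R => packet1 l a b x * cis (- (x * xi))).
  apply: cmeasurableM; first exact: cmeasurable_packet1.
  apply: cmeasurable_cis; apply: measurableT_comp => //; exact: measurable_funM.
(* Recentring the Gaussian at 0 turns its centre into a phase. *)
rewrite -(cintegral_shift1 a mF).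
transitivity (cintegral mu setT (fun x => cis (a * (b - xi)) * ((gauss l x)%:C * cis ((b - xi) * x)))).
  apply: eq_cintegral => x _; rewrite /packet1 addrAC subrr add0r -mulrA -cisD mulrCA.
  by rewrite -cisD; congr (_ * cis _); ring.
rewrite cintegralZ//; last first.
  apply: (cintegrable_le measurableT _ (integrable_gauss l0)).
    apply: cmeasurableM.
      by apply: cmeasurable_real; exact: measurable_gauss.
    by apply: cmeasurable_cis; exact: measurable_funM.
  by move=> x _; rewrite cabsM cabs_cis mulr1 cabs_real ger0_norm// gauss_ge0.
rewrite cintegral_gauss_cis// /packet1 rmorphM/= -[b - xi]opprB gauss_opp opprB.
rewrite (_ : a * (b - xi) = a * b + - a * xi); last by ring.
by rewrite cisD; ring.
Qed.

End gaussian_packets_1d.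

Section gaussian_packets.
Context {R : realType} {n : nat}.
Local Notation V := 'rV[R]_n.
Local Notation leb := (@lebesgue_rV R n).
Implicit Types (l a b : 'I_n -> R).

Definition packet l a b (x : V) : R[i] := \prod_(i < n) packet1 (l i) (a i) (b i) (x 0 i).

(** The scalar produced by the unitary transform: in each coordinate sqrt(pi / l) divided by sqrt(2
    pi), times a phase. *)
Definition packet_const l a b : R[i] :=
  \prod_(i < n) ((Num.sqrt (2 * l i))^-1%:C * cis (a i * b i)).

Lemma cintegrable_packet l a b : (forall i, 0 < l i) -> cintegrable leb setT (packet l a b).
Proof.
move=> l0; have [] := @cintegral_prod R n (fun i => packet1 (l i) (a i) (b i)) => // i.
exact: cintegrable_packet1.
Qed.

Lemma inverse_fourierE (g : V -> R[i]) (x : V) : inverse_fourier g x = fourier g (- x).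
Proof.
rewrite /inverse_fourier /fourier; congr (_ * _); apply: eq_cintegral => y _; congr (_ * cis _).
rewrite /dotp -sumrN; apply: eq_bigr => i _; rewrite mxE; ring.
Qed.

Lemma fourier_constE : (fourier_const (R := R) (n := n)) = \prod_(i < n) (Num.sqrt (2 * pi))^-1.
Proof. by rewrite /fourier_const prodr_const card_ord exprVn. Qed.

Lemma fourier_const_gt0 : 0 < fourier_const (R := R) (n := n).
Proof. by rewrite invr_gt0 exprn_gt0// sqrtr_gt0 mulr_gt0// pi_gt0. Qed.

Lemma fourier_packet l a b : (forall i, 0 < l i) ->
  fourier (packet l a b) = fun xi =>
    packet_const l a b * packet (fun i => (4 * l i)^-1) b (fun i => - a i) xi.
Proof.
move=> l0; apply/funext => xi; rewrite /fourier.
have -> : cintegral leb setT (fun x => packet l a b x * cis (- dotp x xi)) =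
    cintegral leb setT (fun x => \prod_(i < n) (packet1 (l i) (a i) (b i) (x 0 i) * cis (- (x 0 i * xi 0 i)))).
  by apply: eq_cintegral => x _; rewrite big_split/= /packet -cis_sum /dotp sumrN.
have [|_ ->] := @cintegral_prod R n (fun i t => packet1 (l i) (a i) (b i) t * cis (- (t * xi 0 i))).
  move=> i; apply: (@cintegrable_le _ _ _ (@lebesgue_measure R) _ measurableT _ (fun x => gauss (l i) (x - a i))).
  - apply: cmeasurableM; first exact: cmeasurable_packet1.
    by apply: cmeasurable_cis; apply: measurableT_comp => //; exact: measurable_funM.
  - exact: integrable_gauss_shift.
  - by move=> x _; rewrite cabsM cabs_cis mulr1 cabs_packet1.
under eq_bigr do rewrite fourier_packet1//.
rewrite big_split/= mulrA; congr (_ * _).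
rewrite fourier_constE rmorph_prod/= -big_split/=; apply: eq_bigr => i _.
rewrite mulrA; congr (_ * _); rewrite -rmorphM/=; congr (_%:C).
have -> : pi / l i = (2 * pi) * (2 * l i)^-1 :> R by field; rewrite gt_eqF.
rewrite [Num.sqrt (_ / _)]sqrtrM ?mulr_ge0 ?pi_ge0// mulKf.
  by rewrite sqrtrV// mulr_ge0// ltW.
by rewrite gt_eqF// sqrtr_gt0 mulr_gt0// pi_gt0.
Qed.

Lemma packet_constK l a b : (forall i, 0 < l i) ->
  packet_const (fun i => (4 * l i)^-1) b (fun i => - a i) * packet_const l a b = 1.
Proof.
move=> l0; rewrite /packet_const -big_split/= big1// => i _.
rewrite mulrACA -cisD (_ : _ + _ = 0) ?cis0 ?mulr1; last by ring.
rewrite -rmorphM/= -invfM -sqrtrM ?mulr_ge0 ?invr_ge0 ?mulr_ge0 ?ltW//.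
rewrite (_ : _ * _ = 1) ?sqrtr1 ?invr1//.
by field; rewrite gt_eqF.
Qed.

Lemma packetN l a b x : packet l (fun i => - a i) (fun i => - b i) x = packet l a b (- x).
Proof.
apply: eq_bigr => i _; rewrite mxE /packet1 mulNr mulrN; congr (_%:C * _).
by rewrite -gauss_opp; congr gauss; ring.
Qed.

Lemma fourierZ (c : R[i]) (f : V -> R[i]) : cintegrable leb setT f ->
  fourier (fun x => c * f x) = fun xi => c * fourier f xi.
Proof.
move=> fi; apply/funext => xi; rewrite /fourier mulrCA; congr (_ * _).
rewrite -cintegralZ; [|by []|].
  by apply: eq_cintegral => x _; rewrite mulrA.
rewrite (_ : (fun x => _) = (fun x => cis (- dotp x xi) * f x)); last by apply/funext => x; rewrite mulrC.
apply: (@cintegrable_bounded _ _ _ _ _ _ _ _ 1) => //.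
  by apply: cmeasurable_cis; apply: measurableT_comp => //; apply: measurable_dotp.
by move=> x _; rewrite cabs_cis.
Qed.

Lemma fourier_fourier_packet l a b x : (forall i, 0 < l i) ->
  fourier (fourier (packet l a b)) x = packet l a b (- x).
Proof.
move=> l0; have l0' i : 0 < (4 * l i)^-1 by rewrite invr_gt0 mulr_gt0.
rewrite fourier_packet// fourierZ; last exact: cintegrable_packet.
rewrite fourier_packet//= mulrA [_ * packet_const _ b _]mulrC packet_constK// mul1r -packetN.
have -> // : (fun i => (4 * (4 * l i)^-1)^-1) = l.
by apply/funext => i; rewrite invfM invrK mulrA mulVf ?mul1r.
Qed.

Lemma packetE l a b x : packet l a b x =
  (expR (- \sum_(i < n) l i * (x 0 i - a i) ^+ 2))%:C * cis (\sum_(i < n) b i * x 0 i).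
Proof.
rewrite /packet big_split/= -rmorph_prod/= cis_sum -sumrN expR_sum; congr ((_)%:C * _).
by apply: eq_bigr => i _; rewrite /gauss mulNr.
Qed.

Lemma cabs_packet l a b x : cabs (packet l a b x) = expR (- \sum_(i < n) l i * (x 0 i - a i) ^+ 2).
Proof. by rewrite packetE cabsM cabs_cis mulr1 cabs_real ger0_norm// expR_ge0. Qed.

(** Coordinatewise, c u - l u^2 <= c^2 / (4 l) by completing the square with u = |x_i - a_i|;
    replacing |x_i| by u costs the term c |a_i|. *)
Lemma packet_decay l a (c : R) : 0 <= c -> (forall i, 0 < l i) ->
  exists M : R, forall x : V,
    expR (c * norm1 x) * expR (- \sum_(i < n) l i * (x 0 i - a i) ^+ 2) <= M.
Proof.
move=> c0 l0; exists (expR (\sum_(i < n) (c * `|a i| + c ^+ 2 / (4 * l i)))) => x.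
rewrite -expRD ler_expR /norm1 mulr_sumr -sumrN -big_split/= ler_sum// => i _.
have h : c * `|x 0 i| <= c * `|a i| + c * `|x 0 i - a i|.
  by rewrite -mulrDr ler_wpM2l// addrC -{1}(subrK (a i) (x 0 i)) ler_normD.
apply: (@le_trans _ _ (c * `|a i| + (c * `|x 0 i - a i| - l i * `|x 0 i - a i| ^+ 2))).
  by rewrite real_normK ?num_real// addrA lerD2r.
rewrite lerD2l; set u := `|_ - _|.
have li := l0 i.
rewrite -subr_ge0 (_ : _ - _ = l i * (u - c / (2 * l i)) ^+ 2); last by field; rewrite gt_eqF.
by rewrite mulr_ge0 ?sqr_ge0// ltW.
Qed.

End gaussian_packets.

(** * Packets are Gelfand-Shilov test functions *)

Section coordinate_derivatives.
Context {R : realType} {n : nat}.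
Local Notation V := 'rV[R]_n.

Lemma derive_comp1 (g : R -> R) (q : V -> R) (x v : V) :
  differentiable q x -> differentiable g (q x) ->
  'D_v (g \o q) x = 'D_v q x * g^`()%classic (q x).
Proof.
move=> dq dg; rewrite !deriveE//; last exact: differentiable_comp.
by rewrite diff_comp//= [in LHS]diff1E.
Qed.

Lemma differentiable_cosR (y : R) : differentiable (cos : R -> R) y.
Proof. by apply/derivable1_diffP; exact: derivable_cos. Qed.

Lemma differentiable_sinR (y : R) : differentiable (sin : R -> R) y.
Proof. by apply/derivable1_diffP; exact: derivable_sin. Qed.

Lemma derive_coord (i j : 'I_n) (x : V) :
  'D_(delta_mx 0 i) (fun x : V => x 0 j) x = (i == j)%:R.
Proof.
have @f : {linear V -> R}.
  by exists (fun N : V => N 0 j); do 2![eexists]; do ?[constructor];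
     rewrite ?mxE// => ? *; rewrite ?mxE//; move=> ?; rewrite !mxE.
have cf : continuous f by exact: coord_continuous.
rewrite (_ : (fun _ => _) = f)// deriveE; last exact: linear_differentiable.
by rewrite diff_lin//= mxE eqxx/= eq_sym.
Qed.

End coordinate_derivatives.

Section tame.
Context {R : realType} {n : nat}.
Local Notation V := 'rV[R]_n.
Variables (th : V -> R) (b : 'I_n -> R).
Hypothesis dth : forall x, differentiable th x.
Hypothesis Dth : forall x i, 'D_(delta_mx 0 i) th x = b i.

(** The algebra generated by the coordinates and by the cosine and sine of the phase [th]. It is
    stable under partial derivatives because those of [th] are constant, and it has polynomial
    growth; the derivatives of a packet are tame functions times its Gaussian. *)
Inductive tame : (V -> R) -> Prop :=
| tame_cst c : tame (cst c)
| tame_coord i : tame (fun x => x 0 i)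
| tame_cos : tame (cos \o th)
| tame_sin : tame (sin \o th)
| tameD p q : tame p -> tame q -> tame (p + q)
| tameM p q : tame p -> tame q -> tame (p * q).

Lemma tame_differentiable p : tame p -> forall x, differentiable p x.
Proof.
elim=> [c|i|||p1 q _ dp _ dq|p1 q _ dp _ dq] x.
- exact: differentiable_cst.
- exact: differentiable_coord.
- by apply: differentiable_comp; [exact: dth|exact: differentiable_cosR].
- by apply: differentiable_comp; [exact: dth|exact: differentiable_sinR].
- exact: differentiableD.
- exact: differentiableM.
Qed.

Lemma tame_derive p i : tame p ->
  exists2 q, tame q & forall x, 'D_(delta_mx 0 i) p x = q x.
Proof.
elim=> [c|j|||p1 q tp [p' tp' Hp] tq [q' tq' Hq]|p1 q tp [p' tp' Hp] tq [q' tq' Hq]].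
- by exists (cst 0); [exact: tame_cst|move=> x; rewrite derive_cst].
- by exists (cst (i == j)%:R); [exact: tame_cst|move=> x; rewrite derive_coord].
- exists (cst (- b i) * (sin \o th)).
    by apply: tameM; [exact: tame_cst|exact: tame_sin].
  move=> x; rewrite derive_comp1//; last exact: differentiable_cosR.
  rewrite Dth derive1E; have -> := @derive_val _ _ _ _ _ _ _ (is_derive_cos (th x)).
  by rewrite /= mulrN -mulNr.
- exists (cst (b i) * (cos \o th)).
    by apply: tameM; [exact: tame_cst|exact: tame_cos].
  move=> x; rewrite derive_comp1//; last exact: differentiable_sinR.
  by rewrite Dth derive1E; have -> := @derive_val _ _ _ _ _ _ _ (is_derive_sin (th x)).
- exists (p' + q'); first exact: tameD.
  move=> x; rewrite deriveD ?Hp ?Hq//; apply: diff_derivable; exact: tame_differentiable.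
- exists (p1 * q' + q * p'); first by apply: tameD; exact: tameM.
  move=> x; rewrite deriveM ?Hp ?Hq//; apply: diff_derivable; exact: tame_differentiable.
Qed.

Lemma tame_bound p : tame p ->
  exists C N, 0 <= C /\ forall x, `|p x| <= C * japanese x ^+ N.
Proof.
have j1 N (x : V) : 1 <= japanese x ^+ N by rewrite exprn_ege1// japanese_ge1.
elim=> [c|i|||p1 q tp [C [N [C0 HN]]] tq [C' [N' [C0' HN']]]|p1 q tp [C [N [C0 HN]]] tq [C' [N' [C0' HN']]]].
- by exists `|c|, 0%N; split => // x; rewrite expr0 mulr1.
- exists 1, 1%N; split => // x; rewrite mul1r expr1.
  exact: le_trans (normr_coord_le_enorm x i) (enorm_le_japanese x).
- by exists 1, 0%N; split => // x; rewrite expr0 mulr1; exact: normr_cos_le1.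
- by exists 1, 0%N; split => // x; rewrite expr0 mulr1; exact: normr_sin_le1.
- exists (C + C'), (N + N')%N; split => [|x]; first exact: addr_ge0.
  rewrite mulrDl (le_trans (ler_normD _ _))// lerD//.
  + by rewrite (le_trans (HN x))// exprD mulrA ler_peMr// mulr_ge0// (le_trans _ (j1 N x)).
  + by rewrite (le_trans (HN' x))// exprD mulrCA ler_peMl// mulr_ge0// (le_trans _ (j1 N' x)).
- exists (C * C'), (N + N')%N; split => [|x]; first exact: mulr_ge0.
  by rewrite exprD mulrACA normrM ler_pM.
Qed.

End tame.

Section packet_schwartz.
Context {R : realType} {n : nat}.
Local Notation V := 'rV[R]_n.
Variables (l a b : 'I_n -> R).
Hypothesis l0 : forall i, 0 < l i.

Let th (x : V) := \sum_(i < n) b i * x 0 i.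
Let Q (x : V) := \sum_(i < n) l i * (x 0 i - a i) ^+ 2.
Let E (x : V) := expR (- Q x).

Let derive_sum_coord (f : 'I_n -> R -> R) (f' : 'I_n -> R -> R) :
  (forall i t, is_derive t (1 : R) (f i) (f' i t)) ->
  (forall x : V, differentiable (fun x : V => \sum_(i < n) f i (x 0 i)) x) /\
  (forall (x : V) j, 'D_(delta_mx 0 j) (fun x : V => \sum_(i < n) f i (x 0 i)) x = f' j (x 0 j)).
Proof.
move=> df.
have dfi i (x : V) : differentiable (f i \o (fun x : V => x 0 i)) x.
  apply: differentiable_comp; first exact: differentiable_coord.
  by apply/derivable1_diffP; case: (df i (x 0 i)).
have E1 : (fun x : V => \sum_(i < n) f i (x 0 i)) = \sum_(i < n) (f i \o (fun x : V => x 0 i)).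
  by apply/funext => x; rewrite fct_sumE.
rewrite E1; split => [x|x j]; first exact: differentiable_sum.
rewrite derive_sum; last by move=> i; exact: diff_derivable.
rewrite (bigD1 j)//= [X in _ + X]big1 ?addr0 => [|i ij].
  rewrite derive_comp1; last 2 first.
  - exact: differentiable_coord.
  - by apply/derivable1_diffP; case: (df j (x 0 j)).
  by rewrite derive_coord eqxx mul1r derive1E; case: (df j (x 0 j)).
rewrite derive_comp1; last 2 first.
- exact: differentiable_coord.
- by apply/derivable1_diffP; case: (df i (x 0 i)).
by rewrite derive_coord eq_sym (negbTE ij) mul0r.
Qed.

Let dth : forall x, differentiable th x.
Proof.
apply: (derive_sum_coord (f := fun i t => b i * t) (f' := fun i t => b i) _).1 => i t.
by apply: is_derive_eq; rewrite /GRing.scale/=; ring.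
Qed.

Let Dth : forall x i, 'D_(delta_mx 0 i) th x = b i.
Proof.
apply: (derive_sum_coord (f := fun i t => b i * t) (f' := fun i t => b i) _).2 => i t.
by apply: is_derive_eq; rewrite /GRing.scale/=; ring.
Qed.

Let dQ : (forall x, differentiable Q x) /\
  forall x i, 'D_(delta_mx 0 i) Q x = 2 * l i * (x 0 i - a i).
Proof.
apply: (derive_sum_coord (f := fun i t => l i * (t - a i) ^+ 2)
  (f' := fun i t => 2 * l i * (t - a i))) => i t.
by apply: is_derive_eq; rewrite /GRing.scale/= ?expr1; ring.
Qed.

Let dE : (forall x, differentiable E x) /\
  forall x i, 'D_(delta_mx 0 i) E x = (- (2 * l i) * (x 0 i - a i)) * E x.
Proof.
have dm : forall t, differentiable (fun t : R => expR (- t)) t.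
  move=> t; apply/derivable1_diffP.
  have h : is_derive t (1 : R) (fun t : R => expR (- t)) (- expR (- t)).
    by apply: is_derive_eq; rewrite /GRing.scale/=; ring.
  by case: h.
have [d1 d2] := dQ.
have EE : E = (fun t : R => expR (- t)) \o Q by [].
rewrite EE; split => [x|x i]; first exact: differentiable_comp.
rewrite derive_comp1// d2 derive1E.
have -> : 'D_1 (fun t : R => expR (- t)) (Q x) = - expR (- Q x).
  have h : is_derive (Q x) (1 : R) (fun t : R => expR (- t)) (- expR (- Q x)).
    by apply: is_derive_eq; rewrite /GRing.scale/=; ring.
  by case: h.
by rewrite /=; ring.
Qed.

Lemma partials_tame p (s : seq 'I_n) : tame th p ->
  exists2 q, tame th q & partials s (fun x => p x * E x) = (fun x => q x * E x).
Proof.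
move=> tp; elim: s => [|i s [q tq IH]]; first by exists p.
have [q' tq' Hq'] := tame_derive dth Dth i tq.
exists (q' + q * (cst (- (2 * l i)) * ((fun x => x 0 i) + cst (- a i)))).
  apply: tameD => //; apply: tameM => //; apply: tameM; first exact: tame_cst.
  by apply: tameD; [exact: tame_coord|exact: tame_cst].
rewrite [partials _ _]/= -/(partials s (fun x => p x * E x)) IH; apply/funext => x.
have [d1 d2] := dE.
have dq := tame_differentiable dth tq.
rewrite (_ : (fun x : V => q x * E x) = q * E)//.
rewrite deriveM; last 2 first.
- exact: diff_derivable.
- exact: diff_derivable.
rewrite d2 Hq' /GRing.scale/= -[(_ + _) x]/(q' x + q x * (- (2 * l i) * (x 0 i + - a i))).
by ring.
Qed.

Lemma tame_gaussian_schwartz p : tame th p -> real_schwartz (fun x => p x * E x).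
Proof.
move=> tp s; have [q tq ->] := partials_tame s tp.
split => [x|m].
  rewrite (_ : (fun x : V => q x * E x) = q * E)//.
  by apply: differentiableM; [exact: (tame_differentiable dth)|exact: dE.1].
have [C [N [C0 HN]]] := tame_bound tq.
(* The power m + N of [japanese x] is at most e^((m + N) (norm1 x)), which the Gaussian beats. *)
have [M HM] := packet_decay a (ler0n R (m + N)) l0.
exists (C * M) => x; rewrite normrM (ger0_norm (expR_ge0 _)) mulrA.
have j0 : 0 <= japanese x by rewrite ltW// japanese_gt0.
apply: (@le_trans _ _ (C * (japanese x ^+ (m + N) * E x))).
  rewrite mulrA ler_wpM2r ?expR_ge0// exprD mulrCA ler_wpM2l ?exprn_ge0//.
rewrite ler_wpM2l// (le_trans _ (HM x))// ler_wpM2r ?expR_ge0//.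
rewrite expRM_natl lerXn2r ?nnegrE ?expR_ge0//.
apply: le_trans (expR_ge1Dx _); rewrite (le_trans (japanese_le x))// lerD2l.
exact: enorm_le_norm1.
Qed.

Lemma schwartz_packet (c : R[i]) : schwartz (fun x => c * packet l a b x).
Proof.
split.
- rewrite (_ : (fun x => _) = (fun x =>
    (cst (complex.Re c) * (cos \o th) + cst (- complex.Im c) * (sin \o th)) x * E x)).
    apply: tame_gaussian_schwartz; apply: tameD; apply: tameM; first exact: tame_cst.
    + exact: tame_cos.
    + exact: tame_cst.
    + exact: tame_sin.
  apply/funext => x; rewrite packetE !ReM !ImM/= -/(th x) -/(Q x) -/(E x) !mul0r subr0 addr0.
  by rewrite -[(_ + _) x]/(complex.Re c * cos (th x) + - complex.Im c * sin (th x)); ring.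
- rewrite (_ : (fun x => _) = (fun x =>
    (cst (complex.Re c) * (sin \o th) + cst (complex.Im c) * (cos \o th)) x * E x)).
    apply: tame_gaussian_schwartz; apply: tameD; apply: tameM; first exact: tame_cst.
    + exact: tame_sin.
    + exact: tame_cst.
    + exact: tame_cos.
  apply/funext => x; rewrite packetE !ImM !ReM/= -/(th x) -/(Q x) -/(E x) !mul0r subr0 addr0.
  by rewrite -[(_ + _) x]/(complex.Re c * sin (th x) + complex.Im c * cos (th x)); ring.
Qed.

End packet_schwartz.

Section packet_gs.
Context {R : realType} {n : nat}.
Local Notation V := 'rV[R]_n.
Implicit Types (l a b : 'I_n -> R).

Lemma packet_exp_bound l a b (c : R[i]) (r : R) : 0 < r -> (forall i, 0 < l i) ->
  (ereal_sup (range (fun x : V => (expR (r * enorm x) * cabs (c * packet l a b x))%:E)) < +oo)%E.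
Proof.
move=> r0 l0; have [M HM] := packet_decay a (ltW r0) l0.
apply: (@le_lt_trans _ _ (cabs c * M)%:E); last exact: ltry.
apply: ge_ereal_sup => _ [x _ <-]; rewrite lee_fin cabsM cabs_packet mulrCA.
rewrite ler_wpM2l ?cabs_ge0// (le_trans _ (HM x))// ler_wpM2r ?expR_ge0// ler_expR.
by rewrite ler_wpM2l ?(ltW r0)// enorm_le_norm1.
Qed.

Lemma gs_packet l a b (c : R[i]) : (forall i, 0 < l i) ->
  gs_space (fun x : V => c * packet l a b x).
Proof.
move=> l0; split; first exact: schwartz_packet.
move=> r r0; rewrite /gs_norm.
have l0' i : 0 < (4 * l i)^-1 by rewrite invr_gt0 mulr_gt0.
rewrite fourierZ; last exact: cintegrable_packet.
rewrite fourier_packet//; under [X in (_ + ereal_sup (range X))%E]eq_fun do rewrite mulrA.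
by apply: lte_add_pinfty; exact: packet_exp_bound.
Qed.

Lemma gs_fourier_packet l a b : (forall i, 0 < l i) ->
  gs_space (fourier (packet l a b : V -> R[i])).
Proof.
move=> l0; rewrite fourier_packet//; apply: gs_packet => i.
by rewrite invr_gt0 mulr_gt0.
Qed.

End packet_gs.

(** * From Gaussian tests to indicator tests *)

Section interval_approximation.
Context {R : realType}.

(* For k -> oo this tends to the indicator of [-1, 1]: with v = 2^(-t^2), the
   quantity k 2^k v^k = k 2^(k (1 - t^2)) tends to +oo for |t| <= 1 and to 0
   for |t| > 1. *)
Definition plateau (k : nat) (t : R) : R :=
  1 - (1 - gauss (ln 2) t ^+ k) ^+ (k * 2 ^ k).

Let L : R := ln 2.
Let L0 : 0 < L. Proof. by rewrite ln_gt0// ltr1n. Qed.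

Let gaussX k (t : R) : gauss L t ^+ k = expR (- (k%:R * L * t ^+ 2)).
Proof. by rewrite /gauss -expRM_natl; congr expR; ring. Qed.

Let pow2E k : (2 ^ k)%:R = expR (k%:R * L) :> R.
Proof. by rewrite expRM_natl lnK ?posrE// natrX. Qed.

Let v01 k (t : R) : 0 <= gauss L t ^+ k <= 1.
Proof.
rewrite gaussX expR_ge0/= -[leRHS]expR0 ler_expR oppr_le0.
by apply: mulr_ge0 (sqr_ge0 _); rewrite mulr_ge0// ltW.
Qed.

Let Nv k (t : R) : (k * 2 ^ k)%:R * gauss L t ^+ k = k%:R * expR (k%:R * (L * (1 - t ^+ 2))).
Proof. by rewrite natrM pow2E gaussX -mulrA -expRD; congr (_ * expR _); ring. Qed.

Lemma bernoulli_le (y : R) N : 0 <= y <= 1 -> 1 - (1 - y) ^+ N <= N%:R * y.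
Proof.
move=> /andP[y0 y1]; elim: N => [|N ih]; first by rewrite expr0 subrr mul0r.
have p1 : (1 - y) ^+ N <= 1 by rewrite exprn_ile1 ?subr_ge0// gerBl.
rewrite exprS -natr1; have : 0 <= (1 - y) ^+ N by rewrite exprn_ge0// subr_ge0.
nra.
Qed.

Lemma plateau_ge0 k t : 0 <= plateau k t.
Proof.
have /andP[v0 v1] := v01 k t.
by rewrite subr_ge0 exprn_ile1 ?subr_ge0// gerBl.
Qed.

Lemma plateau_le1 k t : plateau k t <= 1.
Proof.
have /andP[v0 v1] := v01 k t.
by rewrite gerBl exprn_ge0// subr_ge0.
Qed.

Lemma plateau_le k t : plateau k t <= k%:R * expR (k%:R * (L * (1 - t ^+ 2))).
Proof. by rewrite -Nv; exact: bernoulli_le (v01 k t). Qed.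

(** A bound by one Gaussian, uniform in [k], is what dominated limits require. For t^2 <= 2 the
    plateau is at most 1 and 2 = e^(ln 2) compensates the Gaussian. *)
Lemma plateau_dominated k (t : R) : plateau k t <= (2 + 4 / L) * gauss (L / 4) t.
Proof.
have LV0 : 0 <= 4 / L by rewrite divr_ge0// ltW.
have [t2|t2] := leP (t ^+ 2) 2.
  apply: le_trans (plateau_le1 _ _) _.
  apply: (@le_trans _ _ (2 * gauss (L / 4) t)); last first.
    by rewrite ler_wpM2r ?gauss_ge0// lerDl.
  have -> : 2 * gauss (L / 4) t = expR (L - L / 4 * t ^+ 2).
    by rewrite expRD /gauss /L lnK ?posrE// mulNr.
  rewrite -[leLHS]expR0 ler_expR.
  have := L0; nra.
case: k => [|k].
  by rewrite /plateau mul0n expr0 subrr mulr_ge0 ?gauss_ge0// addr_ge0.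
apply: le_trans (plateau_le _ _) _.
have k1 : 1 <= k.+1%:R :> R by rewrite ler1n.
apply: (@le_trans _ _ (4 / L * gauss (L / 4) t)); last first.
  by rewrite ler_wpM2r ?gauss_ge0// lerDr.
(* The factor k.+1 costs 4 / L and a quarter of the rate; since t^2 > 2, the exponent that remains
   still lies below - L t^2 / 4. *)
have h1 : k.+1%:R <= 4 / L * expR (k.+1%:R * (L / 4)).
  apply: (@le_trans _ _ (4 / L * (k.+1%:R * (L / 4)))).
    by rewrite le_eqVlt; apply/orP; left; apply/eqP; field; rewrite gt_eqF.
  by rewrite ler_wpM2l// (le_trans _ (expR_ge1Dx _))// lerDr.
apply: (@le_trans _ _ (4 / L * expR (k.+1%:R * (L / 4)) * expR (k.+1%:R * (L * (1 - t ^+ 2))))).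
  by rewrite ler_wpM2r ?expR_ge0.
rewrite -mulrA -expRD ler_wpM2l// /gauss ler_expR.
set K := k.+1%:R in k1 *.
have := L0; set q := t ^+ 2 in t2 *; move=> l0.
rewrite -mulrDr -subr_ge0 (_ : _ - _ = L / 4 * (K * (4 * q - 5) - q)); last by field.
by rewrite mulr_ge0 ?divr_ge0 ?(ltW l0)// subr_ge0; nra.
Qed.

Lemma cvg_plateau (t : R) : (fun k => plateau k t) @ \oo --> ((`|t| <= 1)%R%:R : R).
Proof.
have [t1|t1] := leP `|t| 1; last first.
  have t2 : 0 < L * (t ^+ 2 - 1).
    by rewrite mulr_gt0// subr_gt0 -real_normK ?num_real// expr_gt1.
  set c := L * _ in t2.
  (* From e^(-k c) <= (k c / 2)^(-2), one power of k being used up by the factor in front. *)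
  apply: (@squeeze_cvgr _ _ _ _ (fun=> 0) (fun k => 4 / c ^+ 2 * k%:R^-1)).
  - near=> k; rewrite plateau_ge0/= (le_trans (plateau_le _ _))//.
    have k0 : 0 < k%:R :> R by rewrite ltr0n; near: k; exists 1%N.
    rewrite (_ : k%:R * (L * (1 - t ^+ 2)) = - (2 * (k%:R * c / 2))); last by rewrite /c; field.
    rewrite expRN expRM_natl.
    have h : k%:R * c / 2 <= expR (k%:R * c / 2).
      by apply: le_trans (expR_ge1Dx _); rewrite lerDr.
    have p0 : 0 < k%:R * c / 2 by apply: divr_gt0 => //; exact: mulr_gt0.
    apply: (@le_trans _ _ (k%:R * (k%:R * c / 2) ^- 2)).
      apply: ler_wpM2l; first exact: ltW.
      rewrite lef_pV2 ?posrE ?exprn_gt0 ?expR_gt0// lerXn2r ?nnegrE ?expR_ge0//.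
      exact: ltW.
    by rewrite le_eqVlt; apply/orP; left; apply/eqP; field; rewrite !gt_eqF.
  - exact: cvg_cst.
  - rewrite -[X in _ --> X](mulr0 (4 / c ^+ 2)); apply: cvgM; first exact: cvg_cst.
    apply/gtr0_cvgV0; last exact: cvgr_idn.
    by exists 1%N => // m /= m1; rewrite ltr0n.
have t2 : 0 <= L * (1 - t ^+ 2).
  by rewrite mulr_ge0 ?(ltW L0)// subr_ge0 -real_normK ?num_real// expr_le1.
(* With v = 2^(-t^2), (1 - v^k)^(k 2^k) <= e^(-k 2^k v^k) <= e^(-k), because 2^k v^k >= 1 for |t| <=
   1. *)
rewrite /=; apply: (@squeeze_cvgr _ _ _ _ (fun k : nat => 1 - expR (- k%:R)) (fun=> 1)).
- near=> k; rewrite plateau_le1 andbT lerD2l lerN2.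
  have /andP[v0 v1] := v01 k t.
  have h1 : 1 - gauss L t ^+ k <= expR (- gauss L t ^+ k) by exact: expR_ge1Dx.
  apply: (@le_trans _ _ (expR (- gauss L t ^+ k) ^+ (k * 2 ^ k))).
    by rewrite lerXn2r ?nnegrE ?subr_ge0 ?expR_ge0.
  rewrite -expRM_natl ler_expR mulrN lerN2 Nv ler_peMr// -[leLHS]expR0 ler_expR.
  by rewrite mulr_ge0.
- rewrite -[X in _ --> X]subr0; apply: cvgB; first exact: cvg_cst.
  have := @cvgr_expR R; move=> h; exact: (cvg_comp _ _ cvgr_idn h).
- exact: cvg_cst.
Unshelve. all: by end_near.
Qed.

(** The binomial theorem, whose constant term cancels the leading 1: a plateau is a finite
    combination of centred Gaussians, so products of plateaux over the coordinates are combinations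
    of test Gaussians. *)
Lemma plateauE k (t : R) : plateau k t = \sum_(j < k * 2 ^ k)
  (- ((-1) ^+ j.+1 *+ 'C(k * 2 ^ k, j.+1))) * gauss ((j.+1 * k)%:R * ln 2) t.
Proof.
rewrite /plateau exprBn big_ord_recl/= expr0 expr1n !mulr1 bin0 mulr1n opprD addrA subrr add0r -sumrN.
apply: eq_bigr => j _; rewrite expr1n mulr1 mulNr; congr (- _).
rewrite -mulrnAl; congr (_ * _).
by rewrite -exprM gaussX /gauss mulnC; congr expR; rewrite mulNr.
Qed.

End interval_approximation.

Section gaussian_test_functions.
Context {R : realType} {n : nat}.
Local Notation V := 'rV[R]_n.

Definition closed_box (a b : 'I_n -> R) : set V :=
  [set x | forall i, a i <= x 0 i <= b i].

Lemma measurable_closed_box a b : measurable (closed_box a b).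
Proof.
rewrite (_ : closed_box a b = \bigcap_(i in setT) [set x : V | a i <= x 0 i <= b i]).
  apply: fin_bigcap_measurable => // i _.
  rewrite (_ : [set _ | _] = (fun x : V => x 0 i) @^-1` `[a i, b i]%classic).
    by rewrite -[X in measurable X]setTI; apply: measurable_coord.
  by apply/seteqP; split => x /=; rewrite in_itv.
by apply/seteqP; split => [x h i _|x h i]; [exact: h|exact: (h i)].
Qed.

Lemma closed_boxI a b a' b' : closed_box a b `&` closed_box a' b' =
  closed_box (fun i => Num.max (a i) (a' i)) (fun i => Num.min (b i) (b' i)).
Proof.
apply/seteqP; split => [x [h h'] i|x h].
  by have /andP[? ?] := h i; have /andP[? ?] := h' i; rewrite ge_max le_min; apply/andP; split; apply/andP.
by split => i; have := h i; rewrite ge_max le_min => /andP[/andP[? ?] /andP[? ?]]; apply/andP.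
Qed.

Definition closed_boxes : set (set V) := [set A | exists a b, A = closed_box a b].

Lemma setI_closed_boxes : setI_closed closed_boxes.
Proof. by move=> _ _ [a [b ->]] [a' [b' ->]]; rewrite closed_boxI; eexists; eexists. Qed.

(** A half-space x_i >= c is a countable union of closed boxes, and half-lines generate the Borel
    sets of the line. *)
Lemma measurable_rV_closed_boxes (A : set V) : measurable A -> <<s closed_boxes >> A.
Proof.
have mc (i : 'I_n) : measurable_fun [set: g_sigma_algebraType closed_boxes]
    (fun x : V => x 0 i).
  apply: (measurability _ (RGenCInfty.measurableE R)) => _ [_ [c ->] <-].
  rewrite setTI (_ : _ @^-1` _ = \bigcup_k closed_box
    (fun j => if j == i then c else - k%:R) (fun j => k%:R)).
    apply: bigcup_measurable => k _; apply: sub_sigma_algebra.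
    by eexists; eexists.
  apply/seteqP; split => x /=; rewrite in_itv/= andbT.
    move=> cx; exists (Num.truncn (norm1 x)).+1 => // j.
    have h : `|x 0 j| <= (Num.truncn (norm1 x)).+1%:R.
      rewrite (le_trans (normr_coord_le_norm1 x j))// ltW//; exact: truncnS_gt.
    by move: h; rewrite ler_norml => /andP[h1 ->]; rewrite andbT; case: ifPn => [/eqP ->|].
  by move=> [k _ /(_ i)]; rewrite eqxx => /andP[].
move: A; apply: smallest_sub; first exact: smallest_sigma_algebra.
rewrite -bigcup_seq => A [i _ [B mB <-]].
exact: mc.
Qed.

(** [P] is to be read as: the test identity at hand holds for this function. Limits are dominated by
    one centred Gaussian, so that closure under them is dominated convergence. *)
Variable P : (V -> R) -> Prop.
Hypothesis P_gauss : forall l a : 'I_n -> R, (forall i, 0 < l i) ->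
  P (fun x => \prod_(i < n) gauss (l i) (x 0 i - a i)).
Hypothesis P_lin : forall (c : R) f g, P f -> P g -> P (fun x => c * f x + g x).
Hypothesis P_lim : forall (phi : nat -> V -> R) (f : V -> R) (C k : R), 0 < k ->
  (forall m, P (phi m)) ->
  (forall m x, `|phi m x| <= C * \prod_(i < n) gauss k (x 0 i)) ->
  (forall x, (fun m => phi m x) @ \oo --> f x) -> P f.

Let P_0 : P (fun=> 0).
Proof.
have h : P (fun x : V => \prod_(i < n) gauss 1 (x 0 i - 0)) by exact: P_gauss.
have := P_lin (-1) h h; congr P; apply/funext => x; by rewrite mulN1r addNr.
Qed.

Let P_sum I (s : seq I) (c : I -> R) (f : I -> V -> R) :
  (forall i, P (f i)) -> P (fun x => \sum_(i <- s) c i * f i x).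
Proof.
move=> Pf; elim: s => [|i s ih].
  by rewrite (_ : (fun x => _) = (fun=> 0))//; apply/funext => x; rewrite big_nil.
rewrite (_ : (fun x => _) = (fun x => c i * f i x + \sum_(i <- s) c i * f i x)).
  exact: P_lin.
by apply/funext => x; rewrite big_cons.
Qed.

Let P_plateau k (a r : 'I_n -> R) : (0 < k)%N -> (forall i, 0 < r i) ->
  P (fun x => \prod_(i < n) plateau k ((x 0 i - a i) / r i)).
Proof.
move=> k0 r0; set N := (k * 2 ^ k)%N.
pose c (j : 'I_N) : R := - ((-1) ^+ j.+1 *+ 'C(N, j.+1)).
pose l (i : 'I_n) (j : 'I_N) : R := (j.+1 * k)%:R * ln 2 / r i ^+ 2.
have l0 i j : 0 < l i j.
  by rewrite divr_gt0 ?exprn_gt0// mulr_gt0 ?ln_gt0 ?ltr1n// ltr0n muln_gt0 k0.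
have -> : (fun x : V => \prod_(i < n) plateau k ((x 0 i - a i) / r i)) =
  (fun x : V => \sum_(J : {ffun 'I_n -> 'I_N}) (\prod_(i < n) c (J i)) *
     \prod_(i < n) gauss (l i (J i)) (x 0 i - a i)).
  apply/funext => x; under eq_bigr do rewrite plateauE.
  rewrite bigA_distr_bigA/=; apply: eq_bigr => J _; rewrite -big_split/=.
  apply: eq_bigr => i _; congr (_ * _); rewrite /gauss/l expr_div_n; congr expR.
  by field; rewrite gt_eqF.
by apply: P_sum => J; apply: P_gauss.
Qed.

Let gauss_box_bound (r : R) : exists2 C, 0 <= C & forall x : V, (forall i, `|x 0 i| <= r) ->
  1 <= C * \prod_(i < n) gauss 1 (x 0 i).
Proof.
exists (expR (\sum_(i < n) r ^+ 2)) => [|x xr]; first exact: expR_ge0.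
rewrite -expR_sum -expRD -[leLHS]expR0 ler_expR -big_split/= sumr_ge0// => i _.
rewrite mulN1r subr_ge0 -[leLHS]real_normK ?num_real// lerXn2r ?nnegrE//.
exact: le_trans (xr i).
Qed.

Let indic_closed_boxE a b (x : V) : \1_(closed_box a b) x =
  \prod_(i < n) (a i <= x 0 i <= b i)%R%:R :> R.
Proof.
rewrite indicE; have [/set_mem h|] := boolP (x \in closed_box a b).
  by rewrite big1// => i _; rewrite h.
move=> /negP h; have : exists i, ~~ (a i <= x 0 i <= b i).
  apply: contrapT => /forallNP H; apply: h; apply/mem_set => i.
  by have /negP := H i; rewrite negbK.
by move=> [i /negbTE hi]; rewrite (bigD1 i)//= hi mul0r.
Qed.

Let P_box_lt a b : (forall i, a i < b i) -> P (\1_(closed_box a b)).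
Proof.
move=> ab; pose c i := (a i + b i) / 2; pose r i := (b i - a i) / 2.
have r0 i : 0 < r i by rewrite divr_gt0 ?subr_gt0.
pose L : R := ln 2; have L0 : 0 < L by rewrite ln_gt0// ltr1n.
pose rho := 1 + \sum_(i < n) r i; have rho0 : 0 < rho.
  by rewrite ltr_pwDl// sumr_ge0// => i _; exact: ltW.
have rrho i : r i <= rho.
  rewrite /rho (bigD1 i)//= addrCA lerDl addr_ge0// sumr_ge0// => j _; exact: ltW.
(* From (u - v)^2 >= u^2 / 2 - v^2 half of the rate L / 4 survives the removal of the centre; [rho]
   exceeds every half-width, so one rate serves for all coordinates. *)
pose k := L / 8 / rho ^+ 2; have k0 : 0 < k by rewrite !divr_gt0 ?exprn_gt0.
have bnd i (t : R) m : plateau m ((t - c i) / r i) <=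
    (2 + 4 / L) * expR (L / 4 * (c i / r i) ^+ 2) * gauss k t.
  apply: le_trans (plateau_dominated _ _) _; rewrite -/L -mulrA.
  rewrite ler_wpM2l ?addr_ge0 ?divr_ge0 ?(ltW L0)// /gauss -expRD ler_expR.
  have h1 : k * t ^+ 2 <= L / 8 * (t / r i) ^+ 2.
    rewrite /k expr_div_n mulrAC -mulrA ler_wpM2l ?divr_ge0 ?(ltW L0)//.
    rewrite ler_wpM2l ?sqr_ge0// lef_pV2 ?posrE ?exprn_gt0//.
    by rewrite lerXn2r ?nnegrE ?(ltW (r0 i)) ?(ltW rho0).
  rewrite mulrBl; set u := t / r i in h1 *; set v := c i / r i.
  have h2 : 0 <= L / 8 * (u - 2 * v) ^+ 2 by rewrite mulr_ge0 ?sqr_ge0// divr_ge0// ltW.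
  have E : L / 8 * (u - 2 * v) ^+ 2 = L / 8 * u ^+ 2 - L / 2 * (u * v) + L / 2 * v ^+ 2 by field.
  rewrite E in h2; have L1 := L0; rewrite -subr_ge0.
  have -> : L / 4 * v ^+ 2 + - k * t ^+ 2 - - (L / 4) * (u - v) ^+ 2 =
    (L / 8 * u ^+ 2 - k * t ^+ 2) + (L / 8 * u ^+ 2 - L / 2 * (u * v) + L / 2 * v ^+ 2) by field.
  by rewrite addr_ge0// subr_ge0.
pose C := \prod_(i < n) ((2 + 4 / L) * expR (L / 4 * (c i / r i) ^+ 2)).
apply: (@P_lim (fun m x => \prod_(i < n) plateau m.+1 ((x 0 i - c i) / r i)) _ C k k0).
- by move=> m; apply: P_plateau.
- move=> m x; rewrite ger0_norm ?prodr_ge0//; last by move=> i _; exact: plateau_ge0.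
  by rewrite /C -big_split/=; apply: ler_prod => i _; rewrite plateau_ge0/=.
- move=> x; rewrite indic_closed_boxE.
  apply: cvg_big => //; first exact: mul_continuous.
  move=> i _; have := @cvg_plateau R ((x 0 i - c i) / r i).
  rewrite normrM normfV (gtr0_norm (r0 i)) ler_pdivrMr// mul1r ler_norml.
  have -> : (- r i <= x 0 i - c i <= r i) = (a i <= x 0 i <= b i).
    by rewrite /r /c; apply/idP/idP => /andP[? ?]; apply/andP; split; lra.
  by rewrite -cvg_shiftS.
Qed.

Let P_box a b : P (\1_(closed_box a b)).
Proof.
have [ab|] := pselect (forall i, a i <= b i); last first.
  move=> nab; have [i /negP] : exists i, ~ (a i <= b i) by apply/existsNP.
  rewrite -ltNge => ba.
  rewrite (_ : \1_ _ = (fun=> 0)); first exact: P_0.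
  apply/funext => x; rewrite indic_closed_boxE (bigD1 i)//= (_ : (_ <= _ <= _) = false) ?mul0r//.
  by apply/negbTE/negP => /andP[h1 h2]; have := le_lt_trans (le_trans h1 h2) ba; rewrite ltxx.
(* A box with a flat side is the limit of boxes widened by 1 / (m + 1) at their upper ends. *)
pose b' m i := b i + m.+1%:R^-1.
pose r := \sum_(i < n) (`|a i| + `|b i| + 1).
have [C C0 HC] := gauss_box_bound r.
apply: (@P_lim (fun m => \1_(closed_box a (b' m))) _ C 1 ltr01).
- by move=> m; apply: P_box_lt => i; rewrite (le_lt_trans (ab i))// ltrDl invr_gt0.
- move=> m x; rewrite indicE; have [/set_mem h|_] := boolP (x \in _); last first.
    by rewrite normr0 mulr_ge0// prodr_ge0// => i _; rewrite gauss_ge0.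
  rewrite normr1; apply: HC => i; have /andP[h1 h2] := h i.
  apply: (@le_trans _ _ (`|a i| + `|b i| + 1)); last first.
    by rewrite /r (bigD1 i)//= lerDl sumr_ge0// => j _; rewrite !addr_ge0.
  have m1 : m.+1%:R^-1 <= 1 :> R by rewrite invf_le1// ler1n.
  have := ler_norm (b i); have := ler_norm (- a i); rewrite normrN.
  have := normr_ge0 (b i); have := normr_ge0 (a i).
  move: h2; rewrite /b' ler_norml; set q := _^-1 in m1 *.
  by move=> *; apply/andP; split; lra.
- move=> x; rewrite indic_closed_boxE.
  rewrite (_ : (fun m => _) = (fun m => \prod_(i < n) (a i <= x 0 i <= b' m i)%R%:R)); last first.
    by apply/funext => m; rewrite indic_closed_boxE.
  apply: cvg_big => //; first exact: mul_continuous.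
  move=> i _; have [xb|xb] := leP (x 0 i) (b i).
    apply: cvg_near_cst; apply: nearW => m.
    by rewrite (le_trans xb)// lerDl.
  rewrite andbF; apply: cvg_near_cst; near=> m.
  rewrite (_ : (_ <= b' m i) = false) ?andbF//; apply/negbTE; rewrite -ltNge /b' -ltrBrDl.
  near: m; have d0 : 0 < x 0 i - b i by rewrite subr_gt0.
  have := @cvg_harmonic R => /cvgr0Pnorm_lt/(_ _ d0); apply: filterS => m.
  by rewrite /= ger0_norm.
Unshelve. all: by end_near.
Qed.

(** Dynkin's theorem: closed boxes are stable under intersection, and the sets whose trace on the
    cube satisfies [P] form a lambda-system. Intersecting with a cube keeps all indicators below one
    Gaussian. *)
Lemma gaussian_test_indic (A : set V) (r : R) : measurable A ->
  P (\1_(A `&` closed_box (fun=> - r) (fun=> r))).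
Proof.
set Q := closed_box _ _.
move=> /measurable_rV_closed_boxes.
have [C C0 HC] := gauss_box_bound r.
have lamH : lambda_system setT [set S : set V | P (\1_(S `&` Q))].
  split => //=.
  - by rewrite setTI; exact: P_box.
  - move=> S S' SS' PS PS'; rewrite /= (_ : \1_ _ = (fun x => -1 * (\1_(S' `&` Q) x) + \1_(S `&` Q) x)).
      exact: P_lin.
    apply/funext => x; rewrite !indicE.
    have [Qx|nQx] := pselect (Q x); last first.
      by rewrite !memNset ?mulr0 ?addr0// => -[].
    have [S'x|nS'x] := pselect (S' x).
      rewrite memNset; last by move=> [[]].
      by rewrite !mem_set ?mulN1r ?addNr//; split => //; exact: SS'.
    rewrite [x \in S' `&` Q]memNset; last by move=> [].
    have [Sx|nSx] := pselect (S x); first by rewrite !mem_set ?mulr0 ?add0r.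
    by rewrite !memNset ?mulr0 ?addr0// => -[]// [].
  - move=> F ndF PF; rewrite /=.
    apply: (@P_lim (fun m => \1_(F m `&` Q)) _ C 1 ltr01) => // [m x|x].
      rewrite indicE; have [/set_mem [_ h]|_] := boolP (x \in _); last first.
        by rewrite normr0 mulr_ge0// prodr_ge0// => i _; rewrite gauss_ge0.
      rewrite normr1; apply: HC => i; rewrite ler_norml; exact: h.
    apply: cvg_near_cst; have [[k _ Fk]|nF] := pselect ((\bigcup_k F k) x).
      exists k => // m /= km; rewrite !indicE !in_setI; congr ((_ && _)%:R).
      have Fm : F m x by move/subsetPset : (ndF _ _ km); exact.
      by rewrite !mem_set//; exists k.
    apply: nearW => m; rewrite !indicE !in_setI; congr ((_ && _)%:R).
    by rewrite !memNset// => Fm; apply: nF; exists m.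
have sub : closed_boxes `<=` [set S : set V | P (\1_(S `&` Q))].
  by move=> _ [a [b ->]]; rewrite /= closed_boxI; exact: P_box.
by move=> /(lambda_system_subset setI_closed_boxes lamH sub); apply.
Qed.

End gaussian_test_functions.

(** * Functions are determined by their Gaussian tests *)

Section test_uniqueness.
Context {R : realType} {n : nat}.
Local Notation V := 'rV[R]_n.
Local Notation leb := (@lebesgue_rV R n).
Local Notation Q r := (closed_box (n := n) (fun=> - r) (fun=> r)).

Lemma bigcup_cubes (x : V) : exists k : nat, Q k%:R x.
Proof.
exists (Num.truncn (norm1 x)).+1 => j; rewrite -ler_norml.
by rewrite (le_trans (normr_coord_le_norm1 x j))// ltW// truncnS_gt.
Qed.

Lemma ae_eq0_indic (B : set V) (g : V -> R[i]) : measurable B -> cmeasurable setT g ->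
  (forall (A : set V) (r : R), measurable A -> A `<=` B ->
    cintegrable leb setT (fun x => g x * (\1_(A `&` Q r) x)%:C) /\
    cintegral leb setT (fun x => g x * (\1_(A `&` Q r) x)%:C) = 0) ->
  {ae leb, forall x, B x -> g x = 0}.
Proof.
move=> mB mg H.
(* [F] is again the real or imaginary part. On a bounded piece of [B] its integral over every
   measurable subset vanishes, hence so does [F (g x)] almost everywhere there. *)
have key (F : R[i] -> R) (k : nat) : F 0 = 0 ->
    (forall z (t : R), F (z * t%:C) = F z * t) ->
    measurable_fun setT (F \o g) ->
    (forall h : V -> R[i], cintegrable leb setT h -> leb.-integrable setT (fun x => (F (h x))%:E)) ->
    (forall h : V -> R[i], cintegral leb setT h = 0 -> \int[leb]_x F (h x) = 0) ->
    {ae leb, forall x, (B `&` Q k%:R) x -> F (g x) = 0}.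
  move=> F0 FZ mF iF cF.
  set D := B `&` Q k%:R.
  have mD : measurable D by apply: measurableI => //; exact: measurable_closed_box.
  have ED (E : set V) : measurable E -> E `<=` D ->
      leb.-integrable E (fun x => (F (g x))%:E) /\ (\int[leb]_(x in E) (F (g x))%:E = 0)%E.
    move=> mE sE.
    have [|i1 i2] := H E k%:R mE; first by move=> x /sE[].
    have EE : E `&` Q k%:R = E by apply/setIidPl => x /sE[].
    rewrite EE in i1 i2.
    have hE : (fun x => (F (g x * (\1_E x)%:C))%:E) = ((fun x => (F (g x))%:E) \_ E).
      apply/funext => x; rewrite FZ indicE patchE; case: ifPn => _; first by rewrite mulr1.
      by rewrite mulr0.
    split.
      by apply/(integrable_mkcond _ mE); rewrite -hE; exact: iF.
    rewrite integral_mkcond -hE.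
    have := cF _ i2; rewrite /Rintegral => /eqP; rewrite fine_eq0 => [/eqP //|].
    by apply: integrable_fin_num => //; exact: iF.
  have := @integral_ae_eq _ _ _ leb D mD (cst 0%E) (fun x => (F (g x))%:E) (ED D mD _).1.
  move=> h.
  have : {ae leb, forall x, D x -> (F (g x))%:E = 0%E}.
    apply: h => //.
    by move=> E sE mE; rewrite (ED E mE sE).2 integral0.
  by apply: filterS => x + Dx => /(_ Dx) [].
have aek (k : nat) : {ae leb, forall x, (B `&` Q k%:R) x -> g x = 0}.
  have h1 : {ae leb, forall x, (B `&` Q k%:R) x -> complex.Re (g x) = 0}.
    apply: (key (@complex.Re R)) => //; first by move=> z t; rewrite ReM/= mulr0 subr0.
    - by case: mg.
    - by move=> h [].
    - by move=> h; rewrite /cintegral => -[].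
  have h2 : {ae leb, forall x, (B `&` Q k%:R) x -> complex.Im (g x) = 0}.
    apply: (key (@complex.Im R)) => //; first by move=> z t; rewrite ImM/= mulr0 add0r.
    - by case: mg.
    - by move=> h [].
    - by move=> h; rewrite /cintegral => -[].
  by apply: filterS2 h1 h2 => x e1 e2 BQ; apply: complexP; [exact: e1|exact: e2].
have : leb.-negligible (\bigcup_k ~` [set x | (B `&` Q k%:R) x -> g x = 0]).
  by apply: negligible_bigcup => k; exact: aek.
apply: negligibleS => x /= /not_implyP[Bx gx].
by have [k Qk] := bigcup_cubes x; exists k => // h; apply: gx; exact: h.
Qed.

Lemma packet_real (l a : 'I_n -> R) (x : V) :
  packet l a (fun=> 0) x = (\prod_(i < n) gauss (l i) (x 0 i - a i))%:C.
Proof.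
rewrite /packet rmorph_prod; apply: eq_bigr => i _.
by rewrite /packet1 mul0r cis0 mulr1.
Qed.

(** Integrability is made part of the tested property, since [g] is only known to be integrable
    against packets; a single packet then supplies the dominating function of every limit. *)
Lemma ae_eq0_gauss (g : V -> R[i]) : cmeasurable setT g ->
  (forall l a : 'I_n -> R, (forall i, 0 < l i) ->
    cintegrable leb setT (fun x => g x * packet l a (fun=> 0) x) /\
    cintegral leb setT (fun x => g x * packet l a (fun=> 0) x) = 0) ->
  {ae leb, forall x, g x = 0}.
Proof.
move=> mg H.
pose P (phi : V -> R) := cintegrable leb setT (fun x => g x * (phi x)%:C) /\
  cintegral leb setT (fun x => g x * (phi x)%:C) = 0.
suff h (A : set V) (r : R) : measurable A -> P (\1_(A `&` Q r)).
  have := @ae_eq0_indic setT g measurableT mg (fun A r mA _ => h A r mA).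
  by apply: filterS => x; exact.
apply: gaussian_test_indic.
- move=> l a l0; have [h1 h2] := H l a l0; rewrite /P.
  by under eq_fun do rewrite -packet_real.
- move=> c f h [i1 e1] [i2 e2].
  have E : (fun x => g x * (c * f x + h x)%:C) =
      (fun x => c%:C * (g x * (f x)%:C) + g x * (h x)%:C).
    by apply/funext => x; rewrite rmorphD rmorphM/=; ring.
  rewrite /P E; split.
    by apply: cintegrableD => //; exact: cintegrableZ.
  by rewrite cintegralD//; [rewrite cintegralZ// e1 e2 mulr0 addr0|exact: cintegrableZ].
- move=> phi f C k k0 Pphi phiC phif.
  have [ig _] := H (fun=> k) (fun=> 0) (fun=> k0).
  have iabs := integrable_cabs measurableT ig.
  have [||x _|x _|i1 c1 c2] := @cdominated_convergence _ _ _ leb setT measurableT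
      (fun m x => g x * (phi m x)%:C) (fun x => g x * (f x)%:C)
      (fun x => `|C| * cabs (g x * packet (fun=> k) (fun=> 0) (fun=> 0) x))
      (fun m => cintegrable_cmeasurable (Pphi m).1).
  + exact: (integrableZl measurableT `|C| iabs).
  + move=> m x _; rewrite !cabsM mulrCA ler_wpM2l ?cabs_ge0// cabs_real packet_real cabs_real.
    have p0 : 0 <= \prod_(i < n) gauss k (x 0 i - 0).
      by rewrite prodr_ge0// => i _; exact: gauss_ge0.
    rewrite (ger0_norm p0); apply: le_trans (phiC m x) _.
    under eq_bigr do rewrite -[x 0 _]subr0.
    by rewrite ler_wpM2r// ler_norm.
  + under eq_fun do rewrite ReM/= mulr0 subr0.
    by rewrite ReM/= mulr0 subr0; apply: cvgM; [exact: cvg_cst|exact: phif].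
  + under eq_fun do rewrite ImM/= mulr0 add0r.
    by rewrite ImM/= mulr0 add0r; apply: cvgM; [exact: cvg_cst|exact: phif].
  split => //; move: c1 c2.
  have -> : (fun k0 => complex.Re (cintegral leb setT (fun x => g x * (phi k0 x)%:C))) = fun=> 0.
    by apply/funext => j; rewrite (Pphi j).2.
  have -> : (fun k0 => complex.Im (cintegral leb setT (fun x => g x * (phi k0 x)%:C))) = fun=> 0.
    by apply/funext => j; rewrite (Pphi j).2.
  move=> c1 c2; apply: complexP; apply/esym.
    exact: (cvg_unique (@norm_hausdorff _ _) (cvg_cst _) c1).
  exact: (cvg_unique (@norm_hausdorff _ _) (cvg_cst _) c2).
Qed.

Lemma represents_unique (T : @functional R n) (g1 g2 : V -> R[i]) :
  represents g1 T -> represents g2 T -> {ae leb, forall x, g1 x = g2 x}.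
Proof.
move=> [m1 h1] [m2 h2].
have : {ae leb, forall x, g1 x - g2 x = 0}.
  apply: ae_eq0_gauss => [|l a l0]; first exact: cmeasurableB.
  have gsp : gs_space (packet l a (fun=> 0)).
    by have := gs_packet a (fun=> 0) 1 l0; under eq_fun do rewrite mul1r.
  have [i1 e1] := h1 _ gsp; have [i2 e2] := h2 _ gsp.
  under eq_fun do rewrite mulrBl.
  split; first exact: cintegrableB.
  by rewrite cintegralB// -e1 -e2 subrr.
by apply: filterS => x /subr0_eq.
Qed.

Lemma regular_represents (T : @functional R n) : regular T -> represents (density T) T.
Proof. by move=> [g Tg]; rewrite /density; case: xgetP => // /(_ g). Qed.

Lemma density_unique (T : @functional R n) (g : V -> R[i]) :
  represents g T -> {ae leb, forall x, density T x = g x}.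
Proof.
by move=> gT; apply: (represents_unique _ gT); apply: regular_represents; exists g.
Qed.

End test_uniqueness.

(** * Exponentially integrable functions and the Fourier transform *)

Section exponential_integrability.
Context {R : realType} {n : nat}.
Local Notation V := 'rV[R]_n.
Local Notation leb := (@lebesgue_rV R n).
Local Notation mu := (@lebesgue_measure R).

Lemma integrable_exp_norm : mu.-integrable setT (EFin \o (fun t : R => expR (- `|t|))).
Proof.
have mf : measurable_fun setT (fun t : R => (expR (- `|t|))%:E).
  by apply/measurable_EFinP; apply: measurableT_comp => //; exact: measurableT_comp.
apply/integrableP; split => //.
under eq_integral do rewrite /= ger0_norm ?expR_ge0//.
have mp := @measurable_exponential_pdf R 1.
have p0 (x : R) : 0 <= exponential_pdf 1 x by exact: exponential_pdf_ge0.
apply: (@le_lt_trans _ _ (\int[mu]_x ((exponential_pdf 1 x)%:E + (exponential_pdf 1 (- x))%:E))%E).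
  apply: ge0_le_integral => //.
  - apply: emeasurable_funD; apply/measurable_EFinP => //.
    by apply: (measurableT_comp mp).
  - move=> x _; rewrite -EFinD lee_fin /exponential_pdf !patchE.
    have [x0|x0] := leP 0 x.
        rewrite [X in _ <= X + _]ifT; last by rewrite inE/= in_itv/= x0.
      rewrite ger0_norm// mul1r mulN1r lerDl; case: ifP => // _.
    rewrite [X in _ <= _ + X]ifT; last by rewrite inE/= in_itv/= oppr_ge0 ltW.
    rewrite ltr0_norm// !mul1r !mulN1r lerDr; case: ifP => // _.
rewrite ge0_integralD//.
- rewrite (ge0_integral_opp1 (f := fun x => (exponential_pdf 1 x)%:E))//.
    by rewrite integral_exponential_pdf// ltry.
  exact/measurable_EFinP.
- by move=> x _; rewrite lee_fin.
- exact/measurable_EFinP.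
- by move=> x _; rewrite lee_fin.
- by apply/measurable_EFinP; exact: (measurableT_comp mp).
Qed.

Lemma integrable_exp_norm1 : leb.-integrable setT (fun x => (expR (- norm1 x))%:E).
Proof.
apply/integrableP; split.
  apply/measurable_EFinP; apply: measurableT_comp => //; apply: measurableT_comp => //.
  exact: measurable_norm1.
under eq_integral do rewrite /= ger0_norm ?expR_ge0// /norm1 -sumrN expR_sum.
rewrite (ge0_integral_prod (f := fun i t => expR (- `|t|))).
- rewrite -ge0_fin_numE; last by apply: prode_ge0 => i _; apply: integral_ge0 => x _; rewrite lee_fin expR_ge0.
  apply: prode_fin_num => i _; exact: integrable_fin_num integrable_exp_norm.
- by move=> i; apply: measurableT_comp => //; exact: measurableT_comp.
- by move=> i x; exact: expR_ge0.
Qed.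

(** Functions integrable after some exponential damping. They pair with every test function and with
    its transform, which decay faster than any exponential, so [of_hat] is a genuine functional on
    them. *)
Definition expint (g : V -> R[i]) := cmeasurable setT g /\
  exists b, (\int[leb]_x (cabs (g x) * expR (- (b * norm1 x)))%:E < +oo)%E.

Lemma measurable_expnorm1 (b : R) : measurable_fun setT (fun x : V => expR (- (b * norm1 x))).
Proof.
apply: measurableT_comp => //; apply: measurableT_comp => //.
by apply: measurable_funM => //; exact: measurable_norm1.
Qed.

Lemma expintM (g f : V -> R[i]) : expint g -> cmeasurable setT f ->
  (forall b, exists M, forall x, cabs (f x) <= M * expR (- (b * norm1 x))) ->
  cintegrable leb setT (fun x => g x * f x).
Proof.
move=> [mg [b gb]] mf fb.
have [M HM] := fb b.
apply: (@cintegrable_le _ _ _ leb setT measurableT _ (fun x => `|M| * (cabs (g x) * expR (- (b * norm1 x))))).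
- exact: cmeasurableM.
- have : leb.-integrable setT (fun x => (cabs (g x) * expR (- (b * norm1 x)))%:E).
    apply/integrableP; split.
      by apply/measurable_EFinP; apply: measurable_funM; [exact: measurable_cabs|exact: measurable_expnorm1].
    by under eq_integral do rewrite /= ger0_norm ?mulr_ge0 ?cabs_ge0 ?expR_ge0//.
  by move=> /(integrableZl measurableT `|M|).
- move=> x _; rewrite cabsM mulrCA ler_wpM2l ?cabs_ge0// (le_trans (HM x))//.
  by rewrite ler_wpM2r ?expR_ge0// ler_norm.
Qed.

Lemma expint_bounded (g k : V -> R[i]) (M : R) : expint g -> cmeasurable setT k ->
  (forall x, cabs (k x) <= M) -> expint (fun x => k x * g x).
Proof.
move=> [mg [b gb]] mk kM; split; first exact: cmeasurableM.
exists b; apply: (@le_lt_trans _ _ (\int[leb]_x (`|M|%:E * (cabs (g x) * expR (- (b * norm1 x)))%:E))%E).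
  apply: ge0_le_integral => //.
  - by move=> x _; rewrite lee_fin mulr_ge0 ?cabs_ge0 ?expR_ge0.
  - apply/measurable_EFinP; apply: measurable_funM; last exact: measurable_expnorm1.
    exact: measurable_cabs (cmeasurableM mk mg).
  - apply/measurable_EFinP.
    by apply: measurable_funM => //; apply: measurable_funM; [exact: measurable_cabs|exact: measurable_expnorm1].
  - move=> x _; rewrite -EFinM lee_fin cabsM -mulrA ler_wpM2r ?mulr_ge0 ?cabs_ge0 ?expR_ge0//.
    by rewrite (le_trans (kM x))// ler_norm.
rewrite ge0_integralZl_EFin//.
- exact: lte_mul_pinfty.
- by move=> x _; rewrite lee_fin mulr_ge0 ?cabs_ge0 ?expR_ge0.
- by apply/measurable_EFinP; apply: measurable_funM; [exact: measurable_cabs|exact: measurable_expnorm1].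
Qed.

End exponential_integrability.

Section gs_theory.
Context {R : realType} {n : nat}.
Local Notation V := 'rV[R]_n.
Local Notation leb := (@lebesgue_rV R n).
Implicit Types (f g : V -> R[i]).

Lemma gs_cmeasurable f : gs_space f -> cmeasurable setT f.
Proof.
move=> [[h1 h2] _]; split; apply: continuous_measurable_rV => x; apply: differentiable_continuous.
- exact: (h1 [::]).1.
- exact: (h2 [::]).1.
Qed.

Lemma gs_norm_ge0 (r : R) f : (0 <= gs_norm r f)%E.
Proof.
by apply: adde_ge0; [apply: ereal_sup_ge; exists (expR (r * enorm (0 : V)) * cabs (f 0))%:E|
  apply: ereal_sup_ge; exists (expR (r * enorm (0 : V)) * cabs (fourier f 0))%:E];
 rewrite ?lee_fin ?mulr_ge0 ?expR_ge0 ?cabs_ge0//; exists 0.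
Qed.

Lemma gs_norm_bound (r : R) f x : gs_space f -> 0 < r ->
  cabs (f x) <= fine (gs_norm r f) * expR (- (r * enorm x)) /\
  cabs (fourier f x) <= fine (gs_norm r f) * expR (- (r * enorm x)).
Proof.
move=> [_ h] r0; have fin := h _ r0.
have fn : gs_norm r f \is a fin_num by rewrite ge0_fin_numE// gs_norm_ge0.
have aux (u : V -> R[i]) : (ereal_sup (range (fun x => (expR (r * enorm x) * cabs (u x))%:E)) <= gs_norm r f)%E ->
    cabs (u x) <= fine (gs_norm r f) * expR (- (r * enorm x)).
  move=> hu; rewrite expRN ler_pdivlMr ?expR_gt0// mulrC.
  rewrite -lee_fin fineK// (le_trans _ hu)//; apply: ereal_sup_ubound; by exists x.
have s0 (u : V -> R[i]) : (0 <= ereal_sup (range (fun x => (expR (r * enorm x) * cabs (u x))%:E)))%E.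
  apply: ereal_sup_ge; exists (expR (r * enorm (0 : V)) * cabs (u 0))%:E; first by exists 0.
  by rewrite lee_fin mulr_ge0 ?expR_ge0 ?cabs_ge0.
by split; apply: aux; [apply: leeDl|apply: leeDr].
Qed.

Lemma norm1_exp_enorm (b : R) (x : V) : 0 <= b ->
  expR (- ((b * n%:R + 1) * enorm x)) <= expR (- (b * norm1 x)).
Proof.
move=> b0; rewrite ler_expR lerN2 mulrDl mul1r -mulrA.
by rewrite (le_trans (ler_wpM2l b0 (norm1_le_enorm x)))// lerDl enorm_ge0.
Qed.

Lemma gs_decay f b : gs_space f -> exists M, forall x,
  cabs (f x) <= M * expR (- (b * norm1 x)) /\
  cabs (fourier f x) <= M * expR (- (b * norm1 x)).
Proof.
(* The factor [n] converts [norm1] into [enorm]; the added 1 makes the rate positive, as finiteness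
   of [gs_norm] requires. *)
move=> gf; pose r := `|b| * n%:R + 1.
have r0 : 0 < r by rewrite ltr_wpDl// mulr_ge0.
exists (fine (gs_norm r f)) => x; have [h1 h2] := gs_norm_bound x gf r0.
have m0 : 0 <= fine (gs_norm r f) by rewrite fine_ge0// gs_norm_ge0.
have e : expR (- (r * enorm x)) <= expR (- (b * norm1 x)).
  rewrite (le_trans (norm1_exp_enorm x (normr_ge0 b)))// ler_expR lerN2.
  by rewrite ler_wpM2r ?norm1_ge0// ler_norm.
by split; [apply: le_trans h1 _|apply: le_trans h2 _]; rewrite ler_wpM2l.
Qed.

Lemma cmeasurable_fourier f : cmeasurable setT f -> cmeasurable setT (fourier f).
Proof.
move=> mf; apply: cmeasurableM; first exact: cmeasurable_cst.
apply: (cmeasurable_cintegral leb (f := fun p : V * V => f p.2 * cis (- dotp p.2 p.1))).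
apply: cmeasurableM; first exact: (cmeasurable_comp mf measurable_snd).
apply: cmeasurable_cis; apply: measurableT_comp => //; apply: measurable_dotp.
- exact: measurable_snd.
- exact: measurable_fst.
Qed.

Lemma cmeasurable_inverse_fourier f : cmeasurable setT f -> cmeasurable setT (inverse_fourier f).
Proof.
move=> mf; have -> : inverse_fourier f = (fun x => fourier f (- x)).
  by apply/funext => x; rewrite inverse_fourierE.
apply: (cmeasurable_comp (cmeasurable_fourier mf)); exact: measurable_rVN.
Qed.

Lemma gs_cintegrable f : gs_space f -> cintegrable leb setT f.
Proof.
move=> gf; have [M HM] := gs_decay 1 gf.
apply: (@cintegrable_le _ _ _ leb setT measurableT _ (fun x => M * expR (- norm1 x))).
- exact: gs_cmeasurable.
- exact: (integrableZl measurableT M integrable_exp_norm1).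
- by move=> x _; have := (HM x).1; rewrite mul1r.
Qed.

Lemma gs_fourier_cintegrable f : gs_space f -> cintegrable leb setT (fourier f).
Proof.
move=> gf; have [M HM] := gs_decay 1 gf.
apply: (@cintegrable_le _ _ _ leb setT measurableT _ (fun x => M * expR (- norm1 x))).
- by apply: cmeasurable_fourier; exact: gs_cmeasurable.
- exact: (integrableZl measurableT M integrable_exp_norm1).
- by move=> x _; have := (HM x).2; rewrite mul1r.
Qed.

Lemma inverse_fourier_decay f b : gs_space f -> exists M, forall x,
  cabs (inverse_fourier f x) <= M * expR (- (b * norm1 x)).
Proof.
move=> gf; have [M HM] := gs_decay b gf; exists M => x.
by rewrite inverse_fourierE -(norm1N x); exact: (HM (- x)).2.
Qed.

Lemma fourier_bounded f : cintegrable leb setT f ->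
  exists M, forall x, cabs (fourier f x) <= M.
Proof.
move=> fi; have mf := cintegrable_cmeasurable fi.
have [_ foo] := (cintegrableP leb measurableT f).1 fi.
exists (fourier_const (R := R) (n := n) * fine (\int[leb]_x (cabs (f x))%:E)%E) => x.
rewrite /fourier cabsM cabs_real ger0_norm ?(ltW fourier_const_gt0)//.
rewrite ler_wpM2l ?(ltW fourier_const_gt0)// -lee_fin fineK; last first.
  by rewrite ge0_fin_numE//; apply: integral_ge0 => y _; rewrite lee_fin cabs_ge0.
apply: le_trans (le_cabs_cintegral leb measurableT _) _.
  apply: cmeasurableM => //; apply: cmeasurable_cis; apply: measurableT_comp => //.
  exact: measurable_dotp.
by under eq_integral do rewrite cabsM cabs_cis mulr1.
Qed.

(** Fubini's theorem, the phase having modulus one. An arbitrary phase [u] covers the transform and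
    its inverse together. *)
Lemma cis_kernel_exchange (u : V * V -> R) f g : measurable_fun setT u ->
  cintegrable leb setT f -> cintegrable leb setT g ->
  cintegral leb setT (fun x => cintegral leb setT (fun y => f y * cis (u (x, y))) * g x) =
  cintegral leb setT (fun y => f y * cintegral leb setT (fun x => g x * cis (u (x, y)))).
Proof.
move=> um fi gi.
have mf := cintegrable_cmeasurable fi; have mg := cintegrable_cmeasurable gi.
have [_ foo] := (cintegrableP leb measurableT f).1 fi.
have [_ goo] := (cintegrableP leb measurableT g).1 gi.
pose F (p : V * V) := f p.2 * g p.1 * cis (u p).
have mF : cmeasurable setT F.
  apply: cmeasurableM; last exact: cmeasurable_cis.
  by apply: cmeasurableM; [exact: (cmeasurable_comp mf measurable_snd)|exact: (cmeasurable_comp mg measurable_fst)].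
have Foo : (\int[leb]_x \int[leb]_y (cabs (F (x, y)))%:E < +oo)%E.
  under eq_integral do under eq_integral do rewrite /F/= !cabsM cabs_cis mulr1 EFinM.
  under eq_integral => x _.
    rewrite ge0_integralZr//; last 3 first.
    - exact: measurable_ecabs.
    - by move=> y _; rewrite lee_fin cabs_ge0.
    - by rewrite lee_fin cabs_ge0.
    over.
  rewrite ge0_integralZl//.
  - by apply: lte_mul_pinfty => //; [apply: integral_ge0 => y _; rewrite lee_fin cabs_ge0|rewrite ge0_fin_numE//; apply: integral_ge0 => y _; rewrite lee_fin cabs_ge0].
  - exact: measurable_ecabs.
  - by move=> y _; rewrite lee_fin cabs_ge0.
  - by apply: integral_ge0 => y _; rewrite lee_fin cabs_ge0.
have [_ _ E] := cFubini mF Foo.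
transitivity (cintegral leb setT (fun x => cintegral leb setT (fun y => F (x, y)))).
  apply: eq_cintegral => x _.
  have -> : (fun y => F (x, y)) = (fun y => g x * (f y * cis (u (x, y)))).
    by apply/funext => y; rewrite /F/=; ring.
  have H : cintegrable leb setT (fun y => f y * cis (u (x, y))).
    rewrite (_ : (fun y => _) = (fun y => cis (u (x, y)) * f y)); last by apply/funext => y; rewrite mulrC.
    apply: (cintegrable_bounded measurableT (M := 1) fi).
      by apply: cmeasurable_cis; apply: (measurableT_comp um).
    by move=> y _; rewrite cabs_cis.
  by have := cintegralZ measurableT (g x) H => ->; exact: mulrC.
rewrite E; apply: eq_cintegral => y _.
have -> : (fun x => F (x, y)) = (fun x => f y * (g x * cis (u (x, y)))).
  by apply/funext => x; rewrite /F/=; ring.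
suff H : cintegrable leb setT (fun x => g x * cis (u (x, y))).
  exact: (cintegralZ measurableT (f y) H).
rewrite (_ : (fun x => _) = (fun x => cis (u (x, y)) * g x)); last by apply/funext => x; rewrite mulrC.
apply: (cintegrable_bounded measurableT (M := 1) gi).
  by apply: cmeasurable_cis; apply: (measurableT_comp um).
by move=> x _; rewrite cabs_cis.
Qed.

Lemma fourier_exchange f g : cintegrable leb setT f -> cintegrable leb setT g ->
  cintegral leb setT (fun x => fourier f x * g x) = cintegral leb setT (fun x => f x * fourier g x).
Proof.
move=> fi gi.
have um : measurable_fun setT (fun p : V * V => - dotp p.2 p.1).
  by apply: measurableT_comp => //; apply: measurable_dotp; [exact: measurable_snd|exact: measurable_fst].
have Z1 := cis_kernel_exchange um fi (cintegrableZ measurableT (fourier_const (R := R) (n := n))%:C gi).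
rewrite /fourier; transitivity (cintegral leb setT (fun x : V =>
    cintegral leb setT (fun y : V => f y * cis (- dotp y x)) * ((fourier_const (R := R) (n := n))%:C * g x))).
  by apply: eq_cintegral => x _; ring.
rewrite Z1; apply: eq_cintegral => y _; congr (_ * _); rewrite -cintegralZ//.
  apply: eq_cintegral => x _; rewrite mulrA; congr (_ * cis (- _)).
  by apply: eq_bigr => i _; rewrite mulrC.
rewrite (_ : (fun x => _) = (fun x => cis (- dotp x y) * g x)); last by apply/funext => x; rewrite mulrC.
apply: (cintegrable_bounded measurableT (M := 1) gi).
  by apply: cmeasurable_cis; apply: measurableT_comp => //; exact: measurable_dotp.
by move=> x _; rewrite cabs_cis.
Qed.

Lemma inverse_fourier_exchange f g : cintegrable leb setT f -> cintegrable leb setT g ->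
  cintegral leb setT (fun x => inverse_fourier f x * g x) =
  cintegral leb setT (fun x => f x * inverse_fourier g x).
Proof.
move=> fi gi.
have um : measurable_fun setT (fun p : V * V => dotp p.2 p.1).
  by apply: measurable_dotp; [exact: measurable_snd|exact: measurable_fst].
have Z1 := cis_kernel_exchange um fi (cintegrableZ measurableT (fourier_const (R := R) (n := n))%:C gi).
rewrite /inverse_fourier; transitivity (cintegral leb setT (fun x : V =>
    cintegral leb setT (fun y : V => f y * cis (dotp x y)) * ((fourier_const (R := R) (n := n))%:C * g x))).
  by apply: eq_cintegral => x _; rewrite mulrAC mulrC.
transitivity (cintegral leb setT (fun y : V => f y * cintegral leb setT
    (fun x : V => ((fourier_const (R := R) (n := n))%:C * g x) * cis (dotp y x)))).
  apply: (etrans _ Z1); apply: eq_cintegral => x _; congr (_ * _); apply: eq_cintegral => y _.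
  by congr (_ * cis _); apply: eq_bigr => i _; rewrite mulrC.
apply: eq_cintegral => y _; congr (_ * _); rewrite -cintegralZ//.
  by apply: eq_cintegral => x _; rewrite mulrA.
rewrite (_ : (fun x => _) = (fun x => cis (dotp y x) * g x)); last by apply/funext => x; rewrite mulrC.
apply: (cintegrable_bounded measurableT (M := 1) gi).
  by apply: cmeasurable_cis; exact: measurable_dotp.
by move=> x _; rewrite cabs_cis.
Qed.

Lemma inverse_fourier_packet (l a b : 'I_n -> R) : (forall i, 0 < l i) ->
  inverse_fourier (packet l a b) = fourier (packet l (fun i => - a i) (fun i => - b i)).
Proof.
move=> l0; apply/funext => x; rewrite inverse_fourierE !fourier_packet//; congr (_ * _).
  by apply: eq_bigr => i _; rewrite mulrNN.
by rewrite -packetN; congr (packet _ _ _ _).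
Qed.

(** Tested against a Gaussian, the two exchange formulas move both transforms from [f] to the
    packet, where inversion is an explicit computation; Gaussian tests then determine the function
    almost everywhere. *)
Lemma fourier_inversion f : gs_space f ->
  {ae leb, forall x, inverse_fourier (fourier f) x = f x}.
Proof.
move=> gf; have fi := gs_cintegrable gf; have ffi := gs_fourier_cintegrable gf.
have mf := gs_cmeasurable gf.
have mi : cmeasurable setT (inverse_fourier (fourier f)).
  by apply: cmeasurable_inverse_fourier; exact: cmeasurable_fourier.
have : {ae leb, forall x, inverse_fourier (fourier f) x - f x = 0}.
  apply: ae_eq0_gauss => [|l a l0]; first exact: cmeasurableB.
  set G := packet l a _.
  have Gi : cintegrable leb setT G by exact: cintegrable_packet.
  have mG := cintegrable_cmeasurable Gi.
  have [M HM] := fourier_bounded ffi.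
  have i1 : cintegrable leb setT (fun x => inverse_fourier (fourier f) x * G x).
    apply: (cintegrable_bounded measurableT (M := M) Gi) => //.
    by move=> x _; rewrite inverse_fourierE.
  have i2 : cintegrable leb setT (fun x => f x * G x).
    rewrite (_ : (fun x => _) = (fun x => G x * f x)); last by apply/funext => x; rewrite mulrC.
    apply: (cintegrable_bounded measurableT (M := 1) fi) => // x _.
    rewrite cabs_packet -[leRHS]expR0 ler_expR oppr_le0 sumr_ge0// => i _.
    by rewrite mulr_ge0 ?sqr_ge0// ltW.
  under eq_fun do rewrite mulrBl.
  split; first exact: cintegrableB.
  rewrite cintegralB// inverse_fourier_exchange// inverse_fourier_packet//.
  rewrite fourier_exchange//; last first.
    apply: gs_fourier_cintegrable.
    have := gs_packet (fun i => - a i) (fun i => - 0) 1 l0.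
    by under eq_fun do rewrite mul1r.
  apply/eqP; rewrite subr_eq0; apply/eqP; apply: eq_cintegral => x _; congr (_ * _).
  by rewrite fourier_fourier_packet// packetN opprK.
by apply: filterS => x /subr0_eq.
Qed.

End gs_theory.

Section monotone_integral.
Context d (T : measurableType d) (R : realType) (mu : {measure set T -> \bar R}).

(* Unlike [ge0_le_integral], no measurability is required. *)
Lemma ge0_le_integral_any (D : set T) (f g : T -> \bar R) :
  (forall x, D x -> (0 <= f x)%E) -> (forall x, D x -> (f x <= g x)%E) ->
  (\int[mu]_(x in D) f x <= \int[mu]_(x in D) g x)%E.
Proof.
move=> f0 fg; rewrite (ge0_integralE mu f0) ge0_integralE; last first.
  by move=> x Dx; rewrite (le_trans (f0 x Dx))// fg.
apply: le_ereal_sup => _ [h hf <-]; exists h => // x; apply: le_trans (hf x) _.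
rewrite !patchE; case: ifPn => // /set_mem Dx; exact: fg.
Qed.

End monotone_integral.

(** * Functionals given by a function on the Fourier side *)

Section of_hat_theory.
Context {R : realType} {n : nat}.
Local Notation V := 'rV[R]_n.
Local Notation leb := (@lebesgue_rV R n).
Implicit Types (f g : V -> R[i]).

Lemma represents_of_hat g : expint g -> represents g (dual_fourier (of_hat g)).
Proof.
move=> eg; split; first exact: eg.1.
move=> f gf; have mf := gs_cmeasurable gf; split.
  by apply: expintM => // b; have [M HM] := gs_decay b gf; exists M => x; exact: (HM x).1.
apply: ae_eq_cintegral => //.
- apply: cmeasurableM; first exact: eg.1.
  by apply: cmeasurable_inverse_fourier; exact: cmeasurable_fourier.
- by apply: cmeasurableM => //; exact: eg.1.
- by apply: filterS (fourier_inversion gf) => x ->.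
Qed.

Lemma hat_of_hat g : expint g -> {ae leb, forall x, hat (of_hat g) x = g x}.
Proof. by move=> eg; apply: density_unique; exact: represents_of_hat. Qed.

Lemma cmeasurable_hat (T : @functional R n) : cmeasurable setT (hat T).
Proof.
rewrite /hat /density; case: xgetP => [g _ []//|_]; exact: cmeasurable_cst.
Qed.

Lemma fourier_linear (a : R[i]) f g x : cintegrable leb setT f -> cintegrable leb setT g ->
  fourier (fun y => a * f y + g y) x = a * fourier f x + fourier g x.
Proof.
move=> fi gi; rewrite /fourier.
have H h : cintegrable leb setT h -> cintegrable leb setT (fun y => h y * cis (- dotp y x)).
  move=> hi; rewrite (_ : (fun y => _) = (fun y => cis (- dotp y x) * h y)); last by apply/funext => y; rewrite mulrC.
  apply: (cintegrable_bounded measurableT (M := 1) hi).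
    by apply: cmeasurable_cis; apply: measurableT_comp => //; exact: measurable_dotp.
  by move=> y _; rewrite cabs_cis.
have -> : (fun y => (a * f y + g y) * cis (- dotp y x)) =
    (fun y => a * (f y * cis (- dotp y x)) + g y * cis (- dotp y x)).
  by apply/funext => y; rewrite mulrDl mulrA.
have Hf := H _ fi; have Hg := H _ gi.
have e1 := cintegralD measurableT (cintegrableZ measurableT a Hf) Hg.
have e2 := cintegralZ measurableT a Hf.
by rewrite e1 e2 mulrDr mulrCA.
Qed.

Lemma gs_dual_of_hat g : expint g -> gs_dual (of_hat g).
Proof.
move=> eg; have iM f : gs_space f -> cintegrable leb setT (fun x => g x * inverse_fourier f x).
  move=> gf; apply: expintM => //.
    by apply: cmeasurable_inverse_fourier; exact: gs_cmeasurable.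
  by move=> b; exact: inverse_fourier_decay.
split.
  move=> a f h gf gh; rewrite /of_hat.
  have -> : (fun x => g x * inverse_fourier (fun y => a * f y + h y) x) =
      (fun x => a * (g x * inverse_fourier f x) + g x * inverse_fourier h x).
    apply/funext => x; rewrite !inverse_fourierE fourier_linear ?mulrDr; try exact: gs_cintegrable.
    by rewrite mulrCA.
  have e1 := cintegralD measurableT (cintegrableZ measurableT a (iM _ gf)) (iM _ gh).
  have e2 := cintegralZ measurableT a (iM _ gf).
  by rewrite e1 e2.
have [mg [b gb]] := eg.
pose r := `|b| * n%:R + 1.
have r0 : 0 < r by rewrite ltr_wpDl// mulr_ge0.
pose I := (\int[leb]_x (cabs (g x) * expR (- (b * norm1 x)))%:E)%E.
have I0 : (0 <= I)%E by apply: integral_ge0 => x _; rewrite lee_fin mulr_ge0 ?cabs_ge0 ?expR_ge0.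
have If : I \is a fin_num by rewrite ge0_fin_numE.
exists r, (fine I); split => // f gf.
apply: le_trans (le_cabs_cintegral leb measurableT (cintegrable_cmeasurable (iM _ gf))) _.
have nf : gs_norm r f \is a fin_num by rewrite ge0_fin_numE ?gs_norm_ge0//; exact: gf.2.
have m0 : 0 <= fine (gs_norm r f) by rewrite fine_ge0// gs_norm_ge0.
rewrite -(fineK nf) [((fine I)%:E)%E]fineK// muleC -ge0_integralZl_EFin//; last 2 first.
- by move=> x _; rewrite lee_fin mulr_ge0 ?cabs_ge0 ?expR_ge0.
- by apply/measurable_EFinP; apply: measurable_funM; [exact: measurable_cabs|exact: measurable_expnorm1].
apply: ge0_le_integral_any => x _; first by rewrite lee_fin cabs_ge0.
rewrite -EFinM lee_fin cabsM mulrCA ler_wpM2l ?cabs_ge0//.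
have [_ h] := gs_norm_bound (- x) gf r0.
rewrite inverse_fourierE (le_trans h)// ler_wpM2l// enormN.
rewrite (le_trans (norm1_exp_enorm x (normr_ge0 b)))// ler_expR lerN2.
by rewrite ler_wpM2r ?norm1_ge0// ler_norm.
Qed.

(** [supp] is defined through neighbourhoods, so this is a passage from local to global null
    sets. *)
Lemma ae_notin_supp g (A : set V) : supp g `<=` A ->
  {ae leb, forall x, ~ A x -> g x = 0}.
Proof.
move=> gA; apply: (@ae_locally _ _ (fun x => g x = 0) (~` A)) => x Ax.
have /existsNP[U] : ~ supp g x by move/gA.
by move=> /not_implyP[Ux /contrapT h]; exists U.
Qed.

Lemma supp_sub_closed g (A : set V) : closed A ->
  {ae leb, forall x, ~ A x -> g x = 0} -> supp g `<=` A.
Proof.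
move=> cA gA x gx; apply: contrapT => Ax; apply: (gx (~` A)) => //.
by apply: open_nbhs_nbhs; split => //; exact: closed_openC.
Qed.

Lemma closed_octant_ge (N : R) : closed (@octant_ge R n N).
Proof.
apply: closedI.
  have -> : octant = \bigcap_(i in [set: 'I_n]) ((fun x : V => x 0 i) @^-1` [set t | 0 <= t]).
    by apply/seteqP; split => x xo; [move=> i _; exact: xo|move=> i; exact: xo].
  apply: closed_bigI => i _; apply: closed_comp; last exact: closed_ge.
  by move=> x _; exact: coord_continuous.
apply: (@closed_comp _ _ (fun x : V => `|x|) [set t | N <= t]); last exact: closed_ge.
by move=> x _; exact: norm_continuous.
Qed.

(** Uses ln <x> <= norm1 x and ln 2 <= 1. It turns membership in any of the spaces E into square
    integrability after an exponential damping. *)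
Lemma exp_weight_ge (a s : R) (x : V) :
  expR (- ((`|s| + `|a|) * norm1 x)) <= exp_weight a s x.
Proof.
rewrite /exp_weight mulrDl opprD expRD; apply: ler_pM; rewrite ?expR_ge0//.
- rewrite /powR gt_eqF ?japanese_gt0// ler_expR.
  have h : 0 <= ln (japanese x) <= norm1 x.
    rewrite ln_ge0 ?japanese_ge1//= (le_trans _ (enorm_le_norm1 x))//.
    rewrite -ler_expR lnK ?posrE ?japanese_gt0// (le_trans (japanese_le x))//.
    by rewrite expR_ge1Dx.
  case/andP: h => h0 h1; have e : - `|s| <= s by rewrite lerNl -normrN ler_norm.
  apply: le_trans (_ : - `|s| * ln (japanese x) <= _); last by rewrite ler_wpM2r.
  by rewrite mulNr lerN2 ler_wpM2l.
- rewrite /powR ifF; last by apply/negbTE; rewrite pnatr_eq0.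
  rewrite ler_expR.
  have l2 : 0 <= ln (2 : R) <= 1.
    rewrite ln_ge0 ?ler1n//= -ler_expR lnK ?posrE//.
    by rewrite (le_trans _ (expR_ge1Dx 1))// -natr1 lexx.
  have e1 := enorm_le_norm1 x; have e0 := enorm_ge0 x.
  apply: le_trans (_ : - `|a| * (enorm x * ln 2) <= _).
    rewrite mulNr lerN2 ler_wpM2l//; case/andP: l2 => l0 l1.
    by rewrite (le_trans _ e1)// ler_piMr.
  rewrite -mulrA ler_wpM2r ?mulr_ge0//; first by case/andP: l2.
  by rewrite lerNl -normrN ler_norm.
Qed.

(** This dictates the choice of [alpha0]: the power of 2 becomes e^(-(|s| + n b) |x|), where |s|
    pays for the factor <x>^s and n b for b norm1 x <= n b |x|. *)
Lemma exp_weight_le (b s : R) (x : V) : 0 <= b ->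
  exp_weight (- ((`|s| + n%:R * b) / ln 2)) s x <= expR (- (b * norm1 x)).
Proof.
move=> b0; have l2 : 0 < ln 2 :> R by rewrite ln_gt0// ltr1n.
rewrite /exp_weight /powR gt_eqF ?japanese_gt0// ifF; last by apply/negbTE; rewrite pnatr_eq0.
rewrite -expRD ler_expR.
have -> : - ((`|s| + n%:R * b) / ln 2) * enorm x * ln 2 = - ((`|s| + n%:R * b) * enorm x).
  by field; rewrite gt_eqF.
have h0 : 0 <= ln (japanese x) by rewrite ln_ge0 ?japanese_ge1.
have h1 : ln (japanese x) <= enorm x.
  by rewrite -ler_expR lnK ?posrE ?japanese_gt0// (le_trans (japanese_le x))// expR_ge1Dx.
have h2 : s * ln (japanese x) <= `|s| * enorm x.
  apply: le_trans (_ : `|s| * ln (japanese x) <= _); first by rewrite ler_wpM2r// ler_norm.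
  by rewrite ler_wpM2l.
have h3 : b * norm1 x <= b * (n%:R * enorm x) by rewrite ler_wpM2l// norm1_le_enorm.
by lra.
Qed.

End of_hat_theory.

(** * Plancherel inequality *)

Section plancherel.
Context {R : realType} {n : nat}.
Local Notation V := 'rV[R]_n.
Local Notation leb := (@lebesgue_rV R n).
Local Notation mu := (@lebesgue_measure R).
Implicit Types (f g q : V -> R[i]).

Let cj (z : R[i]) : R[i] := complex.Re z -i* complex.Im z.

Lemma cintegral_conj f : cintegrable leb setT f ->
  cintegral leb setT (fun x => cj (f x)) = cj (cintegral leb setT f).
Proof.
move=> [f1 f2]; apply: complexP => //=.
have := RintegralZl (-1) measurableT f2; rewrite mulN1r => <-.
by apply: eq_Rintegral => x _; rewrite mulN1r.
Qed.

Let cjM z w : cj (z * w) = cj z * cj w.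
Proof. by apply: complexP; rewrite /= !(ReM, ImM)/=; ring. Qed.

Let cabs_cj z : cabs (cj z) = cabs z.
Proof. by rewrite /cabs /cj; case: z => a b /=; rewrite sqrrN. Qed.

Let cmeasurable_cj f : cmeasurable setT f -> cmeasurable setT (fun x => cj (f x)).
Proof. by move=> [h1 h2]; split => //=; apply: measurableT_comp. Qed.

Lemma inverse_fourier_conj q x : cintegrable leb setT q ->
  fourier (fun y => cj (q y)) x = cj (inverse_fourier q x).
Proof.
move=> qi; rewrite /fourier /inverse_fourier cjM -cintegral_conj; last first.
  rewrite (_ : (fun y => _) = (fun y => cis (dotp x y) * q y)); last by apply/funext => y; rewrite mulrC.
  apply: (cintegrable_bounded measurableT (M := 1) qi).
    by apply: cmeasurable_cis; exact: measurable_dotp.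
  by move=> y _; rewrite cabs_cis.
congr (_ * _); first by apply: complexP; rewrite //= oppr0.
apply: eq_cintegral => y _; rewrite cjM; congr (_ * _).
have -> : dotp x y = dotp y x by apply: eq_bigr => i _; rewrite mulrC.
by rewrite /cis /cj/= cosN sinN.
Qed.

Let cst : R := fourier_const (R := R) (n := n).

(** The kernel by which a Gaussian multiplier of parameter [l] acts: the modulus of the transform of
    that Gaussian modulated at frequency [x]. It is symmetric and has total mass one. *)
Definition heat_kernel (l : R) (x y : V) : R :=
  cst * cabs (packet_const (fun=> l) (fun=> 0) (fun i => x 0 i)) *
  \prod_(i < n) gauss (4 * l)^-1 (y 0 i - x 0 i).

Lemma heat_kernel_ge0 l x y : 0 <= heat_kernel l x y.
Proof.
rewrite /heat_kernel !mulr_ge0 ?cabs_ge0//; first by rewrite ltW// fourier_const_gt0.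
by rewrite prodr_ge0// => i _; exact: gauss_ge0.
Qed.

Lemma cabs_heat_const l (x : V) : 0 < l ->
  cabs (packet_const (fun=> l) (fun=> 0) (fun i => x 0 i)) = (Num.sqrt (2 * l))^-1 ^+ n.
Proof.
move=> l0; rewrite /packet_const -[n in RHS]card_ord -prodr_const.
have cprod (F : 'I_n -> R[i]) : cabs (\prod_i F i) = \prod_i cabs (F i).
  by apply: (big_morph cabs cabsM); rewrite (cabs_real 1) normr1.
rewrite cprod; apply: eq_bigr => i _.
by rewrite cabsM cabs_cis mulr1 cabs_real ger0_norm// invr_ge0 sqrtr_ge0.
Qed.

Lemma heat_kernelC l x y : 0 < l -> heat_kernel l x y = heat_kernel l y x.
Proof.
move=> l0; rewrite /heat_kernel !cabs_heat_const//; congr (_ * _); apply: eq_bigr => i _.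
by rewrite -gauss_opp opprB.
Qed.

Lemma measurable_heat_kernel d (T : measurableType d) l (f g : T -> V) : 0 < l ->
  measurable_fun setT f -> measurable_fun setT g ->
  measurable_fun setT (fun t => heat_kernel l (f t) (g t)).
Proof.
move=> l0 mf mg; rewrite /heat_kernel; under eq_fun do rewrite cabs_heat_const//.
apply: measurable_funM => //; apply: measurable_prod => i _.
apply: (measurableT_comp (measurable_gauss _)).
by apply: measurable_funB; exact: (measurableT_comp (measurable_coord i)).
Qed.

Lemma heat_kernel_integral l x : 0 < l -> (\int[leb]_y (heat_kernel l x y)%:E = 1)%E.
Proof.
move=> l0; rewrite /heat_kernel; under eq_integral do rewrite EFinM.
have k0 : 0 < (4 * l)^-1 by rewrite invr_gt0 mulr_gt0.
have mg i : measurable_fun setT (fun t : R => gauss (4 * l)^-1 (t - x 0 i)).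
  apply: (measurableT_comp (measurable_gauss _)); exact: measurable_funB.
rewrite ge0_integralZl_EFin//; last 3 first.
- by move=> y _; rewrite lee_fin prodr_ge0// => i _; exact: gauss_ge0.
- apply/measurable_EFinP; apply: measurable_prod => i _.
  exact: (measurableT_comp (mg i) (measurable_coord i)).
- by rewrite mulr_ge0 ?cabs_ge0// ltW// fourier_const_gt0.
rewrite (ge0_integral_prod (f := fun i t => gauss (4 * l)^-1 (t - x 0 i)))//; last first.
  by move=> i t; exact: gauss_ge0.
have E i : (\int[mu]_t (gauss (4 * l)^-1 (t - x 0%R i))%:E = (Num.sqrt (pi / (4 * l)^-1))%:E)%E.
  under eq_integral do rewrite addrC.
  rewrite (@ge0_integral_shift1 R (- x 0%R i) (fun t => (gauss (4 * l)^-1 t)%:E)).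
  - have [ig <-] := gauss_integral k0.
    by rewrite /Rintegral fineK//; exact: integrable_fin_num ig.
  - by apply/measurable_EFinP; exact: measurable_gauss.
  - by move=> t; rewrite lee_fin gauss_ge0.
under eq_bigr do rewrite E.
rewrite -(big_morph EFin (@EFinM R) (erefl _)) -EFinM; congr (_%:E); rewrite cabs_heat_const// /cst fourier_constE.
rewrite -[n in X in _ * X * _]card_ord -prodr_const -!big_split/= big1// => i _.
rewrite -invfM -sqrtrM ?mulr_ge0 ?pi_ge0// invrK.
have -> : 2 * pi * (2 * l) = pi * (4 * l) by ring.
by rewrite mulVf// gt_eqF// sqrtr_gt0 !mulr_gt0// pi_gt0.
Qed.

Lemma cabs_packet_prod (l a b : 'I_n -> R) (x : V) :
  cabs (packet l a b x) = \prod_(i < n) gauss (l i) (x 0 i - a i).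
Proof.
rewrite cabs_packet -sumrN expR_sum; apply: eq_bigr => i _.
by rewrite /gauss mulNr.
Qed.

Local Notation G l := (packet (fun=> l) (fun=> 0) (fun=> 0)).

Let bounded_gauss q l : 0 < l -> cintegrable leb setT q ->
  cintegrable leb setT (fun x => fourier q x * G l x).
Proof.
move=> l0 qi; have [M HM] := fourier_bounded qi.
apply: (cintegrable_bounded measurableT (M := M)) => //.
- exact: cintegrable_packet.
- by apply: cmeasurable_fourier; exact: cintegrable_cmeasurable qi.
Qed.

Lemma cintegrable_conj q : cintegrable leb setT q -> cintegrable leb setT (fun x => cj (q x)).
Proof.
move=> /(cintegrableP leb measurableT)[mq qoo]; apply/(cintegrableP leb measurableT); split.
  exact: cmeasurable_cj.
by under eq_integral do rewrite cabs_cj.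
Qed.

(** The exchange formula moves the transform from [q] to the modulated Gaussian [P], whose transform
    is explicit. *)
Lemma heat_kernel_bound l q (x : V) : 0 < l -> cintegrable leb setT q ->
  ((cabs (inverse_fourier (fun y => fourier q y * G l y) x))%:E <=
    \int[leb]_y (cabs (q y) * heat_kernel l x y)%:E)%E.
Proof.
move=> l0 qi; have mq := cintegrable_cmeasurable qi.
set P := packet (fun=> l) (fun=> 0) (fun i => x 0 i).
have Pi : cintegrable leb setT P by exact: cintegrable_packet.
have E : inverse_fourier (fun y => fourier q y * G l y) x =
    cst%:C * cintegral leb setT (fun y => q y * fourier P y).
  rewrite /inverse_fourier -fourier_exchange//; congr (_ * _).
  apply: eq_cintegral => y _; rewrite -mulrA; congr (_ * _).
  rewrite /P !packetE -mulrA; congr (_ * _).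
  rewrite [in cis (\sum_(i < n) _)]big1; last by move=> i _; rewrite mul0r.
  by rewrite cis0 mul1r.
rewrite E cabsM cabs_real ger0_norm ?EFinM; last by rewrite ltW// fourier_const_gt0.
have mqP : cmeasurable setT (fun y => q y * fourier P y).
  by apply: cmeasurableM => //; apply: cmeasurable_fourier; exact: cintegrable_cmeasurable Pi.
apply: le_trans.
  apply: lee_pmul; [by rewrite lee_fin ltW// fourier_const_gt0|by rewrite lee_fin cabs_ge0|exact: lexx|].
  exact: le_cabs_cintegral.
rewrite -ge0_integralZl_EFin//; last 3 first.
- by move=> y _; rewrite lee_fin cabs_ge0.
- exact: measurable_ecabs.
- by rewrite ltW// fourier_const_gt0.
apply: ge0_le_integral_any => y _.
  by rewrite -EFinM lee_fin mulr_ge0 ?cabs_ge0// ltW// fourier_const_gt0.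
rewrite -EFinM lee_fin cabsM /P fourier_packet// cabsM cabs_packet_prod /heat_kernel.
by rewrite mulrCA !mulrA.
Qed.

(** Schur's test. The left side equals the integral of [q] against the Gaussian multiplier applied
    to its conjugate, hence is at most the double integral of |q(x)| |q(y)| H(x, y) with H the heat
    kernel. Bounding the product by half the sum of squares and using that H is symmetric of mass
    one gives the integral of |q|^2. *)
Lemma plancherel_gauss l q : 0 < l -> cintegrable leb setT q ->
  (\int[leb]_x (cabs (inverse_fourier q x) ^+ 2 * cabs (G l x))%:E <=
   \int[leb]_x (cabs (q x) ^+ 2)%:E)%E.
Proof.
move=> l0 qi; have mq := cintegrable_cmeasurable qi.
have qbi := cintegrable_conj qi.
set u := inverse_fourier q.
have mu' : cmeasurable setT u by exact: cmeasurable_inverse_fourier.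
set h := fun x => fourier (fun y => cj (q y)) x * G l x.
have hi : cintegrable leb setT h by exact: bounded_gauss.
have [M HM] := fourier_bounded qi.
have uhi : cintegrable leb setT (fun x => u x * h x).
  apply: (cintegrable_bounded measurableT (M := M) hi) => // x _.
  by rewrite /u inverse_fourierE.
have E x : cabs (u x) ^+ 2 * cabs (G l x) = complex.Re (u x * h x).
  rewrite /h inverse_fourier_conj// -/u mulrA packet_real cabs_real ger0_norm; last first.
    by rewrite prodr_ge0// => i _; exact: gauss_ge0.
  have -> : u x * cj (u x) = (cabs (u x) ^+ 2)%:C.
    by apply: complexP; rewrite sqr_cabs ?ReM ?ImM/=; ring.
  by rewrite ReM/= mulr0 subr0.
under eq_integral do rewrite E.
have -> : (\int[leb]_x (complex.Re (u x * h x))%:E)%E = (complex.Re (cintegral leb setT (fun x => u x * h x)))%:E.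
  by rewrite /= /Rintegral fineK//; apply: integrable_fin_num => //; exact: uhi.1.
apply: (@le_trans _ _ (cabs (cintegral leb setT (fun x => u x * h x)))%:E).
  by rewrite lee_fin (le_trans (ler_norm _))// normr_Re_le.
rewrite /u inverse_fourier_exchange//.
have mh : cmeasurable setT (inverse_fourier h).
  by apply: cmeasurable_inverse_fourier; exact: cintegrable_cmeasurable hi.
apply: le_trans (le_cabs_cintegral leb measurableT (cmeasurableM mq mh)) _.
pose K (p : V * V) := ((cabs (q p.1) ^+ 2 / 2) * heat_kernel l p.1 p.2)%:E.
have mH : measurable_fun setT (fun p : V * V => heat_kernel l p.1 p.2).
  exact: measurable_heat_kernel.
have mK : measurable_fun setT K.
  apply/measurable_EFinP; apply: measurable_funM => //.
  apply: measurable_funM => //; apply: measurable_funX.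
  exact: (measurable_cabs (cmeasurable_comp mq measurable_fst)).
have mHx x : measurable_fun setT (fun y => heat_kernel l x y).
  by apply: measurable_heat_kernel => //; exact: measurable_cst.
have K0 p : (0 <= K p)%E.
  by rewrite lee_fin mulr_ge0 ?heat_kernel_ge0// divr_ge0 ?sqr_ge0.
have IK : (\int[leb]_x \int[leb]_y K (x, y) = \int[leb]_x (cabs (q x) ^+ 2 / 2)%:E)%E.
  apply: eq_integral => x _; rewrite /K/=; under eq_integral do rewrite EFinM.
  rewrite ge0_integralZl_EFin//.
  - by rewrite heat_kernel_integral// mule1.
  - by move=> y _; rewrite lee_fin heat_kernel_ge0.
  - exact/measurable_EFinP.
  - by rewrite divr_ge0 ?sqr_ge0.
have mq2 : measurable_fun setT (fun x => (cabs (q x) ^+ 2 / 2)%:E).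
  apply/measurable_EFinP; apply: measurable_funM => //; apply: measurable_funX.
  exact: measurable_cabs.
have q20 x : (0 <= (cabs (q x) ^+ 2 / 2)%:E)%E by rewrite lee_fin divr_ge0 ?sqr_ge0.
apply: (@le_trans _ _ (\int[leb]_x \int[leb]_y (K (x, y) + K (y, x)))%E).
  apply: ge0_le_integral_any => x _; first by rewrite lee_fin cabs_ge0.
  rewrite cabsM EFinM; apply: le_trans.
    apply: lee_pmul; [by rewrite lee_fin cabs_ge0|by rewrite lee_fin cabs_ge0|exact: lexx|].
    exact: heat_kernel_bound.
  rewrite -ge0_integralZl_EFin ?cabs_ge0//; last 2 first.
  - by move=> y _; rewrite lee_fin mulr_ge0 ?cabs_ge0 ?heat_kernel_ge0.
  - apply/measurable_EFinP; apply: measurable_funM; last exact: mHx.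
    by apply: measurable_cabs; exact: cmeasurable_cj.
  apply: ge0_le_integral_any => y _.
    by rewrite -EFinM lee_fin mulr_ge0 ?cabs_ge0// mulr_ge0 ?cabs_ge0 ?heat_kernel_ge0.
  rewrite cabs_cj /K/= -EFinM -EFinD lee_fin (heat_kernelC y x l0) -mulrDl mulrA.
  rewrite ler_wpM2r ?heat_kernel_ge0//.
  have := sqr_ge0 (cabs (q x) - cabs (q y)); rewrite sqrrB; lra.
have mKx x : measurable_fun setT (fun y => K (x, y)).
  apply/measurable_EFinP.
  by apply: (@measurable_funM _ _ _ _ (fun=> cabs (q x) ^+ 2 / 2) (heat_kernel l x)).
have mKy x : measurable_fun setT (fun y => K (y, x)).
  apply/measurable_EFinP; apply: measurable_funM.
    exact/measurable_EFinP.
  by apply: (@measurable_heat_kernel _ _ _ id (fun=> x)).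
under eq_integral do rewrite ge0_integralD//.
have mKs : measurable_fun setT (fun p : V * V => K (p.2, p.1)).
  apply: (measurableT_comp mK); exact: measurable_swap.
rewrite ge0_integralD//; last 4 first.
- by move=> x _; exact: integral_ge0.
- exact: (measurable_fubini_integral leb mK).
- by move=> x _; exact: integral_ge0.
- exact: (measurable_fubini_integral leb mKs).
set I2 := (\int[leb]_x (cabs (q x) ^+ 2 / 2)%:E)%E in IK *.
have le1 : (\int[leb]_x \int[leb]_y K (x, y) <= I2)%E by rewrite -IK.
have le2 : (\int[leb]_x \int[leb]_y K (y, x) <= I2)%E.
  by rewrite -IK; have := fubini_tonelli K mK K0 => ->.
apply: le_trans (leeD le1 le2) _; rewrite /I2 -ge0_integralD//.
apply: ge0_le_integral_any => x _; first by rewrite adde_ge0.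
by rewrite -EFinD lee_fin -splitr.
Qed.

(** Fatou's lemma removes the Gaussian as its parameter 1 / (k + 1) tends to 0. *)
Lemma plancherel_le q : cintegrable leb setT q ->
  (\int[leb]_x (cabs (inverse_fourier q x) ^+ 2)%:E <=
   \int[leb]_x (cabs (q x) ^+ 2)%:E)%E.
Proof.
move=> qi; set u := inverse_fourier q.
have mu' : cmeasurable setT u.
  by apply: cmeasurable_inverse_fourier; exact: cintegrable_cmeasurable qi.
pose l (k : nat) : R := k.+1%:R^-1.
have l0 k : 0 < l k by rewrite invr_gt0.
pose F k x := (cabs (u x) ^+ 2 * cabs (G (l k) x))%:E.
have cvgF x : F ^~ x @ \oo --> (cabs (u x) ^+ 2)%:E.
  apply: cvg_EFin; first exact: nearW.
  rewrite -[X in _ --> X]mulr1; apply: cvgM; first exact: cvg_cst.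
  have -> : (fun k => cabs (G (l k) x)) = (fun k => expR (- (l k * enorm x ^+ 2))).
    apply/funext => k; rewrite cabs_packet sqr_enorm mulr_sumr; congr expR; congr (- _).
    by apply: eq_bigr => i _; rewrite subr0.
  rewrite -expR0; apply: continuous_cvg; first exact: continuous_expR.
  rewrite -oppr0 -[in X in _ --> X](mul0r (enorm x ^+ 2)).
  by apply: cvgN; apply: cvgM; [exact: cvg_harmonic|exact: cvg_cst].
have mF k : measurable_fun setT (F k).
  apply/measurable_EFinP; apply: measurable_funM.
    by apply: measurable_funX; exact: measurable_cabs.
  by apply: measurable_cabs; apply: cintegrable_cmeasurable; exact: cintegrable_packet.
have F0 k x : setT x -> (0 <= F k x)%E by move=> _; rewrite lee_fin mulr_ge0 ?sqr_ge0 ?cabs_ge0.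
have := @fatou _ _ _ leb setT measurableT F mF F0.
have -> : (fun x => limn_einf (F^~ x)) = (fun x => (cabs (u x) ^+ 2)%:E).
  apply/funext => x; have c := cvgF x.
  by rewrite is_cvg_limn_einfE; [exact/cvg_lim|apply: cvgP c].
move=> h; apply: le_trans h _.
rewrite limn_einf_lim; apply: lime_le; first exact: is_cvg_einfs.
apply: nearW => k; apply: (@le_trans _ _ (\int[leb]_x F k x)%E).
  by apply: ereal_inf_lbound; exists k => /=.
exact: plancherel_gauss.
Qed.

(** [L2norm] is taken on the space side, where [of_hat q] is represented by the inverse transform of
    [q]; this is how Plancherel enters the norms of the blocks [box_op k]. *)
Lemma L2norm_of_hat q : cintegrable leb setT q -> expint q ->
  (L2norm (of_hat q) <= (\int[leb]_x (cabs (q x) ^+ 2)%:E) `^ 2^-1)%E.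
Proof.
move=> qi eq; have [M HM] := fourier_bounded qi.
have mi : cmeasurable setT (inverse_fourier q).
  by apply: cmeasurable_inverse_fourier; exact: cintegrable_cmeasurable qi.
have rep : represents (inverse_fourier q) (of_hat q).
  split => // f gf; have fi := gs_cintegrable gf; split.
    apply: (cintegrable_bounded measurableT (M := M) fi) => // x _.
    by rewrite inverse_fourierE.
  by rewrite /of_hat inverse_fourier_exchange.
rewrite /L2norm /weighted_L2 asboolT; last by exists (inverse_fourier q).
rewrite unlock; apply: gt0_ler_poweR; rewrite ?invr_ge0// ?in_itv/= ?leey ?andbT//.
- by apply: integral_ge0 => x _; rewrite lee_fin powR_ge0.
- by apply: integral_ge0 => x _; rewrite lee_fin sqr_ge0.
apply: le_trans (plancherel_le qi).
have mT : cmeasurable setT (density (of_hat q)).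
  rewrite /density; case: xgetP => [g _ []//|_]; exact: cmeasurable_cst.
rewrite le_eqVlt; apply/orP; left; apply/eqP; apply: ge0_ae_eq_integral => //.
- apply/measurable_EFinP; apply: (@measurableT_comp _ _ _ _ _ _ (@powR R ^~ 2)) => //.
  apply: measurableT_comp => //; apply: measurable_funM => //.
  exact: measurable_cabs.
- by apply/measurable_EFinP; apply: measurable_funX; exact: measurable_cabs.
- by move=> x _; rewrite lee_fin sqr_ge0.
- apply: filterS (density_unique rep) => x -> _.
  by rewrite /= mul1r ger0_norm ?cabs_ge0// powR_mulrn ?cabs_ge0.
Qed.

End plancherel.

(** * Kernels of the linear equation *)

Section exponential_series.
Context {R : realType}.
Implicit Types (d : nat -> R) (t : R).

Definition expgrowth d := exists C L : R, 0 <= L /\ forall k, `|d k| <= C * L ^+ k.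

(** The sum of d_k t^k / k!. In this normalisation differentiation is the shift of [d]. *)
Definition eseries d t : R := limn (pseries (fun k => d k / k`!%:R) t).

Lemma expgrowth_shift m d : expgrowth d -> expgrowth (fun k => d (m + k)%N).
Proof.
move=> [C [L [L0 H]]]; exists (C * L ^+ m), L; split => // k.
by rewrite -mulrA -exprD.
Qed.

Lemma is_cvg_eseries d t : expgrowth d -> cvgn (pseries (fun k => d k / k`!%:R) t).
Proof.
move=> [C [L [L0 H]]]; apply: normed_cvg.
apply: (@series_le_cvg _ _ (fun k => C * exp_coeff (L * `|t|) k)) => [//= k|k|k|].
- rewrite mulr_ge0//; last by rewrite exp_coeff_ge0// mulr_ge0.
  by rewrite (le_trans (normr_ge0 (d 0%N)))// (le_trans (H _))// expr0 mulr1.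
- rewrite /= !normrM normfV normr_nat normrX /exp_coeff/= exprMn !mulrA.
  by rewrite mulrAC ler_wpM2r ?invr_ge0// ler_wpM2r ?exprn_ge0.
- have -> : series (fun k => C * exp_coeff (L * `|t|) k) = (fun N => C * series (exp_coeff (L * `|t|)) N).
    by apply/funext => N; rewrite /series/= mulr_sumr.
  by apply: is_cvgMl_tmp; exact: is_cvg_series_exp_coeff.
Qed.

Lemma cvg_eseries d t : expgrowth d ->
  (fun N => \sum_(0 <= k < N) d k / k`!%:R * t ^+ k) @ \oo --> eseries d t.
Proof. by move=> gd; exact: (@is_cvg_eseries d t gd). Qed.

Lemma is_derive_eseries d t : expgrowth d ->
  is_derive t (1 : R) (eseries d) (eseries (fun k => d (1 + k)%N) t).
Proof.
move=> gd; have E c : pseries_diffs (fun k => c k / k`!%:R) = (fun k => c k.+1 / k`!%:R :> R).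
  apply/funext => k; rewrite /pseries_diffs factS natrM invfM.
  by rewrite mulrCA [_ * (k.+1%:R^-1 * _)]mulrA divff ?mul1r// pnatr_eq0.
rewrite /eseries -(E d); apply: (@pseries_snd_diffs _ _ (`|t| + 1)).
- exact: is_cvg_eseries.
- by rewrite E; apply: (@is_cvg_eseries _ _ (expgrowth_shift 1 gd)).
- by rewrite !E; apply: (@is_cvg_eseries _ _ (expgrowth_shift 2 gd)).
- by rewrite [ltRHS]ger0_norm ?addr_ge0// ltrDl.
Qed.

Lemma derive1n_eseries m d : expgrowth d ->
  derive1n m (eseries d) = eseries (fun k => d (m + k)%N).
Proof.
move=> gd; elim: m => [|m IH]; first by rewrite derive1n0.
rewrite derive1nS IH; apply/funext => t; rewrite derive1E.
case: (is_derive_eseries t (expgrowth_shift m gd)) => _ ->.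
congr (eseries _ t); apply/funext => i; by rewrite addnA addn1.
Qed.

Lemma eseries0 d : eseries d 0 = d 0%N.
Proof.
apply: cvg_lim => //; rewrite -cvg_shiftS; apply: cvg_near_cst; apply: nearW => k.
rewrite /pseries /series/= big_nat_recl// expr0 mulr1 fact0 divr1 big1 ?addr0// => i _.
by rewrite expr0n/= mulr0.
Qed.

(** The reason for solving the kernel equation by a series: partial sums are measurable in time and
    in the parameters, so the kernels are jointly measurable in time and frequency. *)
Lemma measurable_eseries dT (T : measurableType dT) (d : T -> nat -> R) (t : T -> R) :
  (forall x, expgrowth (d x)) -> (forall k, measurable_fun setT (fun x => d x k)) ->
  measurable_fun setT t -> measurable_fun setT (fun x => eseries (d x) (t x)).
Proof.
move=> gd md mt.
apply: (@measurable_fun_cvg _ _ _ _ (fun N x => \sum_(0 <= k < N) d x k / k`!%:R * t x ^+ k)).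
  move=> N; apply: measurable_sum => k; apply: measurable_funM; last exact: measurable_funX.
  exact: measurable_funM.
by move=> x _; exact: cvg_eseries.
Qed.

Lemma is_derive_sum_sqr3 (f g h : R -> R) (t a b c : R) :
  is_derive t (1 : R) f a -> is_derive t (1 : R) g b -> is_derive t (1 : R) h c ->
  is_derive t (1 : R) (fun s => f s ^+ 2 + g s ^+ 2 + h s ^+ 2) (2 * (f t * a + g t * b + h t * c)).
Proof.
by move=> df dg dh; apply: is_derive_eq; rewrite /GRing.scale/= ?expr1; ring.
Qed.

(** E e^(-K t) is nonincreasing for t >= 0, E e^(K t) is nondecreasing for t <= 0, and both vanish
    at 0. *)
Lemma gronwall_eq0 (E dE : R -> R) (K : R) :
  (forall t, is_derive t (1 : R) E (dE t)) -> (forall t, `|dE t| <= K * E t) ->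
  (forall t, 0 <= E t) -> E 0 = 0 -> forall t, E t = 0.
Proof.
move=> dEE bE E0 E00 t.
have dF s (c : R) : is_derive s (1 : R) (fun t => E t * expR (c * t)) ((dE s + c * E s) * expR (c * s)).
  have := dEE s => dEs.
  have de : is_derive s (1 : R) (fun t => expR (c * t)) (c * expR (c * s)).
    by apply: is_derive_eq; rewrite /GRing.scale/= mulr1 mulrC.
  by apply: is_derive_eq; rewrite /GRing.scale/=; ring.
have cF (c : R) : continuous (fun t => E t * expR (c * t)).
  move=> s; apply: differentiable_continuous; apply/derivable1_diffP.
  by case: (dF s c).
apply/eqP; rewrite eq_le E0 andbT.
have [t0|t0] := leP 0 t.
- have := @ler0_derive1_nincr R (fun t => E t * expR (- K * t)) 0 t.
  move=> /(_ _ _ _ 0 t (lexx _) t0 (lexx _)) h; move: h; rewrite E00 mul0r => h.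
  rewrite -(pmulr_lle0 (E t) (expR_gt0 (- K * t))); apply: h.
  + by move=> x _; case: (dF x (- K)).
  + move=> x _; rewrite derive1E; case: (dF x (- K)) => _ ->.
    rewrite pmulr_lle0 ?expR_gt0// mulNr subr_le0; exact: le_trans (ler_norm _) (bE x).
  + by apply: continuous_subspaceT; exact: cF.
- have := @ger0_derive1_ndecr R (fun t => E t * expR (K * t)) t 0.
  move=> /(_ _ _ _ t 0 (lexx _) (ltW t0) (lexx _)) h; move: h; rewrite E00 mul0r => h.
  rewrite -(pmulr_lle0 (E t) (expR_gt0 (K * t))); apply: h.
  + by move=> x _; case: (dF x K).
  + move=> x _; rewrite derive1E; case: (dF x K) => _ ->.
    rewrite mulr_ge0 ?expR_ge0//.
    rewrite -lerBlDr sub0r; apply: le_trans (_ : - `|dE x| <= _); first by rewrite lerN2.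
    by rewrite lerNl -normrN ler_norm.
  + by apply: continuous_subspaceT; exact: cF.
Qed.

End exponential_series.

Section kernel_series.
Context {R : realType}.
Variables (tau delta sigma : R).
Hypothesis tau0 : 0 < tau.

(** A state holds three consecutive coefficients d_k, d_(k+1), d_(k+2); the equation reads tau
    d_(k+3) = - (d_(k+2) + (delta + tau) rho d_(k+1) + rho d_k). *)
Definition kernel_step (rho : R) (p : R * R * R) : R * R * R :=
  (p.1.2, p.2, - ((p.2 + (delta + tau) * rho * p.1.2 + rho * p.1.1) / tau)).

Definition kernel_state (j : nat) (rho : R) (k : nat) : R * R * R :=
  iter k (kernel_step rho) ((0%N == j)%:R, (1%N == j)%:R, (2%N == j)%:R).

Definition kernel_coef j rho k : R := (kernel_state j rho k).1.1.

Let natr_b (b : bool) : `|b%:R : R| <= 1.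
Proof. by case: b; rewrite ?normr1 ?normr0. Qed.

Lemma kernel_coef_growth j rho : expgrowth (kernel_coef j rho).
Proof.
(* One step multiplies the largest entry of the state by at most [L]; L >= 1 accounts for the two
   entries that are merely shifted. *)
pose L := 1 + (1 + `|(delta + tau) * rho| + `|rho|) / tau.
have L1 : 1 <= L by rewrite lerDl divr_ge0 ?addr_ge0// ltW.
exists 1, L; split; first exact: le_trans L1.
suff H k : [/\ `|(kernel_state j rho k).1.1| <= L ^+ k,
    `|(kernel_state j rho k).1.2| <= L ^+ k & `|(kernel_state j rho k).2| <= L ^+ k].
  by move=> k; rewrite mul1r; case: (H k).
elim: k => [|k [h1 h2 h3]]; first by rewrite /kernel_state/= expr0; split; exact: natr_b.
have Lk : L ^+ k <= L ^+ k.+1 by rewrite exprS ler_peMl// exprn_ge0// (le_trans _ L1).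
rewrite /kernel_state iterS -/(kernel_state j rho k).
case: (kernel_state j rho k) h1 h2 h3 => -[x y] z /= h1 h2 h3; split.
- exact: le_trans h2 Lk.
- exact: le_trans h3 Lk.
rewrite normrN normrM normfV (gtr0_norm tau0) ler_pdivrMr// exprS.
apply: le_trans (ler_normD _ _) _; rewrite normrM.
apply: (@le_trans _ _ (`|z| + `|(delta + tau) * rho| * `|y| + `|rho| * `|x|)).
  by rewrite lerD2r (le_trans (ler_normD _ _))// normrM.
apply: (@le_trans _ _ ((1 + `|(delta + tau) * rho| + `|rho|) * L ^+ k)).
  by rewrite !mulrDl mul1r !lerD// ler_wpM2l.
rewrite mulrAC ler_wpM2r ?exprn_ge0 ?(le_trans _ L1)//.
by rewrite /L [leRHS]mulrDl mul1r divfK ?gt_eqF// lerDr ltW.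
Qed.

Let derive1n_kernel j rho m t : derive1n m (eseries (kernel_coef j rho)) t =
  eseries (fun k => kernel_coef j rho (m + k)%N) t.
Proof. by rewrite derive1n_eseries//; exact: kernel_coef_growth. Qed.

Lemma kernel_ode_eseries j rho : kernel_ode tau delta rho (eseries (kernel_coef j rho)).
Proof.
move=> t; have gr := kernel_coef_growth j rho; split.
  move=> m _; rewrite derive1n_eseries//.
  by case: (is_derive_eseries t (expgrowth_shift m gr)).
rewrite !derive1n_kernel.
have c m := @cvg_eseries _ _ t (expgrowth_shift m gr).
pose p m N := \sum_(0 <= k < N) kernel_coef j rho (m + k)%N / k`!%:R * t ^+ k.
pose u N := tau * p 3%N N + p 2%N N + (delta + tau) * rho * p 1%N N + rho * p 0%N N.
have h : u @ \oo --> tau * eseries (fun k => kernel_coef j rho (3 + k)) t +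
    eseries (fun k => kernel_coef j rho (2 + k)) t +
    (delta + tau) * rho * eseries (fun k => kernel_coef j rho (1 + k)) t +
    rho * eseries (kernel_coef j rho) t.
  apply: cvgD; first apply: cvgD; first apply: cvgD; last exact: (cvgM (cvg_cst _) (c 0%N)).
  - exact: (cvgM (cvg_cst _) (c 3%N)).
  - exact: (c 2%N).
  - exact: (cvgM (cvg_cst _) (c 1%N)).
move: h.
have -> : u = fun=> 0.
  apply/funext => N; rewrite /u /p !mulr_sumr -!big_split/= big1// => i _.
  rewrite [kernel_coef j rho (3 + i)]/kernel_coef /kernel_state !addSn add0n !iterS /=.
  rewrite -/(kernel_state j rho i) /kernel_coef /kernel_state !iterS /=.
  by move: (i`!%:R^-1 : R) => w; field; rewrite gt_eqF.
by move=> h; exact: (cvg_unique (@norm_hausdorff _ _) h (cvg_cst _)).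
Qed.

(** Gronwall's inequality for the energy u^2 + u'^2 + u''^2 of the difference. Uniqueness identifies
    the kernel, which is chosen by [xget], with its series. *)
Lemma kernel_ode_unique rho (y1 y2 : R -> R) :
  kernel_ode tau delta rho y1 -> kernel_ode tau delta rho y2 ->
  (forall i, (i < 3)%N -> derive1n i y1 0 = derive1n i y2 0) -> y1 = y2.
Proof.
move=> h1 h2 h0.
pose u m t := derive1n m y1 t - derive1n m y2 t.
have du m t : (m < 3)%N -> is_derive t (1 : R) (u m) (u m.+1 t).
  move=> m3; have d1 := (h1 t).1 m m3; have d2 := (h2 t).1 m m3.
  rewrite /u !derive1nS !derive1E; apply: is_deriveB; exact: derivableP.
have u3 t : u 3%N t = - ((u 2%N t + (delta + tau) * rho * u 1%N t + rho * u 0%N t) / tau).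
  have [_ e1] := h1 t; have [_ e2] := h2 t; rewrite /u.
  apply: (mulIf (lt0r_neq0 tau0)); rewrite mulNr divfK ?lt0r_neq0//.
  move: e1 e2; rewrite !derive1n0.
  move: (derive1n 3 y1 t) (derive1n 2 y1 t) (derive1n 1 y1 t) (y1 t) => a3 a2 a1 a0.
  move: (derive1n 3 y2 t) (derive1n 2 y2 t) (derive1n 1 y2 t) (y2 t) => b3 b2 b1 b0 e1 e2.
  apply: subr0_eq; transitivity ((tau * a3 + a2 + (delta + tau) * rho * a1 + rho * a0) -
    (tau * b3 + b2 + (delta + tau) * rho * b1 + rho * b0)); first by ring.
  by rewrite e1 e2 subrr.
pose E t := u 0%N t ^+ 2 + u 1%N t ^+ 2 + u 2%N t ^+ 2.
pose dE t := 2 * (u 0%N t * u 1%N t + u 1%N t * u 2%N t + u 2%N t * u 3%N t).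
have dEE t : is_derive t (1 : R) E (dE t).
  have d0 := @du 0%N t isT; have d1 := @du 1%N t isT; have d2 := @du 2%N t isT.
  exact: is_derive_sum_sqr3.
pose A := `|(delta + tau) * rho|; pose B := `|rho|.
have EK t : `|dE t| <= (2 + 2 * (1 + A + B) / tau) * E t.
  set x := `|u 0%N t|; set y := `|u 1%N t|; set z := `|u 2%N t|.
  have E' : E t = x ^+ 2 + y ^+ 2 + z ^+ 2 by rewrite /E /x /y /z -!normrX !ger0_norm ?sqr_ge0.
  have x0 : 0 <= x by exact: normr_ge0.
  have y0 : 0 <= y by exact: normr_ge0.
  have z0 : 0 <= z by exact: normr_ge0.
  have A0 : 0 <= A by exact: normr_ge0.
  have B0 : 0 <= B by exact: normr_ge0.
  have w : `|u 3%N t| * tau <= z + A * y + B * x.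
    rewrite u3 normrN normrM normfV (gtr0_norm tau0) divfK ?lt0r_neq0//.
    by rewrite (le_trans (ler_normD _ _))// normrM lerD2r (le_trans (ler_normD _ _))// normrM.
  have xy : x * y <= E t by rewrite E'; nra.
  have yz : y * z <= E t by rewrite E'; nra.
  have xz : x * z <= E t by rewrite E'; nra.
  have xyz : x * y + y * z <= E t.
    rewrite E'; have := sqr_ge0 (x - y); have := sqr_ge0 (y - z).
    have := sqr_ge0 x; have := sqr_ge0 z; rewrite !sqrrB; lra.
  have zz : z * z <= E t by rewrite E'; nra.
  have zw : z * `|u 3%N t| <= (1 + A + B) / tau * E t.
    rewrite mulrAC ler_pdivlMr// -mulrA.
    apply: le_trans (ler_wpM2l z0 w) _.
    have := ler_wpM2l A0 yz; have := ler_wpM2l B0 xz; lra.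
  apply: (@le_trans _ _ (2 * (x * y + y * z + z * `|u 3%N t|))).
    rewrite /dE normrM (ger0_norm (ler0n _ _)) ler_wpM2l//.
    rewrite (le_trans (ler_normD _ _))// normrM lerD2r.
    by rewrite (le_trans (ler_normD _ _))// !normrM.
  have -> : 2 * (1 + A + B) / tau = 2 * ((1 + A + B) / tau) by rewrite mulrA.
  by rewrite [leLHS]mulrDr [leRHS]mulrDl lerD// ?ler_wpM2l// -mulrA ler_wpM2l.
have E0 : E 0 = 0 by rewrite /E /u !h0// !subrr expr0n/= !addr0.
apply/funext => t; apply/eqP; rewrite -subr_eq0 -sqrf_eq0 eq_le sqr_ge0 andbT.
have <- := gronwall_eq0 dEE EK _ E0 t; last first.
  by move=> s; rewrite /E !addr_ge0 ?sqr_ge0.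
by rewrite /E -addrA lerDl addr_ge0 ?sqr_ge0.
Qed.

Lemma jmgt_kernelE j (r : R) : (j < 3)%N ->
  jmgt_kernel tau delta sigma j 1 r = eseries (kernel_coef j (r `^ (2 * sigma))).
Proof.
move=> j3; set rho := r `^ (2 * sigma).
have h : [set y | kernel_ode tau delta ((r / 1) `^ (2 * sigma)) y /\
    forall i, (i < 3)%N -> derive1n i y 0 = (i == j)%:R] (eseries (kernel_coef j rho)).
  split; first by rewrite divr1; exact: kernel_ode_eseries.
  move=> i i3; rewrite derive1n_kernel eseries0 addn0.
  by case: i i3 => [|[|[|//]]] _; rewrite /kernel_coef /kernel_state/=.
rewrite /jmgt_kernel; case: xgetP => [y _ [ode ic]|/(_ (eseries (kernel_coef j rho)))//].
apply: (@kernel_ode_unique rho) => //; first by move: ode; rewrite divr1.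
  exact: kernel_ode_eseries.
by move=> i i3; rewrite ic// (h.2 i i3).
Qed.

Lemma continuous_jmgt_kernel j m r : (j < 3)%N ->
  continuous (derive1n m (jmgt_kernel tau delta sigma j 1 r)).
Proof.
move=> j3 t; rewrite jmgt_kernelE// derive1n_eseries; last exact: kernel_coef_growth.
apply: differentiable_continuous; apply/derivable1_diffP.
by case: (is_derive_eseries t (expgrowth_shift m (kernel_coef_growth j (r `^ (2 * sigma))))).
Qed.

Lemma measurable_jmgt_kernel dT (T : measurableType dT) j m (r t : T -> R) : (j < 3)%N ->
  measurable_fun setT r -> measurable_fun setT t ->
  measurable_fun setT (fun x => derive1n m (jmgt_kernel tau delta sigma j 1 (r x)) (t x)).
Proof.
move=> j3 mr mt.
have -> : (fun x => derive1n m (jmgt_kernel tau delta sigma j 1 (r x)) (t x)) =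
    (fun x => eseries (fun k => kernel_coef j (r x `^ (2 * sigma)) (m + k)%N) (t x)).
  by apply/funext => x; rewrite jmgt_kernelE// derive1n_kernel.
apply: measurable_eseries => // [x|k].
  exact: (expgrowth_shift m (kernel_coef_growth j (r x `^ (2 * sigma)))).
have mrho : measurable_fun setT (fun x => r x `^ (2 * sigma)) by exact: (measurableT_comp (measurable_powR _) mr).
suff [h _ _] : [/\ measurable_fun setT (fun x => (kernel_state j (r x `^ (2 * sigma)) (m + k)).1.1),
    measurable_fun setT (fun x => (kernel_state j (r x `^ (2 * sigma)) (m + k)).1.2) &
    measurable_fun setT (fun x => (kernel_state j (r x `^ (2 * sigma)) (m + k)).2)] by [].
elim: (m + k)%N => [|i [h1 h2 h3]]; first by split; exact: measurable_cst.
split => //.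
pose q x := kernel_state j (r x `^ (2 * sigma)) i.
have -> : (fun x => (kernel_state j (r x `^ (2 * sigma)) i.+1).2) = (fun x =>
    - (((q x).2 + (delta + tau) * (r x `^ (2 * sigma)) * (q x).1.2 + r x `^ (2 * sigma) * (q x).1.1) / tau)) by [].
apply: measurableT_comp => //; apply: measurable_funM => //.
apply: measurable_funD; last exact: measurable_funM.
apply: measurable_funD => //; apply: measurable_funM => //; exact: measurable_funM.
Qed.

(* High frequencies at [lambda = 1]; the algebraic gain in [|xi|] of the last kernel is discarded. *)
Lemma jmgt_kernel_decay N0 : high_frequency tau delta sigma N0 -> 0 < sigma ->
  exists c M : R, [/\ 0 < c, 0 <= M & forall r t, N0 <= r -> 0 <= t ->
    [/\ `|derive1n 1 (jmgt_kernel tau delta sigma 0 1 r) t| <= M * expR (- (c * t)),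
        `|derive1n 1 (jmgt_kernel tau delta sigma 1 1 r) t| <= M * expR (- (c * t)),
        `|derive1n 1 (jmgt_kernel tau delta sigma 2 1 r) t| <= M * expR (- (c * t)) &
        `|derive1n 2 (jmgt_kernel tau delta sigma 2 1 r) t| <= M * expR (- (c * t))]].
Proof.
move=> [N00 _ [c [M [c0 M0 H]]]] s0.
(* The factor 1 + N0^(-sigma) covers both the kernels bounded by M and the one bounded by M
   r^(-sigma) <= M N0^(-sigma). *)
exists c, (M * (1 + N0 `^ (- sigma))); split => //.
  by rewrite mulr_ge0 ?addr_ge0 ?powR_ge0// ltW.
move=> r t Nr t0; have [|h1 h2] := H 1 r t ltr01 _ t0; first by rewrite mulr1.
rewrite mulNr in h1 h2.
have e0 := expR_ge0 (- (c * t)).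
have le1 : M * expR (- (c * t)) <= M * (1 + N0 `^ (- sigma)) * expR (- (c * t)).
  by rewrite ler_wpM2r// ler_peMr ?(ltW M0)// lerDl powR_ge0.
have a0 := normr_ge0 (derive1n 1 (jmgt_kernel tau delta sigma 0 1 r) t).
have a1 := normr_ge0 (derive1n 1 (jmgt_kernel tau delta sigma 1 1 r) t).
have a2 := normr_ge0 (derive1n 2 (jmgt_kernel tau delta sigma 2 1 r) t).
split; [apply: le_trans le1; lra|apply: le_trans le1; lra| |apply: le_trans le1; lra].
apply: le_trans h2 _; rewrite powR1 mulr1 ler_wpM2r// ler_wpM2l ?(ltW M0)//.
rewrite (@le_trans _ _ (N0 `^ (- sigma)))// ?lerDr//.
rewrite !powRN lef_pV2 ?posrE ?powR_gt0//; last exact: lt_le_trans Nr.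
by apply: ge0_ler_powR; rewrite ?nnegrE ?(ltW s0) ?(ltW N00)// (le_trans (ltW N00)).
Qed.

End kernel_series.

(** * Convolution on the octant *)

Section octants.
Context {R : realType} {n : nat}.
Local Notation V := 'rV[R]_n.

Lemma octant_geD (N : R) (x y : V) : octant_ge N x -> octant_ge N y -> octant_ge N (x + y).
Proof.
move=> [x0 Nx] [y0 _]; split.
  by move=> i; rewrite mxE addr_ge0.
apply: le_trans Nx _; rewrite [`|x|]/Num.Def.normr/= mx_normrE.
apply/bigmax_leP; split => /=; first exact: normr_ge0.
move=> [i j] _; rewrite ord1 /=.
have h : `|(x + y) 0 j| <= `|x + y|.
  rewrite [`|x + y|]/Num.Def.normr/= mx_normrE.
  exact: (le_bigmax _ (fun ij : 'I_1 * 'I_n => `|(x + y) ij.1 ij.2|) (0, j)).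
apply: le_trans h; rewrite mxE !ger0_norm ?addr_ge0// lerDl; exact: y0.
Qed.

Lemma octant_ge_norm1 (N : R) (x : V) : octant_ge N x -> N <= norm1 x.
Proof. by move=> [_ Nx]; exact: le_trans Nx (normr_le_norm1 x). Qed.

Lemma octant_ge_mul0 (K : pzSemiRingType) (N : R) (f : V -> K) (x y : V) :
  (forall x, ~ octant_ge N x -> f x = 0) -> ~ octant_ge N x -> f (x - y) * f y = 0.
Proof.
move=> f0 Nx; have [Ny|/f0->] := pselect (octant_ge N y); last by rewrite mulr0.
have [Nxy|/f0->] := pselect (octant_ge N (x - y)); last by rewrite mul0r.
by case: Nx; rewrite -(subrK y x); exact: octant_geD.
Qed.

(* A convolution at [x] only sees the values at points of norm at most [norm1 x - N],
   because [norm1] is additive on the octant. *)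
Lemma octant_ge_local (K : pzSemiRingType) (N r : R) (f g : V -> K) (x y : V) :
  (forall x, ~ octant_ge N x -> f x = 0) -> (forall x, ~ octant_ge N x -> g x = 0) ->
  (norm1 y < r -> f y = g y) -> (norm1 (x - y) < r -> f (x - y) = g (x - y)) -> norm1 x < r + N ->
  f (x - y) * f y = g (x - y) * g y.
Proof.
move=> f0 g0 fgy fgx xr.
have [Ny|Ny] := pselect (octant_ge N y); last by rewrite (f0 y)// (g0 y)// !mulr0.
have [Nxy|Nxy] := pselect (octant_ge N (x - y)); last by rewrite (f0 (x - y))// (g0 (x - y))// !mul0r.
have := norm1_octantD Nxy.1 Ny.1; rewrite subrK => E.
have := octant_ge_norm1 Nxy; have := octant_ge_norm1 Ny => h1 h2.
by rewrite fgy ?fgx//; lra.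
Qed.

End octants.

Section self_convolution.
Context {R : realType} {n : nat}.
Local Notation V := 'rV[R]_n.
Local Notation leb := (@lebesgue_rV R n).

(** Extended-real, so that the integral identities below hold with no prior finiteness; [rconv_le]
    supplies finiteness when [A] is in L^2. *)
Definition rconv (A : V -> R) (x : V) : \bar R := (\int[leb]_y (A (x - y) * A y)%:E)%E.

Definition conv (f : V -> R[i]) (x : V) : R[i] :=
  cintegral leb setT (fun y => f (x - y) * f y).

Lemma measurable_rVBx (x : V) : measurable_fun setT (fun y : V => x - y).
Proof. by apply: measurable_rVB => //; exact: measurable_cst. Qed.

Section rconv.
Variable A : V -> R.
Hypothesis mA : measurable_fun setT A.
Hypothesis A0 : forall x, 0 <= A x.

Lemma rconv_ge0 x : (0 <= rconv A x)%E.
Proof. by apply: integral_ge0 => y _; rewrite lee_fin mulr_ge0. Qed.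

Let mAB (x : V) : measurable_fun setT (fun y : V => A (x - y)).
Proof. exact: (measurableT_comp mA (measurable_rVBx x)). Qed.

(** A product is at most half the sum of the squares, and the integral is invariant under y -> x -
    y. *)
Lemma rconv_le x : (rconv A x <= \int[leb]_y (A y ^+ 2)%:E)%E.
Proof.
apply: (@le_trans _ _ (\int[leb]_y ((A (x - y) ^+ 2 / 2)%:E + (A y ^+ 2 / 2)%:E))%E).
  apply: ge0_le_integral_any => y _; first by rewrite lee_fin mulr_ge0.
  rewrite -EFinD lee_fin; have := sqr_ge0 (A (x - y) - A y); rewrite sqrrB; lra.
have q0 y : (0 <= (A y ^+ 2 / 2)%:E)%E by rewrite lee_fin divr_ge0 ?sqr_ge0.
have mq : measurable_fun setT (fun y => (A y ^+ 2 / 2)%:E).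
  by apply/measurable_EFinP; apply: measurable_funM => //; exact: measurable_funX.
rewrite ge0_integralD//; last first.
  exact: (measurableT_comp mq (measurable_rVBx x)).
rewrite (@ge0_integral_reflect _ _ x (fun y => (A y ^+ 2 / 2)%:E))// -ge0_integralD//.
apply: ge0_le_integral_any => y _; first by rewrite adde_ge0.
by rewrite -EFinD -splitr.
Qed.

Let mK : measurable_fun setT (fun p : V * V => (A (p.1 - p.2) * A p.2)%:E).
Proof.
apply/measurable_EFinP; apply: measurable_funM; last exact: (measurableT_comp mA measurable_snd).
apply: (measurableT_comp mA); exact: measurable_rVB.
Qed.

Lemma measurable_rconv : measurable_fun setT (rconv A).
Proof. exact: (measurable_fubini_integral leb mK). Qed.

Lemma integral_rconv : (\int[leb]_x rconv A x = (\int[leb]_y (A y)%:E) * (\int[leb]_y (A y)%:E))%E.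
Proof.
have K0 p : (0 <= (A (p.1 - p.2) * A p.2)%:E)%E by rewrite lee_fin mulr_ge0.
have F := fubini_tonelli (fun p : V * V => (A (p.1 - p.2) * A p.2)%:E) mK K0.
have -> : (\int[leb]_x rconv A x = \int[leb]_y \int[leb]_x (A (x - y) * A y)%:E)%E by exact: F.
have mE : measurable_fun setT (fun x => (A x)%:E) by exact/measurable_EFinP.
have Ae0 x : (0 <= (A x)%:E)%E by rewrite lee_fin.
rewrite -ge0_integralZl//; last by apply: integral_ge0.
apply: eq_integral => y _.
under eq_integral do rewrite EFinM.
rewrite ge0_integralZr//; last first.
  apply: (measurableT_comp mE); apply: measurable_rVB => //; exact: measurable_cst.
congr (_ * _)%E; under eq_integral do rewrite addrC.
exact: (@ge0_integral_shift _ _ (- y) (fun x => (A x)%:E)).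
Qed.

(** The self-convolution is at most q everywhere and has integral at most r^2. *)
Lemma integral_sqr_rconv (q r : R) : (\int[leb]_y (A y ^+ 2)%:E <= q%:E)%E ->
  (\int[leb]_y (A y)%:E <= r%:E)%E ->
  (\int[leb]_x (fine (rconv A x) ^+ 2)%:E <= (q * r ^+ 2)%:E)%E.
Proof.
move=> Aq Ar.
have r0 : 0 <= r by rewrite -lee_fin (le_trans _ Ar)// integral_ge0// => y _; rewrite lee_fin.
have q0 : 0 <= q by rewrite -lee_fin (le_trans _ Aq)// integral_ge0// => y _; rewrite lee_fin sqr_ge0.
have cq x : (rconv A x <= q%:E)%E by exact: le_trans (rconv_le x) Aq.
have cf x : rconv A x \is a fin_num.
  by rewrite ge0_fin_numE ?rconv_ge0// (le_lt_trans (cq x))// ltry.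
apply: (@le_trans _ _ (\int[leb]_x (q%:E * rconv A x))%E).
  apply: ge0_le_integral_any => x _; first by rewrite lee_fin sqr_ge0.
  rewrite expr2 EFinM fineK//; apply: lee_pmul; rewrite ?rconv_ge0//.
rewrite ge0_integralZl//; [|exact: measurable_rconv|by move=> x _; exact: rconv_ge0].
rewrite integral_rconv expr2 EFinM; apply: lee_pmul => //.
- by apply: mule_ge0; apply: integral_ge0 => y _; rewrite lee_fin.
- by rewrite EFinM; apply: lee_pmul => //; apply: integral_ge0 => y _; rewrite lee_fin.
Qed.

End rconv.

Lemma eq_conv (f g : V -> R[i]) x : cmeasurable setT f -> cmeasurable setT g ->
  {ae leb, forall y, f y = g y} -> conv f x = conv g x.
Proof.
move=> mf mg fg; have m := measurable_rVBx x.
apply: ae_eq_cintegral => //.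
- by apply: cmeasurableM => //; exact: (cmeasurable_comp mf m).
- by apply: cmeasurableM => //; exact: (cmeasurable_comp mg m).
- by apply: filterS2 fg (ae_reflect x fg) => y -> -> _.
Qed.

Lemma cmeasurable_conv dT (T : measurableType dT) (f : T * V -> R[i]) :
  cmeasurable setT f -> cmeasurable setT (fun p : T * V => conv (fun y => f (p.1, y)) p.2).
Proof.
move=> mf; apply: (cmeasurable_cintegral leb
  (f := fun q : (T * V) * V => f (q.1.1, q.1.2 - q.2) * f (q.1.1, q.2))).
have m11 : measurable_fun setT (fun q : (T * V) * V => q.1.1).
  exact: (measurableT_comp measurable_fst measurable_fst).
have m12 : measurable_fun setT (fun q : (T * V) * V => q.1.2).
  exact: (measurableT_comp measurable_snd measurable_fst).
apply: cmeasurableM; apply: (cmeasurable_comp mf); apply: measurable_fun_pair => //.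
exact: measurable_rVB.
Qed.

Lemma cabs_conv_le (f : V -> R[i]) (A : V -> R) x : cmeasurable setT f ->
  (forall y, cabs (f y) <= A y) -> ((cabs (conv f x))%:E <= rconv A x)%E.
Proof.
move=> mf fA; apply: le_trans (le_cabs_cintegral leb measurableT _) _.
  by apply: cmeasurableM => //; exact: (cmeasurable_comp mf (measurable_rVBx x)).
apply: ge0_le_integral_any => y _; first by rewrite lee_fin cabs_ge0.
by rewrite lee_fin cabsM ler_pM ?cabs_ge0.
Qed.

(* On the octant [norm1] is additive, so the weight factors out of the convolution. *)
Lemma conv_weight (N b : R) (f : V -> R[i]) x : (forall y, ~ octant_ge N y -> f y = 0) ->
  cintegrable leb setT (fun y => f (x - y) * f y) ->
  conv (fun y => (expR (b * norm1 y))%:C * f y) x = (expR (b * norm1 x))%:C * conv f x.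
Proof.
move=> f0 fi; rewrite /conv -cintegralZ//; apply: eq_cintegral => y _.
have [Ny|Ny] := pselect (octant_ge N y); last by rewrite (f0 y)// !mulr0.
have [Nxy|Nxy] := pselect (octant_ge N (x - y)); last by rewrite (f0 (x - y))// mulr0 !mul0r mulr0.
have := norm1_octantD Nxy.1 Ny.1; rewrite subrK => E.
by rewrite E mulrDr expRD rmorphM/=; ring.
Qed.

End self_convolution.

(** * Scalar majorant iteration *)

Section majorant.
Context {R : realType} {n : nat}.
Local Notation V := 'rV[R]_n.
Local Notation leb := (@lebesgue_rV R n).
Variables (N C e q : R) (a : V -> R).
Hypotheses (N0 : 0 < N) (C0 : 0 <= C) (Ce : 4 * C * e <= 1).
Hypothesis ma : measurable_fun setT a.
Hypothesis a0 : forall x, 0 <= a x.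
Hypothesis aN : forall x, ~ octant_ge N x -> a x = 0.
Hypothesis ae_ : (\int[leb]_x (a x)%:E <= e%:E)%E.
Hypothesis aq : (\int[leb]_x (a x ^+ 2)%:E <= q%:E)%E.

(** The iteration A -> a + C (A convolved with itself) from 0. Times e^(-c t), its m-th term
    dominates the m-th Picard iterate, with C the constant of the Duhamel integral. *)
Fixpoint maj (m : nat) : V -> R :=
  if m is m'.+1 then fun x => a x + C * fine (rconv (maj m') x) else fun=> 0.

(** The condition 4 C e <= 1 makes both bounds reproduce themselves: e + C (2 e)^2 <= 2 e in L^1,
    and, since (x + y)^2 <= 2 x^2 + 2 y^2, 2 q + 2 C^2 (4 q) (2 e)^2 <= 4 q for the square of the
    L^2 norm. *)
Lemma majP m : [/\ measurable_fun setT (maj m), forall x, 0 <= maj m x,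
  forall x, ~ octant_ge N x -> maj m x = 0,
  (\int[leb]_x (maj m x)%:E <= (2 * e)%:E)%E &
  (\int[leb]_x (maj m x ^+ 2)%:E <= (4 * q)%:E)%E].
Proof.
have e0 : 0 <= e by rewrite -lee_fin (le_trans _ ae_)// integral_ge0// => y _; rewrite lee_fin.
have q0 : 0 <= q by rewrite -lee_fin (le_trans _ aq)// integral_ge0// => y _; rewrite lee_fin sqr_ge0.
elim: m => [|m [mA A0 AN Ae Aq]] /=.
  split => //.
  - by rewrite integral0 lee_fin mulr_ge0.
  - by under eq_integral do rewrite expr0n/=; rewrite integral0 lee_fin mulr_ge0.
set A := maj m in mA A0 AN Ae Aq *.
have mr := measurable_rconv mA.
have mf : measurable_fun setT (fun x => fine (rconv A x)) by exact: measurableT_comp.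
have f0 x : 0 <= fine (rconv A x) by rewrite fine_ge0// rconv_ge0.
have cf x : rconv A x \is a fin_num.
  by rewrite ge0_fin_numE ?rconv_ge0// (le_lt_trans (rconv_le mA A0 x))// (le_lt_trans Aq)// ltry.
split.
- by apply: measurable_funD => //; exact: measurable_funM.
- by move=> x; rewrite addr_ge0// mulr_ge0.
- move=> x Nx; rewrite aN// add0r /rconv.
  under eq_integral do rewrite (octant_ge_mul0 _ AN Nx).
  by rewrite integral0 mulr0.
- under eq_integral do rewrite EFinD EFinM.
  rewrite ge0_integralD//; last 4 first.
  + by move=> x _; rewrite lee_fin.
  + exact/measurable_EFinP.
  + by move=> x _; rewrite -EFinM lee_fin mulr_ge0.
  + by apply/measurable_EFinP; exact: measurable_funM.
  rewrite ge0_integralZl_EFin//; last 2 first.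
  + by move=> x _; rewrite lee_fin.
  + exact/measurable_EFinP.
  have -> : (\int[leb]_x (fine (rconv A x))%:E = \int[leb]_x rconv A x)%E.
    by apply: eq_integral => x _; rewrite fineK.
  rewrite integral_rconv//.
  apply: (@le_trans _ _ (e%:E + C%:E * ((2 * e)%:E * (2 * e)%:E))%E).
    apply: leeD => //; apply: lee_pmul => //.
      by apply: mule_ge0; apply: integral_ge0 => y _; rewrite lee_fin.
    by apply: lee_pmul => //; apply: integral_ge0 => y _; rewrite lee_fin.
  rewrite -!EFinM -EFinD lee_fin; have := ler_wpM2r e0 Ce; lra.
- apply: (@le_trans _ _ (\int[leb]_x ((2 * a x ^+ 2)%:E + (2 * C ^+ 2 * fine (rconv A x) ^+ 2)%:E))%E).
    apply: ge0_le_integral_any => x _; first by rewrite lee_fin sqr_ge0.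
    rewrite -EFinD lee_fin; have := sqr_ge0 (a x - C * fine (rconv A x)).
    rewrite sqrrB sqrrD exprMn; lra.
  have ms : measurable_fun setT (fun x => (a x ^+ 2)%:E).
    by apply/measurable_EFinP; exact: measurable_funX.
  have mfs : measurable_fun setT (fun x => (fine (rconv A x) ^+ 2)%:E).
    by apply/measurable_EFinP; exact: measurable_funX.
  have s0 x : (0 <= (a x ^+ 2)%:E)%E by rewrite lee_fin sqr_ge0.
  have fs0 x : (0 <= (fine (rconv A x) ^+ 2)%:E)%E by rewrite lee_fin sqr_ge0.
  under eq_integral do rewrite (EFinM 2) (EFinM (2 * C ^+ 2)).
  have C20 : 0 <= 2 * C ^+ 2 by rewrite mulr_ge0 ?sqr_ge0.
  rewrite ge0_integralD//; last 4 first.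
  + by move=> x _; rewrite mule_ge0.
  + exact: measurable_funeM.
  + by move=> x _; rewrite mule_ge0// lee_fin.
  + exact: measurable_funeM.
  rewrite !ge0_integralZl_EFin//.
  apply: (@le_trans _ _ ((2 : R)%:E * q%:E + (2 * C ^+ 2)%:E * (4 * q * (2 * e) ^+ 2)%:E)%E).
    apply: leeD; apply: lee_pmul; rewrite ?lee_fin ?integral_ge0//.
    exact: integral_sqr_rconv.
  rewrite -!EFinM -EFinD lee_fin.
  have h : (4 * C * e) ^+ 2 <= 1 by rewrite expr_le1// !mulr_ge0.
  have := ler_wpM2l q0 h; rewrite mulr1 !exprMn; lra.
Qed.

Lemma maj_stable m x : norm1 x < m%:R * N -> maj m.+1 x = maj m x.
Proof.
elim: m x => [|m IH] x xm; first by move: xm; rewrite mul0r ltNge norm1_ge0.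
rewrite [LHS]/= [RHS]/=; congr (_ + C * fine _); apply: eq_integral => y _.
have [_ _ h1 _ _] := majP m.+1; have [_ _ h2 _ _] := majP m.
congr EFin; apply: (octant_ge_local (y := y) h1 h2 (IH y) (IH (x - y))).
by move: xm; rewrite -natr1 mulrDl mul1r.
Qed.

Lemma maj_stableD m k x : norm1 x < m%:R * N -> maj (m + k) x = maj m x.
Proof.
move=> xm; elim: k => [|k IH]; first by rewrite addn0.
rewrite addnS maj_stable// (lt_le_trans xm)// ler_wpM2r ?(ltW N0)// ler_nat.
exact: leq_addr.
Qed.

End majorant.

Section fatou_bound.
Context d (T : measurableType d) (R : realType) (mu : {measure set T -> \bar R}).

(** Fatou's lemma for sequences that are eventually constant at each point, as the iterates are. *)
Lemma le_integral_near_cst (f : nat -> T -> \bar R) (g : T -> \bar R) (M : \bar R) :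
  (forall m, measurable_fun setT (f m)) -> (forall m x, (0 <= f m x)%E) ->
  (forall x, \forall m \near \oo, f m x = g x) ->
  (forall m, (\int[mu]_x f m x <= M)%E) -> (\int[mu]_x g x <= M)%E.
Proof.
move=> mf f0 fg fM; have f0' k x : setT x -> (0 <= f k x)%E by [].
have := @fatou _ _ _ mu setT measurableT f mf f0'.
have -> : (fun x => limn_einf (f^~ x)) = g.
  apply/funext => x; have c : f^~ x @ \oo --> g x.
    by apply: cvg_near_cst; exact: fg.
  by rewrite is_cvg_limn_einfE; [exact/cvg_lim|apply: cvgP c].
move=> h; apply: le_trans h _.
rewrite limn_einf_lim; apply: lime_le; first exact: is_cvg_einfs.
apply: nearW => k; apply: (@le_trans _ _ (\int[mu]_x f k x)%E) => //.
by apply: ereal_inf_lbound; exists k => /=.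
Qed.

End fatou_bound.

Definition ccvg {R : realType} (u : nat -> R[i]) (z : R[i]) :=
  (fun k => complex.Re (u k)) @ \oo --> complex.Re z /\
  (fun k => complex.Im (u k)) @ \oo --> complex.Im z.

(** * Picard iteration *)

Section duhamel.
Context {R : realType} {n : nat}.
Local Notation V := 'rV[R]_n.
Local Notation leb := (@lebesgue_rV R n).
Local Notation mu := (@lebesgue_measure R).

Lemma rconvZ (s : R) (A : V -> R) x : measurable_fun setT A -> (forall y, 0 <= A y) ->
  rconv (fun y => s * A y) x = ((s ^+ 2)%:E * rconv A x)%E.
Proof.
move=> mA A0; rewrite /rconv -ge0_integralZl_EFin ?sqr_ge0//.
- by apply: eq_integral => y _; rewrite -EFinM; congr EFin; ring.
- by move=> y _; rewrite lee_fin mulr_ge0.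
- apply/measurable_EFinP; apply: measurable_funM => //.
  exact: (measurableT_comp mA (measurable_rVBx x)).
Qed.

(** The indicator of [0, t] as a numerical factor: Duhamel integrals then run over the whole line,
    and joint measurability and Fubini apply to a fixed domain. *)
Definition window (t th : R) : R := (0 <= th)%R%:R * (th <= t)%R%:R.

Lemma measurable_natb dT (T : measurableType dT) (b : T -> bool) : measurable_fun setT b ->
  measurable_fun setT (fun x => (b x)%:R : R).
Proof.
move=> mb; have -> : (fun x => (b x)%:R : R) = (fun x => if b x then 1 else 0).
  by apply/funext => x; case: (b x).
exact: measurable_fun_ifT.
Qed.

Lemma measurable_window dT (T : measurableType dT) (f g : T -> R) :
  measurable_fun setT f -> measurable_fun setT g ->
  measurable_fun setT (fun x => window (f x) (g x)).
Proof.
by move=> mf mg; apply: measurable_funM; apply: measurable_natb; exact: measurable_fun_ler.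
Qed.

Lemma window_ge0 t th : 0 <= window t th.
Proof. by rewrite mulr_ge0. Qed.

Lemma window_neq0 t th : window t th != 0 -> 0 <= th <= t.
Proof.
rewrite /window; case: (0 <= th) => /=; last by rewrite mul0r eqxx.
by case: (th <= t) => //; rewrite mulr0 eqxx.
Qed.

Lemma windowE t th : window t th = \1_(`[0, t]%classic) th.
Proof.
rewrite /window indicE mem_setE in_itv/=.
by case: (0 <= th); case: (th <= t); rewrite ?mulr1 ?mulr0 ?mul0r.
Qed.

Lemma integral_window_exp (c t : R) : 0 < c ->
  (\int[mu]_th (window t th * expR (- (c * th)))%:E <= (c^-1)%:E)%E.
Proof.
move=> c0; apply: (@le_trans _ _ (\int[mu]_th ((c^-1)%:E * (exponential_pdf c th)%:E))%E).
  apply: ge0_le_integral_any => th _; first by rewrite lee_fin mulr_ge0 ?window_ge0 ?expR_ge0.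
  rewrite -EFinM lee_fin /exponential_pdf patchE /window.
  have [th0|th0] := leP 0 th; last first.
    rewrite !mul0r mulr_ge0 ?invr_ge0 ?(ltW c0)//; case: ifP => // _.
    by rewrite mulr_ge0 ?expR_ge0// ltW.
  rewrite ifT; last by rewrite inE/= in_itv/= th0.
  rewrite mulrA mulVf ?gt_eqF// mul1r mulNr mul1r ler_piMl ?expR_ge0//.
  by case: (th <= t).
rewrite ge0_integralZl_EFin ?invr_ge0 ?(ltW c0)//.
- by rewrite integral_exponential_pdf// mule1.
- by move=> x _; rewrite lee_fin exponential_pdf_ge0// ltW.
- by apply/measurable_EFinP; exact: measurable_exponential_pdf.
Qed.

Lemma integrable_window (t K : R) :
  mu.-integrable setT (EFin \o (fun th => window t th * K)).
Proof.
apply/integrableP; split.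
  apply/measurable_EFinP; apply: measurable_funM => //; exact: measurable_window.
apply: (@le_lt_trans _ _ (\int[mu]_th (`|K|%:E * (\1_(`[0, t]%classic) th)%:E))%E).
  apply: ge0_le_integral_any => th _ //.
  by rewrite /= normrM (ger0_norm (window_ge0 _ _)) windowE -EFinM mulrC.
rewrite ge0_integralZl_EFin//.
- apply: lte_mul_pinfty => //; rewrite integral_indic// setIT.
  have fin : (lebesgue_measure (`[0%R, t]%classic : set R) < +oo)%E.
    by rewrite lebesgue_measure_itv/=; case: ifP => // _; rewrite -EFinB ltry.
  exact: fin.
- by apply/measurable_EFinP; exact: measurable_indic.
Qed.

Definition duhamel (k : R -> V -> R) (f : R -> V -> R[i]) (t : R) (x : V) : R[i] :=
  cintegral mu setT (fun th => (window t th * k (t - th) x)%:C * conv (f th) x).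

Section fixed_point.
Variables (N c M e q : R) (a : V -> R) (k : R -> V -> R) (l : R -> V -> R[i]).
Hypotheses (N0 : 0 < N) (c0 : 0 < c) (M0 : 0 <= M) (Ce : 4 * (M / c) * e <= 1).
Hypothesis ma : measurable_fun setT a.
Hypothesis a0 : forall x, 0 <= a x.
Hypothesis aN : forall x, ~ octant_ge N x -> a x = 0.
Hypothesis ae_ : (\int[leb]_x (a x)%:E <= e%:E)%E.
Hypothesis aq : (\int[leb]_x (a x ^+ 2)%:E <= q%:E)%E.
Hypothesis mk : measurable_fun setT (fun p : R * V => k p.1 p.2).
Hypothesis kb : forall t x, 0 <= t -> octant_ge N x -> `|k t x| <= M * expR (- (c * t)).
Hypothesis kc : forall x, continuous (k ^~ x).
Hypothesis ml : cmeasurable setT (fun p : R * V => l p.1 p.2).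
Hypothesis lN : forall t x, ~ octant_ge N x -> l t x = 0.
Hypothesis lb : forall t x, 0 <= t -> cabs (l t x) <= expR (- (c * t)) * a x.
Hypothesis lc : forall x t (u : nat -> R), u @ \oo --> t -> ccvg (fun j => l (u j) x) (l t x).

Let Mc0 : 0 <= M / c. Proof. by rewrite divr_ge0// ltW. Qed.

Local Notation A := (maj (M / c) a).
Let AP := majP Mc0 Ce ma a0 aN ae_ aq.

Fixpoint picard (m : nat) : R -> V -> R[i] :=
  if m is m'.+1 then fun t x => l t x + duhamel k (picard m') t x else fun _ _ => 0.

Lemma cmeasurable_slice (f : R -> V -> R[i]) t : cmeasurable setT (fun p : R * V => f p.1 p.2) ->
  cmeasurable setT (f t).
Proof.
move=> mf; apply: (cmeasurable_comp mf (g := fun x => (t, x))).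
exact: measurable_fun_pair.
Qed.

Lemma cmeasurable_duhamel_integrand dT (T : measurableType dT) (f : R -> V -> R[i])
    (t th : T -> R) (x : T -> V) : cmeasurable setT (fun p : R * V => f p.1 p.2) ->
  measurable_fun setT t -> measurable_fun setT th -> measurable_fun setT x ->
  cmeasurable setT (fun p => (window (t p) (th p) * k (t p - th p) (x p))%:C * conv (f (th p)) (x p)).
Proof.
move=> mf mt mth mx; apply: cmeasurableM.
  apply: cmeasurable_real; apply: measurable_funM; first exact: measurable_window.
  apply: (measurableT_comp mk (g := fun p => (t p - th p, x p))).
  by apply: measurable_fun_pair => //; exact: measurable_funB.
apply: (cmeasurable_comp (cmeasurable_conv mf) (g := fun p => (th p, x p))).
exact: measurable_fun_pair.
Qed.

Lemma cmeasurable_duhamel f : cmeasurable setT (fun p : R * V => f p.1 p.2) ->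
  cmeasurable setT (fun p : R * V => duhamel k f p.1 p.2).
Proof.
move=> mf.
apply: (cmeasurable_cintegral mu (f := fun q : (R * V) * R =>
  (window q.1.1 q.2 * k (q.1.1 - q.2) q.1.2)%:C * conv (f q.2) q.1.2)).
apply: cmeasurable_duhamel_integrand => //.
- exact: (measurableT_comp measurable_fst measurable_fst).
- exact: (measurableT_comp measurable_snd measurable_fst).
Qed.

Lemma conv_octant0 (f : V -> R[i]) x : (forall y, ~ octant_ge N y -> f y = 0) ->
  ~ octant_ge N x -> conv f x = 0.
Proof.
move=> f0 Nx; rewrite -[RHS](cintegral0 leb setT).
by apply: eq_cintegral => y _; rewrite (octant_ge_mul0 _ f0 Nx).
Qed.

Lemma duhamel_octant0 f t x : (forall th y, ~ octant_ge N y -> f th y = 0) ->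
  ~ octant_ge N x -> duhamel k f t x = 0.
Proof.
move=> f0 Nx; rewrite -[RHS](cintegral0 mu setT).
by apply: eq_cintegral => th _; rewrite (conv_octant0 (f0 th) Nx) mulr0.
Qed.

Lemma cabs_conv_decay (f : R -> V -> R[i]) (B : V -> R) x th :
  cmeasurable setT (fun p : R * V => f p.1 p.2) ->
  measurable_fun setT B -> (forall y, 0 <= B y) -> rconv B x \is a fin_num ->
  (forall y, cabs (f th y) <= expR (- (c * th)) * B y) ->
  cabs (conv (f th) x) <= expR (- (2 * c * th)) * fine (rconv B x).
Proof.
move=> mf mB B0 Bf fB.
have := cabs_conv_le x (cmeasurable_slice th mf) fB.
rewrite rconvZ// -(fineK Bf) -EFinM lee_fin -expRM_natl => h; apply: le_trans h _.
by rewrite ler_wpM2r ?fine_ge0 ?rconv_ge0// ler_expR -mulr_natl; lra.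
Qed.

(** The quadratic term decays like e^(-2 c theta); against e^(-c (t - theta)) this leaves e^(-c t)
    e^(-c theta), and the integral in theta costs 1 / c. Hence the constant M / c with no loss in
    the rate of decay. *)
Lemma cabs_duhamel_le f (B : V -> R) t x : 0 <= t ->
  cmeasurable setT (fun p : R * V => f p.1 p.2) ->
  (forall th y, ~ octant_ge N y -> f th y = 0) ->
  measurable_fun setT B -> (forall y, 0 <= B y) -> rconv B x \is a fin_num ->
  (forall th y, 0 <= th -> cabs (f th y) <= expR (- (c * th)) * B y) ->
  cabs (duhamel k f t x) <= expR (- (c * t)) * (M / c * fine (rconv B x)).
Proof.
move=> t0 mf f0 mB B0 Bf fB.
have [Nx|Nx] := pselect (octant_ge N x); last first.
  by rewrite duhamel_octant0// cabs0 !mulr_ge0 ?expR_ge0 ?fine_ge0 ?rconv_ge0// invr_ge0 ltW.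
have mI : cmeasurable setT (fun th => (window t th * k (t - th) x)%:C * conv (f th) x).
  by apply: (cmeasurable_duhamel_integrand mf).
rewrite -lee_fin; apply: le_trans (le_cabs_cintegral mu measurableT mI) _.
set r := fine (rconv B x); have r0 : 0 <= r by rewrite fine_ge0// rconv_ge0.
apply: (@le_trans _ _ (\int[mu]_th ((expR (- (c * t)) * (M * r))%:E * (window t th * expR (- (c * th)))%:E))%E).
  apply: ge0_le_integral_any => th _; first by rewrite lee_fin cabs_ge0.
  rewrite -EFinM lee_fin cabsM cabs_real normrM (ger0_norm (window_ge0 _ _)).
  have [->|/window_neq0/andP[th0 tht]] := eqVneq (window t th) 0.
    by rewrite !mul0r mulr0.
  have k1 : `|k (t - th) x| <= M * expR (- (c * (t - th))) by apply: kb; rewrite ?subr_ge0.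
  have k2 := cabs_conv_decay mf mB B0 Bf (fB th ^~ th0).
  apply: (@le_trans _ _ (window t th * (M * expR (- (c * (t - th)))) * (expR (- (2 * c * th)) * r))).
    by rewrite ler_pM ?mulr_ge0 ?cabs_ge0 ?window_ge0// ler_wpM2l// window_ge0.
  rewrite le_eqVlt; apply/orP; left; apply/eqP.
  have E : expR (- (c * (t - th))) * expR (- (2 * c * th)) = expR (- (c * t)) * expR (- (c * th)).
    by rewrite -!expRD; congr expR; ring.
  transitivity (window t th * M * r * (expR (- (c * (t - th))) * expR (- (2 * c * th)))); first by ring.
  by rewrite E; ring.
rewrite ge0_integralZl_EFin//; last 3 first.
- by move=> th _; rewrite lee_fin mulr_ge0 ?window_ge0 ?expR_ge0.
- apply/measurable_EFinP; apply: measurable_funM; first exact: measurable_window.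
  by apply: measurableT_comp => //; apply: measurableT_comp => //; exact: measurable_funM.
- by rewrite !mulr_ge0 ?expR_ge0.
apply: le_trans.
  apply: lee_pmul; [by rewrite lee_fin !mulr_ge0 ?expR_ge0| |exact: lexx|exact: integral_window_exp].
  by apply: integral_ge0 => th _; rewrite lee_fin mulr_ge0 ?window_ge0 ?expR_ge0.
by rewrite -EFinM lee_fin le_eqVlt; apply/orP; left; apply/eqP; ring.
Qed.

Lemma picardS m t x : picard m.+1 t x = l t x + duhamel k (picard m) t x.
Proof. by []. Qed.

Lemma eq_duhamel (f g : R -> V -> R[i]) t x :
  (forall th, conv (f th) x = conv (g th) x) -> duhamel k f t x = duhamel k g t x.
Proof. by move=> fg; apply: eq_cintegral => th _; rewrite fg. Qed.

Lemma picardP m : [/\ cmeasurable setT (fun p : R * V => picard m p.1 p.2),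
  forall t x, ~ octant_ge N x -> picard m t x = 0 &
  forall t x, 0 <= t -> cabs (picard m t x) <= expR (- (c * t)) * A m x].
Proof.
elim: m => [|m [mg g0 gb]].
  split; [exact: cmeasurable_cst|by []|].
  by move=> t x _; rewrite /picard/maj cabs0 mulr0.
have [mA A0 _ _ Aq] := AP m.
have Af x : rconv (A m) x \is a fin_num.
  by rewrite ge0_fin_numE ?rconv_ge0// (le_lt_trans (rconv_le mA A0 x))// (le_lt_trans Aq)// ltry.
split.
- by apply: cmeasurableD => //; exact: cmeasurable_duhamel.
- by move=> t x Nx; rewrite picardS lN// duhamel_octant0// addr0.
- move=> t x t0; rewrite picardS (le_trans (cabsD _ _))// [A m.+1 x]/= mulrDr lerD ?lb//.
  exact: cabs_duhamel_le.
Qed.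

Lemma eq_conv_local (f g : V -> R[i]) (r : R) x :
  (forall x, ~ octant_ge N x -> f x = 0) -> (forall x, ~ octant_ge N x -> g x = 0) ->
  (forall y, norm1 y < r -> f y = g y) -> norm1 x < r + N -> conv f x = conv g x.
Proof.
by move=> f0 g0 fg xr; apply: eq_cintegral => y _; exact: (octant_ge_local f0 g0 (fg y) (fg (x - y)) xr).
Qed.

Lemma picard_stable m t x : norm1 x < m%:R * N -> picard m.+1 t x = picard m t x.
Proof.
elim: m t x => [|m IH] t x xm; first by move: xm; rewrite mul0r ltNge norm1_ge0.
rewrite picardS (@eq_duhamel _ (picard m)) ?picardS// => th.
have [_ h1 _] := picardP m.+1; have [_ h2 _] := picardP m.
apply: (eq_conv_local (r := m%:R * N) (h1 th) (h2 th)); first exact: IH.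
by move: xm; rewrite -natr1 mulrDl mul1r.
Qed.

Lemma picard_stableD m j t x : norm1 x < m%:R * N -> picard (m + j) t x = picard m t x.
Proof.
move=> xm; elim: j => [|j IH]; first by rewrite addn0.
rewrite addnS picard_stable// (lt_le_trans xm)// ler_wpM2r ?(ltW N0)// ler_nat.
exact: leq_addr.
Qed.

(** An index from which the iterates no longer change at [x]; it depends on [x] alone, not on
    time. *)
Definition stab_index (x : V) : nat := (Num.truncn (norm1 x / N)).+1.

Lemma lt_stab_index x : norm1 x < (stab_index x)%:R * N.
Proof. by rewrite -ltr_pdivrMr// truncnS_gt. Qed.

Definition mild (t : R) (x : V) : R[i] := picard (stab_index x) t x.

Definition majlim (x : V) : R := A (stab_index x) x.

Lemma near_stab_index x : \forall m \near \oo, exists j, m = (stab_index x + j)%N.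
Proof. by exists (stab_index x) => // m /= h; exists (m - stab_index x)%N; rewrite subnKC. Qed.

Lemma near_mild t x : \forall m \near \oo, picard m t x = mild t x.
Proof.
apply: filterS (near_stab_index x) => _ [j ->].
exact/picard_stableD/lt_stab_index.
Qed.

Lemma near_majlim x : \forall m \near \oo, A m x = majlim x.
Proof.
apply: filterS (near_stab_index x) => _ [j ->].
exact: (maj_stableD N0 Mc0 Ce ma a0 aN ae_ aq _ (lt_stab_index x)).
Qed.

Lemma mild_eq m t x : norm1 x < m%:R * N -> picard m t x = mild t x.
Proof.
move=> xm; have [j _ /(_ (m + j)%N (leq_addl _ _))] := near_mild t x.
by rewrite /= picard_stableD.
Qed.

Lemma cmeasurable_mild : cmeasurable setT (fun p : R * V => mild p.1 p.2).
Proof.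
apply: (@cmeasurable_cvg _ _ _ setT (fun m (p : R * V) => picard m p.1 p.2)) => //.
- by move=> m; case: (picardP m).
- by move=> p _; apply: cvg_near_cst; apply: filterS (near_mild p.1 p.2) => m ->.
- by move=> p _; apply: cvg_near_cst; apply: filterS (near_mild p.1 p.2) => m ->.
Qed.

Lemma mild_octant0 t x : ~ octant_ge N x -> mild t x = 0.
Proof. by have [_ h _] := picardP (stab_index x); exact: h. Qed.

Lemma mild_bound t x : 0 <= t -> cabs (mild t x) <= expR (- (c * t)) * majlim x.
Proof. by have [_ _ h] := picardP (stab_index x); exact: h. Qed.

Lemma majlimP : [/\ measurable_fun setT majlim, forall x, 0 <= majlim x,
  (\int[leb]_x (majlim x)%:E <= (2 * e)%:E)%E &
  (\int[leb]_x (majlim x ^+ 2)%:E <= (4 * q)%:E)%E].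
Proof.
have mA m : measurable_fun setT (A m) by case: (AP m).
have A0 m x : 0 <= A m x by case: (AP m).
split.
- by apply: (@measurable_fun_cvg _ _ _ _ A) => // x _; apply: cvg_near_cst; exact: near_majlim.
- by move=> x; exact: A0.
- apply: (@le_integral_near_cst _ _ _ _ (fun m x => (A m x)%:E)).
  + by move=> m; exact/measurable_EFinP.
  + by move=> m x; rewrite lee_fin.
  + by move=> x; apply: filterS (near_majlim x) => m ->.
  + by move=> m; case: (AP m).
- apply: (@le_integral_near_cst _ _ _ _ (fun m x => (A m x ^+ 2)%:E)).
  + by move=> m; apply/measurable_EFinP; exact: measurable_funX.
  + by move=> m x; rewrite lee_fin sqr_ge0.
  + by move=> x; apply: filterS (near_majlim x) => m ->.
  + by move=> m; case: (AP m).
Qed.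

(** One further iterate gives the same value at [x], and its convolution only sees points where
    iterate number [stab_index x] already equals the limit. *)
Lemma mild_fixed_point t x : mild t x = l t x + duhamel k mild t x.
Proof.
rewrite -(mild_eq (m := (stab_index x).+1)); last first.
  by apply: lt_trans (lt_stab_index x) _; rewrite ltr_pM2r// ltr_nat.
have E th : conv (picard (stab_index x) th) x = conv (mild th) x.
  have [_ h _] := picardP (stab_index x).
  apply: (eq_conv_local (r := (stab_index x)%:R * N) (h th)).
  - by move=> y; exact: mild_octant0.
  - by move=> y; exact: mild_eq.
  - by apply: lt_trans (lt_stab_index x) _; rewrite ltrDl.
by move: (stab_index x) E => m E; rewrite picardS (eq_duhamel _ E).
Qed.

Lemma ccvg_mild (x : V) (t : R) (u : nat -> R) : 0 <= t -> (forall j, 0 <= u j) -> u @ \oo --> t ->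
  ccvg (fun j => mild (u j) x) (mild t x).
Proof.
move=> t0 u0 ut; have [mA A0 _ Aq] := majlimP.
have Af y : rconv majlim y \is a fin_num.
  by rewrite ge0_fin_numE ?rconv_ge0// (le_lt_trans (rconv_le mA A0 y))// (le_lt_trans Aq)// ltry.
suff [d1 d2] : ccvg (fun j => duhamel k mild (u j) x) (duhamel k mild t x).
  have [l1 l2] := lc x ut; rewrite /ccvg; split.
    under eq_fun do rewrite mild_fixed_point ReD.
    by rewrite mild_fixed_point ReD; exact: cvgD.
  under eq_fun do rewrite mild_fixed_point ImD.
  by rewrite mild_fixed_point ImD; exact: cvgD.
have [Nx|Nx] := pselect (octant_ge N x); last first.
  rewrite /ccvg (duhamel_octant0 _ mild_octant0 Nx).
  by split; under eq_fun do rewrite (duhamel_octant0 _ mild_octant0 Nx); exact: cvg_cst.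
have mI s : cmeasurable setT (fun th => (window s th * k (s - th) x)%:C * conv (mild th) x).
  by apply: (cmeasurable_duhamel_integrand cmeasurable_mild).
pose h := fun th => conv (mild th) x.
(* The factor [th != t] removes the only point where the window is discontinuous at s = t, so that
   the integrand converges everywhere; the point is a null set. *)
pose F s th := (window s th * k (s - th) x * (th != t)%:R)%:C * h th.
have mne : measurable_fun setT (fun th : R => (th != t)%:R : R).
  apply: measurable_natb; apply: measurable_neg; exact: measurable_fun_eqr.
have FE s : F s = fun th => ((th != t)%:R)%:C * ((window s th * k (s - th) x)%:C * h th).
  by apply/funext => th; rewrite /F rmorphM/=; ring.
have mF s : cmeasurable setT (F s).
  by rewrite FE; apply: cmeasurableM => //; exact: cmeasurable_real.
have DE s : duhamel k mild s x = cintegral mu setT (F s).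
  rewrite /duhamel; apply: (@ae_eq_cintegral _ _ _ mu setT measurableT _ _ (mI s) (mF s)).
  have : mu.-negligible [set t].
    by exists [set t]; split => //; rewrite lebesgue_measure_set1.
  apply: negligibleS => th /= /not_implyP[_]; rewrite FE => h1; apply: contrapT => tht.
  by apply: h1; have /eqP/negbTE -> : th <> t by []; rewrite mul1r.
have [T uT] : exists T, forall j, u j <= T.
  have cu : cvgn u by apply/cvg_ex; exists t.
  have [B [_ hB]] := cvg_seq_bounded cu.
  exists (B + 1) => j; apply: le_trans (ler_norm _) _.
  by apply: (hB (B + 1)) => //; rewrite ltrDl.
pose S := T.
have hb th : 0 <= th -> cabs (h th) <= fine (rconv majlim x).
  move=> th0; have := cabs_conv_decay cmeasurable_mild mA A0 (Af x) (fun y => @mild_bound th y th0).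
  move=> h1; apply: le_trans h1 _; rewrite ler_piMl ?fine_ge0 ?rconv_ge0//.
  by rewrite -[leRHS]expR0 ler_expR oppr_le0 !mulr_ge0// ltW.
have kM s : 0 <= s -> `|k s x| <= M.
  move=> s0; apply: le_trans (kb s0 Nx) _; rewrite ler_piMr//.
  by rewrite -[leRHS]expR0 ler_expR oppr_le0 mulr_ge0// ltW.
have r0 : 0 <= fine (rconv majlim x) by rewrite fine_ge0// rconv_ge0.
have Fb s th : s <= S -> cabs (F s th) <= window S th * (M * fine (rconv majlim x)).
  move=> sS; rewrite /F cabsM cabs_real normrM (normrM (window s th)) (ger0_norm (window_ge0 _ _)).
  have [->|/window_neq0/andP[th0 ths]] := eqVneq (window s th) 0.
    by rewrite !mul0r mulr_ge0 ?window_ge0// mulr_ge0.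
  have -> : window s th = 1 by rewrite /window th0 ths mulr1.
  have -> : window S th = 1 by rewrite /window th0 (le_trans ths sS) mulr1.
  rewrite !mul1r ler_pM ?cabs_ge0 ?hb// ?mulr_ge0//.
  apply: (@le_trans _ _ (`|k (s - th) x| * 1)); first by rewrite ler_wpM2l//; case: (th != t); rewrite ?normr1 ?normr0.
  by rewrite mulr1 kM// subr_ge0.
have iD := integrable_window S (M * fine (rconv majlim x)).
have Fc th : ccvg (fun j => F (u j) th) (F t th).
  have R1 : (fun j => window (u j) th * k (u j - th) x * (th != t)%:R) @ \oo -->
      window t th * k (t - th) x * (th != t)%:R.
    have [->|tht] := eqVneq th t.
      by rewrite mulr0; under eq_fun do rewrite mulr0; exact: cvg_cst.
    rewrite mulr1; under eq_fun do rewrite mulr1.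
    apply: cvgM.
      apply: cvg_near_cst; have [lt|gt|/eqP] := ltgtP th t; last by rewrite (negbTE tht).
        apply: (filterS _ (cvgr_gt _ ut _ lt)) => j hj.
        by rewrite /window (ltW lt) (ltW hj).
      apply: (filterS _ (cvgr_lt _ ut _ gt)) => j hj.
      by rewrite /window (lt_geF gt) (lt_geF hj).
    have uth : (fun j => u j - th) @ \oo --> t - th by apply: cvgB => //; exact: cvg_cst.
    have kct : k ^~ x @ (t - th) --> k (t - th) x := @kc x (t - th).
    exact: (@cvg_comp _ _ _ (fun j => u j - th) (k ^~ x) _ _ _ uth kct).
  rewrite /F; split.
    under eq_fun do rewrite ReM/= mul0r subr0.
    by rewrite ReM/= mul0r subr0; apply: cvgM => //; exact: cvg_cst.
  under eq_fun do rewrite ImM/= mul0r addr0.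
  by rewrite ImM/= mul0r addr0; apply: cvgM => //; exact: cvg_cst.
have [_ c1 c2] := @cdominated_convergence _ _ _ mu setT measurableT (fun j => F (u j)) (F t) _
  (fun j => mF (u j)) iD (fun j th _ => Fb (u j) th (uT j))
  (fun th _ => (Fc th).1) (fun th _ => (Fc th).2).
rewrite /ccvg DE; split; first by under eq_fun do rewrite DE.
by under eq_fun do rewrite DE.
Qed.

End fixed_point.

End duhamel.

(** * Weighted square integrability *)

Section weighted_squares.
Context {R : realType} {n : nat}.
Local Notation V := 'rV[R]_n.
Local Notation leb := (@lebesgue_rV R n).
Implicit Types (a : V -> R).

Lemma poweR_half_lty (x : \bar R) : (x `^ 2^-1 < +oo)%E -> (x < +oo)%E.
Proof.
by apply: lty_poweRy; rewrite invr_eq0.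
Qed.

Lemma EnormE (al s : R) (T : @functional R n) : regular (dual_fourier T) ->
  Enorm al s T = ((\int[leb]_x ((exp_weight al s x * cabs (hat T x)) ^+ 2)%:E) `^ 2^-1)%E.
Proof.
move=> rT; rewrite /Enorm /weighted_L2 asboolT// unlock; congr (_ `^ _)%E.
apply: eq_integral => x _; rewrite /= -/(hat T) ger0_norm; last first.
  by rewrite mulr_ge0 ?cabs_ge0// mulr_ge0 ?powR_ge0.
by rewrite powR_mulrn// mulr_ge0 ?cabs_ge0// mulr_ge0 ?powR_ge0.
Qed.

Lemma Enorm_lty (al s : R) (T : @functional R n) : (Enorm al s T < +oo)%E ->
  regular (dual_fourier T) /\
  (\int[leb]_x ((exp_weight al s x * cabs (hat T x)) ^+ 2)%:E < +oo)%E.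
Proof.
move=> h; have rT : regular (dual_fourier T).
  by apply: contrapT => nr; move: h; rewrite /Enorm /weighted_L2 asboolF.
by split => //; apply: poweR_half_lty; rewrite -EnormE.
Qed.

(** Nonnegative functions square integrable after exponential damping at some rate: one class for
    all the data, whatever the indices of their spaces. *)
Definition wsq a := [/\ measurable_fun setT a, forall x, 0 <= a x &
  exists2 b, 0 <= b & (\int[leb]_x ((a x * expR (- (b * norm1 x))) ^+ 2)%:E < +oo)%E].

Lemma measurable_wsq a b : measurable_fun setT a ->
  measurable_fun setT (fun x => ((a x * expR (- (b * norm1 x))) ^+ 2)%:E).
Proof.
move=> ma; apply/measurable_EFinP; apply: measurable_funX; apply: measurable_funM => //.
exact: measurable_expnorm1.
Qed.

Lemma wsq_mono a (b b' : R) : (forall x, 0 <= a x) -> b <= b' ->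
  (\int[leb]_x ((a x * expR (- (b * norm1 x))) ^+ 2)%:E < +oo)%E ->
  (\int[leb]_x ((a x * expR (- (b' * norm1 x))) ^+ 2)%:E < +oo)%E.
Proof.
move=> a0 bb'; apply: le_lt_trans; apply: ge0_le_integral_any => x _.
  by rewrite lee_fin sqr_ge0.
rewrite lee_fin ler_pXn2r// ?nnegrE ?mulr_ge0 ?expR_ge0// ler_wpM2l//.
by rewrite ler_expR lerN2 ler_wpM2r// norm1_ge0.
Qed.

Lemma wsqD a1 a2 : wsq a1 -> wsq a2 -> wsq (fun x => a1 x + a2 x).
Proof.
move=> [m1 p1 [b1 b10 i1]] [m2 p2 [b2 b20 i2]]; split.
- exact: measurable_funD.
- by move=> x; rewrite addr_ge0.
pose b := b1 + b2; exists b; first by rewrite addr_ge0.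
have {}i1 := wsq_mono p1 (_ : b1 <= b) i1; have {}i2 := wsq_mono p2 (_ : b2 <= b) i2.
apply: (@le_lt_trans _ _ (\int[leb]_x (2%:E * ((a1 x * expR (- (b * norm1 x))) ^+ 2)%:E +
    2%:E * ((a2 x * expR (- (b * norm1 x))) ^+ 2)%:E))%E).
  apply: ge0_le_integral_any => x _; first by rewrite lee_fin sqr_ge0.
  rewrite -!EFinM -EFinD lee_fin mulrDl.
  have := sqr_ge0 (a1 x * expR (- (b * norm1 x)) - a2 x * expR (- (b * norm1 x))).
  rewrite sqrrB sqrrD; lra.
have q0 a x : (0 <= ((a x * expR (- (b * norm1 x))) ^+ 2)%:E)%E by rewrite lee_fin sqr_ge0.
have mq a : measurable_fun setT a -> measurable_fun setT
    (fun x => ((a x * expR (- (b * norm1 x))) ^+ 2)%:E) by exact: measurable_wsq.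
rewrite ge0_integralD//; last 4 first.
- by move=> x _; rewrite mule_ge0.
- by apply: measurable_funeM; exact: mq.
- by move=> x _; rewrite mule_ge0.
- by apply: measurable_funeM; exact: mq.
rewrite !ge0_integralZl_EFin//; [|exact: mq|exact: mq].
by apply: lte_add_pinfty; apply: lte_mul_pinfty => //; [apply: i1|apply: i2]; rewrite ?lerDl ?lerDr.
Qed.

Lemma wsq_le a1 a2 : wsq a1 -> measurable_fun setT a2 -> (forall x, 0 <= a2 x <= a1 x) -> wsq a2.
Proof.
move=> [m1 p1 [b b0 i1]] m2 h; split => //; first by move=> x; case/andP: (h x).
exists b => //; apply: le_lt_trans i1; apply: ge0_le_integral_any => x _.
  by rewrite lee_fin sqr_ge0.
have /andP[h0 h1] := h x.
by rewrite lee_fin ler_pXn2r// ?nnegrE ?mulr_ge0 ?expR_ge0// ler_wpM2r// expR_ge0.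
Qed.

Lemma wsqZ (r : R) a : 0 <= r -> wsq a -> wsq (fun x => r * a x).
Proof.
move=> r0 [m p [b b0 i]]; split.
- exact: measurable_funM.
- by move=> x; rewrite mulr_ge0.
exists b => //; apply: (@le_lt_trans _ _ (\int[leb]_x ((r ^+ 2)%:E * ((a x * expR (- (b * norm1 x))) ^+ 2)%:E))%E).
  apply: ge0_le_integral_any => x _; first by rewrite lee_fin sqr_ge0.
  by rewrite -EFinM lee_fin -exprMn mulrA.
rewrite ge0_integralZl_EFin ?sqr_ge0//; last first.
- exact: measurable_wsq.
- by move=> x _; rewrite lee_fin sqr_ge0.
by apply: lte_mul_pinfty => //; rewrite lee_fin sqr_ge0.
Qed.

Lemma wsq_hat (al s : R) (T : @functional R n) : (Enorm al s T < +oo)%E ->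
  wsq (fun x => cabs (hat T x)).
Proof.
move=> /Enorm_lty[_ h]; split.
- by apply: measurable_cabs; exact: cmeasurable_hat.
- by move=> x; exact: cabs_ge0.
exists (`|s| + `|al|); first by rewrite addr_ge0.
apply: le_lt_trans h; apply: ge0_le_integral_any => x _; first by rewrite lee_fin sqr_ge0.
have w0 : 0 <= exp_weight al s x by rewrite mulr_ge0 ?powR_ge0.
rewrite lee_fin ler_pXn2r// ?nnegrE ?mulr_ge0 ?expR_ge0 ?cabs_ge0 ?powR_ge0//.
by rewrite mulrC ler_wpM2r ?cabs_ge0// exp_weight_ge.
Qed.

Lemma measurable_sqr_exp a (b : R) : measurable_fun setT a ->
  measurable_fun setT (fun x => ((a x * expR (- (b * norm1 x))) ^+ 2 + expR (- norm1 x))%:E).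
Proof.
move=> ma; apply/measurable_EFinP; apply: measurable_funD.
  by apply: measurable_funX; apply: measurable_funM => //; exact: measurable_expnorm1.
by have := @measurable_expnorm1 R n 1; under eq_fun do rewrite mul1r.
Qed.

Lemma integral_sqr_exp_lty a (b : R) : measurable_fun setT a ->
  (\int[leb]_x ((a x * expR (- (b * norm1 x))) ^+ 2)%:E < +oo)%E ->
  (\int[leb]_x ((a x * expR (- (b * norm1 x))) ^+ 2 + expR (- norm1 x))%:E < +oo)%E.
Proof.
move=> ma ab; under eq_integral do rewrite EFinD.
have m1 := measurable_wsq b ma.
have m2 : measurable_fun setT (fun x : V => (expR (- norm1 x))%:E).
  by apply/measurable_EFinP; have := @measurable_expnorm1 R n 1; under eq_fun do rewrite mul1r.
have p1 x : setT x -> (0 <= ((a x * expR (- (b * norm1 x))) ^+ 2)%:E)%E by rewrite lee_fin sqr_ge0.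
have p2 (x : V) : setT x -> (0 <= (expR (- norm1 x))%:E)%E by rewrite lee_fin expR_ge0.
rewrite (@ge0_integralD _ _ _ leb setT measurableT _ _ p1 m1 p2 m2).
apply: lte_add_pinfty => //; have /integrableP[_] := @integrable_exp_norm1 R n.
move=> h; apply: le_lt_trans h; apply: ge0_le_integral_any => x _; first by rewrite lee_fin expR_ge0.
by rewrite gee0_abs// lee_fin expR_ge0.
Qed.

(** Passes from L^2 to L^1: with u a damped amplitude and v = e^(- norm1), the right-hand side is
    integrable. *)
Lemma sqr_exp_ge (u v : R) : 0 <= v <= 1 -> u * v <= u ^+ 2 + v.
Proof.
move=> /andP[v0 v1]; have := sqr_ge0 (u - v); rewrite sqrrB.
have : v ^+ 2 <= v by rewrite expr2 ler_piMl.
by have := sqr_ge0 u; lra.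
Qed.

Lemma expNnorm1_bound (x : V) : 0 <= expR (- norm1 x) <= 1.
Proof. by rewrite expR_ge0/= -[leRHS]expR0 ler_expR oppr_le0 norm1_ge0. Qed.

Lemma wsq_small (N : R) a : wsq a -> 0 < N -> (forall x, ~ octant_ge N x -> a x = 0) ->
  forall e : R, 0 < e -> exists b q : R, [/\ 0 <= b,
    (\int[leb]_x (a x * expR (- (b * norm1 x)))%:E <= e%:E)%E &
    (\int[leb]_x ((a x * expR (- (b * norm1 x))) ^+ 2)%:E <= q%:E)%E].
Proof.
move=> [ma a0 [b b0 ab]] N0 aN e e0.
pose A x := (a x * expR (- (b * norm1 x))) ^+ 2 + expR (- norm1 x).
have mA : measurable_fun setT (fun x => (A x)%:E) by exact: measurable_sqr_exp.
have A0 x : 0 <= A x by rewrite addr_ge0 ?sqr_ge0 ?expR_ge0.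
have IA : (\int[leb]_x (A x)%:E < +oo)%E by exact: integral_sqr_exp_lty.
set I := (\int[leb]_x (A x)%:E)%E in IA.
have I0 : (0 <= I)%E by apply: integral_ge0 => x _; rewrite lee_fin.
have If : I \is a fin_num by rewrite ge0_fin_numE.
pose r := fine I; have r0 : 0 <= r by rewrite fine_ge0.
(* On the support [norm1] is at least N, so extra damping at rate [be] gains e^(-be N) = e^(-r / e);
   by 1 + r / e <= e^(r / e), r times this is at most e. *)
pose be := r / (N * e).
have be0 : 0 <= be by rewrite divr_ge0// mulr_ge0 ?(ltW N0) ?(ltW e0).
have small : expR (- (be * N)) * r <= e.
  rewrite expRN mulrC ler_pdivrMr ?expR_gt0//.
  have E : be * N = r / e by rewrite /be; field; rewrite !gt_eqF.
  apply: (@le_trans _ _ (e * (1 + r / e))).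
    by rewrite mulrDr mulr1 mulrCA divff ?gt_eqF// mulr1 lerDr ltW.
  by rewrite ler_wpM2l ?(ltW e0)// E expR_ge1Dx.
have pt x : a x * expR (- ((b + 1 + be) * norm1 x)) <= expR (- (be * N)) * A x.
  have [Nx|Nx] := pselect (octant_ge N x); last by rewrite aN// mul0r mulr_ge0 ?expR_ge0.
  have h : be * N <= be * norm1 x by rewrite ler_wpM2l// octant_ge_norm1.
  have E : a x * expR (- ((b + 1 + be) * norm1 x)) =
      (a x * expR (- (b * norm1 x))) * expR (- norm1 x) * expR (- (be * norm1 x)).
    have -> : - ((b + 1 + be) * norm1 x) = - (b * norm1 x) + - norm1 x + - (be * norm1 x) by ring.
    by rewrite !expRD !mulrA.
  rewrite E mulrC ler_pM ?expR_ge0//.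
  - by rewrite !mulr_ge0 ?expR_ge0.
  - by rewrite ler_expR lerN2.
  - exact/sqr_exp_ge/expNnorm1_bound.
have aw b' : b <= b' -> (\int[leb]_x ((a x * expR (- (b' * norm1 x))) ^+ 2)%:E < +oo)%E.
  by move=> bb'; exact: (wsq_mono a0 bb').
exists (b + 1 + be), (fine (\int[leb]_x ((a x * expR (- ((b + 1 + be) * norm1 x))) ^+ 2)%:E)%E); split.
- by rewrite !addr_ge0.
- apply: (@le_trans _ _ (\int[leb]_x ((expR (- (be * N)))%:E * (A x)%:E))%E).
    apply: ge0_le_integral_any => x _; first by rewrite lee_fin mulr_ge0 ?expR_ge0.
    by rewrite -EFinM lee_fin.
  rewrite ge0_integralZl_EFin ?expR_ge0//; last by move=> x _; rewrite lee_fin.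
  by rewrite -/I -(fineK If) -EFinM lee_fin.
- rewrite fineK// ge0_fin_numE; first by apply: aw; rewrite -addrA lerDl addr_ge0.
  by apply: integral_ge0 => x _; rewrite lee_fin sqr_ge0.
Qed.

Lemma expint_wsq (h : V -> R[i]) : cmeasurable setT h -> wsq (fun x => cabs (h x)) -> expint h.
Proof.
move=> mh [mc c0 [b b0 hb]]; split => //; exists (b + 1).
apply: le_lt_trans (integral_sqr_exp_lty mc hb); apply: ge0_le_integral_any => x _.
  by rewrite lee_fin mulr_ge0 ?cabs_ge0 ?expR_ge0.
rewrite lee_fin mulrDl opprD expRD mulrA mul1r.
exact/sqr_exp_ge/expNnorm1_bound.
Qed.

Lemma cintegrable_conv (f : V -> R[i]) (A : V -> R) x : cmeasurable setT f ->
  (forall y, cabs (f y) <= A y) -> (rconv A x < +oo)%E ->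
  cintegrable leb setT (fun y => f (x - y) * f y).
Proof.
move=> mf fA Af; apply: cintegrable_lty => //.
  by apply: cmeasurableM => //; exact: (cmeasurable_comp mf (measurable_rVBx x)).
apply: le_lt_trans Af; apply: ge0_le_integral_any => y _; first by rewrite lee_fin cabs_ge0.
by rewrite lee_fin cabsM ler_pM ?cabs_ge0.
Qed.

End weighted_squares.

(** * The equation on the Fourier side *)

Section fourier_side.
Context {R : realType} {n : nat}.
Local Notation V := 'rV[R]_n.
Local Notation leb := (@lebesgue_rV R n).

Lemma cintegrable_duhamel (k : R -> V -> R) (f : R -> V -> R[i]) (M r t : R) (x : V) :
  measurable_fun setT (fun p : R * V => k p.1 p.2) ->
  cmeasurable setT (fun p : R * V => f p.1 p.2) -> 0 <= M ->
  (forall s, 0 <= s -> `|k s x| <= M) ->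
  (forall th, 0 <= th -> cabs (conv (f th) x) <= r) ->
  cintegrable (@lebesgue_measure R) setT
    (fun th => (window t th * k (t - th) x)%:C * conv (f th) x).
Proof.
move=> mk mf M0 kM fr.
apply: (@cintegrable_le _ _ _ (@lebesgue_measure R) setT measurableT _ (fun th => window t th * (M * r))).
- exact: (cmeasurable_duhamel_integrand mk mf).
- exact: integrable_window.
- move=> th _; rewrite cabsM cabs_real normrM (ger0_norm (window_ge0 _ _)).
  have [->|/window_neq0/andP[th0 tht]] := eqVneq (window t th) 0; first by rewrite !mul0r.
  rewrite -mulrA ler_wpM2l ?window_ge0// ler_pM ?cabs_ge0 ?fr//.
  by rewrite kM// subr_ge0.
Qed.

Lemma fourier_side_solution (N c M : R) (a : V -> R) (k : R -> V -> R) (l : R -> V -> R[i]) :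
  0 < N -> 0 < c -> 0 <= M -> wsq a -> (forall x, ~ octant_ge N x -> a x = 0) ->
  measurable_fun setT (fun p : R * V => k p.1 p.2) ->
  (forall t x, 0 <= t -> octant_ge N x -> `|k t x| <= M * expR (- (c * t))) ->
  (forall x, continuous (k ^~ x)) ->
  cmeasurable setT (fun p : R * V => l p.1 p.2) ->
  (forall t x, ~ octant_ge N x -> l t x = 0) ->
  (forall t x, 0 <= t -> cabs (l t x) <= expR (- (c * t)) * a x) ->
  (forall x t (u : nat -> R), u @ \oo --> t -> ccvg (fun j => l (u j) x) (l t x)) ->
  exists (b : R) (A : V -> R) (g : R -> V -> R[i]),
  [/\ 0 <= b,
      [/\ measurable_fun setT A, forall x, 0 <= A x, (\int[leb]_x (A x)%:E < +oo)%E &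
          (\int[leb]_x (A x ^+ 2)%:E < +oo)%E],
      [/\ cmeasurable setT (fun p : R * V => g p.1 p.2),
          forall t x, ~ octant_ge N x -> g t x = 0,
          forall t x, 0 <= t -> cabs (g t x) <= expR (- (c * t)) * (expR (b * norm1 x) * A x) &
          forall x (t : R) (u : nat -> R), 0 <= t -> (forall j, 0 <= u j) -> u @ \oo --> t ->
            ccvg (fun j => g (u j) x) (g t x)],
      forall t x, 0 <= t -> cabs (conv (g t) x) <= expR (b * norm1 x) * fine (rconv A x) &
      forall t x, g t x = l t x + duhamel k g t x].
Proof.
move=> N0 c0 M0 wa aN mk kb kc ml lN lb lc.
have Mc0 : 0 <= M / c by rewrite divr_ge0// ltW.
(* The smallness demanded by the majorant iteration; the added 1 keeps it defined when M = 0. *)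
pose e := (4 * (M / c) + 1)^-1.
have e0 : 0 < e by rewrite invr_gt0 ltr_wpDl// mulr_ge0.
have Ce : 4 * (M / c) * e <= 1.
  by rewrite /e ler_pdivrMr ?mul1r ?lerDl// ltr_wpDl// mulr_ge0.
have [b [q [b0 ae_ aq]]] := wsq_small wa N0 aN e0.
have [ma a0 _] := wa.
pose w (x : V) := expR (- (b * norm1 x)).
pose W (x : V) := expR (b * norm1 x).
have wW x : W x * w x = 1 by rewrite /W /w -expRD subrr expR0.
have mw : measurable_fun setT w by exact: measurable_expnorm1.
have mW : measurable_fun setT W.
  have := @measurable_expnorm1 R n (- b).
  by under eq_fun do rewrite mulNr opprK.
pose a' x := a x * w x; pose l' t x := (w x)%:C * l t x.
have ma' : measurable_fun setT a' by exact: measurable_funM.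
have a'0 x : 0 <= a' x by rewrite mulr_ge0 ?expR_ge0.
have a'N x : ~ octant_ge N x -> a' x = 0 by move=> Nx; rewrite /a' aN// mul0r.
have ml' : cmeasurable setT (fun p : R * V => l' p.1 p.2).
  apply: cmeasurableM => //; apply: cmeasurable_real.
  exact: (measurableT_comp mw measurable_snd).
have l'N t x : ~ octant_ge N x -> l' t x = 0 by move=> Nx; rewrite /l' lN// mulr0.
have l'b t x : 0 <= t -> cabs (l' t x) <= expR (- (c * t)) * a' x.
  move=> t0; rewrite /l' cabsM cabs_real ger0_norm ?expR_ge0// /a' mulrA mulrC.
  by rewrite ler_wpM2r ?expR_ge0// lb.
have ccvgZ (r : R) (u : nat -> R[i]) z : ccvg u z -> ccvg (fun j => r%:C * u j) (r%:C * z).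
  move=> [h1 h2]; split.
    under eq_fun do rewrite ReM/= mul0r subr0.
    by rewrite ReM/= mul0r subr0; apply: cvgM => //; exact: cvg_cst.
  under eq_fun do rewrite ImM/= mul0r addr0.
  by rewrite ImM/= mul0r addr0; apply: cvgM => //; exact: cvg_cst.
have l'c x t (u : nat -> R) : u @ \oo --> t -> ccvg (fun j => l' (u j) x) (l' t x).
  by move=> ut; apply: ccvgZ; exact: lc.
pose G := mild N k l'; pose A := majlim N c M a'.
have [mA A0 IA QA] := majlimP N0 c0 M0 Ce ma' a'0 a'N ae_ aq.
have mG := cmeasurable_mild N0 c0 M0 Ce ma' a'0 a'N ae_ aq mk kb ml' l'N l'b.
have GN := mild_octant0 c0 M0 Ce ma' a'0 a'N ae_ aq mk kb ml' l'N l'b.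
have Gb := mild_bound c0 M0 Ce ma' a'0 a'N ae_ aq mk kb ml' l'N l'b.
have Gc := ccvg_mild N0 c0 M0 Ce ma' a'0 a'N ae_ aq mk kb kc ml' l'N l'b l'c.
have Ge := mild_fixed_point N0 c0 M0 Ce ma' a'0 a'N ae_ aq mk kb ml' l'N l'b.
rewrite -/G in mG GN Gb Gc Ge; rewrite -/A in mA A0 IA QA Gb; clearbody G A.
have Af x : rconv A x \is a fin_num.
  by rewrite ge0_fin_numE ?rconv_ge0// (le_lt_trans (rconv_le mA A0 x))// (le_lt_trans QA)// ltry.
have Gb1 t x : 0 <= t -> cabs (G t x) <= A x.
  move=> t0; apply: le_trans (Gb _ _ t0) _; rewrite ler_piMl//.
  by rewrite -[leRHS]expR0 ler_expR oppr_le0 mulr_ge0// ltW.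
have cG t x : 0 <= t -> conv (fun y => (W y)%:C * G t y) x = (W x)%:C * conv (G t) x.
  move=> t0; apply: (conv_weight (N := N)); first by move=> y; exact: GN.
  apply: (cintegrable_conv (cmeasurable_slice t mG) (Gb1 t ^~ t0)).
  by rewrite -ge0_fin_numE ?rconv_ge0.
exists b, A, (fun t x => (W x)%:C * G t x); split; first exact: b0.
- split; [exact: mA|exact: A0| |]; first by rewrite (le_lt_trans IA)// ltry.
  by rewrite (le_lt_trans QA)// ltry.
- split.
  + apply: cmeasurableM => //; apply: cmeasurable_real.
    exact: (measurableT_comp mW measurable_snd).
  + by move=> t x Nx; rewrite GN// mulr0.
  + move=> t x t0; rewrite cabsM cabs_real ger0_norm ?expR_ge0// mulrCA.
    by rewrite ler_wpM2l ?expR_ge0// Gb.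
  + by move=> x t u t0 u0 ut; apply: ccvgZ; exact: Gc.
- move=> t x t0; rewrite cG// cabsM cabs_real ger0_norm ?expR_ge0// ler_wpM2l ?expR_ge0//.
  rewrite -lee_fin fineK//; apply: (cabs_conv_le x (cmeasurable_slice t mG)).
  by move=> y; exact: Gb1.
- move=> t x; rewrite Ge mulrDr; congr (_ + _).
    by rewrite /l' mulrA -rmorphM/= wW rmorph1 mul1r.
  have [Nx|Nx] := pselect (octant_ge N x); last first.
    rewrite !(duhamel_octant0 (N := N))// ?mulr0// => th y Ny.
    by rewrite GN// mulr0.
  have iD : cintegrable (@lebesgue_measure R) setT
      (fun th => (window t th * k (t - th) x)%:C * conv (G th) x).
    apply: (@cintegrable_duhamel _ _ M (fine (rconv A x))) => //.
      move=> s s0; apply: le_trans (kb _ _ s0 Nx) _; rewrite ler_piMr//.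
      by rewrite -[leRHS]expR0 ler_expR oppr_le0 mulr_ge0// ltW.
    move=> th th0; rewrite -lee_fin fineK//.
    by apply: (cabs_conv_le x (cmeasurable_slice th mG)) => y; exact: Gb1.
  have := cintegralZ measurableT (W x)%:C iD; rewrite -/(duhamel k G t x) => <-.
  apply: eq_cintegral => th _.
  have [->|/window_neq0/andP[th0 tht]] := eqVneq (window t th) 0.
    by rewrite !mul0r mulr0.
  by rewrite cG// mulrCA.
Qed.

End fourier_side.

Lemma sqr_le (R : realDomainType) (x y : R) : 0 <= x -> x <= y -> x ^+ 2 <= y ^+ 2.
Proof. by move=> x0 xy; rewrite ler_pXn2r// nnegrE// (le_trans x0). Qed.

(** Dominated convergence is sequential, whereas continuity of curves is stated with the
    neighbourhood filter. *)
Lemma cvg_seq_real (R : realType) (F : R -> R) (t l : R) :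
  (forall u : nat -> R, u @ \oo --> t -> (fun j => F (u j)) @ \oo --> l) -> F @ t --> l.
Proof.
move=> H; apply/cvgrPdist_lt => e e0; apply: contrapT => h.
have sel (j : nat) : exists x, `|t - x| < j.+1%:R^-1 /\ e <= `|l - F x|.
  apply: contrapT => /forallNP nex; apply: h; apply/nbhs_ballP.
  exists j.+1%:R^-1 => /=; first by rewrite invr_gt0.
  by move=> x tx; rewrite ltNge; apply/negP => ex; apply: (nex x).
have [u hu] := choice sel.
have ut : u @ \oo --> t.
  apply/cvgrPdist_lt => d d0; apply: filterS (near_infty_natSinv_lt (PosNum d0)) => j /= jd.
  by apply: lt_trans jd; exact: (hu j).1.
have [j _ /(_ j (leqnn j))] : \forall j \near \oo, `|l - F (u j)| < e.
  by move/cvgrPdist_lt : (H u ut); apply.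
by rewrite /= ltNge (hu j).2.
Qed.

Lemma cvg_sqrt0 (R : realType) (F : R -> R) (t : R) : F @ t --> 0 -> (fun r => Num.sqrt (F r)) @ t --> 0.
Proof.
move=> h; have := @sqrt_continuous R 0; rewrite /continuous_at sqrtr0 => h2.
exact: (cvg_comp _ _ h h2).
Qed.

(** * Densities, squares and multipliers of functionals supported in the octant *)

Section density_facts.
Context {R : realType} {n : nat}.
Local Notation V := 'rV[R]_n.
Local Notation leb := (@lebesgue_rV R n).

Lemma of_hat_ae (g1 g2 : V -> R[i]) f : cmeasurable setT g1 -> cmeasurable setT g2 ->
  {ae leb, forall x, g1 x = g2 x} -> gs_space f -> of_hat g1 f = of_hat g2 f.
Proof.
move=> m1 m2 e gf; have mi := cmeasurable_inverse_fourier (gs_cmeasurable gf).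
apply: (ae_eq_cintegral measurableT (cmeasurableM m1 mi) (cmeasurableM m2 mi)).
by apply: filterS e => x ->.
Qed.

Lemma expint_ae (g1 g2 : V -> R[i]) : expint g1 -> cmeasurable setT g2 ->
  {ae leb, forall x, g2 x = g1 x} -> expint g2.
Proof.
move=> [m1 [b h]] m2 e; split => //; exists b.
have mc g : cmeasurable setT g -> measurable_fun setT (fun x : V => (cabs (g x) * expR (- (b * norm1 x)))%:E).
  move=> mg; apply/measurable_EFinP; apply: measurable_funM; last exact: measurable_expnorm1.
  exact: measurable_cabs.
rewrite (@ge0_ae_eq_integral _ _ _ leb setT _ _ measurableT (mc _ m2) (mc _ m1))//.
- by move=> x _; rewrite lee_fin mulr_ge0 ?cabs_ge0 ?expR_ge0.
- by move=> x _; rewrite lee_fin mulr_ge0 ?cabs_ge0 ?expR_ge0.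
- by apply: filterS e => x -> _.
Qed.

Lemma cmeasurable_dominated_sum (h : V -> R[i]) (A : V -> R) (b : R) : cmeasurable setT h ->
  (\int[leb]_x (A x)%:E < +oo)%E -> (forall x, cabs (h x) <= expR (b * norm1 x) * A x) ->
  expint h.
Proof.
move=> mh IA hA; split => //; exists b; apply: le_lt_trans IA.
apply: ge0_le_integral_any => x _; first by rewrite lee_fin mulr_ge0 ?cabs_ge0 ?expR_ge0.
by rewrite lee_fin expRN ler_pdivrMr ?expR_gt0// mulrC.
Qed.

Lemma conv_octant_ge0 (N : R) (f : V -> R[i]) x : (forall y, ~ octant_ge N y -> f y = 0) ->
  ~ octant_ge N x -> conv f x = 0.
Proof.
move=> f0 Nx; rewrite -[RHS](cintegral0 leb setT).
by apply: eq_cintegral => y _; rewrite (octant_ge_mul0 _ f0 Nx).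
Qed.

Lemma cmeasurable_conv1 (f : V -> R[i]) : cmeasurable setT f -> cmeasurable setT (conv f).
Proof.
move=> mf; apply: (cmeasurable_cintegral leb (f := fun p : V * V => f (p.1 - p.2) * f p.2)).
apply: cmeasurableM; last exact: (cmeasurable_comp mf measurable_snd).
by apply: (cmeasurable_comp mf); exact: measurable_rVB.
Qed.

Lemma expint_exp_bound (g : V -> R[i]) (L b : R) : cmeasurable setT g ->
  (forall x, cabs (g x) <= L * expR (b * norm1 x)) -> expint g.
Proof.
move=> mg gb; apply: (cmeasurable_dominated_sum (A := fun x => `|L| * expR (- norm1 x)) (b := b + 1) mg).
  have := @integrableZl _ _ _ leb setT measurableT `|L| _ (integrable_exp_norm1 (R := R) (n := n)).
  move=> /integrableP[_]; apply: le_lt_trans; apply: ge0_le_integral_any => x _.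
    by rewrite lee_fin mulr_ge0 ?expR_ge0.
  apply: (@le_trans _ _ (`| `|L| * expR (- norm1 x)|)%:E) => //.
  by rewrite lee_fin ler_norm.
move=> x; rewrite mulrCA -expRD; apply: le_trans (gb x) _.
by rewrite mulrDl mul1r addrK ler_wpM2r ?expR_ge0// ler_norm.
Qed.

(** [rconv_le] bounds the convolution of the damped function by [Q], and on the octant undoing the
    damping costs exactly e^(b norm1 x). *)
Lemma conv_exp_bound (N b Q : R) (h : V -> R[i]) x : cmeasurable setT h ->
  (forall y, ~ octant_ge N y -> h y = 0) ->
  (\int[leb]_y ((cabs (h y) * expR (- (b * norm1 y))) ^+ 2)%:E <= Q%:E)%E ->
  cabs (conv h x) <= expR (b * norm1 x) * Q.
Proof.
move=> mh hN hQ.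
pose A y := cabs (h y) * expR (- (b * norm1 y)).
have mA : measurable_fun setT A.
  by apply: measurable_funM; [exact: measurable_cabs|exact: measurable_expnorm1].
have A0 y : 0 <= A y by rewrite mulr_ge0 ?cabs_ge0 ?expR_ge0.
have AQ : (rconv A x <= Q%:E)%E by exact: le_trans (rconv_le mA A0 x) hQ.
pose f y := (expR (- (b * norm1 y)))%:C * h y.
have mf : cmeasurable setT f.
  by apply: cmeasurableM => //; apply: cmeasurable_real; exact: measurable_expnorm1.
have fA y : cabs (f y) <= A y by rewrite /f cabsM cabs_real ger0_norm ?expR_ge0// mulrC.
have hE : conv h x = (expR (b * norm1 x))%:C * conv f x.
  rewrite -(conv_weight (N := N)).
  - have K z u : (expR (b * norm1 z))%:C * ((expR (- (b * norm1 z)))%:C * u) = u.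
      by rewrite mulrA -rmorphM/= -expRD subrr expR0 rmorph1 mul1r.
    by apply: eq_cintegral => y _; rewrite /f !K.
  - by move=> y Ny; rewrite /f hN// mulr0.
  - by apply: (cintegrable_conv mf fA); exact: le_lt_trans AQ (ltry _).
rewrite hE cabsM cabs_real ger0_norm ?expR_ge0// ler_wpM2l ?expR_ge0//.
by rewrite -lee_fin; apply: le_trans AQ; exact: cabs_conv_le.
Qed.

Lemma expint_conv (N : R) (h : V -> R[i]) : cmeasurable setT h ->
  (forall x, ~ octant_ge N x -> h x = 0) -> wsq (fun x => cabs (h x)) -> expint (conv h).
Proof.
move=> mh hN [_ _ [b b0 hb]]; set I := (\int[leb]_x _)%E in hb.
have If : I \is a fin_num.
  by rewrite ge0_fin_numE//; apply: integral_ge0 => x _; rewrite lee_fin sqr_ge0.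
apply: (expint_exp_bound (L := fine I) (b := b)); first exact: cmeasurable_conv1.
move=> x; rewrite mulrC; apply: (conv_exp_bound (N := N)) => //.
by rewrite fineK.
Qed.

Lemma wsq_ae (h1 h2 : V -> R[i]) : wsq (fun x => cabs (h1 x)) -> cmeasurable setT h1 ->
  cmeasurable setT h2 ->
  {ae leb, forall x, h2 x = h1 x} -> wsq (fun x => cabs (h2 x)).
Proof.
move=> [_ _ [b b0 h]] m1 m2 e; split.
- exact: measurable_cabs.
- by move=> x; exact: cabs_ge0.
exists b => //.
rewrite (@ge0_ae_eq_integral _ _ _ leb setT _ _ measurableT
  (measurable_wsq b (measurable_cabs m2)) (measurable_wsq b (measurable_cabs m1)))//.
- by move=> x _; rewrite lee_fin sqr_ge0.
- by move=> x _; rewrite lee_fin sqr_ge0.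
- by apply: filterS e => x -> _.
Qed.

(** A density of a functional supported in the octant vanishes outside [octant_ge N] only almost
    everywhere; its cut vanishes there at every point, as the localisation lemmas require. *)
Definition cut (N : R) (h : V -> R[i]) (x : V) : R[i] := (\1_(octant_ge N) x)%:C * h x.

Lemma cut_octant (N : R) (h : V -> R[i]) x : ~ octant_ge N x -> cut N h x = 0.
Proof. by move=> Nx; rewrite /cut indicE memNset// mul0r. Qed.

Lemma cut_id (N : R) (h : V -> R[i]) x : octant_ge N x -> cut N h x = h x.
Proof. by move=> Nx; rewrite /cut indicE mem_set// mul1r. Qed.

Lemma cmeasurable_cut (N : R) (h : V -> R[i]) : cmeasurable setT h -> cmeasurable setT (cut N h).
Proof.
move=> mh; apply: cmeasurableM => //; apply: cmeasurable_indic; exact: measurable_octant_ge.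
Qed.

Lemma cut_ae (N : R) (h : V -> R[i]) : {ae leb, forall x, ~ octant_ge N x -> h x = 0} ->
  {ae leb, forall x, cut N h x = h x}.
Proof.
apply: filterS => x hx; have [Nx|Nx] := pselect (octant_ge N x); first exact: cut_id.
by rewrite cut_octant// hx.
Qed.

(** The convolution grows at most exponentially, so [of_hat] of it is a genuine functional from
    which the density is recovered. *)
Lemma hat_square (N : R) (T : @functional R n) : 0 < N -> wsq (fun x => cabs (hat T x)) ->
  {ae leb, forall x, ~ octant_ge N x -> hat T x = 0} ->
  [/\ forall x, conv (hat T) x = conv (cut N (hat T)) x, expint (conv (hat T)) &
      {ae leb, forall x, hat (square T) x = (fourier_const (R := R) (n := n))%:C * conv (hat T) x}].
Proof.
move=> N0 wT sT; have mT := cmeasurable_hat T; have mc := cmeasurable_cut N mT.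
have e := cut_ae sT.
have E x : conv (hat T) x = conv (cut N (hat T)) x.
  by apply: eq_conv => //; apply: filterS e => y ->.
have Ef : conv (hat T) = conv (cut N (hat T)) by apply/funext.
have wc : wsq (fun x => cabs (cut N (hat T) x)) by exact: (wsq_ae wT mT mc e).
have ex : expint (conv (hat T)).
  by rewrite Ef; apply: (expint_conv (N := N) mc) => // x; exact: cut_octant.
split => //; apply: (hat_of_hat (g := fun x => (fourier_const (R := R) (n := n))%:C * conv (hat T) x)).
apply: (expint_bounded (M := `|fourier_const (R := R) (n := n)|) ex (cmeasurable_cst _ _)) => x.
by rewrite cabs_real.
Qed.

(** The symbol is bounded only on [octant_ge N], so the integrand must be cut before it can be shown
    integrable. *)
Lemma multiplier_cut (N M : R) (m : V -> R) (h : V -> R[i]) f : 0 <= M ->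
  cmeasurable setT h -> wsq (fun x => cabs (h x)) ->
  {ae leb, forall x, ~ octant_ge N x -> h x = 0} ->
  measurable_fun setT m -> (forall x, octant_ge N x -> `|m x| <= M) -> gs_space f ->
  of_hat (fun x => (m x)%:C * h x) f = of_hat (fun x => (m x)%:C * cut N h x) f /\
  cintegrable leb setT (fun x => (m x)%:C * cut N h x * inverse_fourier f x).
Proof.
move=> M0 mh wh sh mm mM gf.
have mi := cmeasurable_inverse_fourier (gs_cmeasurable gf).
split.
  apply: of_hat_ae => //.
  - by apply: cmeasurableM => //; exact: cmeasurable_real.
  - by apply: cmeasurableM; [exact: cmeasurable_real|exact: cmeasurable_cut].
  - by apply: filterS (cut_ae sh) => x ->.
apply: expintM => //; last by move=> b; exact: inverse_fourier_decay.
have e : expint (fun x => (m x * \1_(octant_ge N) x)%:C * h x).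
  apply: (expint_bounded (M := M) (expint_wsq mh wh)).
    apply: cmeasurable_real; apply: measurable_funM => //; apply: measurable_indic.
    exact: measurable_octant_ge.
  move=> x; rewrite cabs_real indicE; have [Nx|Nx] := pselect (octant_ge N x).
    by rewrite mem_set// mulr1 mM.
  by rewrite memNset// mulr0 normr0.
rewrite (_ : (fun x => _) = (fun x => (m x * \1_(octant_ge N) x)%:C * h x))//.
by apply/funext => x; rewrite /cut rmorphM mulrA.
Qed.

End density_facts.

Section window_integrals.
Context {R : realType}.
Local Notation mu := (@lebesgue_measure R).

Lemma windowM_restrict (t : R) (F : R -> R) :
  (fun th => (window t th * F th)%:E) = (fun th => (F th)%:E) \_ `[0, t]%classic.
Proof.
apply/funext => th; rewrite patchE windowE indicE; case: ifPn => _; first by rewrite mul1r.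
by rewrite mul0r.
Qed.

Lemma cintegrable_window (t : R) (F : R -> R[i]) :
  cintegrable mu `[0, t]%classic F <-> cintegrable mu setT (fun th => (window t th)%:C * F th).
Proof.
have mI : measurable (`[0, t]%classic : set R) by exact: measurable_itv.
have E1 : (fun th => (complex.Re ((window t th)%:C * F th))%:E) =
    (fun th => (complex.Re (F th))%:E) \_ `[0, t]%classic.
  by rewrite -windowM_restrict; apply/funext => th; rewrite ReM/= mul0r subr0.
have E2 : (fun th => (complex.Im ((window t th)%:C * F th))%:E) =
    (fun th => (complex.Im (F th))%:E) \_ `[0, t]%classic.
  by rewrite -windowM_restrict; apply/funext => th; rewrite ImM/= mul0r addr0.
split => -[h1 h2]; split.
- by rewrite E1; exact: ((@integrable_mkcond _ _ R mu _ (fun th => (complex.Re (F th))%:E) mI).1 h1).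
- by rewrite E2; exact: ((@integrable_mkcond _ _ R mu _ (fun th => (complex.Im (F th))%:E) mI).1 h2).
- by apply: (@integrable_mkcond _ _ R mu _ (fun th => (complex.Re (F th))%:E) mI).2; rewrite -E1.
- by apply: (@integrable_mkcond _ _ R mu _ (fun th => (complex.Im (F th))%:E) mI).2; rewrite -E2.
Qed.

Lemma cintegral_window (t : R) (F : R -> R[i]) :
  cintegral mu `[0, t]%classic F = cintegral mu setT (fun th => (window t th)%:C * F th).
Proof.
apply: complexP; rewrite /= Rintegral_mkcond; apply: eq_Rintegral => th _;
  rewrite patchE windowE indicE ?ReM ?ImM/=; case: ifPn => _;
  by rewrite ?mul1r ?mul0r ?subr0 ?addr0.
Qed.

End window_integrals.

(** * Regularity of the solution *)

Section solution_curve.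
Context {R : realType} {n : nat}.
Local Notation V := 'rV[R]_n.
Local Notation leb := (@lebesgue_rV R n).
Local Notation mu := (@lebesgue_measure R).
Variables (N b c al s : R) (A : V -> R) (g : R -> V -> R[i]).
Hypotheses (b0 : 0 <= b) (c0 : 0 < c).
Hypothesis mA : measurable_fun setT A.
Hypothesis A0 : forall x, 0 <= A x.
Hypothesis IA : (\int[leb]_x (A x)%:E < +oo)%E.
Hypothesis QA : (\int[leb]_x (A x ^+ 2)%:E < +oo)%E.
Hypothesis mg : cmeasurable setT (fun p : R * V => g p.1 p.2).
Hypothesis gN : forall t x, ~ octant_ge N x -> g t x = 0.
Hypothesis gb : forall t x, 0 <= t -> cabs (g t x) <= expR (- (c * t)) * (expR (b * norm1 x) * A x).
Hypothesis gc : forall x (t : R) (u : nat -> R), 0 <= t -> (forall j, 0 <= u j) -> u @ \oo --> t ->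
  ccvg (fun j => g (u j) x) (g t x).
Hypothesis alw : forall x : V, exp_weight al s x <= expR (- (b * norm1 x)).

Let v t : @functional R n := of_hat (g t).

Let mgt t : cmeasurable setT (g t). Proof. exact: cmeasurable_slice. Qed.

Let gb1 t x : 0 <= t -> cabs (g t x) <= expR (b * norm1 x) * A x.
Proof.
move=> t0; apply: le_trans (gb _ t0) _; rewrite ler_piMl ?mulr_ge0 ?expR_ge0//.
by rewrite -[leRHS]expR0 ler_expR oppr_le0 mulr_ge0// ltW.
Qed.

Lemma curve_expint t : 0 <= t -> expint (g t).
Proof. by move=> t0; apply: (cmeasurable_dominated_sum (mgt t) IA (fun x => @gb1 t x t0)). Qed.

Lemma curve_wsq t : 0 <= t -> wsq (fun x => cabs (g t x)).
Proof.
move=> t0; split; [exact: measurable_cabs|by move=> x; exact: cabs_ge0|].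
exists b => //; apply: le_lt_trans QA; apply: ge0_le_integral_any => x _.
  by rewrite lee_fin sqr_ge0.
rewrite lee_fin ler_pXn2r// ?nnegrE ?mulr_ge0 ?cabs_ge0 ?expR_ge0//.
by rewrite expRN ler_pdivrMr ?expR_gt0// mulrC gb1.
Qed.

Lemma curve_hat t : 0 <= t -> {ae leb, forall x, hat (v t) x = g t x}.
Proof. by move=> t0; apply: hat_of_hat; exact: curve_expint. Qed.

Lemma curve_supp t : 0 <= t -> supp (hat (v t)) `<=` octant_ge N.
Proof.
move=> t0; apply: supp_sub_closed; first exact: closed_octant_ge.
by apply: filterS (curve_hat t0) => x -> /gN.
Qed.

Lemma curve_dual t : 0 <= t -> gs_dual (v t) /\ regular (dual_fourier (v t)).
Proof.
move=> t0; have e := curve_expint t0; split; first exact: gs_dual_of_hat.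
by exists (g t); exact: represents_of_hat.
Qed.

Lemma curve_measurable f : gs_space f -> cmeasurable (`[0, +oo[ : set R) (fun t => v t f).
Proof.
move=> gf; apply: cmeasurableS => //.
have mi := cmeasurable_inverse_fourier (gs_cmeasurable gf).
apply: (cmeasurable_cintegral leb (f := fun p : R * V => g p.1 p.2 * inverse_fourier f p.2)).
by apply: cmeasurableM => //; exact: (cmeasurable_comp mi measurable_snd).
Qed.

Let w (x : V) := exp_weight al s x.
Let w0 x : 0 <= w x. Proof. by rewrite mulr_ge0 ?powR_ge0. Qed.
Let mw : measurable_fun setT w. Proof. exact: measurable_exp_weight. Qed.

Let wg x t : 0 <= t -> w x * cabs (g t x) <= A x.
Proof.
move=> t0; apply: (@le_trans _ _ (expR (- (b * norm1 x)) * (expR (b * norm1 x) * A x))).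
  by rewrite ler_pM ?cabs_ge0 ?w0 ?alw ?gb1.
by rewrite mulrA -expRD addNr expR0 mul1r.
Qed.

Lemma Enorm_represents (T : @functional R n) (h : V -> R[i]) : represents h (dual_fourier T) ->
  Enorm al s T = ((\int[leb]_x ((w x * cabs (h x)) ^+ 2)%:E) `^ 2^-1)%E.
Proof.
move=> rh; rewrite EnormE; last by exists h.
have mq (q : V -> R[i]) : cmeasurable setT q -> measurable_fun setT (fun x => ((w x * cabs (q x)) ^+ 2)%:E).
  move=> mq; apply/measurable_EFinP; apply: measurable_funX; apply: measurable_funM => //.
  exact: measurable_cabs.
congr (_ `^ _)%E; apply: (ge0_ae_eq_integral measurableT).
- by apply: mq; exact: cmeasurable_hat.
- by apply: mq; exact: rh.1.
- by move=> x _; rewrite lee_fin sqr_ge0.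
- by move=> x _; rewrite lee_fin sqr_ge0.
- by apply: filterS (density_unique rh) => x e _; rewrite /hat e.
Qed.

Lemma curve_Espace t : 0 <= t -> Espace al s (v t).
Proof.
move=> t0; have [d _] := curve_dual t0; split => //.
rewrite (Enorm_represents (represents_of_hat (curve_expint t0))).
apply: poweR_lty; apply: le_lt_trans QA; apply: ge0_le_integral_any => x _.
  by rewrite lee_fin sqr_ge0.
by rewrite lee_fin sqr_le ?wg// mulr_ge0 ?w0 ?cabs_ge0.
Qed.

Lemma represents_curveB r t : 0 <= r -> 0 <= t ->
  represents (fun x => g r x - g t x) (dual_fourier (fun f => v r f - v t f)).
Proof.
move=> r0 t0; have [m1 h1] := represents_of_hat (curve_expint r0).
have [m2 h2] := represents_of_hat (curve_expint t0).
split; first exact: cmeasurableB.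
move=> f gf; have [i1 e1] := h1 f gf; have [i2 e2] := h2 f gf.
under eq_fun do rewrite mulrBl; split; first exact: cintegrableB.
rewrite cintegralB//; move: e1 e2; rewrite /dual_fourier => <- <- //.
Qed.

(** The squared distance as a real number, so that its limit is taken in R; it is finite at
    nonnegative times only. *)
Let J (t r : R) := complex.Re (cintegral leb setT (fun x => ((w x * cabs (g r x - g t x)) ^+ 2)%:C)).

Let JE t r : 0 <= r -> 0 <= t ->
  (\int[leb]_x ((w x * cabs (g r x - g t x)) ^+ 2)%:E = (J t r)%:E)%E.
Proof.
move=> r0 t0; rewrite /J /= /Rintegral fineK// ge0_fin_numE; last first.
  by apply: integral_ge0 => x _; rewrite lee_fin sqr_ge0.
apply: (@le_lt_trans _ _ (\int[leb]_x (4%:E * (A x ^+ 2)%:E))%E).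
  apply: ge0_le_integral_any => x _; first by rewrite lee_fin sqr_ge0.
  have h : w x * cabs (g r x - g t x) <= 2 * A x.
    apply: (@le_trans _ _ (w x * (cabs (g r x) + cabs (g t x)))).
      by rewrite ler_wpM2l ?w0// (le_trans (cabsD _ _))// cabsN.
    by rewrite mulrDr mulr2n mulrDl mul1r lerD ?wg.
  rewrite -EFinM lee_fin (_ : 4 * A x ^+ 2 = (2 * A x) ^+ 2); last by ring.
  by rewrite sqr_le// mulr_ge0 ?w0 ?cabs_ge0.
rewrite ge0_integralZl_EFin//.
- exact: lte_mul_pinfty.
- by move=> x _; rewrite lee_fin sqr_ge0.
- by apply/measurable_EFinP; exact: measurable_funX.
Qed.

(** Times are clamped to [0, +oo[ because [gc] controls nonnegative times only; the filter
    restricted to the half-line sees the same function. *)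
Let J_cvg t : 0 <= t -> (fun r => J t (Num.max 0 r)) @ t --> (0 : R).
Proof.
move=> t0.
apply: cvg_seq_real => u ut; pose r j := Num.max 0 (u j).
have r0 j : 0 <= r j by rewrite le_max lexx.
have rt : r @ \oo --> t.
  apply/cvgrPdist_lt => e e0; move/cvgrPdist_lt : ut => /(_ e e0); apply: filterS => j.
  apply: le_lt_trans; rewrite /r; have [//|uj] := leP 0 (u j).
  by rewrite subr0 ger0_norm// (le_trans _ (ler_norm _))// lerDl oppr_ge0 ltW.
have iA : leb.-integrable setT (EFin \o (fun x => 4 * A x ^+ 2)).
  apply/integrableP; split.
    by apply/measurable_EFinP; apply: measurable_funM => //; exact: measurable_funX.
  apply: (@le_lt_trans _ _ (\int[leb]_x (4%:E * (A x ^+ 2)%:E))%E).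
    by apply: ge0_le_integral_any => x _ //; rewrite /= ger0_norm ?mulr_ge0 ?sqr_ge0.
  rewrite ge0_integralZl_EFin//.
  - exact: lte_mul_pinfty.
  - by move=> x _; rewrite lee_fin sqr_ge0.
  - by apply/measurable_EFinP; exact: measurable_funX.
have sq x j : (w x * cabs (g (r j) x - g t x)) ^+ 2 = w x ^+ 2 *
    ((complex.Re (g (r j) x) - complex.Re (g t x)) ^+ 2 + (complex.Im (g (r j) x) - complex.Im (g t x)) ^+ 2).
  by rewrite exprMn sqr_cabs !ReD !ReN !ImD !ImN.
have cv x : (fun j => (w x * cabs (g (r j) x - g t x)) ^+ 2) @ \oo --> (0 : R).
  have [h1 h2] := gc x t0 r0 rt.
  have -> : (fun j => (w x * cabs (g (r j) x - g t x)) ^+ 2) = (fun j => w x ^+ 2 *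
    ((complex.Re (g (r j) x) - complex.Re (g t x)) ^+ 2 + (complex.Im (g (r j) x) - complex.Im (g t x)) ^+ 2)).
    by apply/funext => j; exact: sq.
  have z1 : (fun j => complex.Re (g (r j) x) - complex.Re (g t x)) @ \oo --> (0 : R).
    by rewrite -[X in _ --> X](subrr (complex.Re (g t x))); apply: cvgB => //; exact: cvg_cst.
  have z2 : (fun j => complex.Im (g (r j) x) - complex.Im (g t x)) @ \oo --> (0 : R).
    by rewrite -[X in _ --> X](subrr (complex.Im (g t x))); apply: cvgB => //; exact: cvg_cst.
  rewrite -[X in _ --> X](mulr0 (w x ^+ 2)); apply: cvgM; first exact: cvg_cst.
  rewrite -[X in _ --> X](addr0 0); apply: cvgD.
    by rewrite -[X in _ --> X](mulr0 0); under eq_fun do rewrite expr2; exact: cvgM.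
  by rewrite -[X in _ --> X](mulr0 0); under eq_fun do rewrite expr2; exact: cvgM.
have [||x _|x _|_ c1 _] := @cdominated_convergence _ _ _ leb setT measurableT
  (fun j x => ((w x * cabs (g (r j) x - g t x)) ^+ 2)%:C) (fun=> 0) (fun x => 4 * A x ^+ 2) _ iA.
- move=> j; apply: cmeasurable_real; apply: measurable_funX; apply: measurable_funM => //.
  by apply: measurable_cabs; exact: cmeasurableB.
- move=> j x _; rewrite cabs_real ger0_norm ?sqr_ge0//.
  have h : w x * cabs (g (r j) x - g t x) <= 2 * A x.
    apply: (@le_trans _ _ (w x * (cabs (g (r j) x) + cabs (g t x)))).
      by rewrite ler_wpM2l ?w0// (le_trans (cabsD _ _))// cabsN.
    by rewrite mulrDr mulr2n mulrDl mul1r lerD ?wg.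
  rewrite (_ : 4 * A x ^+ 2 = (2 * A x) ^+ 2); last by ring.
  by rewrite sqr_le// mulr_ge0 ?w0 ?cabs_ge0.
- exact: cv.
- exact: cvg_cst.
- by move: c1; rewrite cintegral0.
Qed.

Lemma curve_Ccurves : Ccurves al s v.
Proof.
move=> t t0; split; first exact: curve_Espace.
have E r : 0 <= r -> Enorm al s (fun f => v r f - v t f) = (Num.sqrt (J t (Num.max 0 r)))%:E.
  move=> r0; rewrite (Enorm_represents (represents_curveB r0 t0)) JE// poweR_EFin.
  by rewrite powR12_sqrt ?max_r// -lee_fin -JE// integral_ge0// => x _; rewrite lee_fin sqr_ge0.
have S : (fun r => (Num.sqrt (J t (Num.max 0 r)))%:E) @ t --> 0%E.
  have S0 : (fun r => Num.sqrt (J t (Num.max 0 r))) @ t --> (0 : R).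
    exact: (cvg_sqrt0 (J_cvg t0)).
  by apply: cvg_EFin; [exact: nearW|exact: S0].
apply: cvg_trans (@cvg_within_filter _ _ _ _ _ _ `[0, +oo[%classic S).
apply: near_eq_cvg; rewrite /prop_near1 /within/=; apply: nearW => r /=.
by rewrite in_itv/= andbT => r0; rewrite E.
Qed.

Lemma cube_norm1 (k : 'rV[int]_n) (x : V) : cube k x ->
  norm1 x <= norm1 (map_mx intr k) + n%:R /\ norm1 (map_mx intr k) <= norm1 x + n%:R.
Proof.
move=> kx.
have h i : `|x 0 i - (map_mx intr k : V) 0 i| <= 1.
  by rewrite mxE ler_norml; have /andP[] := kx i; lra.
split; rewrite -[n in n%:R]card_ord -sum1_card natr_sum -big_split/=; apply: ler_sum => i _.
  rewrite -[x 0 i](subrK ((map_mx intr k : V) 0 i)) (le_trans (ler_normD _ _))//.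
  by rewrite [leRHS]addrC lerD2r.
rewrite -[(map_mx intr k : V) 0 i](subKr (x 0 i)) (le_trans (ler_normB _ _))//.
by rewrite lerD2l.
Qed.

Lemma cube_inj (k k' : 'rV[int]_n) (x : V) : cube k x -> cube k' x -> k = k'.
Proof.
have E (m : int) (y : R) : m%:~R <= y < m%:~R + 1 -> Num.floor y = m.
  by move=> h; apply: floor_def; rewrite rmorphD.
by move=> h h'; apply/rowP => i; rewrite -(E _ _ (h i)) (E _ _ (h' i)).
Qed.

Lemma measurable_cube (k : 'rV[int]_n) : measurable (@cube R n k).
Proof.
have -> : @cube R n k = \bigcap_(i in [set: 'I_n])
    ((fun x : V => x 0 i) @^-1` `[(k 0 i)%:~R, (k 0 i)%:~R + 1[%classic).
  by apply/seteqP; split => x kx i; [move=> _; rewrite /= in_itv; exact: kx|have := kx i I; rewrite /= in_itv].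
apply: fin_bigcap_measurable => // i _; rewrite -[X in measurable X]setTI.
by apply: measurable_coord => //; exact: measurable_itv.
Qed.

Let ind k (x : V) : R := \1_(@cube R n k) x.

Let ind01 k x : 0 <= ind k x <= 1.
Proof. by rewrite /ind indicE; case: (x \in _); rewrite /= ?lexx ?ler01. Qed.

Let mind k : measurable_fun setT (ind k).
Proof. by apply: measurable_indic; exact: measurable_cube. Qed.

Let q t k x : R[i] := (ind k x)%:C * hat (v t) x.

Let mq t k : cmeasurable setT (q t k).
Proof. by apply: cmeasurableM; [exact: cmeasurable_real|exact: cmeasurable_hat]. Qed.

Let expint_hat t : 0 <= t -> expint (hat (v t)).
Proof.
by move=> t0; apply: (expint_ae (curve_expint t0) (cmeasurable_hat _)); exact: curve_hat.
Qed.

Let cintegrable_q t k : 0 <= t -> cintegrable leb setT (q t k).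
Proof.
move=> t0; rewrite (_ : q t k = fun x => hat (v t) x * (ind k x)%:C); last first.
  by apply/funext => x; rewrite /q mulrC.
apply: expintM; [exact: expint_hat|exact: cmeasurable_real|move=> r].
exists (expR (`|r| * (norm1 (map_mx intr k : V) + n%:R))) => x.
rewrite cabs_real /ind indicE; have [kx|kx] := pselect (cube k x); last first.
  by rewrite memNset// normr0 mulr_ge0 ?expR_ge0.
rewrite mem_set// normr1 -expRD -[leLHS]expR0 ler_expR subr_ge0.
apply: (@le_trans _ _ (`|r| * norm1 x)); first by rewrite ler_wpM2r ?norm1_ge0// ler_norm.
by rewrite ler_wpM2l// (cube_norm1 kx).1.
Qed.

Let expint_q t k : 0 <= t -> expint (q t k).
Proof.
move=> t0; apply: (expint_bounded (M := 1) (expint_hat t0)); first exact: cmeasurable_real.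
by move=> x; rewrite cabs_real ger0_norm; case/andP: (ind01 k x).
Qed.

(** The mass of A^2 on the cube k; [C k] bounds e^(b norm1) there. Together with the time decay they
    bound each localised L^2 norm, and the masses add up to at most the integral of A^2. *)
Let S k := (\int[leb]_x (ind k x * A x ^+ 2)%:E)%E.
Let C k := expR (b * (norm1 (map_mx intr k : V) + n%:R)).

Let S_fin k : S k \is a fin_num.
Proof.
rewrite ge0_fin_numE; last first.
  by apply: integral_ge0 => x _; rewrite lee_fin mulr_ge0 ?sqr_ge0//; case/andP: (ind01 k x).
apply: le_lt_trans QA; apply: ge0_le_integral_any => x _; have /andP[i0 i1] := ind01 k x.
  by rewrite lee_fin mulr_ge0 ?sqr_ge0.
by rewrite lee_fin ler_piMl ?sqr_ge0.
Qed.

Let S_ge0 k : 0 <= fine (S k).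
Proof.
apply: fine_ge0; apply: integral_ge0 => x _.
by rewrite lee_fin mulr_ge0 ?sqr_ge0//; case/andP: (ind01 k x).
Qed.

Lemma L2norm_box t k : 0 <= t ->
  (L2norm (box_op k (v t)) <= (expR (- (c * t)) * (C k * Num.sqrt (fine (S k))))%:E)%E.
Proof.
move=> t0; apply: le_trans (L2norm_of_hat (cintegrable_q k t0) (expint_q k t0)) _.
have h : (\int[leb]_x (cabs (q t k x) ^+ 2)%:E <= ((expR (- (c * t)) * C k) ^+ 2 * fine (S k))%:E)%E.
  have mqq (h : V -> R[i]) : cmeasurable setT h -> measurable_fun setT (fun x => (cabs ((ind k x)%:C * h x) ^+ 2)%:E).
    move=> mh; apply/measurable_EFinP; apply: measurable_funX; apply: measurable_cabs.
    by apply: cmeasurableM => //; exact: cmeasurable_real.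
  rewrite (@ge0_ae_eq_integral _ _ _ leb setT _ (fun x => (cabs ((ind k x)%:C * g t x) ^+ 2)%:E) measurableT); last 5 first.
  - by apply: mqq; exact: cmeasurable_hat.
  - exact: mqq.
  - by move=> x _; rewrite lee_fin sqr_ge0.
  - by move=> x _; rewrite lee_fin sqr_ge0.
  - by apply: filterS (curve_hat t0) => x e _; rewrite /q e.
  rewrite EFinM fineK// -ge0_integralZl_EFin ?sqr_ge0//; last 2 first.
  - by move=> x _; rewrite lee_fin mulr_ge0 ?sqr_ge0//; case/andP: (ind01 k x).
  - by apply/measurable_EFinP; apply: measurable_funM => //; exact: measurable_funX.
  apply: ge0_le_integral_any => x _; first by rewrite lee_fin sqr_ge0.
  rewrite -EFinM lee_fin cabsM cabs_real /ind indicE; have [kx|kx] := pselect (cube k x); last first.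
    by rewrite memNset// normr0 !mul0r expr0n/= mulr0.
  rewrite mem_set// normr1 !mul1r -exprMn sqr_le ?cabs_ge0//.
  apply: le_trans (gb x t0) _; rewrite -mulrA ler_wpM2l ?expR_ge0// ler_wpM2r//.
  by rewrite ler_expR ler_wpM2l// (cube_norm1 kx).1.
have C0 : 0 <= expR (- (c * t)) * C k by rewrite mulr_ge0 ?expR_ge0.
have -> : ((expR (- (c * t)) * (C k * Num.sqrt (fine (S k))))%:E =
    ((expR (- (c * t)) * C k) ^+ 2 * fine (S k))%:E `^ 2^-1)%E.
  have p0 : 0 <= (expR (- (c * t)) * C k) ^+ 2 * fine (S k) by rewrite mulr_ge0 ?sqr_ge0.
  by rewrite poweR_EFin powR12_sqrt// sqrtrM ?sqr_ge0// sqrtr_sqr ger0_norm// mulrA.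
apply: gt0_ler_poweR; [by rewrite invr_ge0| | |exact: h].
  by rewrite in_itv/= leey andbT integral_ge0// => x _; rewrite lee_fin sqr_ge0.
by rewrite in_itv/= leey andbT lee_fin mulr_ge0 ?sqr_ge0.
Qed.

Let B k := C k * Num.sqrt (fine (S k)).
Let B0 k : 0 <= B k. Proof. by rewrite mulr_ge0 ?expR_ge0 ?sqrtr_ge0. Qed.

Let L2norm_ge0 (T : @functional R n) : (0 <= L2norm T)%E.
Proof. by rewrite /L2norm /weighted_L2; case: ifP => // _; exact: Lnorm_ge0. Qed.

Lemma box_norm1 k : (box_norm 1%:E v k <= (c^-1 * B k)%:E)%E.
Proof.
rewrite /box_norm Lnorm1.
apply: (@le_trans _ _ (\int[mu]_t ((c^-1 * B k)%:E * (exponential_pdf c t)%:E))%E).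
  apply: ge0_le_integral_any => t _; first exact: abse_ge0.
  have p0 : 0 <= exponential_pdf c t by rewrite exponential_pdf_ge0// ltW.
  case: ifPn => t0; last by rewrite abse0 -EFinM lee_fin mulr_ge0// mulr_ge0// invr_ge0 ltW.
  rewrite gee0_abs ?L2norm_ge0//; apply: le_trans (L2norm_box k t0) _.
  rewrite -EFinM lee_fin /exponential_pdf patchE ifT; last by rewrite inE/= in_itv/= t0.
  rewrite le_eqVlt; apply/orP; left; apply/eqP.
  by rewrite -/(B k) mulNr; move: (B k) (expR _) => y z; field; rewrite gt_eqF.
rewrite ge0_integralZl_EFin//.
- by rewrite integral_exponential_pdf// mule1.
- by move=> t _; rewrite lee_fin exponential_pdf_ge0// ltW.
- by apply/measurable_EFinP; exact: measurable_exponential_pdf.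
- by rewrite mulr_ge0// invr_ge0 ltW.
Qed.

Lemma box_normy k : (box_norm +oo%E v k <= (B k)%:E)%E.
Proof.
rewrite /box_norm unlock; case: ifPn => _; last by rewrite lee_fin.
apply/ess_sup_inf.ess_supP; apply: nearW => t /=.
case: ifPn => t0; last by rewrite abse0 lee_fin.
rewrite gee0_abs ?L2norm_ge0//; apply: le_trans (L2norm_box k t0) _.
rewrite lee_fin -/(B k) ler_piMl//.
by rewrite -[leRHS]expR0 ler_expR oppr_le0 mulr_ge0// ltW.
Qed.

Let Csum (s0 : seq 'rV[int]_n) : uniq s0 ->
  (\sum_(k <- s0) S k <= \int[leb]_x (A x ^+ 2)%:E)%E.
Proof.
move=> us; rewrite -ge0_integral_sum//; last 2 first.
- move=> k; apply/measurable_EFinP; apply: measurable_funM => //; exact: measurable_funX.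
- by move=> k x _; rewrite lee_fin mulr_ge0 ?sqr_ge0//; case/andP: (ind01 k x).
apply: ge0_le_integral_any => x _.
  by apply: sume_ge0 => k _; rewrite lee_fin mulr_ge0 ?sqr_ge0//; case/andP: (ind01 k x).
rewrite sumEFin -mulr_suml lee_fin ler_piMl ?sqr_ge0//.
have [[k ks kx]|h] := pselect (exists2 k, k \in s0 & cube k x).
  rewrite (bigD1_seq k)//= big1_seq ?addr0; first by case/andP: (ind01 k x).
  move=> k' /andP[kk' _]; rewrite /ind indicE memNset// => k'x.
  by move/eqP: kk'; apply; exact: cube_inj k'x kx.
rewrite big1_seq// => k /andP[_ ks]; rewrite /ind indicE memNset// => kx.
by apply: h; exists k.
Qed.

Lemma curve_Ltilde gamma (D : R) : 0 <= D ->
  (forall k, (box_norm gamma v k <= (D * B k)%:E)%E) -> Ltilde gamma al s v.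
Proof.
move=> D0 bD; split; [exact: curve_dual|exact: curve_measurable|].
apply: poweR_lty.
(* The weight at k cancels the factor e^(b norm1 k) of [C k]; what remains is e^(b n), the variation
   over one cube. *)
pose E : R := D * expR (b * n%:R).
apply: (@le_lt_trans _ _ ((E ^+ 2)%:E * \int[leb]_x (A x ^+ 2)%:E)%E); last first.
  by apply: lte_mul_pinfty => //; rewrite lee_fin sqr_ge0.
apply: ge_ereal_sup => _ [F [finF _] <-].
rewrite fsbig_finite//=.
move: (finmap.fset_uniq (fset_set F)); move: (finmap.enum_fset (fset_set F)) => s0 us.
apply: (@le_trans _ _ (\sum_(k <- s0) ((E ^+ 2)%:E * S k))%E); last first.
  rewrite -ge0_sume_distrr; last by move=> k _; rewrite -(fineK (S_fin k)) lee_fin.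
  apply: lee_pmul => //; first by rewrite lee_fin sqr_ge0.
    by apply: sume_ge0 => k _; rewrite -(fineK (S_fin k)) lee_fin.
  exact: Csum.
apply: lee_sum => k _.
have wk0 : 0 <= exp_weight al s (map_mx intr k : V) by rewrite mulr_ge0 ?powR_ge0.
have bn0 : (0 <= box_norm gamma v k)%E by exact: Lnorm_ge0.
have wC : exp_weight al s (map_mx intr k : V) * C k <= expR (b * n%:R).
  apply: (@le_trans _ _ (expR (- (b * norm1 (map_mx intr k : V))) * C k)).
    by rewrite ler_wpM2r ?expR_ge0.
  by rewrite /C -expRD mulrDr addKr.
have step : ((exp_weight al s (map_mx intr k : V))%:E * box_norm gamma v k <=
    (E * Num.sqrt (fine (S k)))%:E)%E.
  apply: (@le_trans _ _ (exp_weight al s (map_mx intr k : V) * (D * B k))%:E).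
    by rewrite (EFinM (exp_weight _ _ _)); apply: lee_pmul.
  have -> : exp_weight al s (map_mx intr k : V) * (D * B k) =
      D * (exp_weight al s (map_mx intr k : V) * C k) * Num.sqrt (fine (S k)) by rewrite /B; ring.
  rewrite lee_fin /E.
  by rewrite ler_wpM2r ?sqrtr_ge0// ler_wpM2l.
have p0 : (0 <= (exp_weight al s (map_mx intr k : V))%:E * box_norm gamma v k)%E by exact: mule_ge0.
apply: le_trans (lee_pmul p0 p0 step step) _.
by rewrite -EFinM -expr2 exprMn sqr_sqrtr// EFinM fineK.
Qed.

End solution_curve.

(** * Existence *)

Section mild_formulation.
Context {R : realType} {n : nat}.
Local Notation V := 'rV[R]_n.
Local Notation leb := (@lebesgue_rV R n).
Local Notation mu := (@lebesgue_measure R).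
Local Notation cst := (fourier_const (R := R) (n := n)).
Variables (tau delta sigma N c M kap : R).
Hypotheses (tau0 : 0 < tau) (N0 : 0 < N) (c0 : 0 < c) (M0 : 0 <= M).

Let K j m t (x : V) := derive1n m (jmgt_kernel tau delta sigma j 1 (enorm x)) t.

Hypothesis decay : forall r t, N <= r -> 0 <= t ->
    [/\ `|derive1n 1 (jmgt_kernel tau delta sigma 0 1 r) t| <= M * expR (- (c * t)),
        `|derive1n 1 (jmgt_kernel tau delta sigma 1 1 r) t| <= M * expR (- (c * t)),
        `|derive1n 1 (jmgt_kernel tau delta sigma 2 1 r) t| <= M * expR (- (c * t)) &
        `|derive1n 2 (jmgt_kernel tau delta sigma 2 1 r) t| <= M * expR (- (c * t))].

Let octant_enorm (x : V) : octant_ge N x -> N <= enorm x.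
Proof. by move=> [_ h]; exact: le_trans h (normr_le_enorm x). Qed.

Let mK j m : (j < 3)%N -> measurable_fun setT (fun p : R * V => K j m p.1 p.2).
Proof.
move=> j3; apply: measurable_jmgt_kernel => //.
exact: (measurableT_comp measurable_enorm measurable_snd).
Qed.

Let mK1 j m t : (j < 3)%N -> measurable_fun setT (K j m t).
Proof.
by move=> j3; apply: measurable_jmgt_kernel => //; exact: measurable_enorm.
Qed.

Let cK j m x : (j < 3)%N -> continuous (fun t => K j m t x).
Proof. by move=> j3; exact: continuous_jmgt_kernel. Qed.

Let K1b j t x : (j < 3)%N -> 0 <= t -> octant_ge N x -> `|K j 1 t x| <= M * expR (- (c * t)).
Proof.
move=> j3 t0 /octant_enorm Nx; have [h0 h1 h2 _] := decay Nx t0.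
case: j j3 => [_|[_|[_|?//]]]; [exact: h0|exact: h1|exact: h2].
Qed.

Let K1M j t x : (j < 3)%N -> 0 <= t -> octant_ge N x -> `|K j 1 t x| <= M.
Proof.
move=> j3 t0 Nx; apply: le_trans (K1b j3 t0 Nx) _; rewrite ler_piMr//.
by rewrite -[leRHS]expR0 ler_expR oppr_le0 mulr_ge0// ltW.
Qed.

(** All that the construction retains of the data and of the solutions: the indices of their spaces
    no longer appear. *)
Definition regular_octant (T : @functional R n) :=
  wsq (fun x => cabs (hat T x)) /\ {ae leb, forall x, ~ octant_ge N x -> hat T x = 0}.

Variables psi0 psi1 psi2 : @functional R n.

Definition data_hat (t : R) (x : V) : R[i] :=
  (K 0 1 t x)%:C * cut N (hat psi0) x + (K 1 1 t x)%:C * cut N (hat psi1) x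
  + (K 2 1 t x)%:C * cut N (hat psi2) x
  - kap%:C * ((K 2 1 t x)%:C * cut N (hat (square psi1)) x).

Definition data_bound (x : V) : R := M * (1 + `|kap|) *
  (cabs (cut N (hat psi0) x) + cabs (cut N (hat psi1) x) + cabs (cut N (hat psi2) x)
   + cabs (cut N (hat (square psi1)) x)).

Definition data_op (t : R) : @functional R n := fun f =>
  kernel_op tau delta sigma 1 0 t psi0 f + kernel_op tau delta sigma 1 1 t psi1 f
  + kernel_op tau delta sigma 1 2 t psi2 f
  - kap%:C * kernel_op tau delta sigma 1 2 t (square psi1) f.

Hypotheses (g0 : regular_octant psi0) (g1 : regular_octant psi1) (g2 : regular_octant psi2).
Hypothesis w3 : wsq (fun x => cabs (hat (square psi1) x)).

Let g3 : regular_octant (square psi1).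
Proof.
split => //; have [e _ h] := hat_square N0 g1.1 g1.2.
apply: filterS h => x -> Nx; rewrite e (conv_octant_ge0 _ Nx) ?mulr0// => y.
exact: cut_octant.
Qed.

Let wcut T : regular_octant T -> wsq (fun x => cabs (cut N (hat T) x)).
Proof.
move=> [w _]; apply: (wsq_le w).
  by apply: measurable_cabs; apply: cmeasurable_cut; exact: cmeasurable_hat.
move=> x; rewrite cabs_ge0/=; have [Nx|Nx] := pselect (octant_ge N x); first by rewrite cut_id.
by rewrite cut_octant// cabs0 cabs_ge0.
Qed.

Lemma wsq_data_bound : wsq data_bound.
Proof.
apply: wsqZ; first by rewrite mulr_ge0// addr_ge0.
by apply: wsqD; [apply: wsqD; [apply: wsqD|]|]; exact: wcut.
Qed.

Lemma data_bound_octant x : ~ octant_ge N x -> data_bound x = 0.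
Proof. by move=> Nx; rewrite /data_bound !cut_octant// !cabs0 !addr0 mulr0. Qed.

Let mcut (T : @functional R n) : cmeasurable setT (cut N (hat T)).
Proof. by apply: cmeasurable_cut; exact: cmeasurable_hat. Qed.

Lemma cmeasurable_data_hat : cmeasurable setT (fun p : R * V => data_hat p.1 p.2).
Proof.
have H j T : (j < 3)%N -> cmeasurable setT (fun p : R * V => (K j 1 p.1 p.2)%:C * cut N (hat T) p.2).
  move=> j3; apply: cmeasurableM; first by apply: cmeasurable_real; exact: mK.
  exact: (cmeasurable_comp (mcut T) measurable_snd).
apply: cmeasurableB; last by apply: cmeasurableM; [exact: cmeasurable_cst|exact: H].
by apply: cmeasurableD; [apply: cmeasurableD|]; exact: H.
Qed.

Lemma data_hat_octant t x : ~ octant_ge N x -> data_hat t x = 0.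
Proof. by move=> Nx; rewrite /data_hat !cut_octant// !mulr0 !addr0 subr0. Qed.

Lemma data_hat_bound t x : 0 <= t -> cabs (data_hat t x) <= expR (- (c * t)) * data_bound x.
Proof.
move=> t0; have [Nx|Nx] := pselect (octant_ge N x); last first.
  by rewrite data_hat_octant// cabs0 mulr_ge0 ?expR_ge0//; case: wsq_data_bound.
set E := expR _; have E0 : 0 <= E by exact: expR_ge0.
have H j z : (j < 3)%N -> cabs ((K j 1 t x)%:C * z) <= E * (M * (1 + `|kap|)) * cabs z.
  move=> j3; rewrite cabsM cabs_real ler_wpM2r ?cabs_ge0//.
  by rewrite (le_trans (K1b j3 t0 Nx))// mulrC ler_wpM2l// ler_peMr// lerDl.
have H3 z : cabs (kap%:C * ((K 2 1 t x)%:C * z)) <= E * (M * (1 + `|kap|)) * cabs z.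
  rewrite !cabsM !cabs_real mulrA ler_wpM2r ?cabs_ge0//.
  apply: (@le_trans _ _ (`|kap| * (M * E))); first by rewrite ler_wpM2l// K1b.
  by rewrite mulrCA [E * _]mulrCA ler_wpM2l// mulrC ler_wpM2l// lerDr.
rewrite /data_hat /data_bound [X in _ <= X](mulrA E).
set D := E * (M * _) in H H3 *; rewrite !(mulrDr D).
apply: le_trans (cabsD _ _) _; rewrite cabsN; apply: lerD; last exact: H3.
apply: le_trans (cabsD _ _) _; apply: lerD; last exact: H.
by apply: le_trans (cabsD _ _) _; apply: lerD; exact: H.
Qed.

Let ccvgD (f g : nat -> R[i]) a b : ccvg f a -> ccvg g b -> ccvg (fun i => f i + g i) (a + b).
Proof.
move=> [f1 f2] [h1 h2]; split.
  have -> : (fun i => complex.Re (f i + g i)) = (fun i => complex.Re (f i) + complex.Re (g i)).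
    by apply/funext => i; rewrite ReD.
  by rewrite ReD; exact: cvgD.
have -> : (fun i => complex.Im (f i + g i)) = (fun i => complex.Im (f i) + complex.Im (g i)).
  by apply/funext => i; rewrite ImD.
by rewrite ImD; exact: cvgD.
Qed.

Lemma ccvg_data_hat x t (u : nat -> R) : u @ \oo --> t ->
  ccvg (fun j => data_hat (u j) x) (data_hat t x).
Proof.
move=> ut.
have H j z : (j < 3)%N -> ccvg (fun i => (K j 1 (u i) x)%:C * z) ((K j 1 t x)%:C * z).
  move=> j3; have Kc : (fun i => K j 1 (u i) x) @ \oo --> K j 1 t x.
    exact: (@cvg_comp _ _ _ u (fun t => K j 1 t x) _ _ _ ut (@cK j 1 x j3 t)).
  split.
    under eq_fun do rewrite ReM/= mul0r subr0.
    by rewrite ReM/= mul0r subr0; apply: cvgM => //; exact: cvg_cst.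
  under eq_fun do rewrite ImM/= mul0r addr0.
  by rewrite ImM/= mul0r addr0; apply: cvgM => //; exact: cvg_cst.
have E s : data_hat s x = (K 0 1 s x)%:C * cut N (hat psi0) x + (K 1 1 s x)%:C * cut N (hat psi1) x
  + (K 2 1 s x)%:C * cut N (hat psi2) x + (K 2 1 s x)%:C * (- kap%:C * cut N (hat (square psi1)) x).
  by rewrite /data_hat; ring.
rewrite E; have -> : (fun j => data_hat (u j) x) = (fun s => (K 0 1 (u s) x)%:C * cut N (hat psi0) x + (K 1 1 (u s) x)%:C * cut N (hat psi1) x
  + (K 2 1 (u s) x)%:C * cut N (hat psi2) x + (K 2 1 (u s) x)%:C * (- kap%:C * cut N (hat (square psi1)) x)).
  by apply/funext => j; exact: E.
by apply: ccvgD; [apply: ccvgD; [apply: ccvgD|]|]; exact: H.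
Qed.

Lemma data_opE t f : 0 <= t -> gs_space f ->
  data_op t f = of_hat (data_hat t) f /\
  cintegrable leb setT (fun x => data_hat t x * inverse_fourier f x).
Proof.
move=> t0 gf.
have H j T : (j < 3)%N -> regular_octant T ->
    kernel_op tau delta sigma 1 j t T f = of_hat (fun x => (K j 1 t x)%:C * cut N (hat T) x) f /\
    cintegrable leb setT (fun x => (K j 1 t x)%:C * cut N (hat T) x * inverse_fourier f x).
  move=> j3 [w s]; apply: (multiplier_cut (M := M)) => //; first exact: cmeasurable_hat.
  - exact: mK1.
  - by move=> x; exact: K1M.
have [e0 i0] := H 0%N _ isT g0; have [e1 i1] := H 1%N _ isT g1.
have [e2 i2] := H 2%N _ isT g2; have [e3 i3] := H 2%N _ isT g3.
have E : (fun x => data_hat t x * inverse_fourier f x) = (fun x =>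
    (K 0 1 t x)%:C * cut N (hat psi0) x * inverse_fourier f x +
    (K 1 1 t x)%:C * cut N (hat psi1) x * inverse_fourier f x +
    (K 2 1 t x)%:C * cut N (hat psi2) x * inverse_fourier f x -
    kap%:C * ((K 2 1 t x)%:C * cut N (hat (square psi1)) x * inverse_fourier f x)).
  by apply/funext => x; rewrite /data_hat; ring.
have i01 := cintegrableD measurableT i0 i1; have i012 := cintegrableD measurableT i01 i2.
have i3k := cintegrableZ measurableT kap%:C i3.
rewrite /data_op e0 e1 e2 e3 /of_hat E; split; last exact: cintegrableB.
have c1 := cintegralB measurableT i012 i3k; have c2 := cintegralD measurableT i01 i2.
have c3 := cintegralD measurableT i0 i1; have c4 := cintegralZ measurableT kap%:C i3.
by rewrite c1 c2 c3 c4.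
Qed.

(** [kap] is the coefficient of the nonlinearity and [cst] the (2 pi)^(-n/2) of the convolution
    theorem, so that [duhamel] can use the bare convolution. *)
Definition mild_kernel (t : R) (x : V) : R := kap * (cst * K 2 2 t x).

Lemma measurable_mild_kernel : measurable_fun setT (fun p : R * V => mild_kernel p.1 p.2).
Proof. by apply: measurable_funM => //; apply: measurable_funM => //; exact: mK. Qed.

Lemma mild_kernel_bound t x : 0 <= t -> octant_ge N x ->
  `|mild_kernel t x| <= `|kap| * cst * M * expR (- (c * t)).
Proof.
move=> t0 /octant_enorm Nx; have [_ _ _ h] := decay Nx t0.
rewrite /mild_kernel !normrM (ger0_norm (ltW fourier_const_gt0)) -!mulrA.
by rewrite ler_wpM2l// ler_wpM2l// ltW// fourier_const_gt0.
Qed.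

Lemma continuous_mild_kernel x : continuous (mild_kernel ^~ x).
Proof.
move=> t; apply: cvgM; first exact: cvg_cst.
by apply: cvgM; [exact: cvg_cst|exact: cK].
Qed.

(** Any representative [h] of the density may be used: the jointly measurable [g] for existence, the
    cut density for uniqueness. *)
Lemma nonlinearityE (s : R) (T : @functional R n) (h : V -> R[i]) f :
  regular_octant T -> cmeasurable setT h -> {ae leb, forall x, hat T x = h x} -> gs_space f ->
  kernel_op tau delta sigma 2 2 s (square T) f =
  cintegral leb setT (fun x => (cst * K 2 2 s x)%:C * conv h x * inverse_fourier f x).
Proof.
move=> [w sT] mh e gf; have [E _ hs] := hat_square N0 w sT.
have mi := cmeasurable_inverse_fourier (gs_cmeasurable gf).
have mK2 : cmeasurable setT (fun x => (K 2 2 s x)%:C) by apply: cmeasurable_real; exact: mK1.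
apply: (ae_eq_cintegral measurableT).
- by apply: cmeasurableM => //; apply: cmeasurableM => //; exact: cmeasurable_hat.
- apply: cmeasurableM => //; apply: cmeasurableM; last exact: cmeasurable_conv1.
  by apply: cmeasurable_real; apply: measurable_funM => //; exact: mK1.
- apply: filterS hs => x -> _; rewrite (eq_conv x (cmeasurable_hat T) mh e).
  by rewrite -/(K 2 2 s x) rmorphM/= mulrA [(K 2 2 s x)%:C * _]mulrC.
Qed.

(** The pointwise equation is multiplied by the inverse transform of the test function and
    integrated, and Fubini exchanges time and frequency. The convolution is at most e^(b norm1)
    times the integrable [rconv A], and the test function absorbs the exponential. *)
Lemma mild_solution (b : R) (A : V -> R) (g : R -> V -> R[i]) : kap != 0 -> 0 <= b ->
  measurable_fun setT A -> (forall x, 0 <= A x) -> (\int[leb]_x (A x)%:E < +oo)%E ->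
  (\int[leb]_x (A x ^+ 2)%:E < +oo)%E ->
  cmeasurable setT (fun p : R * V => g p.1 p.2) ->
  (forall t x, ~ octant_ge N x -> g t x = 0) ->
  (forall t x, 0 <= t -> cabs (g t x) <= expR (- (c * t)) * (expR (b * norm1 x) * A x)) ->
  (forall t x, 0 <= t -> cabs (conv (g t) x) <= expR (b * norm1 x) * fine (rconv A x)) ->
  (forall t x, g t x = data_hat t x + duhamel mild_kernel g t x) ->
  forall t f, 0 <= t -> gs_space f ->
  let nonlinearity th := kernel_op tau delta sigma 2 2 (t - th) (square (of_hat (g th))) f in
  cintegrable mu `[0, t]%classic nonlinearity /\
  of_hat (g t) f = data_op t f + kap%:C * cintegral mu `[0, t]%classic nonlinearity.
Proof.
move=> kap0 b0 mA A0 IA QA mg gN gb cb ge t f t0 gf nl.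
have mi := cmeasurable_inverse_fourier (gs_cmeasurable gf).
set phi := inverse_fourier f in mi.
have mk := measurable_mild_kernel.
have reg th : 0 <= th -> regular_octant (of_hat (g th)).
  move=> th0; have e := curve_hat c0 A0 IA mg gb th0.
  have mh := cmeasurable_hat (of_hat (g th)).
  split; first exact: (wsq_ae (curve_wsq b0 c0 A0 QA mg gb th0) (cmeasurable_slice th mg) mh e).
  by apply: filterS e => x ->; exact: gN.
pose F (p : R * V) := (window t p.1 * mild_kernel (t - p.1) p.2)%:C * conv (g p.1) p.2 * phi p.2.
have mF : cmeasurable setT F.
  apply: cmeasurableM; last exact: (cmeasurable_comp mi measurable_snd).
  by apply: (cmeasurable_duhamel_integrand mk mg); [exact: measurable_cst|exact: measurable_fst|exact: measurable_snd].
pose r x := fine (rconv A x).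
have Af x : rconv A x \is a fin_num.
  by rewrite ge0_fin_numE ?rconv_ge0// (le_lt_trans (rconv_le mA A0 x)).
have r0 x : 0 <= r x by rewrite fine_ge0// rconv_ge0.
have [P HP] := inverse_fourier_decay b gf.
pose L := `|kap| * cst * M.
have L0 : 0 <= L by rewrite !mulr_ge0// ltW// fourier_const_gt0.
have kL s x : 0 <= s -> octant_ge N x -> `|mild_kernel s x| <= L.
  move=> s0 Nx; apply: le_trans (mild_kernel_bound s0 Nx) _; rewrite ler_piMr//.
  by rewrite -[leRHS]expR0 ler_expR oppr_le0 mulr_ge0// ltW.
have conv0 th x : ~ octant_ge N x -> conv (g th) x = 0.
  by move=> Nx; apply: (conv_octant_ge0 (N := N)) => // y; exact: gN.
have Fb th x : cabs (F (th, x)) <= window t th * (L * `|P|) * r x.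
  have -> : F (th, x) = (window t th * mild_kernel (t - th) x)%:C * conv (g th) x * phi x by [].
  rewrite cabsM cabsM cabs_real normrM (ger0_norm (window_ge0 _ _)).
  have [->|/window_neq0/andP[th0 tht]] := eqVneq (window t th) 0; first by rewrite !mul0r.
  have [Nx|Nx] := pselect (octant_ge N x); last first.
    rewrite conv0// cabs0 mulr0 mul0r; apply: mulr_ge0 => //.
    by apply: mulr_ge0; [exact: window_ge0|exact: mulr_ge0].
  have h1 := kL _ _ (_ : 0 <= t - th) Nx; have h2 := cb th x th0; have h3 := HP x.
  apply: (@le_trans _ _ (window t th * L * (expR (b * norm1 x) * r x) * (`|P| * expR (- (b * norm1 x))))).
    rewrite ler_pM ?mulr_ge0 ?cabs_ge0 ?window_ge0//.
      rewrite ler_pM ?mulr_ge0 ?cabs_ge0 ?window_ge0// ler_wpM2l ?window_ge0// h1// subr_ge0//.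
    by rewrite (le_trans h3)// ler_wpM2r ?expR_ge0// ler_norm.
  rewrite le_eqVlt; apply/orP; left; apply/eqP.
  have E : expR (b * norm1 x) * expR (- (b * norm1 x)) = 1 by rewrite -expRD subrr expR0.
  transitivity (window t th * L * `|P| * r x * (expR (b * norm1 x) * expR (- (b * norm1 x)))); first by ring.
  by rewrite E; ring.
have mr : measurable_fun setT (fun x => (r x)%:E).
  by apply/measurable_EFinP; apply: measurableT_comp => //; exact: measurable_rconv.
have Ir : (\int[leb]_x (r x)%:E < +oo)%E.
  have -> : (\int[leb]_x (r x)%:E = \int[leb]_x rconv A x)%E.
    by apply: eq_integral => x _; rewrite fineK.
  have IA0 : (0 <= \int[leb]_x (A x)%:E)%E by apply: integral_ge0 => x _; rewrite lee_fin.
  by rewrite integral_rconv//; apply: lte_mul_pinfty => //; rewrite ge0_fin_numE.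
have Ir0 : (0 <= \int[leb]_x (r x)%:E)%E by apply: integral_ge0 => x _; rewrite lee_fin.
have Irf : (\int[leb]_x (r x)%:E)%E \is a fin_num by rewrite ge0_fin_numE.
have Foo : (\int[mu]_th \int[leb]_x (cabs (F (th, x)))%:E < +oo)%E.
  have /integrableP[_] := integrable_window t (L * `|P| * fine (\int[leb]_x (r x)%:E)%E).
  apply: le_lt_trans; apply: ge0_le_integral_any => th _.
    by apply: integral_ge0 => x _; rewrite lee_fin cabs_ge0.
  apply: (@le_trans _ _ (\int[leb]_x ((window t th * (L * `|P|))%:E * (r x)%:E))%E).
    apply: ge0_le_integral_any => x _; first by rewrite lee_fin cabs_ge0.
    by rewrite -EFinM lee_fin.
  have w0 : 0 <= window t th * (L * `|P|) by apply: mulr_ge0; [exact: window_ge0|exact: mulr_ge0].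
  rewrite ge0_integralZl_EFin//; last by move=> x _; rewrite lee_fin.
  rewrite -{1}(fineK Irf) -EFinM .
  apply: (@le_trans _ _ (`|window t th * (L * `|P| * fine (\int[leb]_x (r x)%:E)%E)|)%:E) => //.
  by rewrite lee_fin (mulrA (window t th) (L * `|P|)); exact: ler_norm.
have [i1 _ E] := @cFubini _ _ _ _ _ mu leb F mF Foo.
have Fx th : cintegral leb setT (fun x => F (th, x)) = (window t th)%:C * (kap%:C * nl th).
  have [w|/window_neq0/andP[th0 tht]] := eqVneq (window t th) 0.
    rewrite w mul0r -[RHS](cintegral0 leb setT); apply: eq_cintegral => x _.
    by rewrite /F/= w !mul0r.
  have w1 : window t th = 1 by rewrite /window th0 tht mulr1.
  rewrite w1 mul1r /nl (nonlinearityE _ (reg _ th0) (cmeasurable_slice th mg) _ gf); last first.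
    exact: (curve_hat c0 A0 IA mg gb th0).
  have FE : (fun x => F (th, x)) = (fun x => kap%:C * ((cst * K 2 2 (t - th) x)%:C * conv (g th) x * phi x)).
    by apply/funext => x; rewrite /F/= w1 mul1r /mild_kernel [(kap * _)%:C]rmorphM/= !mulrA.
  rewrite FE cintegralZ//.
  have -> : (fun x => (cst * K 2 2 (t - th) x)%:C * conv (g th) x * phi x) =
      (fun x => kap^-1%:C * F (th, x)).
    by apply/funext => x; rewrite (congr1 (fun G => G x) FE) mulrA -rmorphM/= mulVf// rmorph1 mul1r.
  apply: cintegrableZ => //.
  apply: (@cintegrable_le _ _ _ leb setT measurableT _ (fun x => window t th * (L * `|P|) * r x)).
  - by apply: (cmeasurable_comp mF (g := fun x => (th, x))); exact: measurable_fun_pair.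
  - apply: (@integrableZl _ _ _ leb setT measurableT _ (fun x => (r x)%:E)).
    apply/integrableP; split => //.
    by under eq_integral do rewrite gee0_abs ?lee_fin//.
  - by move=> x _; exact: Fb.
have i2 : cintegrable mu setT (fun th => (window t th)%:C * nl th).
  (* [F] contains the coefficient [kap]; dividing by it recovers integrability of the bare
     nonlinearity. *)
  have := cintegrableZ measurableT (kap^-1)%:C i1.
  have -> : (fun th => kap^-1%:C * cintegral leb setT (fun x => F (th, x))) =
      (fun th => (window t th)%:C * nl th); last by [].
  by apply/funext => th; rewrite Fx mulrCA; congr (_ * _);
    rewrite mulrA -rmorphM/= mulVf// rmorph1 mul1r.
split; first exact/cintegrable_window.
have [dE di] := data_opE t0 gf.
rewrite dE cintegral_window /of_hat -/phi.
have gi : cintegrable leb setT (fun x => g t x * phi x).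
  apply: expintM => //; first exact: (curve_expint c0 A0 IA mg gb t0).
  by move=> b'; exact: inverse_fourier_decay.
have -> : (fun x => g t x * phi x) = (fun x => data_hat t x * phi x + duhamel mild_kernel g t x * phi x).
  by apply/funext => x; rewrite ge mulrDl.
have Di : cintegrable leb setT (fun x => duhamel mild_kernel g t x * phi x).
  have -> : (fun x => duhamel mild_kernel g t x * phi x) = (fun x => g t x * phi x - data_hat t x * phi x).
    by apply/funext => x; rewrite ge; ring.
  exact: cintegrableB.
rewrite cintegralD//; congr (_ + _).
have c4 := cintegralZ measurableT kap%:C i2; rewrite -c4.
have -> : (fun th => kap%:C * ((window t th)%:C * nl th)) = (fun th => cintegral leb setT (fun x => F (th, x))).
  by apply/funext => th; rewrite Fx mulrCA.
rewrite E; apply: eq_cintegral => x _.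
have [Nx|Nx] := pselect (octant_ge N x); last first.
  rewrite (duhamel_octant0 (N := N))// mul0r -[LHS](cintegral0 mu setT); apply: eq_cintegral => th _.
  have -> : F (th, x) = (window t th * mild_kernel (t - th) x)%:C * conv (g th) x * phi x by [].
  by rewrite conv0// mulr0 mul0r.
have hk : forall s, 0 <= s -> `|mild_kernel s x| <= L by move=> s s0; exact: kL.
have hc : forall th, 0 <= th -> cabs (conv (g th) x) <= expR (b * norm1 x) * r x by move=> th th0; exact: cb.
have di1 := cintegrable_duhamel t mk mg L0 hk hc.
rewrite /duhamel mulrC; have := cintegralZ measurableT (phi x) di1 => <-.
by apply: eq_cintegral => th _; exact: mulrC.
Qed.

End mild_formulation.

Section existence.
Context {R : realType} {n : nat}.
Local Notation V := 'rV[R]_n.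

Lemma Espace_regular_octant (N al s : R) (T : @functional R n) :
  Espace al s T -> supp (hat T) `<=` octant_ge N -> regular_octant N T.
Proof. by move=> [_ /wsq_hat w] /ae_notin_supp. Qed.

Lemma exists_solution (tau delta sigma BA N0 alpha s' : R) (psi0 psi1 psi2 : @functional R n) :
  (1 <= n)%N -> 0 < tau -> 0 < BA -> 0 < sigma -> alpha <= 0 ->
  high_frequency tau delta sigma N0 ->
  regular_octant N0 psi0 -> regular_octant N0 psi1 -> regular_octant N0 psi2 ->
  wsq (fun x => cabs (hat (square psi1) x)) ->
  exists2 alpha0, alpha0 <= alpha & exists v : R -> @functional R n,
    solution_space alpha0 s' v /\ time_derivative_solution tau delta sigma BA N0 psi0 psi1 psi2 v.
Proof.
move=> n1 tau0 BA0 sigma0 al0 hf g0 g1 g2 w3.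
have N00 : 0 < N0 by case: hf.
have [c [M [c0 M0 decay]]] := jmgt_kernel_decay hf sigma0.
pose kap : R := (1 + BA / 2) / tau.
have kap0 : kap != 0 by rewrite gt_eqF// divr_gt0// addr_gt0// divr_gt0.
have L0 : 0 <= `|kap| * fourier_const (R := R) (n := n) * M.
  by rewrite !mulr_ge0// ltW// fourier_const_gt0.
pose l := data_hat tau delta sigma N0 kap psi0 psi1 psi2.
have lc (x : V) (t : R) u : u @ \oo --> t -> ccvg (fun j => l (u j) x) (l t x).
  by move=> ut; exact: ccvg_data_hat.
have kb t (x : V) : 0 <= t -> octant_ge N0 x ->
    `|mild_kernel tau delta sigma kap t x| <=
    `|kap| * fourier_const (R := R) (n := n) * M * expR (- (c * t)).
  by move=> t0 Nx; apply: (mild_kernel_bound (N := N0)).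
have kc (x : V) : continuous (mild_kernel tau delta sigma kap ^~ x).
  by exact: continuous_mild_kernel.
have [b [A [g [b0 [mA A0 IA QA] [mg gN gb gc] cb ge]]]] :=
  fourier_side_solution N00 c0 L0 (wsq_data_bound kap N00 M0 g0 g1 g2 w3)
    (@data_bound_octant _ _ N0 M kap psi0 psi1 psi2)
    (measurable_mild_kernel delta sigma kap tau0) kb
    kc
    (cmeasurable_data_hat delta sigma N0 kap tau0 psi0 psi1 psi2)
    (@data_hat_octant _ _ tau delta sigma N0 kap psi0 psi1 psi2)
    (data_hat_bound kap N00 M0 decay g0 g1 g2 w3) lc.
(* The added |alpha| forces alpha0 <= alpha: - alpha ln 2 <= |alpha| <= n b', by ln 2 <= 1 and n >=
   1. *)
pose b' := b + `|alpha|.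
have b'0 : 0 <= b' by rewrite addr_ge0.
pose alpha0 := - ((`|s'| + n%:R * b') / ln 2).
have alw (x : V) : exp_weight alpha0 s' x <= expR (- (b * norm1 x)).
  apply: le_trans (exp_weight_le s' x b'0) _.
  by rewrite ler_expR lerN2 ler_wpM2r ?norm1_ge0// lerDl.
have ln20 : 0 < ln (2 : R) by rewrite ln_gt0// ltr1n.
have ln21 : ln (2 : R) <= 1.
  by have := @le_ln1Dx R 1; rewrite -[1 + 1]/(2%:R); apply; apply: lt_trans ltr01; rewrite oppr_lt0.
exists alpha0.
  rewrite /alpha0 lerNl ler_pdivlMr//.
  have : - alpha * ln 2 <= - alpha by rewrite ler_piMr// oppr_ge0.
  move=> /le_trans; apply; apply: (@le_trans _ _ (1 * b')).
    by rewrite mul1r /b' ler0_norm// lerDr.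
  apply: (@le_trans _ _ (n%:R * b')); last by rewrite lerDr.
  by rewrite ler_wpM2r// ler1n.
exists (fun t => of_hat (g t)); split; last first.
  move=> t t0; split; first exact: (curve_supp c0 A0 IA mg gN gb).
  move=> f gf; exact: (mild_solution tau0 N00 c0 M0 decay g0 g1 g2 w3 kap0 b0 mA A0 IA QA mg gN gb cb ge t0 gf).
split; [split|].
- exact: (curve_Ccurves c0 mA A0 IA QA mg gb gc alw).
- apply: (curve_Ltilde c0 mA A0 IA QA mg gb alw (D := c^-1)); first by rewrite invr_ge0 ltW.
  exact: (box_norm1 b0 c0 mA A0 IA QA mg gb).
- apply: (curve_Ltilde c0 mA A0 IA QA mg gb alw (D := 1)) => // k.
  by rewrite mul1r; exact: (box_normy b0 c0 mA A0 IA QA mg gb).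
Qed.

End existence.

(** * Uniqueness *)

Section complex_limits.
Context {R : realType}.

Lemma ccvg_unique (u : nat -> R[i]) (z w : R[i]) : ccvg u z -> ccvg u w -> z = w.
Proof.
move=> [z1 z2] [w1 w2]; apply: complexP.
  exact: (cvg_unique (@norm_hausdorff _ _) z1 w1).
exact: (cvg_unique (@norm_hausdorff _ _) z2 w2).
Qed.

Lemma ccvgZ (c z : R[i]) (u : nat -> R[i]) : ccvg u z -> ccvg (fun j => c * u j) (c * z).
Proof.
move=> [u1 u2]; split.
  have -> : (fun j => complex.Re (c * u j)) =
      (fun j => complex.Re c * complex.Re (u j) - complex.Im c * complex.Im (u j)).
    by apply/funext => j; rewrite ReM.
  by rewrite ReM; apply: cvgB; apply: cvgM => //; exact: cvg_cst.
have -> : (fun j => complex.Im (c * u j)) =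
    (fun j => complex.Re c * complex.Im (u j) + complex.Im c * complex.Re (u j)).
  by apply/funext => j; rewrite ImM.
by rewrite ImM; apply: cvgD; apply: cvgM => //; exact: cvg_cst.
Qed.

Lemma ccvg_real (u : nat -> R) (x : R) : u @ \oo --> x -> ccvg (fun j => (u j)%:C) x%:C.
Proof. by move=> ux; split => //; exact: cvg_cst. Qed.

Lemma cdominated_ccvg d (T : measurableType d) (m : {measure set T -> \bar R})
    (u : nat -> T -> R[i]) (f : T -> R[i]) (g : T -> R) :
  (forall j, cmeasurable setT (u j)) -> m.-integrable setT (EFin \o g) ->
  (forall j x, cabs (u j x) <= g x) -> (forall x, ccvg (fun j => u j x) (f x)) ->
  cintegrable m setT f /\
  ccvg (fun j => cintegral m setT (u j)) (cintegral m setT f).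
Proof.
move=> mu_ ig ug uf.
by have [i1 c1 c2] := @cdominated_convergence _ _ _ m setT measurableT u f g mu_ ig
  (fun j x _ => ug j x) (fun x _ => (uf x).1) (fun x _ => (uf x).2).
Qed.

End complex_limits.

(** * From Gaussians to indicators in a time-dependent identity *)

Section parametric_test.
Context {R : realType} {n : nat}.
Local Notation V := 'rV[R]_n.
Local Notation leb := (@lebesgue_rV R n).
Local Notation mu := (@lebesgue_measure R).

Lemma packet_exp_le (l a : 'I_n -> R) (c : R) : (forall i, 0 < l i) ->
  exists2 M, 0 <= M & forall x : V, cabs (packet l a (fun=> 0) x) <= M * expR (- (c * norm1 x)).
Proof.
move=> l0; have [M HM] := packet_decay (n := n) a (normr_ge0 c) l0.
exists `|M| => // x; rewrite cabs_packet.
apply: (@le_trans _ _ (`|M| * expR (- (`|c| * norm1 x)))); last first.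
  by rewrite ler_wpM2l// ler_expR lerN2 ler_wpM2r ?norm1_ge0// ler_norm.
by rewrite (expRN (`|c| * _)) ler_pdivlMr ?expR_gt0// mulrC (le_trans (HM x))// ler_norm.
Qed.

Variables (U : V -> R[i]) (W : R -> V -> R[i]) (rho : R -> R) (b : R) (k : R[i]).
Hypothesis eU : expint U.
Hypothesis mW : forall th, cmeasurable setT (W th).
Hypothesis rho0 : forall th, 0 <= rho th.
Hypothesis Irho : mu.-integrable setT (EFin \o rho).
Hypothesis Wb : forall th x, cabs (W th x) <= rho th * expR (b * norm1 x).

Let test (phi : V -> R) := [/\ cintegrable leb setT (fun x => U x * (phi x)%:C),
  forall th, cintegrable leb setT (fun x => W th x * (phi x)%:C),
  cintegrable mu setT (fun th => cintegral leb setT (fun x => W th x * (phi x)%:C)) &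
  cintegral leb setT (fun x => U x * (phi x)%:C) =
  k * cintegral mu setT (fun th => cintegral leb setT (fun x => W th x * (phi x)%:C))].

Let test_lin (c : R) f g : test f -> test g -> test (fun x => c * f x + g x).
Proof.
move=> [f1 f2 f3 f4] [g1 g2 g3 g4].
have E (z : V -> R[i]) : (fun x => z x * (c * f x + g x)%:C) =
    (fun x => c%:C * (z x * (f x)%:C) + z x * (g x)%:C).
  by apply/funext => x; rewrite rmorphD rmorphM/=; ring.
have cf1 := cintegrableZ measurableT c%:C f1.
have cf2 th := cintegrableZ measurableT c%:C (f2 th).
have cf3 := cintegrableZ measurableT c%:C f3.
have E1 th : cintegral leb setT (fun x => W th x * (c * f x + g x)%:C) =
    c%:C * cintegral leb setT (fun x => W th x * (f x)%:C) + cintegral leb setT (fun x => W th x * (g x)%:C).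
  rewrite E; have := cintegralD measurableT (cf2 th) (g2 th) => ->.
  by have := cintegralZ measurableT c%:C (f2 th) => ->.
rewrite /test (funext E1) E; split.
- exact: cintegrableD.
- by move=> th; rewrite E; exact: cintegrableD.
- exact: cintegrableD.
- have := cintegralD measurableT cf1 g1 => ->; have := cintegralD measurableT cf3 g3 => ->.
  have := cintegralZ measurableT c%:C f1 => ->; have := cintegralZ measurableT c%:C f3 => ->.
  by rewrite f4 g4 mulrDr mulrCA.
Qed.

Let test_lim (phi : nat -> V -> R) (f : V -> R) (C l : R) : 0 < l ->
  (forall m, test (phi m)) ->
  (forall m x, `|phi m x| <= C * \prod_(i < n) gauss l (x 0 i)) ->
  (forall x, (fun m => phi m x) @ \oo --> f x) -> test f.
Proof.
move=> l0 tphi phiC phif.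
have small (c : R) : exists2 M, 0 <= M & forall m x, cabs (phi m x)%:C <= M * expR (- (c * norm1 x)).
  have [M M0 HM] := packet_exp_le (fun=> 0) c (fun=> l0).
  exists (`|C| * M) => [|m x]; first exact: mulr_ge0.
  have := HM x; rewrite packet_real !cabs_real => h.
  rewrite (le_trans (phiC m x))// -mulrA.
  have -> : \prod_(i < n) gauss l (x 0 i) = \prod_(i < n) gauss l (x 0 i - 0).
    by apply: eq_bigr => i _; rewrite subr0.
  have p0 : 0 <= \prod_(i < n) gauss l (x 0 i - 0) by rewrite prodr_ge0// => i _; exact: gauss_ge0.
  rewrite (ger0_norm p0) in h; rewrite (@le_trans _ _ (`|C| * \prod_(i < n) gauss l (x 0 i - 0)))//.
    by rewrite ler_wpM2r// ler_norm.
  by rewrite ler_wpM2l.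
have cphi (z : R[i]) x : ccvg (fun m => z * (phi m x)%:C) (z * (f x)%:C).
  by apply: ccvgZ; exact: ccvg_real.
have [mU [bU IU]] := eU.
have [M1 M10 HM1] := small bU.
have [i1 c1] : cintegrable leb setT (fun x => U x * (f x)%:C) /\
    ccvg (fun m => cintegral leb setT (fun x => U x * (phi m x)%:C)) (cintegral leb setT (fun x => U x * (f x)%:C)).
  apply: (@cdominated_ccvg _ _ _ leb (fun m x => U x * (phi m x)%:C) _
    (fun x => M1 * (cabs (U x) * expR (- (bU * norm1 x))))) => //.
  - by move=> m; case: (tphi m) => /cintegrable_cmeasurable.
  - apply: (@integrableZl _ _ _ leb setT measurableT M1 (fun x => (cabs (U x) * expR (- (bU * norm1 x)))%:E)).
    apply/integrableP; split.
      by apply/measurable_EFinP; apply: measurable_funM; [exact: measurable_cabs|exact: measurable_expnorm1].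
    by under eq_integral do rewrite /= ger0_norm ?mulr_ge0 ?cabs_ge0 ?expR_ge0//.
  - move=> m x; rewrite cabsM mulrCA; apply: ler_wpM2l; [exact: cabs_ge0|exact: HM1].
have [M2 M20 HM2] := small (b + 1).
have iexp := integrable_exp_norm1 (R := R) (n := n).
pose I := fine (\int[leb]_x (expR (- norm1 x))%:E)%E.
have Wphi th m x : cabs (W th x * (phi m x)%:C) <= rho th * M2 * expR (- norm1 x).
  (* The tests decay at rate b + 1: b cancels the growth of [W] and 1 keeps an integrable factor,
     uniformly in m. *)
  rewrite cabsM; apply: (@le_trans _ _ ((rho th * expR (b * norm1 x)) * (M2 * expR (- ((b + 1) * norm1 x))))).
    by apply: ler_pM; [exact: cabs_ge0|exact: cabs_ge0|exact: Wb|exact: HM2].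
  rewrite mulrACA -expRD le_eqVlt; apply/orP; left; apply/eqP; congr (_ * expR _); ring.
have H2 th : cintegrable leb setT (fun x => W th x * (f x)%:C) /\
    ccvg (fun m => cintegral leb setT (fun x => W th x * (phi m x)%:C)) (cintegral leb setT (fun x => W th x * (f x)%:C)).
  apply: (@cdominated_ccvg _ _ _ leb (fun m x => W th x * (phi m x)%:C) _
    (fun x => rho th * M2 * expR (- norm1 x))) => //.
  - by move=> m; case: (tphi m) => _ /(_ th) /cintegrable_cmeasurable.
  - exact: (@integrableZl _ _ _ leb setT measurableT (rho th * M2) _ iexp).
have [i3 c3] : cintegrable mu setT (fun th => cintegral leb setT (fun x => W th x * (f x)%:C)) /\
    ccvg (fun m => cintegral mu setT (fun th => cintegral leb setT (fun x => W th x * (phi m x)%:C)))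
      (cintegral mu setT (fun th => cintegral leb setT (fun x => W th x * (f x)%:C))).
  apply: (@cdominated_ccvg _ _ _ mu (fun m th => cintegral leb setT (fun x => W th x * (phi m x)%:C)) _
    (fun th => M2 * I * rho th)).
  - by move=> m; case: (tphi m) => _ _ /cintegrable_cmeasurable.
  - exact: (@integrableZl _ _ _ mu setT measurableT (M2 * I) _ Irho).
  - move=> m th; rewrite -lee_fin.
    have [_ /(_ th) ti _ _] := tphi m.
    apply: le_trans (le_cabs_cintegral_integrable measurableT ti) _.
    apply: (@le_trans _ _ (\int[leb]_x ((rho th * M2)%:E * (expR (- norm1 x))%:E))%E).
      apply: ge0_le_integral_any => x _; first by rewrite lee_fin cabs_ge0.
      by rewrite -EFinM lee_fin.
    have r0 : 0 <= rho th * M2 by rewrite mulr_ge0.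
    have fI : (\int[leb]_x (expR (- norm1 x))%:E)%E \is a fin_num by exact: integrable_fin_num.
    rewrite ge0_integralZl_EFin//; last by have /integrableP[] := iexp.
    by rewrite -(fineK fI) -EFinM lee_fin -/I le_eqVlt; apply/orP; left; apply/eqP; ring.
  - by move=> th; exact: (H2 th).2.
split => //; first by move=> th; exact: (H2 th).1.
apply: (ccvg_unique c1); have -> : (fun m => cintegral leb setT (fun x => U x * (phi m x)%:C)) =
    (fun m => k * cintegral mu setT (fun th => cintegral leb setT (fun x => W th x * (phi m x)%:C))).
  by apply/funext => m; case: (tphi m).
exact: ccvgZ.
Qed.

(** Once the identity reaches indicators of bounded measurable subsets of [B], the integrand on the
    right vanishes at each time, hence [U] integrates to 0 over all such sets. *)
Lemma parametric_test (B : set V) : measurable B -> (forall th x, B x -> W th x = 0) ->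
  (forall l a : 'I_n -> R, (forall i, 0 < l i) ->
    cintegrable mu setT (fun th => cintegral leb setT (fun x => W th x * packet l a (fun=> 0) x)) /\
    cintegral leb setT (fun x => U x * packet l a (fun=> 0) x) =
    k * cintegral mu setT (fun th => cintegral leb setT (fun x => W th x * packet l a (fun=> 0) x))) ->
  {ae leb, forall x, B x -> U x = 0}.
Proof.
move=> mB WB H.
have key (A : set V) (r : R) : measurable A -> test (\1_(A `&` closed_box (fun=> - r) (fun=> r))).
  move=> mA; apply: (gaussian_test_indic (P := test)) => // l a l0.
  have [h1 h2] := H l a l0.
  have pE : (fun x : V => (\prod_(i < n) gauss (l i) (x 0 i - a i))%:C) = packet l a (fun=> 0).
    by apply/funext => x; rewrite packet_real.
  have E (z : V -> R[i]) : (fun x => z x * (\prod_(i < n) gauss (l i) (x 0 i - a i))%:C) =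
      (fun x => z x * packet l a (fun=> 0) x).
    by apply/funext => x; rewrite packet_real.
  have E1 : (fun th => cintegral leb setT (fun x => W th x * (\prod_(i < n) gauss (l i) (x 0 i - a i))%:C)) =
      (fun th => cintegral leb setT (fun x => W th x * packet l a (fun=> 0) x)).
    by apply/funext => th; rewrite E.
  have mp : cmeasurable setT (packet l a (fun=> 0)).
    have pi := cintegrable_packet a (fun=> 0) l0.
    exact: (cintegrable_cmeasurable pi).
  have small c : exists M, forall x : V, cabs (packet l a (fun=> 0) x) <= M * expR (- (c * norm1 x)).
    by have [M _ HM] := packet_exp_le a c l0; exists M.
  rewrite /test E1 E; split => //; first exact: expintM.
  by move=> th; rewrite E; apply: expintM => //; exact: expint_exp_bound (mW th) (Wb th).
apply: ae_eq0_indic => //; first by case: eU.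
move=> A r mA AB; have [h1 _ _ h4] := key A r mA; split => //.
rewrite h4; have -> : (fun th => cintegral leb setT (fun x => W th x *
    (\1_(A `&` closed_box (fun=> - r) (fun=> r)) x)%:C)) = (fun=> 0).
  apply/funext => th; rewrite -[RHS](cintegral0 leb setT); apply: eq_cintegral => x _.
  rewrite indicE; have [/set_mem [/AB Bx _]|_] := boolP (x \in _); first by rewrite WB// mul0r.
  by rewrite mulr0.
by rewrite cintegral0 mulr0.
Qed.

End parametric_test.

Section uniqueness.
Context {R : realType} {n : nat}.
Local Notation V := 'rV[R]_n.
Local Notation leb := (@lebesgue_rV R n).
Local Notation mu := (@lebesgue_measure R).
Local Notation cst := (fourier_const (R := R) (n := n)).

(** Continuity bounds the norm near each time and compactness of [0, t] makes the bound uniform. The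
    weight is first lowered to an exponential by [exp_weight_ge]. *)
Lemma Ccurves_bounded (al s : R) (w : R -> @functional R n) (t : R) : Ccurves al s w ->
  exists2 Q : R, 0 <= Q & forall th : R, 0 <= th -> th <= t ->
    (\int[leb]_x ((cabs (hat (w th) x) * expR (- ((`|s| + `|al|) * norm1 x))) ^+ 2)%:E <= Q%:E)%E.
Proof.
move=> Cw.
pose I (th : R) := (\int[leb]_x ((cabs (hat (w th) x) * expR (- ((`|s| + `|al|) * norm1 x))) ^+ 2)%:E)%E.
have mI (h : V -> R[i]) : cmeasurable setT h ->
    measurable_fun setT (fun x => ((cabs (h x) * expR (- ((`|s| + `|al|) * norm1 x))) ^+ 2)%:E).
  by move=> mh; apply: measurable_wsq; exact: measurable_cabs.
have local (th : R) : 0 <= th -> exists2 C : R, 0 <= C & \forall r \near th, 0 <= r -> (I r <= C%:E)%E.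
  move=> th0; have [[dth lth] cth] := Cw th th0; have [rth Ith] := Enorm_lty lth.
  have Ifin : (I th < +oo)%E.
    apply: le_lt_trans Ith; apply: ge0_le_integral_any => x _; first by rewrite lee_fin sqr_ge0.
    rewrite lee_fin sqr_le// ?mulr_ge0 ?cabs_ge0 ?expR_ge0// mulrC.
    by rewrite ler_wpM2r ?cabs_ge0// exp_weight_ge.
  have I0 r : (0 <= I r)%E by apply: integral_ge0 => x _; rewrite lee_fin sqr_ge0.
  (* From (p + q)^2 <= 2 p^2 + 2 q^2, the distance to the curve at [th] being less than 1 nearby. *)
  exists (2 * fine (I th) + 2) => [|]; first by rewrite addr_ge0// mulr_ge0// fine_ge0.
  have : \forall r \near within (`[0, +oo[ : set R) (nbhs th),
      (Enorm al s (fun f => (w r f - w th f)%R) < 1)%E.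
    apply: (cth [set y | (y < 1)%E]); apply: open_nbhs_nbhs; split; first exact: open_ereal_lt_ereal.
    by rewrite /= lte_fin.
  move=> h; have {}h : nbhs th [set r | r \in `[0, +oo[ ->
      (Enorm al s (fun f => (w r f - w th f)%R) < 1)%E] by exact: h.
  apply: (filterS _ h) => r /= hr r0; move: hr.
  rewrite in_itv/= r0 => /(_ isT).
  have [[_ lr] _] := Cw r r0; have [rr _] := Enorm_lty lr.
  have [m1 h1] := regular_represents rr; have [m2 h2] := regular_represents rth.
  have rd : represents (fun x => hat (w r) x - hat (w th) x) (dual_fourier (fun f => w r f - w th f)).
    split; first exact: cmeasurableB.
    move=> f gf; have [i1 e1] := h1 f gf; have [i2 e2] := h2 f gf.
    have -> : (fun x => (hat (w r) x - hat (w th) x) * f x) =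
        (fun x => hat (w r) x * f x - hat (w th) x * f x) by apply/funext => x; rewrite mulrBl.
    split; first exact: cintegrableB.
    have := cintegralB measurableT i1 i2 => ->; move: e1 e2; rewrite /dual_fourier /hat => <- <- //.
  rewrite (Enorm_represents al s rd); set J := (\int[leb]_x _)%E => J1.
  have J0 : (0 <= J)%E by apply: integral_ge0 => x _; rewrite lee_fin sqr_ge0.
  have {}J1 : (J <= 1)%E.
    rewrite leNgt; apply/negP => J1'; move: J1; rewrite ltNge => /negP; apply.
    have := @gt0_ler_poweR R 2^-1 _ 1%E J; rewrite poweR1r; apply => //.
    - by rewrite in_itv/= lee01 leey.
    - by rewrite in_itv/= J0 leey.
    - exact: ltW.
  have : (I r <= 2%:E * (J + I th))%E.
    have md : cmeasurable setT (fun x => hat (w r) x - hat (w th) x) by exact: cmeasurableB.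
    apply: (@le_trans _ _ (2%:E * (\int[leb]_x ((cabs (hat (w r) x - hat (w th) x)
        * expR (- ((`|s| + `|al|) * norm1 x))) ^+ 2)%:E + I th))%E); last first.
      rewrite lee_pmul2l//; apply: leeD => //; apply: ge0_le_integral_any => x _.
        by rewrite lee_fin sqr_ge0.
      rewrite lee_fin sqr_le// ?mulr_ge0 ?cabs_ge0 ?expR_ge0// mulrC.
      by rewrite ler_wpM2r ?cabs_ge0// exp_weight_ge.
    rewrite /I -ge0_integralD//; last 4 first.
      by move=> x _; rewrite lee_fin sqr_ge0.
      exact: mI md.
      by move=> x _; rewrite lee_fin sqr_ge0.
      exact: mI m2.
    rewrite -ge0_integralZl_EFin//; last 2 first.
      by move=> x _; rewrite adde_ge0// lee_fin sqr_ge0.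
      by apply: emeasurable_funD; [exact: mI md|exact: mI m2].
    apply: ge0_le_integral_any => x _; first by rewrite lee_fin sqr_ge0.
    rewrite -EFinD -EFinM lee_fin; set e := expR _.
    have e0 : 0 <= e by exact: expR_ge0.
    have c1 := cabs_ge0 (hat (w r) x - hat (w th) x); have c2 := cabs_ge0 (hat (w th) x).
    have c3 := cabs_ge0 (hat (w r) x).
    have le3 : cabs (hat (w r) x) <= cabs (hat (w r) x - hat (w th) x) + cabs (hat (w th) x).
      by apply: le_trans (cabsD _ _); rewrite subrK.
    set p := cabs _ in c1 le3 *; set q := cabs (hat (w th) x) in c2 le3 *.
    apply: (@le_trans _ _ (((p + q) * e) ^+ 2)); first by rewrite sqr_le ?mulr_ge0// ler_wpM2r.
    rewrite -subr_ge0; have -> : 2 * ((p * e) ^+ 2 + (q * e) ^+ 2) - ((p + q) * e) ^+ 2 = ((p - q) * e) ^+ 2 by ring.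
    exact: sqr_ge0.
  move=> /le_trans; apply; rewrite -(fineK (_ : I th \is a fin_num)) ?ge0_fin_numE//.
  apply: (@le_trans _ _ (2%:E * (1 + (fine (I th))%:E))%E).
    by rewrite lee_pmul2l// leeD2r.
  by rewrite -EFinD -EFinM lee_fin; lra.
(* The bound is the parameter of the covering property, taken along the filter at +oo. *)
have /compact_near_coveringP cov := @segment_compact R 0 t.
have := cov R (pinfty_nbhs R) (fun Q th => 0 <= th -> (I th <= Q%:E)%E) _ _.
move=> H; have [|Q0 [Q0r HQ]] := H.
- move=> x; rewrite /= in_itv/= => /andP[x0 _]; have [C C0 HC] := local x x0.
  exists ([set r | 0 <= r -> (I r <= C%:E)%E], [set Q | C <= Q]).
    by split; [exact: HC|apply: nbhs_pinfty_ge; exact: num_real].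
  by move=> [r Q] [/= h1 h2] r0; rewrite (le_trans (h1 r0))// lee_fin.
- exists (`|Q0| + 1) => [|th th0 tht]; first by rewrite addr_ge0.
  apply: (HQ (`|Q0| + 1)) => //; first by rewrite (le_lt_trans (ler_norm _))// ltrDl.
  by rewrite /= in_itv/= th0.
Qed.

End uniqueness.

Section uniqueness_step.
Context {R : realType} {n : nat}.
Local Notation V := 'rV[R]_n.
Local Notation leb := (@lebesgue_rV R n).
Local Notation mu := (@lebesgue_measure R).
Local Notation cst := (fourier_const (R := R) (n := n)).
Variables (tau delta sigma N c M kap b : R) (Phi : R -> @functional R n).
Hypotheses (tau0 : 0 < tau) (N0 : 0 < N) (c0 : 0 < c) (M0 : 0 <= M).
Hypothesis decay : forall r t, N <= r -> 0 <= t ->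
    [/\ `|derive1n 1 (jmgt_kernel tau delta sigma 0 1 r) t| <= M * expR (- (c * t)),
        `|derive1n 1 (jmgt_kernel tau delta sigma 1 1 r) t| <= M * expR (- (c * t)),
        `|derive1n 1 (jmgt_kernel tau delta sigma 2 1 r) t| <= M * expR (- (c * t)) &
        `|derive1n 2 (jmgt_kernel tau delta sigma 2 1 r) t| <= M * expR (- (c * t))].

(** The data term [Phi] is left arbitrary: two curves share it, and it cancels in their
    difference. *)
Definition mild_curve (w : R -> @functional R n) := forall t : R, 0 <= t ->
  [/\ regular (dual_fourier (w t)), regular_octant N (w t) &
    forall f, gs_space f ->
      let nonlinearity th := kernel_op tau delta sigma 2 2 (t - th) (square (w th)) f in
      cintegrable mu `[0, t]%classic nonlinearity /\
      w t f = Phi t f + kap%:C * cintegral mu `[0, t]%classic nonlinearity].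

Definition locally_bounded (w : R -> @functional R n) := forall t : R,
  exists2 Q : R, 0 <= Q & forall th : R, 0 <= th -> th <= t ->
    (\int[leb]_x ((cabs (hat (w th) x) * expR (- (b * norm1 x))) ^+ 2)%:E <= Q%:E)%E.

Let cut_bound (w : R -> @functional R n) (Q t th : R) x :
  (forall th : R, 0 <= th -> th <= t ->
    (\int[leb]_x ((cabs (hat (w th) x) * expR (- (b * norm1 x))) ^+ 2)%:E <= Q%:E)%E) ->
  0 <= th -> th <= t -> cabs (conv (cut N (hat (w th))) x) <= expR (b * norm1 x) * Q.
Proof.
move=> HQ th0 tht; apply: (conv_exp_bound (N := N)).
- by apply: cmeasurable_cut; exact: cmeasurable_hat.
- by move=> y; exact: cut_octant.
apply: le_trans (HQ th th0 tht); apply: ge0_le_integral_any => y _; first by rewrite lee_fin sqr_ge0.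
rewrite lee_fin sqr_le ?mulr_ge0 ?cabs_ge0 ?expR_ge0// ler_wpM2r ?expR_ge0//.
have [Ny|Ny] := pselect (octant_ge N y); first by rewrite cut_id.
by rewrite cut_octant// cabs0 cabs_ge0.
Qed.

Let mild_difference (n1 n2 : R -> R[i]) (z a1 a2 u : R[i]) (t : R) :
  cintegrable mu `[0, t]%classic n1 -> cintegrable mu `[0, t]%classic n2 ->
  a1 = z + kap%:C * cintegral mu `[0, t]%classic n1 ->
  a2 = z + kap%:C * cintegral mu `[0, t]%classic n2 -> u = a1 - a2 ->
  cintegrable mu setT (fun th => (window t th)%:C * n1 th - (window t th)%:C * n2 th) /\
  u = kap%:C * cintegral mu setT (fun th => (window t th)%:C * n1 th - (window t th)%:C * n2 th).
Proof.
move=> /cintegrable_window i1 /cintegrable_window i2 -> -> ->.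
split; first exact: cintegrableB.
have := cintegralB measurableT i1 i2 => ->.
by rewrite !cintegral_window mulrBr opprD addrACA subrr add0r.
Qed.

Let K s (x : V) := derive1n 2 (jmgt_kernel tau delta sigma 2 1 (enorm x)) s.

(** The difference [U] of the densities is, when tested, [kap] times the time integral of the
    difference [W] of the nonlinearities. If the densities agree almost everywhere for norm1 < r,
    then [W] vanishes at every point with norm1 < r + N at each time, and [parametric_test]
    transfers this to [U]. *)
Lemma uniqueness_step (w1 w2 : R -> @functional R n) (t r : R) : mild_curve w1 -> mild_curve w2 ->
  locally_bounded w1 -> locally_bounded w2 -> 0 <= t ->
  (forall th : R, 0 <= th -> {ae leb, forall x, norm1 x < r -> hat (w1 th) x = hat (w2 th) x}) ->
  {ae leb, forall x, norm1 x < r + N -> hat (w1 t) x = hat (w2 t) x}.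
Proof.
move=> m1 m2 B1 B2 t0 IH.
have [Q1 Q10 HQ1] := B1 t; have [Q2 Q20 HQ2] := B2 t.
pose g (w : R -> @functional R n) th := cut N (hat (w th)).
have mg w th : cmeasurable setT (g w th) by apply: cmeasurable_cut; exact: cmeasurable_hat.
have gae w th : mild_curve w -> 0 <= th -> {ae leb, forall x, hat (w th) x = g w th x}.
  by move=> mw th0; have [_ [_ /cut_ae h] _] := mw th th0; apply: filterS h => x e; exact: esym e.
have mK s : measurable_fun setT (K s) by apply: measurable_jmgt_kernel => //; exact: measurable_enorm.
have Kb s x : 0 <= s -> octant_ge N x -> `|K s x| <= M.
  move=> s0 [_ Nx]; have [_ _ _ h] := decay (le_trans Nx (normr_le_enorm x)) s0.
  apply: le_trans h _; rewrite ler_piMr//.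
  by rewrite -[leRHS]expR0 ler_expR oppr_le0 mulr_ge0// ltW.
have cst0 : 0 <= cst by exact/ltW/fourier_const_gt0.
have conv0 w th x : ~ octant_ge N x -> conv (g w th) x = 0.
  by move=> Nx; apply: (conv_octant_ge0 (N := N)) => // y; exact: cut_octant.
pose F w th x := (cst * K (t - th) x)%:C * conv (g w th) x.
have mF w th : cmeasurable setT (F w th).
  apply: cmeasurableM; last exact: cmeasurable_conv1.
  by apply: cmeasurable_real; apply: measurable_funM => //; exact: mK.
have Fb w Q th x : 0 <= Q -> 0 <= th -> th <= t ->
    (forall th : R, 0 <= th -> th <= t ->
      (\int[leb]_x ((cabs (hat (w th) x) * expR (- (b * norm1 x))) ^+ 2)%:E <= Q%:E)%E) ->
    cabs (F w th x) <= (cst * M * Q) * expR (b * norm1 x).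
  move=> Q0 th0 tht HQ; have [Nx|Nx] := pselect (octant_ge N x); last first.
    rewrite /F conv0// mulr0 cabs0; apply: mulr_ge0; last exact: expR_ge0.
    by apply: mulr_ge0 => //; exact: mulr_ge0.
  rewrite /F cabsM cabs_real normrM (ger0_norm cst0).
  have h := cut_bound x HQ th0 tht.
  have -> : cst * M * Q * expR (b * norm1 x) = (cst * M) * (expR (b * norm1 x) * Q) by ring.
  apply: ler_pM => //; [exact: mulr_ge0|exact: cabs_ge0|].
  by rewrite ler_wpM2l// Kb// subr_ge0.
have expF1 th : 0 <= th -> th <= t -> expint (F w1 th).
  by move=> th0 tht; apply: (expint_exp_bound (mF w1 th)) => x; exact: Fb Q10 th0 tht HQ1.
have expF2 th : 0 <= th -> th <= t -> expint (F w2 th).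
  by move=> th0 tht; apply: (expint_exp_bound (mF w2 th)) => x; exact: Fb Q20 th0 tht HQ2.
pose W th x := (window t th)%:C * (F w1 th x - F w2 th x).
pose U x := hat (w1 t) x - hat (w2 t) x.
have eU : expint U.
  have mU : cmeasurable setT U by apply: cmeasurableB; exact: cmeasurable_hat.
  apply: expint_wsq => //; have [_ [q1 _] _] := m1 t t0; have [_ [q2 _] _] := m2 t t0.
  apply: (wsq_le (wsqD q1 q2)); first exact: measurable_cabs.
  by move=> x; rewrite cabs_ge0/= -(cabsN (hat (w2 t) x)) cabsD.
have mW th : cmeasurable setT (W th).
  by apply: cmeasurableM; [exact: cmeasurable_cst|exact: cmeasurableB].
pose L := cst * M * Q1 + cst * M * Q2.
have L0 : 0 <= L by apply: addr_ge0; apply: mulr_ge0 => //; exact: mulr_ge0.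
have Wb th x : cabs (W th x) <= window t th * L * expR (b * norm1 x).
  rewrite /W cabsM cabs_real ger0_norm ?window_ge0//.
  have [->|/window_neq0/andP[th0 tht]] := eqVneq (window t th) 0; first by rewrite !mul0r.
  rewrite -mulrA ler_wpM2l ?window_ge0// (le_trans (cabsD _ _))// cabsN mulrDl.
  by apply: lerD; [exact: Fb Q10 th0 tht HQ1|exact: Fb Q20 th0 tht HQ2].
have mB : measurable [set x : V | norm1 x < r + N].
  have := measurable_norm1 (R := R) (n := n) measurableT (measurable_itv `]-oo, (r + N)[).
  rewrite setTI; congr measurable; apply/seteqP; split => x /=; by rewrite in_itv.
have WB th x : norm1 x < r + N -> W th x = 0.
  move=> xr; rewrite /W.
  have [->|/window_neq0/andP[th0 tht]] := eqVneq (window t th) 0; first by rewrite mul0r.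
  suff -> : F w1 th x = F w2 th x by rewrite subrr mulr0.
  have e : {ae leb, forall y, norm1 y < r -> g w1 th y = g w2 th y}.
    by apply: filterS3 (IH th th0) (gae w1 th m1 th0) (gae w2 th m2 th0) => y + <- <-.
  have mx := measurable_rVBx x.
  rewrite /F; congr (_ * _); apply: ae_eq_cintegral => //.
  - by apply: cmeasurableM => //; exact: (cmeasurable_comp (mg w1 th) mx).
  - by apply: cmeasurableM => //; exact: (cmeasurable_comp (mg w2 th) mx).
  apply: filterS2 e (ae_reflect x e) => y e1 e2 _.
  by apply: (octant_ge_local (N := N) (r := r)) => // z; exact: cut_octant.
suff : {ae leb, forall x, [set x : V | norm1 x < r + N] x -> U x = 0}.
  by apply: filterS => x h xr; apply/eqP; rewrite -subr_eq0; apply/eqP; exact: h.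
apply: (@parametric_test _ _ U W (fun th => window t th * L) b kap%:C) => //.
- by move=> th; rewrite mulr_ge0// window_ge0.
- exact: integrable_window.
move=> l a l0.
set p := packet l a (fun=> 0).
have gp : gs_space (p : V -> R[i]).
  have := gs_packet a (fun=> 0) 1 l0.
  by have -> : (fun x : V => 1 * packet l a (fun=> 0) x) = p by apply/funext => x; rewrite mul1r.
(* Testing with the transform of a packet makes the packet itself appear on the Fourier side. *)
have gf : gs_space (fourier p) by exact: gs_fourier_packet.
have ip : inverse_fourier (fourier p) = p.
  by apply/funext => x; rewrite inverse_fourierE fourier_fourier_packet// opprK.
have dec c' : exists M', forall x : V, cabs (p x) <= M' * expR (- (c' * norm1 x)).
  by have [M' _ HM] := packet_exp_le a c' l0; exists M'.
have mp : cmeasurable setT p := gs_cmeasurable gp.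
pose nl w th := kernel_op tau delta sigma 2 2 (t - th) (square (w th)) (fourier p).
have nlE w th : mild_curve w -> 0 <= th -> nl w th = cintegral leb setT (fun x => F w th x * p x).
  move=> mw th0; have [_ rw _] := mw th th0.
  by rewrite /nl (nonlinearityE delta sigma tau0 N0 (t - th) rw (mg w th) (gae w th mw th0) gf) ip.
have WE th : cintegral leb setT (fun x => W th x * p x) =
    (window t th)%:C * nl w1 th - (window t th)%:C * nl w2 th.
  have [w0|/window_neq0/andP[th0 tht]] := eqVneq (window t th) 0.
    have z0 (z1 z2 : R[i]) : 0%:C * z1 - 0%:C * z2 = 0 by rewrite !mul0r subrr.
    rewrite w0 z0; apply: etrans (cintegral0 leb setT); apply: eq_cintegral => x _.
    by rewrite /W w0 !mul0r.
  rewrite (nlE w1 th m1 th0) (nlE w2 th m2 th0) -mulrBr.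
  have j1 := expintM (expF1 th th0 tht) mp dec; have j2 := expintM (expF2 th th0 tht) mp dec.
  have := cintegralB measurableT j1 j2 => <-.
  have := cintegralZ measurableT (window t th)%:C (cintegrableB measurableT j1 j2) => <-.
  by apply: eq_cintegral => x _; rewrite /W -mulrA mulrBl.
rewrite (funext WE).
have [rg1 _ /(_ _ gf)[i1 e1]] := m1 t t0; have [rg2 _ /(_ _ gf)[i2 e2]] := m2 t t0.
have [_ /(_ _ gp)[j1 k1]] := regular_represents rg1.
have [_ /(_ _ gp)[j2 k2]] := regular_represents rg2.
have UE : cintegral leb setT (fun x => U x * p x) = w1 t (fourier p) - w2 t (fourier p).
  have -> : (fun x => U x * p x) = (fun x => density (dual_fourier (w1 t)) x * p x - density (dual_fourier (w2 t)) x * p x).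
    by apply/funext => x; rewrite /U /hat mulrBl.
  by have := cintegralB measurableT j1 j2 => ->; rewrite -k1 -k2.
exact: mild_difference i1 i2 e1 e2 UE.
Qed.

(** A density determines its functional only on transforms of test functions. To conclude at [f]
    itself the mild formulation is read once more: its right-hand side depends on the curve only
    through the densities. *)
Lemma mild_curve_unique (w1 w2 : R -> @functional R n) (t : R) f : mild_curve w1 -> mild_curve w2 ->
  locally_bounded w1 -> locally_bounded w2 -> 0 <= t -> gs_space f -> w1 t f = w2 t f.
Proof.
move=> m1 m2 B1 B2 t0 gf.
have step (m : nat) : forall th : R, 0 <= th ->
    {ae leb, forall x, norm1 x < m%:R * N -> hat (w1 th) x = hat (w2 th) x}.
  elim: m => [|m ih] th th0.
    by apply: aeW => x; rewrite mul0r ltNge norm1_ge0.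
  have := @uniqueness_step w1 w2 th (m%:R * N) m1 m2 B1 B2 th0 ih.
  by rewrite -natr1 mulrDl mul1r.
have hatE th : 0 <= th -> {ae leb, forall x, hat (w1 th) x = hat (w2 th) x}.
  move=> th0.
  have : leb.-negligible (\bigcup_m ~` [set x : V | norm1 x < m%:R * N -> hat (w1 th) x = hat (w2 th) x]).
    by apply: negligible_bigcup => m; exact: step.
  apply: negligibleS => x /= hx.
  exists (Num.truncn (norm1 x / N)).+1 => // h; apply: hx; apply: h.
  by rewrite -ltr_pdivrMr// truncnS_gt.
have [_ _ /(_ _ gf)[_ ->]] := m1 t t0; have [_ _ /(_ _ gf)[_ ->]] := m2 t t0.
have nlE (th : R) : 0 <= th -> kernel_op tau delta sigma 2 2 (t - th) (square (w1 th)) f =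
    kernel_op tau delta sigma 2 2 (t - th) (square (w2 th)) f.
  move=> th0; have [_ r1 _] := m1 th th0; have [_ r2 _] := m2 th th0.
  have e1 := nonlinearityE delta sigma tau0 N0 (t - th) r1 (cmeasurable_hat (w2 th)) (hatE th th0) gf.
  have e2 := nonlinearityE delta sigma tau0 N0 (t - th) r2 (cmeasurable_hat (w2 th)) (aeW _ (fun=> erefl)) gf.
  exact: etrans e1 (esym e2).
have eq_duhamel (F1 F2 : R -> R[i]) (z : R[i]) : (forall th, 0 <= th -> F1 th = F2 th) ->
    z + kap%:C * cintegral mu `[0, t]%classic F1 = z + kap%:C * cintegral mu `[0, t]%classic F2.
  move=> F12; congr (_ + _ * _); apply: eq_cintegral => th.
  by rewrite inE/= in_itv/= => /andP[th0 _]; exact: F12.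
exact: eq_duhamel.
Qed.

End uniqueness_step.

Theorem theorem2p1 (R : realType) (n : nat) (tau delta BA sigma alpha s N0 : R)
    (hn : (1 <= n)%N)
    (htau : 0 < tau) (hdelta : 0 < delta) (hBA : 0 < BA) (hsigma : 0 < sigma)
    (halpha : alpha <= 0) (hs : n%:R / 2 - sigma <= s)
    (hN0 : high_frequency tau delta sigma N0) :
  exists epsstar : R, 0 < epsstar /\
    forall psi0 psi1 psi2 : @functional R n,
      Espace alpha (s + sigma) psi0 ->
      Espace alpha (s + sigma) psi1 ->
      Espace alpha s psi2 ->
      Espace alpha s (square psi1) ->
      supp (hat psi0) `<=` octant_ge N0 ->
      supp (hat psi1) `<=` octant_ge N0 ->
      supp (hat psi2) `<=` octant_ge N0 ->
      let epsRough : \bar R :=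
        (Enorm alpha (s + sigma) psi0 + Enorm alpha (s + sigma) psi1
         + Enorm alpha s psi2 + Enorm alpha s (square psi1))%E in
      (0 < epsRough)%E ->
      alpha < 0 \/ (alpha = 0 /\ (epsRough <= epsstar%:E)%E) ->
      exists alpha0 : R, alpha0 <= alpha /\
        exists v : R -> @functional R n,
          [/\ solution_space alpha0 (s + sigma) v,
              time_derivative_solution tau delta sigma BA N0 psi0 psi1 psi2 v
            & forall w : R -> @functional R n,
                solution_space alpha0 (s + sigma) w ->
                time_derivative_solution tau delta sigma BA N0
                  psi0 psi1 psi2 w ->
                forall t : R, 0 <= t -> eq_on_gs (w t) (v t)].
Proof.
(* An arbitrary positive threshold: smallness is obtained from the choice of [alpha0]. *)
exists 1; split=> // psi0 psi1 psi2 E0 E1 E2 E3 S0 S1 S2 epsRough _ _.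
have g0 := Espace_regular_octant E0 S0; have g1 := Espace_regular_octant E1 S1.
have g2 := Espace_regular_octant E2 S2; have w3 := wsq_hat E3.2.
have [al al0 [v [vs vt]]] :=
  exists_solution (s + sigma) hn htau hBA hsigma halpha hN0 g0 g1 g2 w3.
exists al; split=> //; exists v; split=> // w ws wt t t0 f gf.
have N00 : 0 < N0 by case: hN0.
have [c [M [c0 M0 decay]]] := jmgt_kernel_decay hN0 hsigma.
pose kap : R := (1 + BA / 2) / tau.
have curve u : solution_space al (s + sigma) u ->
    time_derivative_solution tau delta sigma BA N0 psi0 psi1 psi2 u ->
    mild_curve tau delta sigma N0 kap (data_op tau delta sigma kap psi0 psi1 psi2) u /\
    locally_bounded (`|s + sigma| + `|al|) u.
  move=> [[Cu _] _] ut; split; last by move=> r; exact: Ccurves_bounded.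
  move=> r r0; have [su eu] := ut r r0; have [Eu _] := Cu r r0.
  by split; [exact: (Enorm_lty Eu.2).1|exact: Espace_regular_octant Eu su|exact: eu].
have [m1 b1] := curve w ws wt; have [m2 b2] := curve v vs vt.
exact: (mild_curve_unique htau N00 c0 M0 decay m1 m2 b1 b2 t0 gf).
Qed.
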